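(* Let $n,K\ge1$ be integers, let $\mathcal F$ be the set of all real $K\times n$ matrices, let $\mathbf F^*\in\mathcal F$ be deterministic, let $\boldsymbol\xi$ be a $K\times n$ random matrix and let $\mathbf Y=\mathbf F^*+\boldsymbol\xi$. Let $\boldsymbol\zeta$ be a $K\times n$ random perturbation matrix independent of $\boldsymbol\xi$. Assume that the entries $\xi_{j,i}$ of $\boldsymbol\xi$ are iid with zero mean and bounded in absolute value by some constant $B_\xi>0$, and that the entries $\zeta_{j,i}$ of $\boldsymbol\zeta$ are iid uniformly distributed in $[-B_\xi,B_\xi]$. Let $\lambda>0$ and let $\pi_0$ be the spectral scaled Student prior on $\mathcal F$, $$\pi_0(d\mathbf F)\propto\det(\lambda^2\mathbf I_K+\mathbf F\mathbf F^\top)^{-(n+K+2)/2}\,d\mathbf F.$$ Let $\widehat{\mathbf F}^{\rm nEWA}$ be the noisy exponentially weighted aggregate with prior $\pi_0$ and temperature $\tau$, built from $\bar{\mathbf Y}=\mathbf Y+\boldsymbol\zeta$. Then, for every $\tau\ge2B_\xi^2/n$, $$\mathbf E[\ell_n(\widehat{\mathbf F}^{\rm nEWA},\mathbf F^* )]\le\inf_{\bar{\mathbf F}}\bigg\{\ell_n(\bar{\mathbf F},\mathbf F^* )+4\,r(\bar{\mathbf F})\,(n+K+2)\,\tau\,\log\bigg(1+\frac{\|\bar{\mathbf F}\|_F}{\sqrt{2r(\bar{\mathbf F})}\,\lambda}\bigg)\bigg\}+K\lambda^2,$$ where $r(\bar{\mathbf F})=\mathrm{rank}(\bar{\mathbf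 F})$ and the infimum is taken over all $K\times n$ real matrices $\bar{\mathbf F}$.
   Context: Notation: $\|\cdot\|_F$ is the Frobenius norm, $\mathbf I_K$ the $K\times K$ identity matrix, $d\mathbf F$ the Lebesgue measure on $\mathbb R^{K\times n}$. The empirical loss is $\ell_n(\mathbf F,\mathbf G)=\frac1n\|\mathbf F-\mathbf G\|_F^2$. The measure $\bar\pi_n$ (a random probability measure on $\mathcal F$, depending on $\bar{\mathbf Y}$) is defined by $$\bar\pi_n(d\mathbf F)\propto\exp\Big\{-\frac1{2\tau}\ell_n(\mathbf F,\bar{\mathbf Y})\Big\}\,\pi_0(d\mathbf F),$$ and $\widehat{\mathbf F}^{\rm nEWA}=\int_{\mathcal F}\mathbf F\,\bar\pi_n(d\mathbf F)$. The expectation $\mathbf E$ is over both $\boldsymbol\xi$ and $\boldsymbol\zeta$. For $\bar{\mathbf F}=\mathbf 0$ (rank $0$) the term containing the logarithm is understood to be $0$. *)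

(* Defs.v *)
From HB Require Import structures.
From mathcomp Require Import all_boot all_order all_algebra.
From mathcomp Require Import all_classical all_reals all_analysis.
Set Implicit Arguments.
Unset Strict Implicit.
Unset Printing Implicit Defensive.
Import Order.TTheory GRing.Theory Num.Theory.
Import numFieldNormedType.Exports.
Local Open Scope classical_set_scope.
Local Open Scope ring_scope.

(* The Borel sigma-algebra of 'M[R]_(K, n), presented as the product
   sigma-algebra of R^(K x n), i.e. the one generated by the entry maps. *)

Definition mx_display : measure_display.
Proof. exact: default_measure_display. Qed.

Section measurable_matrix.
Context {R : realType} {K n : nat}.

Definition mx_cylinders : set (set 'M[R]_(K, n)) :=
  \bigcup_(ij in [set: 'I_K * 'I_n])
    preimage_set_system setT (fun M : 'M[R]_(K, n) => M ij.1 ij.2) measurable.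

Let mx_measurable0 : <<s mx_cylinders >> set0.
Proof. exact: sigma_algebra0. Qed.

Let mx_measurableC A : <<s mx_cylinders >> A -> <<s mx_cylinders >> (~` A).
Proof. exact: sigma_algebraC. Qed.

Let mx_measurable_bigcup (F : (set 'M[R]_(K, n))^nat) :
  (forall i, <<s mx_cylinders >> (F i)) -> <<s mx_cylinders >> (\bigcup_i F i).
Proof. exact: sigma_algebra_bigcup. Qed.

HB.instance Definition _ := @isMeasurable.Build mx_display 'M[R]_(K, n)
  <<s mx_cylinders >> mx_measurable0 mx_measurableC mx_measurable_bigcup.

End measurable_matrix.

Lemma measurable_entry (R : realType) K n (i : 'I_K) (j : 'I_n) :
  measurable_fun [set: 'M[R]_(K, n)] (fun M => M i j).
Proof.
move=> _ Y mY; rewrite setTI; apply: sub_sigma_algebra.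
by exists (i, j) => //; exists Y => //; rewrite setTI.
Qed.

Lemma measurable_fun_mx d (T : measurableType d) (R : realType) K n
    (f : T -> 'M[R]_(K, n)) :
  (forall i j, measurable_fun setT (fun x => f x i j)) -> measurable_fun setT f.
Proof.
move=> mf; apply: (@measurability _ _ T 'M[R]_(K, n) setT f mx_cylinders) => //.
move=> _ [_ [[i j] _ [B mB <-]] <-].
by have := mf i j measurableT B mB; rewrite !setTI.
Qed.

Section lebesgue_cons.
Local Open Scope ereal_scope.
Context {R : realType} {n : nat}.
Variable m : {sigma_finite_measure set (n.-tuple R) -> \bar R}.

Let tcons (p : measurableTypeR R * n.-tuple R) : n.+1.-tuple R :=
  [tuple of p.1 :: p.2].

Definition lebesgue_cons : set (n.+1.-tuple R) -> \bar R :=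
  pushforward (@lebesgue_measure R \x m) tcons.

Let measurable_tcons : measurable_fun setT tcons.
Proof. exact: (measurable_cons measurable_fst measurable_snd). Qed.

Let lebesgue_cons0 : lebesgue_cons set0 = 0.
Proof. by rewrite /lebesgue_cons /pushforward preimage_set0 measure0. Qed.

Let lebesgue_cons_ge0 A : 0 <= lebesgue_cons A.
Proof. exact: measure_ge0. Qed.

Let lebesgue_cons_sigma_additive : semi_sigma_additive lebesgue_cons.
Proof.
exact: (@measure_semi_sigma_additive _ _ _
  (measure_function_pushforward__canonical__measure_function_Measure
    (@lebesgue_measure R \x m) measurable_tcons)).
Qed.

HB.instance Definition _ := isMeasure.Build _ _ _ lebesgue_cons
  lebesgue_cons0 lebesgue_cons_ge0 lebesgue_cons_sigma_additive.

Let lebesgue_cons_sigma_finite : sigma_finite setT lebesgue_cons.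
Proof.
have /sigma_finiteP[F [FT ndF Foo]] := sigma_finiteT (@lebesgue_measure R).
have /sigma_finiteP[G [GT ndG Goo]] := sigma_finiteT m.
pose uncons (t : n.+1.-tuple R) : measurableTypeR R * n.-tuple R :=
  (thead t, [tuple of behead t]).
have tconsK : cancel tcons uncons.
  by case=> x t; congr (_, _); apply: val_inj.
have muncons : measurable_fun setT uncons.
  by apply/measurable_fun_pair; [exact: measurable_tnth|exact: measurable_behead].
exists (fun k => uncons @^-1` (F k `*` G k)).
  apply/esym/seteqP; split=> // t _.
  have [i _ Fi] : (\bigcup_i F i) (uncons t).1 by rewrite -FT.
  have [j _ Gj] : (\bigcup_i G i) (uncons t).2 by rewrite -GT.
  exists (maxn i j) => //; split.
    by move: Fi; exact/subsetPset/ndF/leq_maxl.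
  by move: Gj; exact/subsetPset/ndG/leq_maxr.
move=> k; have [mF Fkoo] := Foo k; have [mG Gkoo] := Goo k; split.
  by rewrite -[X in measurable X]setTI; apply: muncons => //; exact: measurableX.
rewrite /lebesgue_cons /pushforward -comp_preimage.
rewrite (_ : uncons \o tcons = id); last by apply/funext => p; exact: tconsK.
by rewrite preimage_id product_measure1E// lte_mul_pinfty// ge0_fin_numE.
Qed.

HB.instance Definition _ := Measure_isSigmaFinite.Build _ _ _ lebesgue_cons
  lebesgue_cons_sigma_finite.

End lebesgue_cons.

(* Lebesgue measure on R^n as the n-fold product of the one on R. *)
Fixpoint lebesgue_tuple (R : realType) (n : nat) :
    {sigma_finite_measure set (n.-tuple R) -> \bar R} :=
  match n with
  | 0 => \d_([tuple] : 0.-tuple R)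
  | n'.+1 => lebesgue_cons (lebesgue_tuple R n')
  end.

(* Lebesgue measure on 'M[R]_(K, n), transported from R^(K * n) by the
   row-major reshaping of coordinates. *)
Section lebesgue_mx.
Context {R : realType} {K n : nat}.

Let mx_of_tuple (t : (K * n).-tuple R) : 'M[R]_(K, n) :=
  vec_mx (\row_k tnth t k).

Definition lebesgue_mx : set 'M[R]_(K, n) -> \bar R :=
  pushforward (lebesgue_tuple R (K * n)) mx_of_tuple.

Let measurable_mx_of_tuple : measurable_fun setT mx_of_tuple.
Proof.
apply: measurable_fun_mx => i j.
rewrite (_ : (fun _ => _) = (@tnth _ R ^~ (mxvec_index i j)));
  first exact: measurable_tnth.
by apply/funext => t; rewrite /mx_of_tuple !mxE.
Qed.

Let lebesgue_mx0 : lebesgue_mx set0 = 0%E.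
Proof. by rewrite /lebesgue_mx /pushforward preimage_set0 measure0. Qed.

Let lebesgue_mx_ge0 A : (0 <= lebesgue_mx A)%E.
Proof. exact: measure_ge0. Qed.

Let lebesgue_mx_sigma_additive : semi_sigma_additive lebesgue_mx.
Proof.
exact: (@measure_semi_sigma_additive _ _ _
  (measure_function_pushforward__canonical__measure_function_Measure
    (lebesgue_tuple R (K * n)) measurable_mx_of_tuple)).
Qed.

HB.instance Definition _ := isMeasure.Build _ _ _ lebesgue_mx
  lebesgue_mx0 lebesgue_mx_ge0 lebesgue_mx_sigma_additive.

End lebesgue_mx.

Section independence.
Context {d} {Omega : measurableType d} {R : realType} (P : probability Omega R).

Definition mutually_independent (I : finType) (X : I -> Omega -> R) : Prop :=
  forall (J : {set I}) (A : I -> set R), (forall i, measurable (A i)) ->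
  P (\bigcap_(i in [set` J]) (X i @^-1` A i)) =
    (\prod_(i in J) P (X i @^-1` A i))%E.

Definition identically_distributed (I : Type) (X : I -> Omega -> R) : Prop :=
  forall (i j : I) (A : set R), measurable A ->
  P (X i @^-1` A) = P (X j @^-1` A).

Definition independent_pair d1 d2 (T1 : measurableType d1)
    (T2 : measurableType d2) (X : Omega -> T1) (Y : Omega -> T2) : Prop :=
  forall A B, measurable A -> measurable B ->
  P (X @^-1` A `&` Y @^-1` B) = (P (X @^-1` A) * P (Y @^-1` B))%E.

Definition iid_entries K n (X : Omega -> 'M[R]_(K, n)) : Prop :=
  let entry (ji : 'I_K * 'I_n) w := X w ji.1 ji.2 in
  mutually_independent entry /\ identically_distributed entry.

End independence.

Section aggregate.
Context {R : realType} {K n : nat}.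
Implicit Types (F G Y : 'M[R]_(K, n)) (lambda tau : R).

(* The library norm `|F| on matrices is the sup norm, hence this definition. *)
Definition frobenius F : R := Num.sqrt (\sum_i \sum_j F i j ^+ 2).

Definition loss F G : R := n%:R^-1 * frobenius (F - G) ^+ 2.

(* The probability measure proportional to f(F) mu(dF), when the total mass is
   positive and finite. *)
Definition normalized_density (mu : set 'M[R]_(K, n) -> \bar R)
    (f : 'M[R]_(K, n) -> R) : set 'M[R]_(K, n) -> \bar R :=
  fun A => ((\int[mu]_(F in A) (f F)%:E) / \int[mu]_F (f F)%:E)%E.

Definition student_prior lambda : set 'M[R]_(K, n) -> \bar R :=
  normalized_density lebesgue_mx
    (fun F => \det ((lambda ^+ 2)%:M + F *m F^T) `^ (- ((n + K + 2)%:R / 2))).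

Definition posterior lambda tau Y : set 'M[R]_(K, n) -> \bar R :=
  normalized_density (student_prior lambda)
    (fun F => expR (- ((2 * tau)^-1 * loss F Y))).

Definition nEWA lambda tau Y : 'M[R]_(K, n) :=
  \matrix_(j, i) fine (\int[posterior lambda tau Y]_F (F j i)%:E)%E.

(* At F = 0 the logarithmic term vanishes, by \rank 0 = 0 (and x / 0 = 0). *)
Definition oracle_bound lambda tau Fstar F : R :=
  loss F Fstar +
  4 * (\rank F)%:R * (n + K + 2)%:R * tau *
    ln (1 + frobenius F / (Num.sqrt (2 * (\rank F)%:R) * lambda)).

End aggregate.

(* Main.v *)
(* With [T = n tau] and [y = Fstar + xi + zeta], a Gaussian scale mixture over a latent
   K x (n+K+2) matrix [G] turns the posterior into a mixture of Gaussians: the posterior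
   mean is an average of [S y], where [S = (1 + T G G^T)^-1] is a contraction, under the
   Gibbs weights [exp (<S y, y> / 2T)].  The bounded-by-uniform noise satisfies a Stein
   identity [E (eta f) = E (kappa f')] with a kernel [0 <= kappa <= 2 B^2 <= T], which
   gives an unbiased-type risk estimate [L(S)] averaged over the Gibbs weights.  Jensen's
   inequality bounds this average by the logarithm of an exponential moment whose
   expectation over the noise is controlled entry by entry (the noise is sub-Gaussian)
   and then through the eigenvalues of [S].  The partition function at [y] is compared
   with that at the shift [y - Fbar] by bounding the change of
   [det (lam^2 + F F^T)] under a rank-[r] perturbation, which produces the logarithm.
   Two such bounds, one with [Fbar] alone and one also splitting [Fstar] along the row
   space of [Fbar], cover all the cases. *)
Require Import Defs.
From HB Require Import structures.
From mathcomp Require Import all_boot all_order all_algebra fingroup perm.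
From mathcomp Require Import all_classical all_reals all_analysis.
From mathcomp Require Import measurable_realfun.
From mathcomp Require spectral complex.
From mathcomp Require Import ring lra zify.
Set Implicit Arguments.
Unset Strict Implicit.
Unset Printing Implicit Defensive.
Import Order.TTheory GRing.Theory Num.Theory.
Import numFieldNormedType.Exports.
Local Open Scope classical_set_scope.
Local Open Scope ring_scope.

(** * Lebesgue measure on matrices *)

(** The risk is multiplied by a weight [13/10] before Jensen's inequality. With weight 1 the terms
    in [Fstar] and [Fbar] would recombine at once into [|Fbar - Fstar|^2], but at [S = 1] the risk
    estimate keeps a term linear in the noise, [dot Fstar eta], whose exponential moment exceeds 1.
    A weight [t > 1] leaves [(1 - t) |Fstar|^2] in the exponent to absorb it; with the noise bounds
    at hand the case [S = 1] reads [2 (1 - t/2)^2 <= t - 1], whose smaller root is [3 - sqrt 3],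
    about 1.268. The price is a surplus [3/10 |Fstar|^2]. It is affordable unless [Fstar] is large
    on the row space of [Fbar], with projection [Q]. In that case this component is kept out of the
    exponential moment, and its Gibbs average is controlled by comparing the partition functions at
    [y] and [y - Fstar Q]; the logarithm then involves [|Fstar Q|] instead of [|Fbar|], and the size
    of [|Fstar Q|^2] pays for the difference. The determinant comparison costs an exponent [9/4]
    only, and the gap up to the constant 4 pays the surplus below the threshold. *)

Section lebesgue_real.
Context {R : realType}.
Local Notation leb := (@lebesgue_measure R).
Local Open Scope ereal_scope.

Lemma lebesgue_measure_shift (a : R) (A : set R) : measurable A ->
  leb ((fun x : R => (x + a)%R) @^-1` A) = leb A.
Proof.
move=> mA; pose f := (fun x : R => (x + a)%R) : measurableTypeR R -> measurableTypeR R.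
have mf : measurable_fun setT f by exact: measurable_funD.
suff /(_ A mA) : forall A, measurable A -> leb A = pushforward leb f A by [].
apply/lebesgue_measure_unique => /= _ [[b c]] _ <-.
rewrite /pushforward (_ : _ @^-1` _ = `](b - a)%R, (c - a)%R]%classic).
  by rewrite !lebesgue_measure_itv/= !lte_fin; case: ifP => h;
    rewrite ?ltrD2r h// -!EFinB; congr (_%:E); ring.
by apply/seteqP; split=> x /=; rewrite !in_itv/= ltrBlDr lerBrDr.
Qed.

Lemma lebesgue_measure_scale (c : R) (A : set R) : (0 < c)%R -> measurable A ->
  leb ((fun x : R => (c * x)%R) @^-1` A) = c^-1%:E * leb A.
Proof.
move=> c0 mA; pose f := (fun x : R => (c * x)%R) : measurableTypeR R -> measurableTypeR R.
have mf : measurable_fun setT f by exact: measurable_funM.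
pose c' := NngNum (ltW c0).
suff /(_ mf A mA) -> : forall A, measurable A -> leb A = mscale c' (pushforward leb f) A.
  by rewrite /mscale/= muleA -EFinM mulVf ?gt_eqF// mul1e.
move=> mf'; apply/lebesgue_measure_unique => /= _ [[a b]] _ <-.
have E : f @^-1` `]a, b] = `](a / c)%R, (b / c)%R]%classic.
  by apply/seteqP; split=> x /=; rewrite /f !in_itv/= ltr_pdivrMr// ler_pdivlMr// ![(x * c)%R]mulrC.
transitivity (c%:E * leb (f @^-1` `]a, b])) => //.
rewrite E !lebesgue_measure_itv/= !lte_fin ltr_pM2r ?invr_gt0//; case: ifP => h;
  rewrite ?mule0// -!EFinB -EFinM; congr (_%:E); field; exact: lt0r_neq0.
Qed.

Lemma lebesgue_measure_scaleN (c : R) (A : set R) : (c != 0)%R -> measurable A ->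
  leb ((fun x : R => (c * x)%R) @^-1` A) = `|c|^-1%:E * leb A.
Proof.
move=> c0 mA; case: (ltgtP c 0%R) c0 => // [cn|cp] _; last first.
  by rewrite gtr0_norm// lebesgue_measure_scale.
rewrite -(lebesgue_measureN mA) ltr0_norm//.
rewrite -[RHS]lebesgue_measure_scale ?oppr_gt0//; last first.
  by rewrite -[X in measurable X]setTI; exact: measurable_funN.
by rewrite /pushforward; congr (leb _); apply/seteqP; split=> x /=;
  rewrite mulNr opprK.
Qed.

End lebesgue_real.

Section box.
Context {R : realType}.
Local Notation leb := (@lebesgue_measure R).
Local Open Scope ereal_scope.

Lemma lebesgue_tuple_box n (A : 'I_n -> set R) : (forall k, measurable (A k)) ->
  lebesgue_tuple R n [set t | forall k, A k (tnth t k)] = \prod_k leb (A k).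
Proof.
elim: n A => [|n IH] A mA /=.
  by rewrite big_ord0 diracE mem_set// => -[].
rewrite big_ord_recl/= -(IH (fun k => A (lift ord0 k)))//.
rewrite /lebesgue_cons /pushforward -product_measure1E//; last first.
  rewrite (_ : [set _ | _] = \bigcap_(k in [set: 'I_n]) ((@tnth n R ^~ k) @^-1` (A (lift ord0 k)))).
    apply: fin_bigcap_measurable => [|k _]; first exact: finite_finset.
    by rewrite -[X in measurable X]setTI; exact: measurable_tnth.
  by apply/seteqP; split => t /= h k => [_|]; exact: h.
  exact: mA.
congr ((_ \x _) _); apply/seteqP; split=> -[x t] /=.
  move=> h; split; first by move: (h ord0); rewrite tnth0.
  by move=> k; move: (h (lift ord0 k)); rewrite tnthS.
move=> [h0 h] k; case: (unliftP ord0 k) => [j|] ->; first by rewrite tnthS.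
by rewrite tnth0.
Qed.

Definition mx_box K n (A : 'I_K -> 'I_n -> set R) : set 'M[R]_(K, n) :=
  [set M | forall i j, A i j (M i j)].

Lemma measurable_mx_box K n (A : 'I_K -> 'I_n -> set R) :
  (forall i j, measurable (A i j)) -> measurable (mx_box A).
Proof.
move=> mA; rewrite (_ : mx_box A = \bigcap_(ij in [set: 'I_K * 'I_n])
    ((fun M : 'M[R]_(K, n) => M ij.1 ij.2) @^-1` A ij.1 ij.2)).
  apply: fin_bigcap_measurable => [|[i j] _]; first exact: finite_finset.
  by rewrite -[X in measurable X]setTI; exact: measurable_entry.
by apply/seteqP; split => M h => [ij _|i j]; [exact: h|exact: (h (i, j))].
Qed.

Lemma lebesgue_mx_box K n (A : 'I_K -> 'I_n -> set R) :
  (forall i j, measurable (A i j)) ->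
  lebesgue_mx (mx_box A) = \prod_i \prod_j leb (A i j).
Proof.
move=> mA; have [g gK Kg] := curry_mxvec_bij K n.
pose B k := A (g k).1 (g k).2.
have BE i j : B (mxvec_index i j) = A i j.
  by rewrite /B (gK (i, j)).
rewrite /lebesgue_mx /pushforward.
rewrite (_ : _ @^-1` _ = [set t | forall k, B k (tnth t k)]); last first.
  apply/seteqP; split=> t /= h.
    by move=> k; case/mxvec_indexP: k => i j; rewrite BE; move: (h i j); rewrite !mxE.
  by move=> i j; rewrite -BE !mxE; exact: h.
rewrite lebesgue_tuple_box => [|k]; last exact: mA.
rewrite pair_big (reindex (uncurry (@mxvec_index K n)))/=; last exact: curry_mxvec_bij.
by apply: eq_bigr => -[i j] _; rewrite BE.
Qed.

Lemma mx_box_sigma_algebra K n : @measurable _ 'M[R]_(K, n) =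
  <<s [set X | exists2 A : 'I_K -> 'I_n -> set R,
               (forall i j, measurable (A i j)) & X = mx_box A] >>.
Proof.
apply/seteqP; split.
  apply: smallest_sub; first exact: smallest_sigma_algebra.
  move=> _ [[i j] _ [B mB <-]]; apply: sub_sigma_algebra.
  exists (fun i' j' => if (i' == i) && (j' == j) then B else setT).
    by move=> i' j'; case: ifP.
  apply/seteqP; split => M; rewrite setTI /=.
    by move=> h i' j' ; case: ifP => // /andP[/eqP-> /eqP->].
  by move=> /(_ i j); rewrite !eqxx.
apply: smallest_sub; first exact: sigma_algebra_measurable.
by move=> _ [A mA ->]; exact: measurable_mx_box.
Qed.

Definition mx_cube K n (k : nat) : set 'M[R]_(K, n) := mx_box (fun _ _ => `[(- k%:R)%R, k%:R%R]%classic).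

Let mx_cube_cover K n : \bigcup_k @mx_cube K n k = setT.
Proof.
apply/seteqP; split => // M _.
pose m : R := (\sum_i \sum_j `|M i j|)%R.
exists (Num.trunc m).+1 => // i j; rewrite /= in_itv/= -ler_norml.
apply: le_trans (ltW (truncnS_gt m)).
rewrite /m (bigD1 i)//= (bigD1 j)//= -addrA lerDl addr_ge0// ?sumr_ge0// => i' _.
by rewrite sumr_ge0.
Qed.

Let mx_cube_fin K n k : lebesgue_mx (@mx_cube K n k) < +oo.
Proof.
rewrite lebesgue_mx_box// ltey_eq; apply/orP; left.
apply: prode_fin_num => i _; apply: prode_fin_num => j _.
by rewrite lebesgue_measure_itv/=; case: ifP.
Qed.

Lemma lebesgue_mx_sigma_finite K n : sigma_finite setT (@lebesgue_mx R K n).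
Proof.
exists (@mx_cube K n); first by rewrite mx_cube_cover.
by move=> k; split; [exact: measurable_mx_box|exact: mx_cube_fin].
Qed.

HB.instance Definition _ K n := Measure_isSigmaFinite.Build _ _ _ (@lebesgue_mx R K n)
  (@lebesgue_mx_sigma_finite K n).

(** Boxes are stable under intersection and generate the sigma-algebra, and the cubes are boxes that
    exhaust the space, so the uniqueness theorem for measures applies. *)
Lemma eq_mx_measure K n (m1 m2 : {measure set 'M[R]_(K, n) -> \bar R}) :
  (forall A, (forall i j, measurable (A i j)) -> m1 (mx_box A) = m2 (mx_box A)) ->
  (forall k, m1 (@mx_cube K n k) < +oo) ->
  forall X, measurable X -> m1 X = m2 X.
Proof.
move=> m12 fin X mX; apply: (@measure_unique _ _ _ _ (@mx_cube K n) (mx_box_sigma_algebra K n) _ _ (mx_cube_cover K n)) => //.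
- move=> _ _ [A mA ->] [B mB ->]; exists (fun i j => A i j `&` B i j).
    by move=> i j; exact: measurableI.
  by apply/seteqP; split => M /= => [[h1 h2] i j|h]; [split=> /=|split=> i j; have [] := h i j].
- by move=> k; exists (fun _ _ => `[(- k%:R)%R, k%:R%R]%classic).
- by move=> _ [A mA ->]; exact: m12.
Qed.

Lemma lebesgue_mx_unique K n (m : {measure set 'M[R]_(K, n) -> \bar R}) :
  (forall A, (forall i j, measurable (A i j)) ->
    m (mx_box A) = \prod_i \prod_j leb (A i j)) ->
  forall X, measurable X -> lebesgue_mx X = m X.
Proof.
move=> mE; apply: eq_mx_measure => [A mA|k]; first by rewrite mE//; exact: lebesgue_mx_box.
exact: mx_cube_fin.
Qed.

End box.

Section measurable_mx.
Context {R : realType} d (X : measurableType d).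

Lemma measurable_mxE K n (f : X -> 'M[R]_(K, n)) i j :
  measurable_fun setT f -> measurable_fun setT (fun x => f x i j).
Proof. by move=> mf; exact: (measurableT_comp (measurable_entry i j) mf). Qed.

Lemma measurable_mulmx K n m (f : X -> 'M[R]_(K, n)) (g : X -> 'M[R]_(n, m)) :
  measurable_fun setT f -> measurable_fun setT g ->
  measurable_fun setT (fun x => f x *m g x).
Proof.
move=> mf mg; apply: measurable_fun_mx => i j.
under eq_fun do rewrite mxE.
by apply: measurable_sum => k; apply: measurable_funM; exact: measurable_mxE.
Qed.

Lemma measurable_addmx K n (f g : X -> 'M[R]_(K, n)) :
  measurable_fun setT f -> measurable_fun setT g ->
  measurable_fun setT (fun x => f x + g x).
Proof.
move=> mf mg; apply: measurable_fun_mx => i j.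
under eq_fun do rewrite mxE.
by apply: measurable_funD; exact: measurable_mxE.
Qed.

Lemma measurable_scalemx K n (f : X -> R) (g : X -> 'M[R]_(K, n)) :
  measurable_fun setT f -> measurable_fun setT g ->
  measurable_fun setT (fun x => f x *: g x).
Proof.
move=> mf mg; apply: measurable_fun_mx => i j.
under eq_fun do rewrite mxE.
by apply: measurable_funM => //; exact: measurable_mxE.
Qed.

Lemma measurable_oppmx K n (f : X -> 'M[R]_(K, n)) :
  measurable_fun setT f -> measurable_fun setT (fun x => - f x).
Proof.
move=> mf; apply: measurable_fun_mx => i j.
under eq_fun do rewrite mxE.
by apply: measurable_funN; exact: measurable_mxE.
Qed.

Lemma measurable_submx K n (f g : X -> 'M[R]_(K, n)) :
  measurable_fun setT f -> measurable_fun setT g ->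
  measurable_fun setT (fun x => f x - g x).
Proof. by move=> mf mg; apply: measurable_addmx => //; exact: measurable_oppmx. Qed.

Lemma measurable_trmx K n (f : X -> 'M[R]_(K, n)) :
  measurable_fun setT f -> measurable_fun setT (fun x => (f x)^T).
Proof.
move=> mf; apply: measurable_fun_mx => i j.
by under eq_fun do rewrite mxE; exact: measurable_mxE.
Qed.

Lemma measurable_mxtrace K (f : X -> 'M[R]_K) :
  measurable_fun setT f -> measurable_fun setT (fun x => \tr (f x)).
Proof. by move=> mf; apply: measurable_sum => i; exact: measurable_mxE. Qed.

Lemma measurable_det K (f : X -> 'M[R]_K) :
  measurable_fun setT f -> measurable_fun setT (fun x => \det (f x)).
Proof.
move=> mf; apply: measurable_sum => s; apply: measurable_funM => //.
by apply: measurable_prod => i _; exact: measurable_mxE.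
Qed.

Lemma measurable_cofactor K (f : X -> 'M[R]_K) i j :
  measurable_fun setT f -> measurable_fun setT (fun x => cofactor (f x) i j).
Proof.
move=> mf; apply: measurable_funM => //; apply: measurable_det.
apply: measurable_fun_mx => i' j'.
by under eq_fun do rewrite !mxE; exact: measurable_mxE.
Qed.

Lemma measurable_invr (f : X -> R) :
  measurable_fun setT f -> measurable_fun setT (fun x => (f x)^-1).
Proof.
move=> mf; rewrite (_ : (fun x => _) = (fun x => if f x == 0 then 0 else
   f x * ((f x ^+ 2) `^ (-1)))); last first.
  apply/funext => x; case: eqVneq => [->|fx0]; first by rewrite invr0.
  by rewrite powR_inv1 ?sqr_ge0// expr2 invfM mulrA divff ?mul1r.
apply: measurable_fun_ifT => //.
  exact: (measurable_fun_eqr mf (measurable_cst _)).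
apply: measurable_funM => //.
exact: (measurableT_comp (measurable_powR (-1)) (measurable_funX 2 mf)).
Qed.

Lemma measurable_invmx K (f : X -> 'M[R]_K) : (forall x, f x \in unitmx) ->
  measurable_fun setT f -> measurable_fun setT (fun x => invmx (f x)).
Proof.
move=> uf mf; under eq_fun do rewrite /invmx uf.
apply: measurable_scalemx; first by apply: measurable_invr; exact: measurable_det.
apply: measurable_fun_mx => i j; under eq_fun do rewrite mxE.
exact: measurable_cofactor.
Qed.

Lemma measurable_col_mx K1 K2 n (f : X -> 'M[R]_(K1, n)) (g : X -> 'M[R]_(K2, n)) :
  measurable_fun setT f -> measurable_fun setT g ->
  measurable_fun setT (fun x => col_mx (f x) (g x)).
Proof.
move=> mf mg; apply: measurable_fun_mx => i j.
by case: (split_ordP i) => k ->;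
  under eq_fun do rewrite ?col_mxEu ?col_mxEd; exact: measurable_mxE.
Qed.

Lemma measurable_row_mx K n1 n2 (f : X -> 'M[R]_(K, n1)) (g : X -> 'M[R]_(K, n2)) :
  measurable_fun setT f -> measurable_fun setT g ->
  measurable_fun setT (fun x => row_mx (f x) (g x)).
Proof.
move=> mf mg; apply: measurable_fun_mx => i j.
by case: (split_ordP j) => k ->;
  under eq_fun do rewrite ?row_mxEl ?row_mxEr; exact: measurable_mxE.
Qed.

End measurable_mx.

Section integral_mx.
Context {R : realType}.
Local Notation leb := (@lebesgue_measure R).
Local Open Scope ereal_scope.

(** The common form of the elementary changes of variables below: a map that pulls every box back to
    a set of the right mass pushes [m] to Lebesgue measure. *)
Lemma integral_mx_pushforward K n d (X : measurableType d)
    (m : {measure set X -> \bar R}) (phi : X -> 'M[R]_(K, n)) :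
  measurable_fun setT phi ->
  (forall A, (forall i j, measurable (A i j)) ->
     m (phi @^-1` mx_box A) = \prod_i \prod_j leb (A i j)) ->
  forall f : 'M[R]_(K, n) -> \bar R, measurable_fun setT f -> (forall F, 0 <= f F) ->
  \int[lebesgue_mx]_F f F = \int[m]_x f (phi x).
Proof.
move=> mphi mE f mf f0.
transitivity (\int[pushforward m phi]_F f F).
  by apply: eq_measure_integral => A mA _; exact: lebesgue_mx_unique.
by rewrite ge0_integral_pushforward.
Qed.

Variables (K n : nat).
Implicit Types f : 'M[R]_(K, n) -> \bar R.

Lemma integral_mx_shift f (H : 'M[R]_(K, n)) :
  measurable_fun setT f -> (forall F, 0 <= f F) ->
  \int[lebesgue_mx]_F f (F + H)%R = \int[lebesgue_mx]_F f F.
Proof.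
move=> mf f0; apply/esym/(@integral_mx_pushforward _ _ _ _ lebesgue_mx (fun F => F + H)%R) => //.
  exact: measurable_addmx.
move=> A mA; rewrite (_ : _ @^-1` _ = mx_box (fun i j => (fun x => (x + H i j)%R) @^-1` A i j)).
  apply: (etrans (lebesgue_mx_box _)).
    move=> i j; rewrite -[X in measurable X]setTI.
    by apply: measurable_funD => //; exact: measurable_id.
  by apply: eq_bigr => i _; apply: eq_bigr => j _; rewrite lebesgue_measure_shift.
by apply/seteqP; split => F h i j; have := h i j; rewrite mxE.
Qed.

Lemma integral_mx_scale f (c : R) : (c != 0)%R ->
  measurable_fun setT f -> (forall F, 0 <= f F) ->
  \int[lebesgue_mx]_F f (c *: F)%R = (`|c| ^- (K * n))%:E * \int[lebesgue_mx]_F f F.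
Proof.
move=> c0 mf f0.
pose k := NngNum (exprn_ge0 (K * n) (normr_ge0 c)).
have mphi : measurable_fun setT (fun F : 'M[R]_(K, n) => c *: F)%R by exact: measurable_scalemx.
rewrite [in RHS](@integral_mx_pushforward _ _ _ _ (mscale k lebesgue_mx) (fun F => c *: F)%R)//; last first.
  move=> A mA; rewrite (_ : _ @^-1` _ = mx_box (fun i j => (fun x => (c * x)%R) @^-1` A i j)); last first.
    by apply/seteqP; split => F h i j; have := h i j; rewrite mxE.
  set S := mx_box _; transitivity (k%:num%:E * lebesgue_mx S) => //.
  rewrite /S lebesgue_mx_box; last first.
    move=> i j; rewrite -[X in measurable X]setTI.
    by apply: measurable_funM => //; exact: measurable_id.
  under eq_bigr do under eq_bigr do rewrite lebesgue_measure_scaleN//.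
  under eq_bigr do rewrite big_split prodEFin big_const/= iter_mulr_1 card_ord.
  rewrite big_split/= prodEFin big_const/= iter_mulr_1 card_ord -exprM mulnC exprVn.
  by rewrite muleA -EFinM divff ?mul1e// expf_neq0// normr_eq0.
rewrite ge0_integral_mscale//; last exact: (measurableT_comp mf mphi).
by rewrite muleA -EFinM mulVf ?mul1e// expf_neq0// normr_eq0.
Qed.

Lemma integral_mx_row_perm f (s : 'S_K) :
  measurable_fun setT f -> (forall F, 0 <= f F) ->
  \int[lebesgue_mx]_F f (row_perm s F) = \int[lebesgue_mx]_F f F.
Proof.
move=> mf f0; apply/esym/(@integral_mx_pushforward _ _ _ _ lebesgue_mx (row_perm s)) => //.
  by apply: measurable_fun_mx => i j; under eq_fun do rewrite mxE; exact: measurable_entry.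
move=> A mA; rewrite (_ : _ @^-1` _ = mx_box (fun i j => A ((s^-1)%g i) j)).
  apply: (etrans (lebesgue_mx_box _)) => //.
  rewrite [RHS](reindex_inj (@perm_inj _ (s^-1)%g)).
  by apply: eq_bigr => i _; apply: eq_bigr => j _.
apply/seteqP; split => F h i j; first by have := h ((s^-1)%g i) j; rewrite mxE permKV.
by have := h (s i) j; rewrite mxE permK.
Qed.

Lemma integral_mx_col_perm f (s : 'S_n) :
  measurable_fun setT f -> (forall F, 0 <= f F) ->
  \int[lebesgue_mx]_F f (col_perm s F) = \int[lebesgue_mx]_F f F.
Proof.
move=> mf f0; apply/esym/(@integral_mx_pushforward _ _ _ _ lebesgue_mx (col_perm s)) => //.
  by apply: measurable_fun_mx => i j; under eq_fun do rewrite mxE; exact: measurable_entry.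
move=> A mA; rewrite (_ : _ @^-1` _ = mx_box (fun i j => A i ((s^-1)%g j))).
  apply: (etrans (lebesgue_mx_box _)) => //.
  apply: eq_bigr => i _; rewrite [RHS](reindex_inj (@perm_inj _ (s^-1)%g)).
  by apply: eq_bigr => j _.
apply/seteqP; split => F h i j; first by have := h i ((s^-1)%g j); rewrite mxE permKV.
by have := h i (s j); rewrite mxE permK.
Qed.

End integral_mx.

Section split_mx.
Context {R : realType}.
Local Notation leb := (@lebesgue_measure R).
Local Open Scope ereal_scope.

Lemma integral_col_mx K1 K2 n (f : 'M[R]_(K1 + K2, n) -> \bar R) :
  measurable_fun setT f -> (forall F, 0 <= f F) ->
  \int[lebesgue_mx]_F f F =
  \int[lebesgue_mx]_(A in [set: 'M[R]_(K1, n)]) \int[lebesgue_mx]_(B in [set: 'M[R]_(K2, n)]) f (col_mx A B).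
Proof.
move=> mf f0.
have mphi : measurable_fun setT (fun p : 'M[R]_(K1, n) * 'M[R]_(K2, n) => col_mx p.1 p.2).
  exact: measurable_col_mx.
rewrite (@integral_mx_pushforward _ _ _ _ _ (lebesgue_mx \x lebesgue_mx) (fun p => col_mx p.1 p.2))//.
  rewrite (fubini_tonelli1 (fun p => f (col_mx p.1 p.2)))//.
    exact: (measurableT_comp mf mphi).
move=> A mA; rewrite big_split_ord/=.
rewrite -(lebesgue_mx_box (A := fun i => A (lshift _ i)))//.
rewrite -(lebesgue_mx_box (A := fun i => A (rshift _ i)))//.
rewrite -product_measure1E; [|exact: measurable_mx_box..].
congr ((_ \x _) _); apply/seteqP; split => -[F G] /= h.
  by split => i j; [have := h (lshift _ i) j; rewrite col_mxEu|have := h (rshift _ i) j; rewrite col_mxEd].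
by move=> i j; case: (split_ordP i) => k ->; rewrite ?col_mxEu ?col_mxEd; apply h.
Qed.

Lemma integral_row_mx K n1 n2 (f : 'M[R]_(K, n1 + n2) -> \bar R) :
  measurable_fun setT f -> (forall F, 0 <= f F) ->
  \int[lebesgue_mx]_F f F =
  \int[lebesgue_mx]_(A in [set: 'M[R]_(K, n1)]) \int[lebesgue_mx]_(B in [set: 'M[R]_(K, n2)]) f (row_mx A B).
Proof.
move=> mf f0.
have mphi : measurable_fun setT (fun p : 'M[R]_(K, n1) * 'M[R]_(K, n2) => row_mx p.1 p.2).
  exact: measurable_row_mx.
rewrite (@integral_mx_pushforward _ _ _ _ _ (lebesgue_mx \x lebesgue_mx) (fun p => row_mx p.1 p.2))//.
  rewrite (fubini_tonelli1 (fun p => f (row_mx p.1 p.2)))//.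
    exact: (measurableT_comp mf mphi).
move=> A mA; under eq_bigr do rewrite big_split_ord/=.
rewrite big_split/=.
rewrite -(lebesgue_mx_box (A := fun i j => A i (lshift _ j)))//.
rewrite -(lebesgue_mx_box (A := fun i j => A i (rshift _ j)))//.
rewrite -product_measure1E; [|exact: measurable_mx_box..].
congr ((_ \x _) _); apply/seteqP; split => -[F G] /= h.
  by split => i j; [have := h i (lshift _ j); rewrite row_mxEl|have := h i (rshift _ j); rewrite row_mxEr].
by move=> i j; case: (split_ordP j) => k ->; rewrite ?row_mxEl ?row_mxEr; apply h.
Qed.

Lemma integral_mx11 (f : 'M[R]_1 -> \bar R) :
  measurable_fun setT f -> (forall F, 0 <= f F) ->
  \int[lebesgue_mx]_F f F = \int[leb]_x f x%:M.
Proof.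
move=> mf f0; apply: (@integral_mx_pushforward _ _ _ _ _ leb (fun x => x%:M)) => //.
  apply: measurable_fun_mx => i j; under eq_fun do rewrite mxE.
  by rewrite !ord1; exact: measurable_id.
move=> A mA; rewrite !big_ord_recl !big_ord0 !mule1; congr (leb _).
apply/seteqP; split => x /=; first by move/(_ ord0 ord0); rewrite mxE.
by move=> h i j; rewrite !ord1 mxE.
Qed.

Lemma integral_mx0 K n (f : 'M[R]_(K, n) -> \bar R) : (K * n = 0)%N ->
  measurable_fun setT f -> (forall F, 0 <= f F) ->
  \int[lebesgue_mx]_F f F = f 0%R.
Proof.
move=> Kn0 mf f0; rewrite (@integral_mx_pushforward _ _ _ _ _ \d_(0 : 'M[R]_(K, n))%R id)//.
  by rewrite integral_dirac// diracT mul1e.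
move=> A mA; have Kn (i : 'I_K) (j : 'I_n) : False.
  by move/eqP: Kn0; rewrite muln_eq0; case/orP => /eqP h; [case: i|case: j] => k; rewrite h.
transitivity (dirac (0 : 'M[R]_(K, n))%R (mx_box A) : \bar R) => //.
rewrite diracE mem_set; last by move=> i j; case: (Kn i j).
by rewrite big1// => i _; rewrite big1// => j _; case: (Kn i j).
Qed.

End split_mx.

(** * Quadratic forms and Gaussian integrals *)

Section dot.
Context {R : realType}.

Definition dot K n (X Y : 'M[R]_(K, n)) : R := \tr (X^T *m Y).

Lemma dotE K n (X Y : 'M[R]_(K, n)) : dot X Y = \sum_i \sum_j X i j * Y i j.
Proof.
rewrite /dot exchange_big /mxtrace/=; apply: eq_bigr => j _.
by rewrite mxE; apply: eq_bigr => i _; rewrite mxE.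
Qed.

Lemma dotC K n (X Y : 'M[R]_(K, n)) : dot X Y = dot Y X.
Proof.
by rewrite !dotE; apply: eq_bigr => i _; apply: eq_bigr => j _; rewrite mulrC.
Qed.

Lemma dotDl K n (X Y Z : 'M[R]_(K, n)) : dot (X + Y) Z = dot X Z + dot Y Z.
Proof. by rewrite /dot linearD mulmxDl mxtraceD. Qed.
Lemma dotNl K n (X Y : 'M[R]_(K, n)) : dot (- X) Y = - dot X Y.
Proof. by rewrite /dot linearN mulNmx -scaleN1r mxtraceZ mulN1r. Qed.
Lemma dotBl K n (X Y Z : 'M[R]_(K, n)) : dot (X - Y) Z = dot X Z - dot Y Z.
Proof. by rewrite dotDl dotNl. Qed.
Lemma dotZl K n a (X Y : 'M[R]_(K, n)) : dot (a *: X) Y = a * dot X Y.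
Proof. by rewrite /dot linearZ/= -scalemxAl mxtraceZ. Qed.
Lemma dotDr K n (X Y Z : 'M[R]_(K, n)) : dot X (Y + Z) = dot X Y + dot X Z.
Proof. by rewrite dotC dotDl ![dot _ X]dotC. Qed.
Lemma dotNr K n (X Y : 'M[R]_(K, n)) : dot X (- Y) = - dot X Y.
Proof. by rewrite dotC dotNl dotC. Qed.
Lemma dotBr K n (X Y Z : 'M[R]_(K, n)) : dot X (Y - Z) = dot X Y - dot X Z.
Proof. by rewrite dotDr dotNr. Qed.
Lemma dotZr K n a (X Y : 'M[R]_(K, n)) : dot X (a *: Y) = a * dot X Y.
Proof. by rewrite dotC dotZl dotC. Qed.
Lemma dot0l K n (X : 'M[R]_(K, n)) : dot 0 X = 0.
Proof. by rewrite -(scale0r 0) dotZl mul0r. Qed.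
Lemma dot0r K n (X : 'M[R]_(K, n)) : dot X 0 = 0.
Proof. by rewrite dotC dot0l. Qed.

Definition dotE_lin := (dotDl, dotDr, dotBl, dotBr, dotNl, dotNr, dotZl, dotZr).

Lemma dotMl K n m (A : 'M[R]_(K, m)) (X : 'M[R]_(m, n)) Y :
  dot (A *m X) Y = dot X (A^T *m Y).
Proof. by rewrite /dot trmx_mul mulmxA. Qed.

Lemma dotMr K n m (X : 'M[R]_(K, m)) (Q : 'M[R]_(m, n)) Y :
  dot (X *m Q) Y = dot X (Y *m Q^T).
Proof. by rewrite /dot trmx_mul -mulmxA mxtrace_mulC -mulmxA. Qed.

Lemma dot_ge0 K n (X : 'M[R]_(K, n)) : 0 <= dot X X.
Proof.
by rewrite dotE sumr_ge0// => i _; rewrite sumr_ge0// => j _; rewrite -expr2 sqr_ge0.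
Qed.

Lemma dot_eq0 K n (X : 'M[R]_(K, n)) : dot X X = 0 -> X = 0.
Proof.
rewrite dotE => /eqP; rewrite psumr_eq0; last first.
  by move=> i _; rewrite sumr_ge0// => j _; rewrite -expr2 sqr_ge0.
move=> /allP h; apply/matrixP => i j; rewrite mxE.
have := h i (mem_index_enum _); rewrite /= psumr_eq0; last first.
  by move=> k _; rewrite -expr2 sqr_ge0.
by move=> /allP /(_ j (mem_index_enum _)); rewrite /= mulf_eq0 orbb => /eqP.
Qed.

Lemma frobenius_sqr K n (X : 'M[R]_(K, n)) : frobenius X ^+ 2 = dot X X.
Proof.
rewrite /frobenius sqr_sqrtr; first by rewrite dotE.
by apply: sumr_ge0 => i _; apply: sumr_ge0 => j _; rewrite sqr_ge0.
Qed.

Lemma dot_col_mx K1 K2 n (A C : 'M[R]_(K1, n)) (B D : 'M[R]_(K2, n)) :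
  dot (col_mx A B) (col_mx C D) = dot A C + dot B D.
Proof. by rewrite /dot tr_col_mx mul_row_col mxtraceD. Qed.

Lemma dot_row_mx K n1 n2 (A C : 'M[R]_(K, n1)) (B D : 'M[R]_(K, n2)) :
  dot (row_mx A B) (row_mx C D) = dot A C + dot B D.
Proof. by rewrite /dot tr_row_mx mul_col_row mxtrace_block. Qed.

Lemma measurable_dot d (X : measurableType d) K n (f g : X -> 'M[R]_(K, n)) :
  measurable_fun setT f -> measurable_fun setT g ->
  measurable_fun setT (fun x => dot (f x) (g x)).
Proof.
move=> mf mg; apply: measurable_mxtrace; apply: measurable_mulmx => //.
exact: measurable_trmx.
Qed.

(** The test matrices have any number of columns, so that matrix inequalities apply directly to
    [dot] without a passage to columns. Symmetry is a separate matter, included in [spd] only. *)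
Definition psd K (P : 'M[R]_K) := forall n (X : 'M[R]_(K, n)), 0 <= dot X (P *m X).

Definition spd K (P : 'M[R]_K) :=
  P^T = P /\ forall n (X : 'M[R]_(K, n)), X != 0 -> 0 < dot X (P *m X).

Lemma psd_gram K m (A : 'M[R]_(K, m)) : psd (A *m A^T).
Proof.
move=> n X; rewrite -mulmxA; have -> : A = A^T^T by rewrite trmxK.
by rewrite -dotMl trmxK dot_ge0.
Qed.

Lemma spd_scalar_gram K m (c : R) (A : 'M[R]_(K, m)) : 0 < c -> spd (c%:M + A *m A^T).
Proof.
move=> c0; split; first by rewrite linearD/= tr_scalar_mx trmx_mul trmxK.
move=> n X X0; rewrite mulmxDl dotDr mul_scalar_mx dotZr.
apply: ltr_wpDr; first exact: psd_gram.
rewrite mulr_gt0// lt0r dot_ge0 andbT; apply: contra_neq X0; exact: dot_eq0.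
Qed.

Lemma spd_unit K (P : 'M[R]_K) : spd P -> P \in unitmx.
Proof.
move=> [PT P0]; rewrite -row_free_unit -kermx_eq0; apply/negPn/negP => h.
have := P0 _ (kermx P)^T; rewrite -trmx0 (inj_eq trmx_inj) => /(_ h).
by rewrite -{2}PT -trmx_mul mulmx_ker trmx0 dot0r ltxx.
Qed.

Lemma spd_inv K (P : 'M[R]_K) : spd P -> spd (invmx P).
Proof.
move=> hP; have uP := spd_unit hP; case: hP => PT P0.
split; first by rewrite trmx_inv PT.
move=> n X X0; rewrite -{1}(mulKVmx uP X) dotC; apply: P0.
by apply: contra_neq X0 => h; rewrite -(mulKVmx uP X) h mulmx0.
Qed.

Lemma psdD K (P Q : 'M[R]_K) : psd P -> psd Q -> psd (P + Q).
Proof. by move=> hP hQ n X; rewrite mulmxDl dotDr addr_ge0. Qed.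

Lemma psd_conj K m (P : 'M[R]_K) (A : 'M[R]_(K, m)) : psd P -> psd (A^T *m P *m A).
Proof. by move=> hP n X; rewrite -!mulmxA -dotMl; exact: hP. Qed.

Lemma psdZ K c (P : 'M[R]_K) : 0 <= c -> psd P -> psd (c *: P).
Proof. by move=> c0 hP n X; rewrite -scalemxAl dotZr mulr_ge0. Qed.

End dot.

(* Change of variables for the maps [F |-> L *m F]. *)
Section change_of_variables.
Context {R : realType}.
Local Open Scope ereal_scope.

Definition jacobian K (L : 'M[R]_K) := forall n (f : 'M[R]_(K, n) -> \bar R),
  measurable_fun setT f -> (forall F, 0 <= f F) ->
  \int[lebesgue_mx]_F f (L *m F) = (`|\det L| ^- n)%:E * \int[lebesgue_mx]_F f F.

Lemma measurable_mull d (X : measurableType d) K n m (A : 'M[R]_(K, n))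
  (f : X -> 'M[R]_(n, m)) : measurable_fun setT f -> measurable_fun setT (fun x => A *m f x)%R.
Proof. exact: measurable_mulmx. Qed.

(** Once the first row is fixed, the remaining rows undergo [L] followed by a translation, and the
    first row itself is only scaled. Tonelli, translation invariance and scaling therefore
    suffice. *)
Lemma jacobian_lblock K (a : 'M[R]_1) (l : 'M[R]_(K, 1)) (L : 'M[R]_K) :
  (\det a != 0)%R -> jacobian L -> jacobian (block_mx a 0 l L : 'M[R]_(1 + K)).
Proof.
move=> a0 JL n f mf f0.
have mcol (A : 'M[R]_(1, n)) : measurable_fun setT (fun B : 'M[R]_(K, n) => f (col_mx A B)).
  by apply: (measurableT_comp mf); exact: measurable_col_mx.
have mF : measurable_fun setT (fun F : 'M[R]_(1 + K, n) => block_mx a 0 l L *m F)%R.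
  exact: measurable_mull.
rewrite integral_col_mx//; last exact: (measurableT_comp mf mF).
under eq_integral => A _.
  under eq_integral => B _.
    rewrite mul_block_col mul0mx addr0 (addrC (l *m A)%R).
    over.
  rewrite (JL _ (fun B => f (col_mx (a *m A) (B + l *m A)%R)))//; last first.
    apply: (measurableT_comp mf); apply: measurable_col_mx => //.
    exact: measurable_addmx.
  rewrite (integral_mx_shift (f := fun B => f (col_mx (a *m A) B)))//.
  rewrite {1}(mx11_scalar a) mul_scalar_mx.
  over.
have mpair : measurable_fun setT (fun p : 'M[R]_(1, n) * 'M[R]_(K, n) => f (col_mx p.1 p.2)).
  by apply: (measurableT_comp mf); exact: measurable_col_mx.
pose g (A : 'M[R]_(1, n)) : \bar R := \int[lebesgue_mx]_(B in [set: 'M[R]_(K, n)]) f (col_mx A B).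
have mg : measurable_fun setT g.
  exact: (measurable_fun_fubini_tonelli_F (fun p : 'M[R]_(1, n) * 'M[R]_(K, n) => f (col_mx p.1 p.2))).
rewrite ge0_integralZl_EFin//; last 2 first.
- by move=> A _; exact: integral_ge0.
- apply: (measurableT_comp mg); exact: measurable_scalemx.
rewrite (integral_mx_scale (f := g))//.
- rewrite -integral_col_mx// muleA -EFinM; congr (_%:E * _).
  by rewrite det_lblock normrM exprMn invfM mulrC mul1n {2}(mx11_scalar a) det_scalar1.
- by move: a0; rewrite {1}(mx11_scalar a) det_scalar1.
- by move=> A; exact: integral_ge0.
Qed.

End change_of_variables.

(** * Cholesky factorization *)

Section cholesky.
Context {R : realType}.

(** Induction on the Schur complement. The factor comes with its own change of variables formula, so
    this formula is only established for the triangular maps built here, which is what the Gaussian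
    and Student integrals use. *)
Lemma cholesky K (P : 'M[R]_K) : spd P ->
  exists L : 'M[R]_K, [/\ P = L *m L^T, 0 < \det L & jacobian L].
Proof.
elim: K P => [|K IH] P hP.
  exists 1%:M; split; first by apply/matrixP => -[].
    by rewrite det1.
  move=> n f mf f0; rewrite det1 normr1 expr1n invr1 mul1e.
  by apply: eq_integral => F _; rewrite mul1mx.
change 'M[R]_(1 + K) in P; have PT : P^T = P by case: hP.
have P0 n (X : 'M[R]_(1 + K, n)) : X != 0 -> 0 < dot X (P *m X) by case: hP => _; exact.
pose p : R := ulsubmx P 0 0; pose b := dlsubmx P; pose P' := drsubmx P.
have PE : P = block_mx p%:M b^T b P'.
  rewrite -{1}(submxK P) -mx11_scalar; congr block_mx.
  by rewrite /b trmx_dlsub PT.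
have P'T : (P'^T = P')%R by rewrite /P' trmx_drsub PT.
have p0 : (0 < p)%R.
  have := P0 _ (col_mx 1%:M 0 : 'M[R]_(1 + K, 1)).
  rewrite PE mul_block_col !mulmx0 !mulmx1 !addr0 dot_col_mx dot0l addr0.
  rewrite /dot trmx1 mul1mx mxtrace_scalar; apply.
  apply/eqP => /(congr1 (usubmx (m1 := 1))); rewrite col_mxKu linear0.
  by move/matrixP/(_ 0%R 0%R)/eqP; rewrite !mxE eqxx oner_eq0.
have pn0 : p != 0%R by rewrite gt_eqF.
pose P2 := (P' - p^-1 *: (b *m b^T))%R.
have hP2 : spd P2.
  split; first by rewrite /P2 linearB/= linearZ/= trmx_mul trmxK P'T.
  (* [Y] completes [X] by the first row that minimizes the form of [P]; the minimum is the form of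
     the Schur complement [P2]. *)
  move=> n X X0; pose Y : 'M[R]_(1 + K, n) := col_mx (- p^-1 *: (b^T *m X)) X.
  have /P0 : Y != 0%R.
    apply: contra_neq X0 => /(congr1 (dsubmx (m1 := 1))).
    by rewrite col_mxKd linear0.
  rewrite PE mul_block_col mul_scalar_mx scalerA mulrN mulfV// scaleN1r addNr.
  rewrite dot_col_mx dot0r add0r; congr (_ < dot X _)%R.
  by rewrite mulmxBl -!scalemxAr -scalemxAl mulmxA scaleNr addrC.
have [L [LE L0 JL]] := IH _ hP2.
pose a := Num.sqrt p; have a0 : (0 < a)%R by rewrite sqrtr_gt0.
have aa : (a * a = p)%R by rewrite -expr2 sqr_sqrtr// ltW.
pose C : 'M[R]_(1 + K) := block_mx a%:M 0 (a^-1 *: b) L.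
have PC : P = C *m C^T.
  rewrite PE tr_block_mx mulmx_block !trmx0 !mulmx0 !mul0mx !addr0 tr_scalar_mx -scalar_mxM aa.
  rewrite linearZ/= mul_mx_scalar mul_scalar_mx !scalerA mulfV ?gt_eqF// !scale1r.
  congr block_mx; rewrite -scalemxAl -scalemxAr scalerA -invfM aa -LE.
  by rewrite addrC /P2 subrK.
exists C; split; first exact: PC.
- by rewrite (@det_lblock _ 1 K) det_scalar1 mulr_gt0.
- by apply: jacobian_lblock; rewrite // det_scalar1 gt_eqF.
Qed.

Lemma spd_det_gt0 K (P : 'M[R]_K) : spd P -> (0 < \det P)%R.
Proof.
by move=> /cholesky[L [-> L0 _]]; rewrite det_mulmx det_tr mulr_gt0.
Qed.

End cholesky.

(** * Gaussian integrals over matrices *)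

Section gaussian.
Context {R : realType}.
Local Notation leb := (@lebesgue_measure R).
Local Open Scope ereal_scope.

(** The explicit value [(2 pi)^(K n / 2)] never enters: these masses cancel between the two sides of
    each mixture identity, and only their positivity matters. *)
Definition gauss_mass K n : R :=
  fine (\int[lebesgue_mx]_(F in [set: 'M[R]_(K, n)]) (expR (- (dot F F / 2)))%:E).

Let mgauss K n : measurable_fun setT (fun F : 'M[R]_(K, n) => (expR (- (dot F F / 2)))%:E).
Proof.
apply/measurable_EFinP; apply: (measurableT_comp (@measurable_expR R)).
by apply: measurable_funN; apply: measurable_funM => //; exact: measurable_dot.
Qed.

Let gaussE K n : exists2 c : R, (0 < c)%R &
  \int[lebesgue_mx]_(F in [set: 'M[R]_(K, n)]) (expR (- (dot F F / 2)))%:E = c%:E.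
Proof.
have split_exp (x y : R) : (expR (- ((x + y) / 2)))%:E = (expR (- (x / 2)))%:E * (expR (- (y / 2)))%:E.
  by rewrite -EFinM -expRD mulrDl opprD.
have mulE K' n' (x : R) : \int[lebesgue_mx]_(F in [set: 'M[R]_(K', n')])
    ((expR x)%:E * (expR (- (dot F F / 2)))%:E) =
    (expR x)%:E * \int[lebesgue_mx]_(F in [set: 'M[R]_(K', n')]) (expR (- (dot F F / 2)))%:E.
  by rewrite ge0_integralZl_EFin//; exact: mgauss.
have mulE' K' n' (x : R) : (0 <= x)%R -> \int[lebesgue_mx]_(F in [set: 'M[R]_(K', n')])
    (x%:E * (expR (- (dot F F / 2)))%:E) =
    x%:E * \int[lebesgue_mx]_(F in [set: 'M[R]_(K', n')]) (expR (- (dot F F / 2)))%:E.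
  by move=> x0; rewrite ge0_integralZl_EFin//; exact: mgauss.
have E0 K' n' : (K' * n' = 0)%N -> \int[lebesgue_mx]_(F in [set: 'M[R]_(K', n')]) (expR (- (dot F F / 2)))%:E = 1.
  by move=> h; rewrite integral_mx0//; rewrite dot0l mul0r oppr0 expR0.
have rowE n' : exists2 c : R, (0 < c)%R &
  \int[lebesgue_mx]_(F in [set: 'M[R]_(1, n')]) (expR (- (dot F F / 2)))%:E = c%:E.
  elim: n' => [|n' [c c0 IH]]; first by exists 1%R; rewrite ?E0.
  pose c1 := (Num.sqrt (pi : R) * Num.sqrt 2)%R.
  exists (c1 * c)%R; first by rewrite !mulr_gt0// sqrtr_gt0// pi_gt0.
  rewrite (@integral_row_mx _ 1 1 n')//.
  under eq_integral => A _.
    under eq_integral => B _ do rewrite (@dot_row_mx R 1 1 n') split_exp.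
    rewrite mulE IH muleC.
    over.
  rewrite mulE' ?(ltW c0)// EFinM muleC; congr (_ * _).
  have s2 : ((Num.sqrt 2 : R)^-1 != 0)%R by rewrite invr_eq0 gt_eqF// sqrtr_gt0.
  have := @integral_mx_scale R 1 1 (fun F => (expR (- dot F F))%:E) _ s2.
  rewrite normfV muln1 expr1 invrK => h.
  rewrite [LHS](eq_integral (fun F : 'M[R]_1 => (expR (- dot ((Num.sqrt 2)^-1 *: F) ((Num.sqrt 2)^-1 *: F)))%:E)); last first.
    move=> F _; rewrite dotZl dotZr mulrA -invfM -expr2 sqr_sqrtr//; congr ((expR (- _))%:E).
    by rewrite mulrC.
  have mg : measurable_fun setT (fun F : 'M[R]_1 => (expR (- dot F F))%:E).
    apply/measurable_EFinP; apply: (measurableT_comp (@measurable_expR R)).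
    by apply: measurable_funN; exact: measurable_dot.
  rewrite h// integral_mx11// /c1 EFinM muleC ger0_norm ?sqrtr_ge0//; congr (_ * _).
  rewrite -integralT_gauss; apply: eq_integral => x _; congr (expR (- _))%:E.
  by rewrite dotE !big_ord_recl !big_ord0 !addr0 mxE eqxx mulr1n expr2.
elim: K => [|K [c c0 IH]]; first by exists 1%R; rewrite ?E0.
have [c1 c10 E1] := rowE n.
exists (c1 * c)%R; first by rewrite mulr_gt0.
rewrite (@integral_col_mx _ 1 K n)//.
under eq_integral => A _.
  under eq_integral => B _ do rewrite (@dot_col_mx R 1 K n) split_exp.
  rewrite mulE IH muleC.
  over.
by rewrite mulE' ?(ltW c0)// E1 -EFinM mulrC.
Qed.

Lemma gauss_mass_gt0 K n : (0 < gauss_mass K n)%R.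
Proof. by rewrite /gauss_mass; have [c c0 ->] := gaussE K n. Qed.

Lemma integral_gauss0 K n :
  \int[lebesgue_mx]_(F in [set: 'M[R]_(K, n)]) (expR (- (dot F F / 2)))%:E = (gauss_mass K n)%:E.
Proof. by rewrite /gauss_mass; have [c c0 ->] := gaussE K n. Qed.

End gaussian.

Section gaussian_integral.
Context {R : realType} (K n : nat).
Implicit Types (P : 'M[R]_K) (F G Y : 'M[R]_(K, n)).

(** The unnormalized Gaussian density with precision [P] and mean [invmx P *m Y]. The linear term is
    kept in place of the mean, so that exponential tilts act by addition on [Y]. *)
Definition gauss_weight P Y F : R := expR (dot F Y - dot F (P *m F) / 2).

Lemma measurable_gauss_weight P Y : measurable_fun setT (gauss_weight P Y).
Proof.
apply: (measurableT_comp (@measurable_expR R)); apply: measurable_funB.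
  exact: measurable_dot.
by apply: measurable_funM => //; apply: measurable_dot => //; exact: measurable_mull.
Qed.

Lemma powR_sqr_inv (x : R) m : 0 < x -> (x ^- 2) `^ (- (m%:R / 2)) = x ^+ m.
Proof.
move=> x0; rewrite -powR_inv1 ?exprn_ge0 ?ltW// -powR_mulrn ?ltW// -!powRrM.
by rewrite -powR_mulrn ?ltW//; congr (_ `^ _); field.
Qed.

Lemma gauss_weight_center P Y F : spd P ->
  gauss_weight P Y (F + invmx P *m Y) =
  expR (dot Y (invmx P *m Y) / 2) * expR (- (dot F (P *m F) / 2)).
Proof.
move=> hP; have uP := spd_unit hP; case: hP => PT _.
rewrite /gauss_weight -expRD; congr expR; rewrite mulmxDr mulKVmx// !dotE_lin.
have -> : dot (invmx P *m Y) (P *m F) = dot F Y.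
  by rewrite dotMl trmx_inv PT mulKmx// dotC.
rewrite [dot (invmx P *m Y) Y]dotC; lra.
Qed.

Lemma integral_gauss_weight P Y : spd P ->
  (\int[lebesgue_mx]_F (gauss_weight P Y F)%:E)%E =
  (gauss_mass K n * \det P `^ (- (n%:R / 2)) * expR (dot Y (invmx P *m Y) / 2))%:E.
Proof.
move=> hP; have uP := spd_unit hP.
have [L [LE L0 JL]] := cholesky (spd_inv hP).
have mq := measurable_gauss_weight.
have mE (Q : 'M[R]_K) : measurable_fun setT (fun F => (expR (- (dot F (Q *m F) / 2)))%:E).
  apply/measurable_EFinP; apply: (measurableT_comp (@measurable_expR R)).
  apply: measurable_funN; apply: measurable_funM => //.
  by apply: measurable_dot => //; exact: measurable_mull.
rewrite -(integral_mx_shift (f := fun F => (gauss_weight P Y F)%:E) (invmx P *m Y)); last 2 first.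
- exact/measurable_EFinP.
- by move=> F; rewrite lee_fin expR_ge0.
under eq_integral do rewrite gauss_weight_center// EFinM.
rewrite ge0_integralZl_EFin ?expR_ge0//.
rewrite muleC [RHS]EFinM; congr (_ * _)%E.
have ge0 F : (0 <= (expR (- (dot F (P *m F) / 2)))%:E)%E by rewrite lee_fin expR_ge0.
have := JL n (fun F => (expR (- (dot F (P *m F) / 2)))%:E) (mE P) ge0.
rewrite (gtr0_norm L0); under [X in X = _ -> _]eq_integral => F _.
  rewrite /= dotMl; have -> : L^T *m (P *m (L *m F)) = F.
    have uL : L \in unitmx by rewrite unitmxE unitfE gt_eqF.
    rewrite -[RHS](mulKmx uL) -[LHS](mulKmx uL); congr (_ *m _).
    by rewrite (mulmxA L L^T) -LE mulKmx.
  over.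
rewrite integral_gauss0 => h.
have dP : \det P = \det L ^- 2.
  by rewrite -(invmxK P) LE det_inv det_mulmx det_tr expr2.
rewrite dP powR_sqr_inv// mulrC EFinM h muleA -EFinM divff ?mul1e//.
by rewrite expf_neq0// gt_eqF.
Qed.

Lemma gauss_weight_reflect P Y F : spd P ->
  gauss_weight P Y (- F + invmx P *m Y) = gauss_weight P Y (F + invmx P *m Y).
Proof.
move=> hP; rewrite !gauss_weight_center//; congr (_ * expR (- (_ / 2))).
by rewrite mulmxN dotNl dotNr opprK.
Qed.

Lemma normr_le_expR (x : R) : `|x| <= expR x + expR (- x).
Proof.
rewrite ler_norml; apply/andP; split.
  have := expR_ge1Dx (- x); have := expR_gt0 x; lra.
have := expR_ge1Dx x; have := expR_gt0 (- x); lra.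
Qed.

Lemma gauss_weight_tilt P Y F (c : R) i j :
  expR (c * F i j) * gauss_weight P Y F = gauss_weight P (Y + c *: delta_mx i j) F.
Proof.
rewrite /gauss_weight -expRD; congr expR; rewrite dotDr dotZr.
have -> : dot F (delta_mx i j) = F i j.
  rewrite dotE (bigD1 i)//= (bigD1 j)//= mxE !eqxx mulr1 big1 => [|k kj].
    rewrite addr0 big1 ?addr0// => k ki; rewrite big1// => l _.
    by rewrite mxE (negPf ki) mulr0.
  by rewrite mxE (negPf kj) andbF mulr0.
by ring.
Qed.

Lemma integrable_gauss_weight P Y : spd P ->
  lebesgue_mx.-integrable setT (EFin \o gauss_weight P Y).
Proof.
move=> hP; apply/integrableP; split.
  by apply/measurable_EFinP; exact: measurable_gauss_weight.
under eq_integral do rewrite /= ger0_norm ?expR_ge0//.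
by rewrite integral_gauss_weight// ltry.
Qed.

(** By [|x| <= exp x + exp (- x)] the entry factor is dominated by two tilts of the weight, whose
    integrals are already known. *)
Lemma integrable_gauss_weight_entry P Y i j : spd P ->
  lebesgue_mx.-integrable setT (EFin \o (fun F => F i j * gauss_weight P Y F)).
Proof.
move=> hP; apply: (@le_integrable _ _ _ _ _ measurableT _
    (EFin \o (fun F => gauss_weight P (Y + 1 *: delta_mx i j) F +
                       gauss_weight P (Y + (-1) *: delta_mx i j) F))).
- apply/measurable_EFinP; apply: measurable_funM; first exact: measurable_entry.
  exact: measurable_gauss_weight.
- move=> F _ /=; rewrite lee_fin normrM [X in _ * X]ger0_norm ?expR_ge0//.
  rewrite [leRHS]ger0_norm ?addr_ge0 ?expR_ge0//.
  rewrite -!gauss_weight_tilt -mulrDl ler_wpM2r ?expR_ge0// mul1r mulN1r.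
  exact: normr_le_expR.
- rewrite (_ : _ \o _ = (EFin \o gauss_weight P (Y + 1 *: delta_mx i j)) \+
     (EFin \o gauss_weight P (Y + (-1) *: delta_mx i j)))%E//.
  by apply: integrableD => //; exact: integrable_gauss_weight.
Qed.

End gaussian_integral.

Section gaussian_mean.
Context {R : realType} (K n : nat).
Implicit Types (P : 'M[R]_K) (F Y : 'M[R]_(K, n)).
Local Open Scope ereal_scope.

Lemma integral_mx_reflect (f : 'M[R]_(K, n) -> \bar R) (M : 'M[R]_(K, n)) :
  measurable_fun setT f -> (forall F, 0 <= f F) ->
  \int[lebesgue_mx]_F f (M - F)%R = \int[lebesgue_mx]_F f F.
Proof.
move=> mf f0.
have n1 : (-1 != 0 :> R)%R by rewrite oppr_eq0 oner_eq0.
have mg : measurable_fun setT (fun F => f (F + M)%R).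
  by apply: (measurableT_comp mf); exact: measurable_addmx.
rewrite -[RHS](integral_mx_shift M)//.
have := integral_mx_scale n1 mg (fun F => f0 _).
rewrite normrN1 expr1n invr1 mul1e => <-.
by apply: eq_integral => F _; rewrite scaleN1r addrC.
Qed.

(** The reflection about the mean preserves the weight and exchanges the positive and negative parts
    of the centered entry, so the centered integral vanishes. *)
Lemma integral_gauss_weight_entry P Y i j : spd P ->
  \int[lebesgue_mx]_F (F i j * gauss_weight P Y F)%:E =
  ((invmx P *m Y)%R i j)%:E * \int[lebesgue_mx]_F (gauss_weight P Y F)%:E.
Proof.
move=> hP; set M := (invmx P *m Y)%R.
pose g F := ((F i j - M i j) * gauss_weight P Y F)%R.
have mg : measurable_fun setT g.
  apply: measurable_funM; last exact: measurable_gauss_weight.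
  by apply: measurable_funB => //; exact: measurable_entry.
have i1 := integrable_gauss_weight_entry Y i j hP.
have i2 := integrable_gauss_weight Y hP.
have ig : lebesgue_mx.-integrable setT (EFin \o g).
  rewrite (_ : _ \o _ = (EFin \o (fun F => F i j * gauss_weight P Y F)%R) \-
    (fun F => (M i j)%:E * (EFin \o gauss_weight P Y) F)); last first.
    by apply/funext => F; rewrite /= /g mulrBl EFinB [in LHS](EFinM (M i j)).
  by apply: integrableB => //; exact: integrableZl.
have ig0 : \int[lebesgue_mx]_F (g F)%:E = 0.
  rewrite integralE; have -> : \int[lebesgue_mx]_F (EFin \o g)^\- F = \int[lebesgue_mx]_F (EFin \o g)^\+ F.
    rewrite -[RHS](integral_mx_reflect (M + M)%R); last 2 first.
    - by apply: measurable_funepos; exact/measurable_EFinP.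
    - by move=> F; exact: funepos_ge0.
    apply: eq_integral => F _; rewrite funenegE funeposE/= /g.
    have -> : gauss_weight P Y (M + M - F)%R = gauss_weight P Y F.
      rewrite -[in RHS](subrK M F) -gauss_weight_reflect// opprB.
      by congr gauss_weight; rewrite addrAC.
    rewrite !mxE; congr maxe; congr (_%:E); ring.
  rewrite subee//; apply: integrable_pos_fin_num => //.
rewrite -[RHS]add0e -ig0 -integralZl// -integralD//; last exact: integrableZl.
by apply: eq_integral => F _ /=; rewrite -EFinM -EFinD /g; congr _%:E; ring.
Qed.

End gaussian_mean.

(** * Probability measures given by a density *)

Section normalized_density.
Context {R : realType} {K n : nat}.
Variables (mu : {measure set 'M[R]_(K, n) -> \bar R}) (f : 'M[R]_(K, n) -> R) (c : R).
Hypotheses (mf : measurable_fun setT f) (f0 : forall F, 0 <= f F) (c0 : 0 < c).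
Hypothesis fc : (\int[mu]_F (f F)%:E = c%:E)%E.
Local Open Scope ereal_scope.

Let mEf : measurable_fun setT (EFin \o f).
Proof. exact/measurable_EFinP. Qed.

Lemma normalized_densityE A : normalized_density mu f A = c^-1%:E * \int[mu]_(F in A) (f F)%:E.
Proof. by rewrite /normalized_density fc inver gt_eqF// muleC. Qed.

Let nd0 : normalized_density mu f set0 = 0.
Proof. by rewrite normalized_densityE integral_set0 mule0. Qed.

Let nd_ge0 A : 0 <= normalized_density mu f A.
Proof.
rewrite normalized_densityE mule_ge0// ?lee_fin ?invr_ge0 ?(ltW c0)//.
by apply: integral_ge0 => F _; rewrite lee_fin.
Qed.

Let nd_sigma_additive : semi_sigma_additive (normalized_density mu f).
Proof.
move=> F mF tF mUF; apply: cvg_toP.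
  apply: ereal_nondecreasing_is_cvgn => m k mk.
  by apply: lee_sum_nneg_natr => // i _ _; exact: nd_ge0.
rewrite normalized_densityE ge0_integral_bigcup//; last first.
- by move=> x _; rewrite lee_fin.
- exact: measurable_funTS.
rewrite -nneseriesZl; last by move=> *; apply: integral_ge0 => x _; rewrite lee_fin.
by apply: eq_eseriesr => i _; rewrite normalized_densityE.
Qed.

Let nd_setT : normalized_density mu f setT = 1.
Proof. by rewrite normalized_densityE fc -EFinM mulVf ?gt_eqF. Qed.

(** The hypotheses are arguments of the term, so that the measure and probability structures can be
    attached to it; it still unfolds to [normalized_density mu f]. *)
Definition nd_fun & measurable_fun setT f & (forall F, 0 <= f F)%R & (0 < c)%R
  & \int[mu]_F (f F)%:E = c%:E := normalized_density mu f.

HB.instance Definition _ := isMeasure.Build _ _ _ (nd_fun mf f0 c0 fc)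
  nd0 nd_ge0 nd_sigma_additive.

HB.instance Definition _ := Measure_isProbability.Build _ _ _ (nd_fun mf f0 c0 fc) nd_setT.

Definition nd_probability : probability 'M[R]_(K, n) R := nd_fun mf f0 c0 fc.

Import HBNNSimple.

Let integral_nd_indic E : measurable E ->
  \int[nd_probability]_F (\1_E F)%:E = c^-1%:E * \int[mu]_F (\1_E F * f F)%:E.
Proof.
move=> mE; rewrite integral_indic// setIT.
transitivity (normalized_density mu f E) => //.
rewrite normalized_densityE integral_mkcond; congr (_ * _).
apply: eq_integral => F _; rewrite /patch indicE; case: ifP => _; first by rewrite mul1r.
by rewrite mul0r.
Qed.

Let integral_nd_nnsfun (h : {nnsfun 'M[R]_(K, n) >-> R}) :
  \int[nd_probability]_F (h F)%:E = c^-1%:E * \int[mu]_F (h F * f F)%:E.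
Proof.
have mh (r : R) : measurable_fun setT (fun x => (r * (\1_(h @^-1` [set r]) x * f x))%:E).
  apply/measurable_EFinP; apply: measurable_funM => //.
  by apply: measurable_funM => //; exact: measurable_indic.
under [LHS]eq_integral do rewrite fimfunE -fsumEFin//.
rewrite [LHS]ge0_integral_fsum//; last 2 first.
  - by move=> r; exact/measurable_EFinP/measurableT_comp.
  - by move=> k x _; rewrite EFinM nnfun_muleindic_ge0.
rewrite -[RHS]ge0_integralZl ?lee_fin ?invr_ge0 ?(ltW c0)//; last 2 first.
  - by apply/measurable_EFinP; exact: measurable_funM.
  - by move=> x _; rewrite lee_fin mulr_ge0.
under [RHS]eq_integral.
  move=> x xD; rewrite fimfunE mulr_fsuml// -EFinM mulr_fsumr -fsumEFin//.
  over.
have rge0 (r : R) x : (0 <= r * \1_(h @^-1` [set r]) x)%R.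
  by rewrite -lee_fin EFinM nnfun_muleindic_ge0.
have mrf (r : R) : measurable_fun setT (fun x => r * \1_(h @^-1` [set r]) x * f x)%R.
  by apply: measurable_funM => //; apply: measurable_funM => //; exact: measurable_indic.
rewrite [RHS]ge0_integral_fsum//; last 2 first.
  - by move=> r; apply/measurable_EFinP; exact: measurable_funM.
  - by move=> r x _; rewrite lee_fin mulr_ge0 ?invr_ge0 ?(ltW c0)// mulr_ge0.
apply: eq_fsbigr => r /set_mem[x _ hr].
have r0 : (0 <= r)%R by rewrite -hr.
under eq_integral do rewrite EFinM.
rewrite ge0_integralZl_EFin//; last first.
  by apply/measurable_EFinP; exact: measurable_indic.
rewrite integral_nd_indic//.
under [in RHS]eq_integral do rewrite -mulrA EFinM.
rewrite [in RHS]ge0_integralZl_EFin ?invr_ge0 ?(ltW c0)//; last first.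
  by move=> y _; rewrite lee_fin mulrA mulr_ge0.
under [in RHS]eq_integral do rewrite EFinM.
rewrite [in RHS]ge0_integralZl_EFin//; last first.
  by apply/measurable_EFinP; apply: measurable_funM => //; exact: measurable_indic.
  by move=> y _; rewrite lee_fin mulr_ge0.
by rewrite muleCA.
Qed.

(** Change of measure: indicators, then simple functions, then monotone convergence. *)
Lemma ge0_integral_nd (g : 'M[R]_(K, n) -> \bar R) :
  measurable_fun setT g -> (forall F, 0 <= g F) ->
  \int[nd_probability]_F g F = c^-1%:E * \int[mu]_F (g F * (f F)%:E).
Proof.
move=> mg g0; pose g_ := nnsfun_approx measurableT mg.
transitivity (limn (fun k => \int[nd_probability]_F (g_ k F)%:E)).
  rewrite -monotone_convergence//=.
  - apply: eq_integral => x _; apply/esym/cvg_lim => //=.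
    exact: cvg_nnsfun_approx.
  - by move=> k; exact/measurable_EFinP.
  - by move=> k x _; rewrite lee_fin.
  - by move=> x _ a b ab; rewrite lee_fin//; exact/lefP/nd_nnsfun_approx.
have mgf k : measurable_fun setT (fun x => (g_ k x * f x)%:E).
  by apply/measurable_EFinP; exact: measurable_funM.
have ndgf x : {homo (fun k => (g_ k x * f x)%:E) : a b / (a <= b)%N >-> a <= b}.
  by move=> a b ab; rewrite lee_fin ler_wpM2r//; exact/lefP/nd_nnsfun_approx.
rewrite (_ : \int[mu]_F _ = limn (fun k => \int[mu]_F (g_ k F * f F)%:E)); last first.
  rewrite -monotone_convergence//=.
  - apply: eq_integral => x _; apply/esym/cvg_lim => //.
    under eq_fun do rewrite EFinM.
    by apply: cvgeZr => //; exact: cvg_nnsfun_approx.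
  - by move=> k x _; rewrite lee_fin mulr_ge0.
rewrite -limeMl//.
  by congr (limn _); apply/funext => k /=; rewrite integral_nd_nnsfun.
apply/ereal_nondecreasing_is_cvgn => a b ab; apply: ge0_le_integral => //.
- by move=> x _; rewrite lee_fin mulr_ge0.
- by move=> x _; exact: ndgf.
Qed.

Lemma integral_nd (g : 'M[R]_(K, n) -> R) : measurable_fun setT g ->
  mu.-integrable setT (EFin \o (fun F => g F * f F)%R) ->
  \int[nd_probability]_F (g F)%:E = c^-1%:E * \int[mu]_F (g F * f F)%:E.
Proof.
move=> mg ig; have mEg : measurable_fun setT (EFin \o g) by exact/measurable_EFinP.
have posE F : (EFin \o g)^\+ F * (f F)%:E = (EFin \o (fun F => g F * f F)%R)^\+ F.
  by rewrite !funeposE/= EFinM maxe_pMl ?lee_fin// mul0e.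
have negE F : (EFin \o g)^\- F * (f F)%:E = (EFin \o (fun F => g F * f F)%R)^\- F.
  by rewrite !funenegE/= -mulNr EFinM maxe_pMl ?lee_fin// mul0e.
rewrite integralE !ge0_integral_nd//; [|exact: measurable_funeneg|exact: measurable_funepos].
under eq_integral do rewrite posE.
under [X in _ - _ * X]eq_integral do rewrite negE.
rewrite -muleBr//; first by rewrite -integralE.
by apply: fin_num_adde_defr; exact: integrable_pos_fin_num.
Qed.

End normalized_density.

(** * Bounded measurable functions *)

Section bounded_measurable.
Context d (X : measurableType d) {R : realType}.
Implicit Types f g : X -> R.

(** This class is closed under every operation needed below and integrable for every probability, so
    linearity and Fubini come without further side conditions. *)
Definition bm f := measurable_fun setT f /\ exists M, forall x, `|f x| <= M.

Lemma bm_cst c : bm (fun _ => c).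
Proof. by split; [exact: measurable_cst|exists `|c|]. Qed.

Lemma bmD f g : bm f -> bm g -> bm (fun x => f x + g x).
Proof.
move=> [mf [M fM]] [mg [N gN]]; split; first exact: measurable_funD.
by exists (M + N) => x; rewrite (le_trans (ler_normD _ _))// lerD.
Qed.

Lemma bmN f : bm f -> bm (fun x => - f x).
Proof.
move=> [mf [M fM]]; split; first exact: measurable_funN.
by exists M => x; rewrite normrN.
Qed.

Lemma bmB f g : bm f -> bm g -> bm (fun x => f x - g x).
Proof. by move=> bf /bmN bg; exact: bmD. Qed.

Lemma bmM f g : bm f -> bm g -> bm (fun x => f x * g x).
Proof.
move=> [mf [M fM]] [mg [N gN]]; split; first exact: measurable_funM.
by exists (M * N) => x; rewrite normrM ler_pM.
Qed.

Lemma bmZ c f : bm f -> bm (fun x => c * f x).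
Proof. by apply: bmM; exact: bm_cst. Qed.

Lemma bmX f m : bm f -> bm (fun x => f x ^+ m).
Proof.
move=> bf; elim: m => [|m IH]; first exact: bm_cst.
by under eq_fun do rewrite exprS; exact: bmM.
Qed.

Lemma bm_sum (I : Type) (s : seq I) (F : I -> X -> R) :
  (forall i, bm (F i)) -> bm (fun x => \sum_(i <- s) F i x).
Proof.
move=> bF; elim: s => [|i s IH].
  by under eq_fun do rewrite big_nil; exact: bm_cst.
by under eq_fun do rewrite big_cons; exact: bmD.
Qed.

Lemma bm_expR f : bm f -> bm (fun x => expR (f x)).
Proof.
move=> [mf [M fM]]; split; first exact: (measurableT_comp (@measurable_expR R) mf).
exists (expR M) => x; rewrite ger0_norm ?expR_ge0// ler_expR.
by rewrite (le_trans _ (fM x))// ler_norm.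
Qed.

Lemma eq_bm f g : f =1 g -> bm f -> bm g.
Proof. by move=> /funext ->. Qed.

End bounded_measurable.

Section bounded_integral.
Context d (X : measurableType d) {R : realType} (mu : probability X R).
Implicit Types f g : X -> R.

Lemma bm_integrable f : bm f -> mu.-integrable setT (EFin \o f).
Proof.
move=> [mf [M fM]].
apply: (@le_integrable _ _ _ mu _ measurableT _ (EFin \o cst `|M|)).
- exact/measurable_EFinP.
- by move=> x _ /=; rewrite lee_fin normr_id (le_trans (fM x))// ler_norm.
- exact: finite_measure_integrable_cst.
Qed.

Lemma bm_integralE f : bm f ->
  (\int[mu]_x (f x)%:E)%E = (\int[mu]_x f x)%:E.
Proof.
move=> bf; rewrite /Rintegral fineK//; apply: integrable_fin_num => //.
exact: bm_integrable.
Qed.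

Lemma bm_integral_cst c : \int[mu]_x c = c.
Proof.
by rewrite /Rintegral integral_cst//= probability_setT mule1.
Qed.

Lemma bm_integralD f g : bm f -> bm g ->
  \int[mu]_x (f x + g x) = \int[mu]_x f x + \int[mu]_x g x.
Proof. by move=> bf bg; rewrite RintegralD//; exact: bm_integrable. Qed.

Lemma bm_integralB f g : bm f -> bm g ->
  \int[mu]_x (f x - g x) = \int[mu]_x f x - \int[mu]_x g x.
Proof. by move=> bf bg; rewrite RintegralB//; exact: bm_integrable. Qed.

Lemma bm_integralZ c f : bm f -> \int[mu]_x (c * f x) = c * \int[mu]_x f x.
Proof. by move=> bf; rewrite RintegralZl//; exact: bm_integrable. Qed.

Lemma bm_integral_sum (I : Type) (s : seq I) (F : I -> X -> R) :
  (forall i, bm (F i)) ->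
  \int[mu]_x (\sum_(i <- s) F i x) = \sum_(i <- s) \int[mu]_x F i x.
Proof.
move=> bF; elim: s => [|i s IH].
  by under eq_Rintegral do rewrite big_nil; rewrite bm_integral_cst big_nil.
under eq_Rintegral do rewrite big_cons; rewrite bm_integralD//; last exact: bm_sum.
by rewrite big_cons IH.
Qed.

Lemma bm_integral_le f g : bm f -> bm g -> (forall x, f x <= g x) ->
  \int[mu]_x f x <= \int[mu]_x g x.
Proof. by move=> bf bg fg; apply: le_Rintegral => //; exact: bm_integrable. Qed.

Lemma bm_integral_ge0 f : (forall x, 0 <= f x) -> 0 <= \int[mu]_x f x.
Proof. by move=> f0; apply: Rintegral_ge0. Qed.

Lemma bm_integral_gt0 f : bm f -> (exists2 e, 0 < e & forall x, e <= f x) ->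
  0 < \int[mu]_x f x.
Proof.
move=> bf [e e0 ef]; apply: (lt_le_trans e0); rewrite -[leLHS]bm_integral_cst.
by apply: bm_integral_le => //; exact: bm_cst.
Qed.

(* Jensen's inequality for the exponential, in the form [1 + z <= exp z] with
   [z = phi - log E exp phi]. *)
Lemma exp_jensen f w : bm f -> bm w -> (forall x, 0 <= w x) -> 0 < \int[mu]_x w x ->
  (\int[mu]_x (f x * w x)) / \int[mu]_x w x <=
  ln ((\int[mu]_x (expR (f x) * w x)) / \int[mu]_x w x).
Proof.
move=> bf bw w0 W0; set W := \int[mu]_x w x; set Z := \int[mu]_x (expR (f x) * w x).
have bef := bm_expR bf.
have Z0 : 0 < Z.
  case: (bf) => _ [M fM]; apply: (@lt_le_trans _ _ (\int[mu]_x (expR (- M) * w x))).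
    by rewrite bm_integralZ// mulr_gt0// expR_gt0.
  apply: bm_integral_le; [exact: bmZ|exact: bmM|move=> x].
  by rewrite ler_wpM2r// ler_expR lerNl (le_trans _ (fM x))// -normrN ler_norm.
set l := ln (Z / W); have lE : expR (- l) * Z = W.
  by rewrite expRN lnK ?posrE ?divr_gt0// invf_div divfK// gt_eqF.
have : \int[mu]_x ((1 + (f x - l)) * w x) <= W.
  rewrite -lE -bm_integralZ; last exact: bmM.
  apply: bm_integral_le.
  - by apply: bmM => //; apply: bmD; [exact: bm_cst|apply: bmB => //; exact: bm_cst].
  - by apply: bmZ; exact: bmM.
  - by move=> x; rewrite mulrA ler_wpM2r// -expRD [- l + _]addrC expR_ge1Dx.
rewrite (_ : (fun x => _) = (fun x => (1 - l) * w x + f x * w x)); last first.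
  by apply/funext => x; ring.
rewrite bm_integralD; [|exact: bmZ|exact: bmM].
rewrite bm_integralZ// -/W ler_pdivrMr// => h; lra.
Qed.

End bounded_integral.

(** * Differentiation of exponential integrals in a real parameter *)

Section exponential_moments.
Context d (X : measurableType d) {R : realType} (mu : probability X R).
Variables (s c : X -> R) (T : R).
Hypotheses (bs : bm s) (bc : bm c).

(** Along the line [H + v *: delta_mx j i] the Gibbs exponent is a quadratic polynomial in [v], and
    this is its nonconstant part: [s] will be the diagonal entry of [S] and [c] the entry of
    [S *m H]. *)
Definition exp_phase (v : R) x := (s x * v ^+ 2 / 2 + c x * v) / T.

Definition exp_moment k (w : X -> R) (v : R) : R :=
  \int[mu]_x (w x * (s x * v + c x) ^+ k * expR (exp_phase v x)).

Let is_derive_integrand k (w0 s0 c0 v : R) :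
  is_derive v 1 (fun v => w0 * (s0 * v + c0) ^+ k * expR ((s0 * v ^+ 2 / 2 + c0 * v) / T))
    (w0 * (k%:R * s0 * (s0 * v + c0) ^+ k.-1 + (s0 * v + c0) ^+ k.+1 / T) *
      expR ((s0 * v ^+ 2 / 2 + c0 * v) / T)).
Proof.
pose p1 : {poly R} := w0 *: (s0 *: 'X + c0%:P) ^+ k.
pose p2 : {poly R} := T^-1 *: ((s0 / 2) *: 'X^2 + c0 *: 'X).
have p1E z : p1.[z] = w0 * (s0 * z + c0) ^+ k.
  by rewrite /p1 hornerZ horner_exp hornerD hornerZ hornerX hornerC.
have p2E z : p2.[z] = (s0 * z ^+ 2 / 2 + c0 * z) / T.
  by rewrite /p2 hornerZ hornerD !hornerZ hornerX hornerXn; ring.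
have dp1E z : (deriv p1).[z] = w0 * (k%:R * s0 * (s0 * z + c0) ^+ k.-1).
  rewrite /p1 derivZ deriv_exp derivD derivZ derivX derivC addr0.
  rewrite hornerZ hornerMn hornerM horner_exp hornerD !hornerZ hornerX !hornerC.
  by rewrite -mulr_natl; ring.
have dp2E z : (deriv p2).[z] = (s0 * z + c0) / T.
  rewrite /p2 derivZ derivD !derivZ derivX derivXn /= hornerZ hornerD !hornerZ hornerMn.
  by rewrite hornerXn hornerC -mulr_natl mulrC; congr (_ * _); field.
rewrite (_ : (fun v => _) = horner p1 * (expR \o horner p2)); last first.
  by apply/funext => z; rewrite -[RHS]/(p1.[z] * expR p2.[z]) p1E p2E.
have d2 : is_derive v 1 (expR \o horner p2) (expR p2.[v] * (deriv p2).[v]).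
  exact: is_derive1_comp.
apply: (is_derive_eq (is_deriveM _ _)) => //=.
rewrite p1E dp1E p2E dp2E /GRing.scale/= [_ ^+ k.+1]exprS; ring.
Qed.

Let bq v : bm (exp_phase v).
Proof.
by rewrite /exp_phase; apply: bmM; [apply: bmD|exact: bm_cst]; apply: bmM => //;
  try exact: bm_cst; apply: bmM => //; exact: bm_cst.
Qed.

Let bm_integrand k w v : bm w -> bm (fun x => w x * (s x * v + c x) ^+ k * expR (exp_phase v x)).
Proof.
move=> bw; apply: bmM; last exact: bm_expR.
apply: bmM => //; apply: bmX; apply: bmD => //; apply: bmM => //; exact: bm_cst.
Qed.

Let bm_derivand k w v : bm w -> bm (fun x =>
  w x * (k%:R * s x * (s x * v + c x) ^+ k.-1 + (s x * v + c x) ^+ k.+1 / T) * expR (exp_phase v x)).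
Proof.
move=> bw; have bl : bm (fun x => s x * v + c x).
  by apply: bmD => //; apply: bmM => //; exact: bm_cst.
apply: bmM; last exact: bm_expR.
apply: bmM => //; apply: bmD; apply: bmM; rewrite ?(bmX, bm_cst)//; try exact: bmX; try exact: bm_cst.
exact: bmZ.
Qed.

Lemma is_derive_exp_moment k (w : X -> R) (v : R) : bm w ->
  is_derive v (1 : R) (exp_moment k w)
   (k%:R * exp_moment k.-1 (fun x => w x * s x) v + exp_moment k.+1 w v / T).
Proof.
move=> bw.
pose f v x := w x * (s x * v + c x) ^+ k * expR (exp_phase v x).
pose f' v x := w x * (k%:R * s x * (s x * v + c x) ^+ k.-1 + (s x * v + c x) ^+ k.+1 / T) * expR (exp_phase v x).
have df (v' : R) (x : X) : is_derive v' (1 : R) (f ^~ x) (f' v' x) by exact: is_derive_integrand.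
have d1f (v' : R) (x : X) : partial1of2 f v' x = f' v' x.
  by rewrite partial1of2E; apply: derive_val.
have [_ [Ms sM]] := bs; have [_ [Mc cM]] := bc; have [_ [Mw wM]] := bw.
(* Domination on the interval of radius 1 around [v]: [V] bounds the parameter, [L] the factor
   [s x * v' + c x], and [G] the derivative of the integrand. *)
pose V := `|v| + 1.
pose L := Ms * V + Mc.
pose G : R := Mw * (k%:R * Ms * L ^+ k.-1 + L ^+ k.+1 * `|T^-1|) * expR ((Ms * V ^+ 2 / 2 + Mc * V) * `|T^-1|).
have Gub v' x : `]v - 1, v + 1[%classic v' -> `|f' v' x| <= G.
  rewrite /= in_itv/= => /andP[v1 v2].
  have Vv : `|v'| <= V.
    rewrite ler_norml /V; apply/andP; split.
      by have := ler_norm (- v); rewrite normrN; lra.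
    by have := ler_norm v; lra.
  have V0 : 0 <= V by rewrite /V.
  have l0 : `|s x * v' + c x| <= L.
    by rewrite (le_trans (ler_normD _ _))// lerD// normrM ler_pM.
  rewrite /f' !normrM ler_pM ?mulr_ge0//.
    rewrite ler_pM// (le_trans (ler_normD _ _))// lerD//.
      rewrite !normrM ler_pM ?mulr_ge0//; first by rewrite normr_nat ler_wpM2l.
      by rewrite normrX lerXn2r// nnegrE (le_trans _ l0).
    rewrite normrM ler_wpM2r// normrX lerXn2r// nnegrE (le_trans _ l0)//.
  rewrite ger0_norm ?expR_ge0// ler_expR (le_trans (ler_norm _))//.
  rewrite /exp_phase normrM ler_wpM2r// (le_trans (ler_normD _ _))// lerD//.
    have v2' : `|v' ^+ 2| <= V ^+ 2 by rewrite normrX lerXn2r// nnegrE.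
    by rewrite normrM (gtr0_norm (_ : 0 < 2^-1))// ler_wpM2r// normrM ler_pM.
  by rewrite normrM ler_pM.
have vI : `]v - 1, v + 1[%classic v by rewrite /= in_itv/= ltrBlDr ltrDl; apply/andP; split; lra.
have iG : mu.-integrable setT (EFin \o cst `|G|).
  exact: finite_measure_integrable_cst.
have ibf v' : mu.-integrable setT (EFin \o f v').
  by apply: bm_integrable; exact: bm_integrand.
have drf (v' : R) (x : X) : derivable (f ^~ x) v' (1 : R) by apply: ex_derive.
have Gub' v' x : `]v - 1, v + 1[%classic v' -> setT x -> `|partial1of2 f v' x| <= cst `|G| x.
  by move=> Iv' _; rewrite d1f (le_trans (Gub _ _ Iv'))// ler_norm.
have dF := @derivable_under_integral _ _ _ mu f setT measurableT v (v - 1) (v + 1) vI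
  (fun v' _ => ibf v') (fun v' x _ _ => drf v' x) (cst `|G|) (fun=> normr_ge0 _) iG Gub'.
have := @differentiation_under_integral _ _ _ mu f setT measurableT v (v - 1) (v + 1) vI
  (fun v' _ => ibf v') (fun v' x _ _ => drf v' x) (cst `|G|) (fun=> normr_ge0 _) iG Gub'.
rewrite derive1E => D; apply: DeriveDef => //; rewrite [LHS]D.
under eq_Rintegral do rewrite d1f.
rewrite /exp_moment -RintegralZl//; last first.
  by apply: bm_integrable; apply: bm_integrand; exact: bmM.
rewrite -RintegralZr//; last by apply: bm_integrable; exact: bm_integrand.
rewrite -bm_integralD; last 2 first.
- by apply: bmZ; apply: bm_integrand; exact: bmM.
- by apply: bmM; [exact: bm_integrand|exact: bm_cst].
by apply: eq_Rintegral => x _; rewrite /f'; ring.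
Qed.

End exponential_moments.

(** * Stein identities and exponential moments of the noise *)

Section stein_kernel.
Context {R : realType} (B : R).
Hypothesis B0 : 0 < B.
Local Notation leb := (@lebesgue_measure R).

(** A kernel for [v = s + t] with [s] fixed and [t] uniform on [[-B, B]]. Each branch is the
    antiderivative of [- v] that vanishes at the corresponding end [s + B] or [s - B] of the
    support; the jump between the branches is placed at [v = 0]. *)
Definition stein_kernel (s v : R) : R :=
  ((if 0 <= v then (s + B) ^+ 2 else (s - B) ^+ 2) - v ^+ 2) / 2.

Lemma FTC2_everywhere (F f : R -> R) (a b : R) : a <= b ->
  (forall x, is_derive x (1 : R) F (f x)) -> continuous f ->
  \int[leb]_(x in `[a, b]) f x = F b - F a.
Proof.
move=> ab dF cf; move: ab; rewrite le_eqVlt => /predU1P[->|ab].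
  by rewrite set_itv1 Rintegral_set1 subrr.
have cF : continuous F.
  move=> x; apply: differentiable_continuous; apply/derivable1_diffP.
  by have [] := dF x.
rewrite /Rintegral (continuous_FTC2 ab (F := F)) //.
- exact: continuous_subspaceT.
- split; [by move=> x _; have [] := dF x|exact/cvg_at_right_filter/cF|exact/cvg_at_left_filter/cF].
- by move=> x _; rewrite derive1E; apply: derive_val.
Qed.

Lemma continuous_itv_integrable (f : R -> R) (a b : R) : continuous f ->
  leb.-integrable `[a, b] (EFin \o f).
Proof.
move=> cf; apply: continuous_compact_integrable; first exact: segment_compact.
exact: continuous_subspaceT.
Qed.

(** Integration by parts on each side of [v = 0] has no contribution from the ends, where the kernel
    vanishes, and leaves the jump [((s + B)^2 - (s - B)^2) / 2] at 0. The result is linear in [s],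
    so it disappears after averaging over a centered [s], whatever its law. *)
Lemma stein_uniform (s : R) (h h' : R -> R) : `|s| <= B ->
  (forall v, is_derive v (1 : R) h (h' v)) -> continuous h' ->
  \int[leb]_(t in `[- B, B]) ((s + t) * h (s + t) - stein_kernel s (s + t) * h' (s + t)) =
  2 * B * s * h 0.
Proof.
rewrite ler_norml => /andP[sB1 sB2] dh ch'.
have ch : continuous h.
  move=> x; apply: differentiable_continuous; apply/derivable1_diffP.
  by have [] := dh x.
pose g c t : R := (s + t) * h (s + t) - (c ^+ 2 - (s + t) ^+ 2) / 2 * h' (s + t).
pose G c t : R := - ((c ^+ 2 - (s + t) ^+ 2) / 2 * h (s + t)).
have dG c t : is_derive t (1 : R) (G c) (g c t).
  have d1 : is_derive t (1 : R) (h \o (fun t => s + t)) (h' (s + t)).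
    have ds : is_derive t (1 : R) (fun t : R => s + t) 1.
      by rewrite -[X in is_derive _ _ _ X]add0r; exact: is_deriveD.
    by rewrite -[h' _]mulr1; apply: is_derive1_comp; exact: dh.
  pose p : {poly R} := (c ^+ 2 / 2)%:P - 2^-1 *: (s%:P + 'X) ^+ 2.
  have pE z : p.[z] = (c ^+ 2 - (s + z) ^+ 2) / 2.
    by rewrite /p hornerD hornerN hornerZ horner_exp hornerD hornerX !hornerC; ring.
  have dpE z : (deriv p).[z] = - (s + z).
    rewrite /p derivD derivN derivZ deriv_exp derivD derivX !derivC.
    rewrite hornerD hornerC hornerN hornerZ hornerMn hornerM horner_exp !hornerD hornerX !hornerC.
    by rewrite /= -mulr_natl; field.
  rewrite (_ : G c = - (horner p * (h \o (fun t => s + t)))); last first.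
    by apply/funext => z; rewrite -[RHS]/(- (p.[z] * h (s + z))) pE.
  apply: (is_derive_eq (is_deriveN (is_deriveM _ _))).
  rewrite pE dpE /g /GRing.scale/=; ring.
have cg c : continuous (g c).
  have cs : continuous (fun t : R => s + t) by move=> x; apply: cvgD; [exact: cvg_cst|exact: cvg_id].
  have c1 : continuous (fun t => h (s + t)) by move=> x; apply: continuous_comp; [exact: cs|exact: ch].
  have c2 : continuous (fun t => h' (s + t)) by move=> x; apply: continuous_comp; [exact: cs|exact: ch'].
  move=> x; apply: cvgB; apply: cvgM; try exact: c1; try exact: c2; try exact: cs.
  apply: cvgM; last exact: cvg_cst.
  apply: cvgB; first exact: cvg_cst.
  by apply: (cvgM (cs x) (cs x)).
pose D t := (s + t) * h (s + t) - stein_kernel s (s + t) * h' (s + t).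
have DE1 : {in `[- s, B], D =1 g (s + B)}.
  by move=> t; rewrite in_itv/= => /andP[t1 _]; rewrite /D /stein_kernel /g -lerBlDl sub0r t1.
have DE2 : {in `[- B, - s[, D =1 g (s - B)}.
  move=> t; rewrite in_itv/= => /andP[_ t1]; rewrite /D /stein_kernel /g.
  by rewrite ifN// -ltNge -ltrBrDl sub0r.
have I1 : leb.-integrable `[- s, B] (EFin \o D).
  apply: eq_integrable (continuous_itv_integrable _ _ (cg (s + B))) => //.
  by move=> t; rewrite inE => /= tI; rewrite DE1.
have I2' : leb.-integrable `[- B, - s[ (EFin \o g (s - B)).
  have := continuous_itv_integrable (- B) (- s) (cg (s - B)); apply: integrableS => //.
  by move=> t /=; rewrite !in_itv/= => /andP[-> /ltW ->].
have I2 : leb.-integrable `[- B, - s[ (EFin \o D).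
  apply: eq_integrable I2' => //.
  by move=> t; rewrite inE => /= tI; rewrite DE2.
have split_itv : `[- B, B]%classic = `[- B, - s[%classic `|` `[- s, B]%classic :> set R.
  by rewrite (@itv_bndbnd_setU _ _ _ (BLeft (- s)))// bnd_simp; lra.
have dis : [disjoint `[- B, - s[%classic & `[- s, B]%classic : set R].
  apply/disj_setPS => t /= []; rewrite !in_itv/= => /andP[_ h1] /andP[h2 _].
  by move: (lt_le_trans h1 h2); rewrite ltxx.
have IU : leb.-integrable (`[- B, - s[ `|` `[- s, B]) (EFin \o D).
  have mU : measurable_fun (`[- B, - s[ `|` `[- s, B]) (EFin \o D).
    by apply/measurable_funU => //; split; [exact: measurable_int I2|exact: measurable_int I1].
  apply/integrableP; split => //; rewrite ge0_integral_setU//; last exact: measurableT_comp.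
  by move/integrableP: I1 => [_ h1]; move/integrableP: I2 => [_ h2]; rewrite lte_add_pinfty.
transitivity (\int[leb]_(t in `[- B, B]) D t) => //.
rewrite split_itv Rintegral_setU//.
have -> : \int[leb]_(t in `[- s, B]) D t = \int[leb]_(t in `[- s, B]) g (s + B) t.
  by apply: eq_Rintegral => t; rewrite inE => /= tI; rewrite DE1.
have -> : \int[leb]_(t in `[- B, - s[) D t = \int[leb]_(t in `[- B, - s[) g (s - B) t.
  by apply: eq_Rintegral => t; rewrite inE => /= tI; rewrite DE2.
rewrite Rintegral_itv_bndo_bndc//.
rewrite (FTC2_everywhere _ (dG (s - B)) (cg _)); last lra.
rewrite (FTC2_everywhere _ (dG (s + B)) (cg _)); last lra.
by rewrite /G !subrr; field.
Qed.

Lemma stein_kernel_ge0 (s t : R) : `|s| <= B -> `|t| <= B -> 0 <= stein_kernel s (s + t).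
Proof.
rewrite !ler_norml => /andP[s1 s2] /andP[t1 t2]; rewrite /stein_kernel; case: ifP => h; first nra.
have : s + t < 0 by rewrite ltNge h.
by move=> ?; nra.
Qed.

(** Keeping the negative square, instead of the plain bound [2 * B ^+ 2], is what later improves the
    variance bound to [4 / 3 * B ^+ 2]. *)
Lemma stein_kernel_le (s t : R) : `|s| <= B -> stein_kernel s t <= (4 * B ^+ 2 - t ^+ 2) / 2.
Proof.
rewrite !ler_norml => /andP[s1 s2]; rewrite /stein_kernel ler_wpM2r// lerB//.
by case: ifP => h; nra.
Qed.

End stein_kernel.

Section parametric_integral.
Context d1 d2 (X : measurableType d1) (Y : measurableType d2) {R : realType}.
Variables (mu : probability X R) (nu : probability Y R).

Lemma measurable_integral2 (f : X * Y -> R) : measurable_fun setT f ->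
  measurable_fun setT (fun x => \int[nu]_y f (x, y)).
Proof.
move=> mf; have mEf : measurable_fun setT (EFin \o f) by exact/measurable_EFinP.
apply: (measurableT_comp (f := fine)); first exact: fine_measurable.
rewrite (_ : (fun x => _) = (fun x => \int[nu]_y (EFin \o f)^\+ (x, y) -
   \int[nu]_y (EFin \o f)^\- (x, y))%E); last first.
  apply/funext => x; rewrite integralE; congr (_ - _)%E; apply: eq_integral => y _.
    by rewrite !funeposE.
  by rewrite !funenegE.
apply: emeasurable_funB.
  by apply: (measurable_fun_fubini_tonelli_F (EFin \o f)^\+%E) => //; exact: measurable_funepos.
by apply: (measurable_fun_fubini_tonelli_F (EFin \o f)^\-%E) => //; exact: measurable_funeneg.
Qed.

Lemma bm_pair1 (f : X * Y -> R) x : bm f -> bm (fun y => f (x, y)).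
Proof.
move=> [mf [M fM]]; split; last by exists M.
exact: (measurableT_comp mf (pair1_measurable x)).
Qed.

Lemma bm_pair2 (f : X * Y -> R) y : bm f -> bm (fun x => f (x, y)).
Proof.
move=> [mf [M fM]]; split; last by exists M.
exact: (measurableT_comp mf (pair2_measurable y)).
Qed.

Lemma bm_integral2 (f : X * Y -> R) : bm f -> bm (fun x => \int[nu]_y f (x, y)).
Proof.
move=> bf; split; first by apply: measurable_integral2; case: bf.
have [_ [M fM]] := bf; exists M => x.
rewrite ler_norml; apply/andP; split.
  rewrite -[leLHS](bm_integral_cst nu); apply: bm_integral_le.
  - exact: bm_cst.
  - exact: bm_pair1.
  - by move=> y; have := fM (x, y); rewrite ler_norml => /andP[].
rewrite -[leRHS](bm_integral_cst nu); apply: bm_integral_le.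
- exact: bm_pair1.
- exact: bm_cst.
- by move=> y; have := fM (x, y); rewrite ler_norml => /andP[].
Qed.

Lemma bm_integrable_prod (f : X * Y -> R) : bm f -> (mu \x nu)%E.-integrable setT (EFin \o f).
Proof.
move=> [mf [M fM]]; apply/integrable12ltyP; first exact/measurable_EFinP.
apply: (@le_lt_trans _ _ (\int[mu]_x \int[nu]_y `|M|%:E)%E); last first.
  by under eq_integral do rewrite integral_cst//= probability_setT mule1;
     rewrite integral_cst//= probability_setT mule1 ltry.
have mnf : measurable_fun setT (fun p => `|(f p)%:E|%E).
  by apply: measurableT_comp => //; exact/measurable_EFinP.
apply: ge0_le_integral => //.
- by move=> x _; exact: integral_ge0.
- exact: (measurable_fun_fubini_tonelli_F (fun p => `|(f p)%:E|%E)).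
move=> x _; apply: ge0_le_integral => //.
- exact: (measurableT_comp mnf (pair1_measurable x)).
- by move=> y _; rewrite lee_fin (le_trans (fM _))// ler_norm.
Qed.

Lemma bm_fubini1 (f : X * Y -> R) : bm f ->
  \int[(mu \x nu)%E]_p f p = \int[mu]_x \int[nu]_y f (x, y).
Proof.
move=> bf; rewrite /Rintegral -integral12_prod_meas1; last exact: bm_integrable_prod.
congr fine; apply: eq_integral => x _.
by rewrite /fubini_F/= bm_integralE//; exact: bm_pair1.
Qed.

Lemma bm_fubini2 (f : X * Y -> R) : bm f ->
  \int[(mu \x nu)%E]_p f p = \int[nu]_y \int[mu]_x f (x, y).
Proof.
move=> bf; rewrite /Rintegral -integral21_prod_meas1; last exact: bm_integrable_prod.
congr fine; apply: eq_integral => y _.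
by rewrite /fubini_G/= bm_integralE//; exact: bm_pair2.
Qed.

End parametric_integral.

(** * Resampling a single noise entry *)

Section resampling.
Context d (Omega : measurableType d) {R : realType} (P : probability Omega R).

Definition upd m n (F : 'M[R]_(m, n)) i0 j0 c : 'M[R]_(m, n) :=
  \matrix_(i, j) if (i == i0) && (j == j0) then c else F i j.

(** Independence of all entries, tested on boxes. The entries may have different laws, so that it
    covers the two noise matrices stacked on top of each other. *)
Definition box_independent m n (W : Omega -> 'M[R]_(m, n)) :=
  forall A : 'I_m -> 'I_n -> set R, (forall i j, measurable (A i j)) ->
  P (W @^-1` mx_box A) = (\prod_i \prod_j P ((fun w => W w i j) @^-1` A i j))%E.

Variables (m n : nat) (W : Omega -> 'M[R]_(m, n)) (i0 : 'I_m) (j0 : 'I_n).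
Hypotheses (mW : measurable_fun setT W) (iW : box_independent W).

Let phi (p : Omega * Omega) := upd (W p.1) i0 j0 (W p.2 i0 j0).

Let mphi : measurable_fun setT phi.
Proof.
apply: measurable_fun_mx => i j; under eq_fun do rewrite mxE.
have mWij k l : measurable_fun setT (fun w => W w k l) by exact: measurable_mxE.
case: (_ && _); first exact: (measurableT_comp (mWij i0 j0) measurable_snd).
exact: (measurableT_comp (mWij i j) measurable_fst).
Qed.

Let mpre (A : set 'M[R]_(m, n)) : measurable A -> measurable (W @^-1` A).
Proof. by move=> mA; rewrite -[X in measurable X]setTI; exact: mW. Qed.

(** One entry may be replaced by an independent copy, because the two laws agree on boxes. This
    allows integration over one entry with the others frozen, although [Omega] itself has no product
    structure. *)
Lemma resample_measure A : measurable A ->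
  pushforward P W A = pushforward (P \x P)%E phi A.
Proof.
apply: (@eq_mx_measure _ _ _
  (measure_function_pushforward__canonical__measure_function_Measure P mW)
  (measure_function_pushforward__canonical__measure_function_Measure (P \x P)%E mphi)).
- move=> {}A mA; rewrite /= /pushforward.
  pose A' i j : set R := if (i == i0) && (j == j0) then setT else A i j.
  have mA' i j : measurable (A' i j) by rewrite /A'; case: ifP.
  have -> : phi @^-1` mx_box A =
      (W @^-1` mx_box A') `*` ((fun w => W w i0 j0) @^-1` A i0 j0).
    apply/seteqP; split => -[w w'] /=.
      move=> h; split => [i j|]; last by have := h i0 j0; rewrite mxE !eqxx.
      by rewrite /A'; case: ifP => // ij; have := h i j; rewrite mxE ij.
    move=> [h h0] i j; rewrite mxE; case: ifP => [/andP[/eqP-> /eqP->]//|ij].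
    by have := h i j; rewrite /A' ij.
  have mWij k l : measurable_fun setT (fun w => W w k l) by exact: measurable_mxE.
  have mC : measurable (W @^-1` mx_box A') by apply: mpre; exact: measurable_mx_box.
  have mD : measurable ((fun w => W w i0 j0) @^-1` A i0 j0).
    by rewrite -[X in measurable X]setTI; exact: mWij.
  apply: (etrans (iW mA)); apply: (etrans _ (esym (product_measure1E P P mC mD))).
  rewrite [X in _ = (X * _)%E](_ : _ = (\prod_i \prod_j P ((fun w => W w i j) @^-1` A' i j))%E); last exact: iW.
  rewrite (bigD1 i0)//= [X in _ = (X * _)%E](bigD1 i0)//=.
  rewrite (bigD1 j0)//= [X in _ = (X * _ * _)%E](bigD1 j0)//=.
  rewrite {1}/A' !eqxx preimage_setT probability_setT mul1e.
  rewrite -muleA muleC; congr (_ * _ * _)%E.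
  + by apply: eq_bigr => j /negPf jj0; rewrite /A' jj0 andbF.
  + by apply: eq_bigr => i /negPf ii0; apply: eq_bigr => j _; rewrite /A' ii0.
- move=> k; rewrite /= /pushforward; apply: (le_lt_trans (probability_le1 _ _)).
    by apply: mpre; exact: measurable_mx_box.
  exact: ltry.
Qed.

Lemma resample (f : 'M[R]_(m, n) -> R) : bm f ->
  \int[P]_w f (W w) = \int[P]_w' \int[P]_w f (upd (W w) i0 j0 (W w' i0 j0)).
Proof.
move=> bf; have [mf [M fM]] := bf.
have bfphi : bm (f \o phi) by split; [exact: (measurableT_comp mf mphi)|exists M => p; exact: fM].
have bfW : bm (f \o W) by split; [exact: (measurableT_comp mf mW)|exists M => p; exact: fM].
have mEf : measurable_fun setT (EFin \o f) by exact/measurable_EFinP.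
apply: (etrans _ (bm_fubini2 P P bfphi)); rewrite /Rintegral; congr fine.
transitivity (\int[pushforward P W]_F (f F)%:E)%E.
  by rewrite (integral_pushforward mW mEf)//; exact: bm_integrable.
transitivity (\int[pushforward (P \x P)%E phi]_F (f F)%:E)%E.
  apply: (@eq_measure_integral _ _ _ _
    (measure_function_pushforward__canonical__measure_function_Measure (P \x P)%E mphi)
    (measure_function_pushforward__canonical__measure_function_Measure P mW)) => A mA _.
  exact: resample_measure.
by rewrite (integral_pushforward mphi mEf)//; exact: bm_integrable_prod.
Qed.

End resampling.

Section noise.
Context d (Omega : measurableType d) {R : realType} (P : probability Omega R).
Variables (K n : nat) (X Z : Omega -> 'M[R]_(K, n)) (B : R) (B0 : 0 < B).
Hypotheses (mX : measurable_fun setT X) (mZ : measurable_fun setT Z).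
Hypotheses (XB : forall w i j, `|X w i j| <= B) (ZB : forall w i j, `|Z w i j| <= B).
Hypothesis XZ_indep : box_independent P (fun w => col_mx (X w) (Z w)).
Hypothesis X_mean0 : forall i j, \int[P]_w X w i j = 0.
Hypothesis Z_uniform : forall i j (A : set R), measurable A ->
  P ((fun w => Z w i j) @^-1` A) = uniform_prob (gtrN B0) A.
Local Notation leb := (@lebesgue_measure R).

Let mW : measurable_fun setT (fun w => col_mx (X w) (Z w)).
Proof. exact: measurable_col_mx. Qed.

Lemma measurable_upd d' (Y : measurableType d') m l (F : Y -> 'M[R]_(m, l)) i j (c : Y -> R) :
  measurable_fun setT F -> measurable_fun setT c ->
  measurable_fun setT (fun y => upd (F y) i j (c y)).
Proof.
move=> mF mc; apply: measurable_fun_mx => i' j'; under eq_fun do rewrite mxE.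
case: (_ && _) => //; exact: measurable_mxE.
Qed.

Lemma upd_entry m l (F : 'M[R]_(m, l)) i j : upd F i j (F i j) = F.
Proof. by apply/matrixP => i' j'; rewrite mxE; case: ifP => // /andP[/eqP-> /eqP->]. Qed.

Lemma updD m l (F G : 'M[R]_(m, l)) i j a b : upd F i j a + upd G i j b = upd (F + G) i j (a + b).
Proof. by apply/matrixP => i' j'; rewrite !mxE; case: ifP. Qed.

Let upd_col_mx (F G : 'M[R]_(K, n)) i j a b :
  upd (upd (col_mx F G) (rshift K i) j b) (lshift K i) j a = col_mx (upd F i j a) (upd G i j b).
Proof.
apply/matrixP => i' j'; rewrite mxE; case: (split_ordP i') => k ->;
  rewrite mxE !(col_mxEu, col_mxEd) !mxE ?eq_lshift ?eq_rshift ?eq_lrshift ?eq_rlshift//=.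
Qed.

(** The order of the integrals is chosen for Stein's identity: the copy of the [Z] entry is
    innermost, where its uniform law is used, and the copy of the [X] entry outermost, where
    centering is used. *)
Lemma resample2 (f : 'M[R]_(K, n) -> 'M[R]_(K, n) -> R) i j :
  bm (fun p : 'M[R]_(K, n) * 'M[R]_(K, n) => f p.1 p.2) ->
  \int[P]_w f (X w) (Z w) = \int[P]_w1 \int[P]_w \int[P]_w2
     f (upd (X w) i j (X w1 i j)) (upd (Z w) i j (Z w2 i j)).
Proof.
move=> [mf [M fM]].
pose g (F : 'M[R]_(K + K, n)) := f (usubmx F) (dsubmx F).
have musub : measurable_fun setT (fun F : 'M[R]_(K + K, n) => usubmx F).
  by apply: measurable_fun_mx => i' j'; under eq_fun do rewrite mxE; exact: measurable_entry.
have mdsub : measurable_fun setT (fun F : 'M[R]_(K + K, n) => dsubmx F).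
  by apply: measurable_fun_mx => i' j'; under eq_fun do rewrite mxE; exact: measurable_entry.
have bg : bm g.
  split; last by exists M => F; exact: (fM (_, _)).
  have := measurableT_comp mf (measurable_fun_pair musub mdsub); exact.
have gE F G : g (col_mx F G) = f F G by rewrite /g col_mxKu col_mxKd.
transitivity (\int[P]_w g (col_mx (X w) (Z w))).
  by apply: eq_Rintegral => w _; rewrite gE.
rewrite (resample (lshift K i) j mW XZ_indep bg).
apply: eq_Rintegral => w1 _; rewrite col_mxEu.
pose h F := g (upd F (lshift K i) j (X w1 i j)).
have bh : bm h.
  split; last by exists M => F; exact: (fM (_, _)).
  have [mg _] := bg.
  have := measurableT_comp mg (@measurable_upd _ _ _ _ (fun F => F) (lshift K i) j (fun=> X w1 i j) (@measurable_id _ _ _) (measurable_cst _)).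
  exact.
transitivity (\int[P]_w h (col_mx (X w) (Z w))) => //.
rewrite (resample (rshift K i) j mW XZ_indep bh).
pose k (p : Omega * Omega) := h (upd (col_mx (X p.1) (Z p.1)) (rshift K i) j (col_mx (X p.2) (Z p.2) (rshift K i) j)).
have bk : bm k.
  split; last by exists M => F; exact: (fM (_, _)).
  have [mh _] := bh.
  have := measurableT_comp mh (@measurable_upd _ _ _ _ (fun p : Omega * Omega => col_mx (X p.1) (Z p.1)) (rshift K i) j (fun p => col_mx (X p.2) (Z p.2) (rshift K i) j) _ _); apply.
    exact: (measurableT_comp mW measurable_fst).
  apply: measurable_mxE; exact: (measurableT_comp mW measurable_snd).
transitivity (\int[P]_y \int[P]_x k (x, y)).
  by apply: eq_Rintegral => y _; apply: eq_Rintegral => x _.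
apply: (etrans (esym (bm_fubini2 P P bk))); apply: (etrans (bm_fubini1 P P bk)).
apply: eq_Rintegral => w _; apply: eq_Rintegral => w2 _.
rewrite /k /h/= col_mxEd -gE; congr g.
by rewrite -upd_col_mx.
Qed.

Lemma integral_uniform_entry (D : R -> R) i j M : measurable_fun setT D ->
  (forall t, `|t| <= B -> `|D t| <= M) ->
  \int[P]_w D (Z w i j) = (2 * B)^-1 * \int[leb]_(t in `[- B, B]) D t.
Proof.
move=> mD DM.
(* [D] is controlled on [[-B, B]] only. Adding [M] and cutting off outside gives a nonnegative
   function, for which the transfer to the uniform law is immediate. *)
pose g t := if `|t| <= B then D t + M else 0.
have mZij : measurable_fun setT (fun w => Z w i j) by exact: measurable_mxE.
have mg : measurable_fun setT g.
  apply: measurable_fun_ifT => //; last exact: measurable_funD.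
  by apply: measurable_fun_ler => //; exact: measurableT_comp.
have g0 t : 0 <= g t.
  by rewrite /g; case: ifP => // /DM; rewrite ler_norml => /andP[h _]; lra.
have gE w : g (Z w i j) = D (Z w i j) + M by rewrite /g ZB.
have bDZ : bm (fun w => D (Z w i j)).
  by split; [exact: (measurableT_comp mD mZij)|exists M => w; exact: DM].
have mEg : measurable_fun setT (EFin \o g) by exact/measurable_EFinP.
have h1 : (\int[P]_w (g (Z w i j))%:E = \int[uniform_prob (gtrN B0)]_t (g t)%:E)%E.
  pose f := (fun w => Z w i j) : Omega -> measurableTypeR R.
  have mf : measurable_fun setT f by exact: mZij.
  transitivity (\int[pushforward P f]_t (g t)%:E)%E.
    by rewrite ge0_integral_pushforward// => t _; rewrite lee_fin.
  apply: eq_measure_integral => A mA _.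
  exact: Z_uniform.
have h1b := integral_uniform (gtrN B0) mEg (fun t => _ : (0 <= (g t)%:E)%E).
rewrite {}h1b in h1; last by move=> t; rewrite lee_fin.
have iD : leb.-integrable `[- B, B] (EFin \o D).
  apply: (@le_integrable _ _ _ leb _ _ _ (EFin \o cst `|M|)) => //.
  - by apply/measurable_EFinP; exact: measurable_funTS.
  - move=> t /=; rewrite in_itv/= -ler_norml => /DM h.
    by rewrite lee_fin normr_id (le_trans h)// ler_norm.
  - by apply: continuous_itv_integrable => x; exact: cvg_cst.
have iM : leb.-integrable `[- B, B] (EFin \o cst M).
  by apply: continuous_itv_integrable => x; exact: cvg_cst.
have hI : (\int[leb]_(t in `[(- B)%R, B]) (EFin \o g) t = \int[leb]_(t in `[(- B)%R, B]) (D t + M)%:E)%E.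
  by apply: eq_integral => t; rewrite inE /= in_itv/= -ler_norml => tB; rewrite /g tB.
have iDM : leb.-integrable `[- B, B] (EFin \o (fun t => D t + M)).
  by rewrite (_ : _ \o _ = (EFin \o D) \+ (EFin \o cst M))%E//; exact: integrableD.
have h2 : \int[P]_w (D (Z w i j) + M) = (2 * B)^-1 * \int[leb]_(t in `[- B, B]) (D t + M).
  rewrite /Rintegral; under eq_integral do rewrite -gE.
  rewrite h1 hI fineM//; last exact: integrable_fin_num.
  congr (_ * _); rewrite /= opprK; congr (_ ^-1); ring.
move: h2; rewrite bm_integralD//; last exact: bm_cst.
rewrite bm_integral_cst RintegralD// Rintegral_cst//= lebesgue_measure_itv/= lte_fin gtrN//.
rewrite -EFinB/= => h2; apply: (addIr M); rewrite h2; field.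
by rewrite gt_eqF.
Qed.

Lemma measurable_stein_kernel d' (Y : measurableType d') (f g : Y -> R) :
  measurable_fun setT f -> measurable_fun setT g ->
  measurable_fun setT (fun y => stein_kernel B (f y) (g y)).
Proof.
move=> mf mg; apply: measurable_funM => //; apply: measurable_funB; last exact: measurable_funX.
apply: measurable_fun_ifT; first exact: measurable_fun_ler.
  by apply: measurable_funX; exact: measurable_funD.
by apply: measurable_funX; exact: measurable_funB.
Qed.

Lemma stein_kernel_normr (s t : R) : `|s| <= B -> `|t| <= B -> `|stein_kernel B s (s + t)| <= 2 * B ^+ 2.
Proof.
move=> sB tB; rewrite ger0_norm ?stein_kernel_ge0//.
apply: (le_trans (stein_kernel_le _ sB)); have := sqr_ge0 (s + t); lra.
Qed.

Let cube : set 'M[R]_(K, n) := mx_box (fun _ _ => `[- B, B]%classic).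

Let cubeP F : cube F <-> forall i j, `|F i j| <= B.
Proof.
by split => h i j; have := h i j; rewrite /= in_itv/= ler_norml.
Qed.

Lemma stein_noise (F F' : 'M[R]_(K, n) -> R) i j (M : R) :
  measurable_fun setT F -> measurable_fun setT F' ->
  (forall (H : 'M[R]_(K, n)) (v : R), is_derive v (1 : R) (fun v : R => F (upd H i j v)) (F' (upd H i j v))) ->
  (forall H : 'M[R]_(K, n), continuous (fun v : R => F' (upd H i j v))) ->
  (forall H : 'M[R]_(K, n), (forall k l, `|H k l| <= 2 * B) -> `|F H| <= M /\ `|F' H| <= M) ->
  \int[P]_w ((X w + Z w) i j * F (X w + Z w) -
    stein_kernel B (X w i j) ((X w + Z w) i j) * F' (X w + Z w)) = 0.
Proof.
move=> mF mF' dF cF' FM.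
pose e (G H : 'M[R]_(K, n)) := (G + H) i j * F (G + H) - stein_kernel B (G i j) ((G + H) i j) * F' (G + H).
(* The indicators make the integrand bounded on all pairs of matrices, as resampling requires, and
   change nothing on the range of the noise. *)
pose f (G H : 'M[R]_(K, n)) := \1_cube G * \1_cube H * e G H.
have mcube : measurable cube by apply: measurable_mx_box => *.
have mD : measurable_fun setT (fun p : 'M[R]_(K, n) * 'M[R]_(K, n) => p.1 + p.2).
  by apply: measurable_addmx; [exact: measurable_fst|exact: measurable_snd].
have cube_ub (G H : 'M[R]_(K, n)) : cube G -> cube H ->
    `|(G + H) i j| <= 2 * B /\ `|F (G + H)| <= M /\ `|F' (G + H)| <= M.
  move=> /cubeP hG /cubeP hH.
  have h k l : `|(G + H) k l| <= 2 * B.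
    by rewrite mxE (le_trans (ler_normD _ _))// (le_trans (lerD (hG k l) (hH k l)))// -mulr2n mulr_natl.
  by split => //; exact: FM.
have bf : bm (fun p : 'M[R]_(K, n) * 'M[R]_(K, n) => f p.1 p.2).
  split.
    apply: measurable_funM.
      apply: measurable_funM.
        exact: (measurableT_comp (measurable_indic mcube) measurable_fst).
      exact: (measurableT_comp (measurable_indic mcube) measurable_snd).
    apply: measurable_funB; apply: measurable_funM.
    - exact: (measurable_mxE i j mD).
    - exact: (measurableT_comp mF mD).
    - apply: measurable_stein_kernel; last exact: (measurable_mxE i j mD).
      by apply: measurable_mxE; exact: measurable_fst.
    - exact: (measurableT_comp mF' mD).
  exists `|2 * B * M + 2 * B ^+ 2 * M| => -[G H]; rewrite /f/= !indicE.
  case: (boolP (G \in cube)) => [/set_mem hG|_]; last by rewrite !mul0r normr0.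
  case: (boolP (H \in cube)) => [/set_mem hH|_]; last by rewrite mulr0 mul0r normr0.
  rewrite !mul1r; apply: le_trans (ler_norm _).
  have [h1 [h2 h3]] := cube_ub _ _ hG hH.
  rewrite /e (le_trans (ler_normB _ _))// lerD//; first by rewrite normrM ler_pM.
  rewrite [leLHS]normrM ler_pM//.
  rewrite mxE; apply: stein_kernel_normr.
    by move/cubeP: hG.
  by move/cubeP: hH.
have fE w : f (X w) (Z w) = e (X w) (Z w).
  by rewrite /f !indicE !mem_set ?mul1r//; apply/cubeP.
transitivity (\int[P]_w f (X w) (Z w)).
  by apply: eq_Rintegral => w _; rewrite fE.
rewrite (resample2 i j bf).
(* This is the value at 0 that [stein_uniform] leaves after integration over the [Z] entry. It does
   not depend on the resampled [X] entry, so the centering of [X] kills the product. *)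
pose c w := F (upd (X w + Z w) i j 0).
have bc : bm c.
  split.
    by apply: (measurableT_comp mF); apply: measurable_upd => //; exact: measurable_addmx.
  exists M => w; have [|h _] := FM (upd (X w + Z w) i j 0); last exact: h.
  move=> k l; rewrite mxE; case: ifP => _; first by rewrite normr0 mulr_ge0 ?(ltW B0).
  by rewrite mxE (le_trans (ler_normD _ _))// (le_trans (lerD (XB _ _ _) (ZB _ _ _)))// -mulr2n mulr_natl.
transitivity (\int[P]_w1 \int[P]_w (X w1 i j * c w)).
  apply: eq_Rintegral => w1 _; apply: eq_Rintegral => w _.
  pose h v := F (upd (X w + Z w) i j v); pose h' v := F' (upd (X w + Z w) i j v).
  pose D t := if `|t| <= B then (X w1 i j + t) * h (X w1 i j + t) -
     stein_kernel B (X w1 i j) (X w1 i j + t) * h' (X w1 i j + t) else 0.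
  have updB v k l : `|v| <= 2 * B -> `|upd (X w + Z w) i j v k l| <= 2 * B.
    move=> vB; rewrite mxE; case: ifP => _ //.
    by rewrite mxE (le_trans (ler_normD _ _))// (le_trans (lerD (XB _ _ _) (ZB _ _ _)))// -mulr2n mulr_natl.
  transitivity (\int[P]_w2 D (Z w2 i j)).
    apply: eq_Rintegral => w2 _; rewrite /D ZB /f !indicE !mem_set ?mul1r.
    - by rewrite /e updD !mxE !eqxx.
    - by apply/cubeP => k l; rewrite mxE; case: ifP.
    - by apply/cubeP => k l; rewrite mxE; case: ifP.
  have sB := XB w1 i j.
  have mst : measurable_fun setT (fun t : R => X w1 i j + t) by exact: measurable_funD.
  have mupd : measurable_fun setT (fun t : R => upd (X w + Z w) i j (X w1 i j + t)).
    exact: measurable_upd.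
  rewrite (@integral_uniform_entry D i j (2 * B * M + 2 * B ^+ 2 * M)); last 2 first.
  - apply: measurable_fun_ifT => //.
      by apply: measurable_fun_ler => //; exact: measurableT_comp.
    apply: measurable_funB; apply: measurable_funM => //.
    + exact: (measurableT_comp mF mupd).
    + exact: measurable_stein_kernel.
    + exact: (measurableT_comp mF' mupd).
  - move=> t tB; rewrite /D tB.
    have stB : `|X w1 i j + t| <= 2 * B.
      by rewrite (le_trans (ler_normD _ _))// (le_trans (lerD sB tB))// -mulr2n mulr_natl.
    have [h1 h2] := FM _ (fun k l => updB _ k l stB).
    rewrite (le_trans (ler_normB _ _))// lerD//; first by rewrite normrM ler_pM.
    by rewrite [leLHS]normrM ler_pM// stein_kernel_normr.
  have -> : \int[leb]_(t in `[- B, B]) D t = \int[leb]_(t in `[- B, B])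
      ((X w1 i j + t) * h (X w1 i j + t) -
       stein_kernel B (X w1 i j) (X w1 i j + t) * h' (X w1 i j + t)).
    by apply: eq_Rintegral => t; rewrite inE /= in_itv/= -ler_norml /D => ->.
  rewrite (stein_uniform sB (dF _) (cF' _)) /c -/(h 0).
  by field; rewrite gt_eqF.
have bX : bm (fun w => X w i j).
  by split; [exact: measurable_mxE|exists B => w; exact: XB].
transitivity (\int[P]_w1 (\int[P]_w c w * X w1 i j)).
  by apply: eq_Rintegral => w1 _; rewrite bm_integralZ// mulrC.
by rewrite bm_integralZ// X_mean0 mulr0.
Qed.

(** Resampling the head position leaves the remaining product unchanged, since the positions in [s]
    are distinct; the head factor then splits off. *)
Lemma expectation_prod (s : seq ('I_K * 'I_n)) (phi : 'I_K * 'I_n -> R -> R -> R) : uniq s ->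
  (forall e, bm (fun p : R * R => phi e p.1 p.2)) ->
  \int[P]_w (\prod_(e <- s) phi e (X w e.1 e.2) (Z w e.1 e.2)) =
  \prod_(e <- s) \int[P]_w phi e (X w e.1 e.2) (Z w e.1 e.2).
Proof.
move=> us bphi; elim: s us => [|[i j] s IH] /=.
  by under eq_Rintegral do rewrite big_nil; rewrite bm_integral_cst big_nil.
move=> /andP[es us].
have mphi (G H : Omega -> 'M[R]_(K, n)) e : measurable_fun setT G -> measurable_fun setT H ->
    bm (fun w => phi e (G w e.1 e.2) (H w e.1 e.2)).
  move=> mG mH; have [mp [M pM]] := bphi e; split; last by exists M => w; exact: (pM (_, _)).
  have := measurableT_comp mp (measurable_fun_pair (measurable_mxE e.1 e.2 mG) (measurable_mxE e.1 e.2 mH)).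
  exact.
pose Pi (G H : 'M[R]_(K, n)) := \prod_(e <- s) phi e (G e.1 e.2) (H e.1 e.2).
have mphi2 e : bm (fun p : 'M[R]_(K, n) * 'M[R]_(K, n) => phi e (p.1 e.1 e.2) (p.2 e.1 e.2)).
  have [mp [M pM]] := bphi e; split; last by exists M => w; exact: (pM (_, _)).
  have := measurableT_comp mp (measurable_fun_pair (measurable_mxE e.1 e.2 measurable_fst) (measurable_mxE e.1 e.2 measurable_snd)).
  exact.
have bm_prod d' (Y : measurableType d') (F : 'I_K * 'I_n -> Y -> R) :
    (forall e, bm (F e)) -> bm (fun y => \prod_(e <- s) F e y).
  move=> bF; elim: (s) => [|e s' IHs].
    by under eq_fun do rewrite big_nil; exact: bm_cst.
  by under eq_fun do rewrite big_cons; exact: bmM.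
pose f (G H : 'M[R]_(K, n)) := phi (i, j) (G i j) (H i j) * Pi G H.
have bf : bm (fun p : 'M[R]_(K, n) * 'M[R]_(K, n) => f p.1 p.2).
  by apply: bmM; [exact: (mphi2 (i, j))|exact: bm_prod].
have bPi : bm (fun w => Pi (X w) (Z w)) by apply: bm_prod => e; exact: mphi.
have PiE G H a b : Pi (upd G i j a) (upd H i j b) = Pi G H.
  apply: eq_big_seq => -[k l] kls /=; rewrite !mxE.
  case: ifP => // /andP[/eqP ki /eqP lj].
  by move: es; rewrite -ki -lj kls.
under eq_Rintegral do rewrite big_cons.
rewrite big_cons -(IH us) -/(Pi _ _).
transitivity (\int[P]_w f (X w) (Z w)) => //.
rewrite (resample2 i j bf).
have := resample2 (f := fun G H => phi (i, j) (G i j) (H i j)) i j (mphi2 (i, j)).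
move=> /= ->.
pose I w1 := \int[P]_w2 phi (i, j) (X w1 i j) (Z w2 i j).
have bI : bm I.
  apply: (bm_integral2 P (f := fun p => phi (i, j) (X p.1 i j) (Z p.2 i j))).
  have [mp [M pM]] := bphi (i, j); split; last by exists M => w; exact: (pM (_, _)).
  have := measurableT_comp mp (measurable_fun_pair
    (measurable_mxE i j (measurableT_comp mX measurable_fst))
    (measurable_mxE i j (measurableT_comp mZ measurable_snd))).
  exact.
have bI1 w1 : bm (fun w2 => phi (i, j) (X w1 i j) (Z w2 i j)).
  exact: (mphi (fun=> X w1) Z (i, j)).
transitivity (\int[P]_w1 (\int[P]_w Pi (X w) (Z w) * I w1)).
  apply: eq_Rintegral => w1 _; rewrite mulrC -bm_integralZ//.
  apply: eq_Rintegral => w _; rewrite mulrC -bm_integralZ//.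
  by apply: eq_Rintegral => w2 _; rewrite /f PiE !mxE !eqxx mulrC.
rewrite bm_integralZ// mulrC; congr (_ * _).
apply: eq_Rintegral => w1 _; rewrite -[LHS](bm_integral_cst P).
by apply: eq_Rintegral => w _; apply: eq_Rintegral => w2 _; rewrite !mxE !eqxx.
Qed.

End noise.

Ltac bm_tac := repeat first [ assumption | exact: bm_cst | apply: bm_expR | apply: bmX
  | apply: bmD | apply: bmB | apply: bmN | apply: bmM ].

(** * Scalar inequalities for the exponential *)

Section real_inequalities.
Context {R : realType}.
Implicit Types a b x d : R.

Lemma FTC_monotone (F f : R -> R) x : 0 <= x ->
  (forall z, is_derive z (1 : R) F (f z)) -> (forall z, 0 <= z -> 0 <= f z) -> F 0 <= F x.
Proof.
rewrite le_eqVlt => /predU1P[<-//|x0] dF f0.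
have cF : {within `[0, x], continuous F}.
  apply: continuous_subspaceT => z; apply: differentiable_continuous; apply/derivable1_diffP.
  by have [] := dF z.
have [c /andP[c0 _] E] := MVT x0 (fun z _ => dF z) cF.
rewrite -subr_ge0 E subr0 mulr_ge0// ?(ltW x0)// f0//; exact: ltW.
Qed.

Lemma is_derive_expRZ c z : is_derive z (1 : R) (fun z : R => expR (c * z)) (c * expR (c * z)).
Proof.
rewrite mulrC; apply: (is_derive1_comp (f := expR) (g := fun z : R => c * z)).
by rewrite -[X in is_derive _ _ _ X]mulr1; exact: is_deriveZ.
Qed.

(** The trapezoid rule overestimates the integral over [[0, d]] of the convex function [expR]. *)
Lemma expR_trapezoid d : 0 <= d -> 2 * (expR d - 1) <= d * (expR d + 1).
Proof.
move=> d0; rewrite -subr_ge0.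
pose F (z : R) := z * (expR z + 1) - 2 * (expR z - 1).
have dF z : is_derive z (1 : R) F (z * expR z - expR z + 1).
  pose p : {poly R} := 'X. pose q : {poly R} := 'X + 2%:P.
  rewrite (_ : F = (fun z : R => z - 2) * expR + (fun z : R => z + 2)); last first.
    by apply/funext => t; rewrite /F -[RHS]/((t - 2) * expR t + (t + 2)); ring.
  have d1 : is_derive z (1 : R) (fun z : R => z - 2) 1.
    by rewrite -[X in is_derive _ _ _ X]subr0; exact: is_deriveB.
  have d2 : is_derive z (1 : R) (fun z : R => z + 2) 1.
    by rewrite -[X in is_derive _ _ _ X]addr0; exact: is_deriveD.
  apply: (is_derive_eq (is_deriveD (is_deriveM _ _) _)).
  by rewrite /GRing.scale/=; ring.
have -> : d * (expR d + 1) - 2 * (expR d - 1) = F d - F 0.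
  by rewrite /F expR0; ring.
rewrite subr_ge0; apply: (FTC_monotone d0 dF) => z z0.
have := expR_ge1Dx (- z); rewrite expRN => h.
have := expR_gt0 z => ez.
have : (1 - z) * expR z <= 1 by rewrite -ler_pdivlMr// mul1r.
lra.
Qed.

Lemma expR_trapezoid2 a b : (a - b) * (expR a - expR b) <= (a - b) ^+ 2 / 2 * (expR a + expR b).
Proof.
wlog ab : a b / b <= a.
  move=> h; case/orP: (le_total b a) => [|/h hab]; first exact: h.
  by rewrite -(opprB b a) -(opprB (expR b)) mulrNN sqrrN [expR a + _]addrC.
have d0 : 0 <= a - b by rewrite subr_ge0.
have := expR_trapezoid d0; have -> : expR a = expR (a - b) * expR b by rewrite -expRD subrK.
have := expR_gt0 b; set E := expR (a - b); set G := expR b; set d := a - b => G0 h.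
have -> : d * (E * G - G) = d * G / 2 * (2 * (E - 1)) by field.
have -> : d ^+ 2 / 2 * (E * G + G) = d * G / 2 * (d * (E + 1)) by field.
by rewrite ler_wpM2l// divr_ge0// mulr_ge0// ltW.
Qed.

(** Convexity between the points 0 and [m]: the tangent bounds at [m * k] for these two points are
    averaged with weights [1 - k] and [k]. *)
Lemma expR_chord (m k : R) : 0 <= k <= 1 -> expR (m * k) <= 1 + k * (expR m - 1).
Proof.
move=> /andP[k0 k1].
have h1 := expR_ge1Dx (m * (1 - k)); have h2 := expR_ge1Dx (- (m * k)).
have e := expR_gt0 (m * k).
have E1 : expR m = expR (m * k) * expR (m * (1 - k)) by rewrite -expRD; congr expR; ring.
have E2 : 1 = expR (m * k) * expR (- (m * k)) by rewrite -expRD subrr expR0.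
have : expR (m * k) * (k * (1 + m * (1 - k)) + (1 - k) * (1 - m * k)) <=
       expR (m * k) * (k * expR (m * (1 - k)) + (1 - k) * expR (- (m * k))).
  by rewrite ler_pM2l// lerD// ler_wpM2l// subr_ge0.
have -> : expR (m * k) * (k * (1 + m * (1 - k)) + (1 - k) * (1 - m * k)) = expR (m * k) by ring.
rewrite mulrDr mulrCA -E1 [_ * ((1 - k) * _)]mulrCA -E2; lra.
Qed.

Lemma expRN_le2 (z : R) : 0 <= z -> expR (- z) <= 1 - z + z ^+ 2 / 2.
Proof.
move=> z0; rewrite -subr_ge0.
pose F (z : R) := (1 - z + z ^+ 2 / 2) - expR (- z).
have -> : 1 - z + z ^+ 2 / 2 - expR (- z) = F z - F 0.
  by rewrite /F oppr0 expR0; ring.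
rewrite subr_ge0; apply: (FTC_monotone (f := fun z => z - 1 + expR (- z)) z0) => [t|t t0].
  pose p : {poly R} := 1 - 'X + 2^-1 *: 'X ^+ 2.
  have pE u : p.[u] = 1 - u + u ^+ 2 / 2.
    by rewrite /p hornerD hornerD hornerN hornerX hornerC hornerZ hornerXn mulrC.
  have dpE u : (deriv p).[u] = u - 1.
    rewrite /p derivD derivB derivC derivX derivZ derivXn !hornerD !hornerN hornerZ.
    by rewrite hornerMn !hornerC hornerXn -mulr_natl; field.
  rewrite (_ : F = horner p - (fun u : R => expR (-1 * u))); last first.
    by apply/funext => u; rewrite /F -[RHS]/(p.[u] - expR (-1 * u)) pE mulN1r.
  apply: (is_derive_eq (is_deriveB _ (is_derive_expRZ _ _))).
  by rewrite dpE mulN1r opprK mulN1r.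
by have := expR_ge1Dx (- t); lra.
Qed.

Lemma expRN_ge3 (z : R) : 0 <= z -> 1 - z + z ^+ 2 / 2 - z ^+ 3 / 6 <= expR (- z).
Proof.
move=> z0; rewrite -subr_ge0.
pose F (z : R) := expR (- z) - (1 - z + z ^+ 2 / 2 - z ^+ 3 / 6).
have -> : expR (- z) - (1 - z + z ^+ 2 / 2 - z ^+ 3 / 6) = F z - F 0.
  by rewrite /F oppr0 expR0; field.
rewrite subr_ge0; apply: (FTC_monotone (f := fun z => - expR (- z) + (1 - z + z ^+ 2 / 2)) z0) => [t|t t0].
  pose p : {poly R} := 1 - 'X + 2^-1 *: 'X ^+ 2 - 6^-1 *: 'X ^+ 3.
  have pE u : p.[u] = 1 - u + u ^+ 2 / 2 - u ^+ 3 / 6.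
    by rewrite /p !hornerD !hornerN hornerX hornerC !hornerZ !hornerXn; ring.
  have dpE u : (deriv p).[u] = - (1 - u + u ^+ 2 / 2).
    rewrite /p !derivB derivD derivB derivC derivX !derivZ !derivXn !hornerD !hornerN !hornerZ.
    by rewrite !hornerMn !hornerC !hornerXn; field.
  rewrite (_ : F = (fun u : R => expR (-1 * u)) - horner p); last first.
    by apply/funext => u; rewrite /F -[RHS]/(expR (-1 * u) - p.[u]) pE mulN1r.
  apply: (is_derive_eq (is_deriveB (is_derive_expRZ _ _) _)).
  by rewrite dpE mulN1r mulN1r opprK.
by have := expRN_le2 t0; lra.
Qed.

(* Convexity in [m] reduces the claim to the numerical bound at [m = 13/20]. *)
Lemma expR_mgf_slope (m : R) : 0 <= m <= 13/20 ->
  1 + 2 / 3 * (expR m - 1) <= expR (48 / 65 * m).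
Proof.
move=> /andP[m0 m1]; pose t := m * (20 / 13).
have t0 : 0 <= t by rewrite /t; lra.
have t01 : 0 <= t <= 1 by rewrite t0 /t/=; lra.
(* With [m = 13/20 * t], division by [expR (48/65 * m) = expR (12/25 * t)] leaves the exponents
   [- 12/25 * t] and [17/100 * t], both interpolated linearly in [t]. *)
have c1 := expR_chord (- (12 / 25)) t01.
have c2 := expR_chord (17 / 100) t01.
have e1 : expR (- (12 / 25) : R) <= 5 / 8.
  rewrite (_ : - (12 / 25) = - (6 / 25) + - (6 / 25)); last by field.
  rewrite expRD -expr2; have h : (0 : R) <= 6 / 25 by lra.
  have := expRN_le2 h; have := expR_gt0 (- (6 / 25) : R); set E := expR _ => E0 E1.
  have E2 : E <= 79 / 100 by lra.
  have : E ^+ 2 <= (79 / 100) ^+ 2 by rewrite lerXn2r ?nnegrE//; lra.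
  lra.
have e2 : expR (17 / 100 : R) <= 1187 / 1000.
  have h : (0 : R) <= 17 / 100 by lra.
  have := expRN_ge3 h; rewrite expRN; have := expR_gt0 (17 / 100 : R).
  set E := expR _ => E0 E1.
  have E3 : 843 / 1000 <= E^-1 by lra.
  have : 843 / 1000 * E <= 1 by rewrite -ler_pdivlMr// div1r.
  lra.
have tm : 48 / 65 * m = 12 / 25 * t by rewrite /t; field.
have mt : m = 48 / 65 * m + 17 / 100 * t by rewrite /t; field.
have E0 := expR_gt0 (48 / 65 * m).
have h1 : expR (- (48 / 65 * m)) <= 1 + t * (expR (- (12 / 25)) - 1).
  by rewrite tm -mulNr.
have h2 : 1 = expR (48 / 65 * m) * expR (- (48 / 65 * m)) by rewrite -expRD subrr expR0.
have h3 : expR m = expR (48 / 65 * m) * expR (17 / 100 * t) by rewrite -expRD -mt.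
have key : 1 / 3 * expR (- (48 / 65 * m)) + 2 / 3 * expR (17 / 100 * t) <= 1.
  have : t * (1 / 3 * (expR (- (12 / 25)) - 1) + 2 / 3 * (expR (17 / 100) - 1)) <= 0.
    by rewrite mulr_ge0_le0//; lra.
  lra.
have : expR (48 / 65 * m) * (1 / 3 * expR (- (48 / 65 * m)) + 2 / 3 * expR (17 / 100 * t)) <= expR (48 / 65 * m).
  by rewrite ger_pMr.
rewrite h3; lra.
Qed.

End real_inequalities.

(** * Sub-Gaussian bounds from a Stein kernel *)

Section sub_gaussian.
Context d (Omega : measurableType d) {R : realType} (P : probability Omega R).
Variables (eta k : Omega -> R) (B : R).
Hypotheses (be : bm eta) (bk : bm k).
Hypothesis stein_exp : forall h, \int[P]_w (eta w * expR (h * eta w)) = h * \int[P]_w (k w * expR (h * eta w)).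
Hypothesis stein_id : \int[P]_w (eta w ^+ 2) = \int[P]_w k w.
Hypothesis kle : forall w, k w <= (4 * B ^+ 2 - eta w ^+ 2) / 2.

Let phi h := \int[P]_w expR (h * eta w).
Let A h := \int[P]_w (eta w * expR (h * eta w)).
Let A2 h := \int[P]_w (eta w ^+ 2 * expR (h * eta w)).
Let v := \int[P]_w (eta w ^+ 2).

Let bexp h : bm (fun w => expR (h * eta w)).
Proof. by apply: bm_expR; exact: bmZ. Qed.

Let phi_gt0 h : 0 < phi h.
Proof.
have [_ [M eM]] := be.
apply: bm_integral_gt0 => //; exists (expR (- (`|h| * M))); first exact: expR_gt0.
move=> w; rewrite ler_expR lerNl (le_trans (ler_norm _))// normrN normrM.
by rewrite ler_wpM2l.
Qed.

Let mean0 : \int[P]_w eta w = 0.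
Proof.
have := stein_exp 0; rewrite mul0r => <-.
by apply: eq_Rintegral => w _; rewrite mul0r expR0 mulr1.
Qed.

(** The variance equals the mean of the kernel, whose upper bound contains [- eta ^+ 2 / 2]; hence
    [v <= 2 B^2 - v / 2]. *)
Lemma variance_le : v <= 4 / 3 * B ^+ 2.
Proof.
have : v <= \int[P]_w ((4 * B ^+ 2 - eta w ^+ 2) / 2).
  by rewrite /v stein_id; apply: bm_integral_le => //; bm_tac.
have -> : (fun w => (4 * B ^+ 2 - eta w ^+ 2) / 2) = (fun w => 2 * B ^+ 2 - 2^-1 * eta w ^+ 2).
  by apply/funext => w; field.
rewrite bm_integralB ?bm_integralZ ?bm_integral_cst -/v; [lra|bm_tac..].
Qed.

Let kexp_le h : \int[P]_w (k w * expR (h * eta w)) <= 2 * B ^+ 2 * phi h - A2 h / 2.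
Proof.
apply: (@le_trans _ _ (\int[P]_w (2 * B ^+ 2 * expR (h * eta w) - 2^-1 * (eta w ^+ 2 * expR (h * eta w))))).
  apply: bm_integral_le; [bm_tac..|move=> w].
  set E := expR _; rewrite [leRHS](_ : _ = (4 * B ^+ 2 - eta w ^+ 2) / 2 * E); last by field.
  by rewrite ler_wpM2r ?expR_ge0.
rewrite bm_integralB ?bm_integralZ -/(A2 _) -/(phi _); [lra|bm_tac..].
Qed.

(* Symmetrization: integrate the trapezoid inequality for [exp] against two
   independent copies of [eta]. *)
Let symm_le h : h * A h <= h ^+ 2 / 2 * (A2 h + v * phi h).
Proof.
have step1 b : h * A h - b * phi h + b * expR b <=
   (h ^+ 2 * A2 h + h ^+ 2 * v * expR b - 2 * b * h * A h + b ^+ 2 * (phi h + expR b)) / 2.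
  have le1 : \int[P]_w (h * (eta w * expR (h * eta w)) - expR b * h * eta w - b * expR (h * eta w) + b * expR b) <=
    \int[P]_w (h ^+ 2 / 2 * (eta w ^+ 2 * expR (h * eta w)) + h ^+ 2 / 2 * expR b * eta w ^+ 2
       - b * h * (eta w * expR (h * eta w)) - b * h * expR b * eta w
       + b ^+ 2 / 2 * expR (h * eta w) + b ^+ 2 / 2 * expR b).
    apply: bm_integral_le; [bm_tac..|move=> w].
    have := expR_trapezoid2 (h * eta w) b; set E := expR _; lra.
  move: le1; rewrite !(bm_integralB, bm_integralD, bm_integralZ, bm_integral_cst); try by bm_tac.
  rewrite -/(A h) -/(phi h) -/(A2 h) -/v mean0 !mulr0 !subr0; lra.
have le2 : \int[P]_w (h * A h - phi h * h * eta w + h * (eta w * expR (h * eta w))) <=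
  \int[P]_w (h ^+ 2 / 2 * A2 h + h ^+ 2 / 2 * v * expR (h * eta w) - h ^+ 2 * A h * eta w
     + h ^+ 2 / 2 * phi h * eta w ^+ 2 + h ^+ 2 / 2 * (eta w ^+ 2 * expR (h * eta w))).
  apply: bm_integral_le; [bm_tac..|move=> w].
  have := step1 (h * eta w); set E := expR _; lra.
move: le2; rewrite !(bm_integralB, bm_integralD, bm_integralZ, bm_integral_cst); try by bm_tac.
rewrite -/(A h) -/(phi h) -/(A2 h) -/v mean0 !mulr0 !subr0; lra.
Qed.

(** Adding the kernel bound and the symmetrized bound cancels [A2 h]. What remains for twice the
    left-hand side is [2 B^2 + v / 2 <= 8/3 B^2]. *)
Let A_le h : h * A h <= 4 / 3 * B ^+ 2 * h ^+ 2 * phi h.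
Proof.
have h1 : h * A h <= h ^+ 2 * (2 * B ^+ 2 * phi h - A2 h / 2).
  by rewrite /A stein_exp mulrA -expr2 ler_wpM2l ?sqr_ge0.
have h2 := symm_le h.
have h3 : h ^+ 2 * (v * phi h) <= h ^+ 2 * (4 / 3 * B ^+ 2 * phi h).
  by rewrite ler_wpM2l ?sqr_ge0// ler_wpM2r ?(ltW (phi_gt0 h))// variance_le.
lra.
Qed.

Lemma mgf_kernel_le h : \int[P]_w (k w * expR (h * eta w)) <= 4 / 3 * B ^+ 2 * phi h.
Proof.
have [->|h0] := eqVneq h 0.
  rewrite /phi; under eq_Rintegral do rewrite mul0r expR0 mulr1.
  under [X in _ <= _ * X]eq_Rintegral do rewrite mul0r expR0.
  by rewrite bm_integral_cst mulr1 -stein_id variance_le.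
have := A_le h; rewrite /A stein_exp; set I := \int[P]_w _ => H.
have h2 : 0 < h ^+ 2 by rewrite exprn_even_gt0.
by rewrite -(ler_pM2l h2); lra.
Qed.

(** [A] is the derivative of [phi], so the bound on [A] makes [phi (h t) * expR (- c t^2)]
    nonincreasing for [t] in [[0, 1]], starting from the value 1. *)
Lemma mgf_le h : phi h <= expR (2 / 3 * B ^+ 2 * h ^+ 2).
Proof.
have dphi z : is_derive z (1 : R) phi (A z).
  have := is_derive_exp_moment P 1 (bm_cst Omega 0) be 0 z (bm_cst Omega 1).
  rewrite mul0r add0r (_ : exp_moment P (fun=> 0) eta 1 0 (fun=> 1) = phi).
    rewrite (_ : exp_moment P (fun=> 0) eta 1 1 (fun=> 1) z / 1 = A z)// divr1.
    apply: eq_Rintegral => w _; rewrite /exp_phase/= mul1r expr1 !mul0r !add0r divr1.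
    by rewrite (mulrC (eta w) z).
  apply/funext => u; apply: eq_Rintegral => w _.
  by rewrite /exp_phase/= expr0 !mul1r !mul0r add0r divr1 mulrC.
pose c := 2 / 3 * B ^+ 2 * h ^+ 2.
pose F (t : R) := - (phi (h * t) * expR (- (c * t ^+ 2))).
pose p : {poly R} := (- c) *: 'X ^+ 2.
have pE u : p.[u] = - (c * u ^+ 2) by rewrite /p hornerZ hornerXn mulNr.
have dpE u : (deriv p).[u] = - (2 * c * u).
  rewrite /p derivZ derivXn hornerZ hornerMn hornerXn -mulr_natl; ring.
have dF (t : R) : is_derive t (1 : R) F ((2 * c * t * phi (h * t) - h * A (h * t)) * expR (- (c * t ^+ 2))).
  have d1 : is_derive t (1 : R) (phi \o (fun t : R => h * t)) (A (h * t) * h).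
    have d0 : is_derive t (1 : R) (fun t : R => h * t) h.
      by rewrite -[X in is_derive _ _ _ X]mulr1; exact: is_deriveZ.
    exact: (@is_derive1_comp _ phi (fun t : R => h * t) t _ _ (dphi (h * t)) d0).
  have d2 : is_derive t (1 : R) (expR \o horner p) (expR p.[t] * (deriv p).[t]).
    exact: is_derive1_comp.
  rewrite (_ : F = - ((phi \o (fun t : R => h * t)) * (expR \o horner p))); last first.
    by apply/funext => u; rewrite /F -[RHS]/(- (phi (h * u) * expR p.[u])) pE.
  apply: (is_derive_eq (is_deriveN (is_deriveM _ _))).
  by rewrite /= pE dpE /GRing.scale/=; ring.
have : F 0 <= F 1.
  apply: (FTC_monotone ler01 dF) => t; rewrite le_eqVlt => /predU1P[<-|t0].
    rewrite mulr0 mul0r sub0r mulr_ge0 ?expR_ge0// oppr_ge0 mulr0 /A.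
    by under eq_Rintegral do rewrite mul0r expR0 mulr1; rewrite mean0 mulr0.
  rewrite mulr_ge0 ?expR_ge0// subr_ge0 -(ler_pM2l t0).
  by have := A_le (h * t); rewrite /c; lra.
rewrite /F !mulr0 mulr1 expr0n/= mulr0 oppr0 expR0 mulr1 expr1n mulr1 lerN2.
have -> : phi 0 = 1.
  rewrite /phi -[RHS](bm_integral_cst P).
  by apply: eq_Rintegral => w _; rewrite mul0r expR0.
by rewrite expRN ler_pdivrMr ?expR_gt0// mul1r.
Qed.

(** Since [k / T] lies in [[0, 1]], the factor [expR (m * (k / T))] lies below its chord and becomes
    affine in [k]. The kernel moment is then at most [2/3 T] times the moment generating function,
    and the factor [1 + 2/3 (expR m - 1)] is bounded by [expR_mgf_slope]. *)
Lemma mgf_joint_le (T m h : R) : 0 < T -> 2 * B ^+ 2 <= T -> 0 <= m <= 13 / 20 ->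
  (forall w, 0 <= k w <= T) ->
  \int[P]_w expR (h * (eta w / Num.sqrt T) + m * (k w / T)) <=
  expR (h ^+ 2 / 3 + 48 / 65 * m).
Proof.
move=> T0 BT m01 kT; pose g := h / Num.sqrt T.
have gE w : h * (eta w / Num.sqrt T) = g * eta w by rewrite /g; ring.
have sT : Num.sqrt T ^+ 2 = T by rewrite sqr_sqrtr// ltW.
have em1 : 0 <= expR m - 1.
  by rewrite subr_ge0 -expR0 ler_expR; case/andP: m01.
apply: (@le_trans _ _ (\int[P]_w (expR (g * eta w) + (expR m - 1) / T * (k w * expR (g * eta w))))).
  apply: bm_integral_le; [bm_tac..|move=> w].
  rewrite expRD gE.
  have k01 : 0 <= k w / T <= 1.
    by have /andP[k0 k1] := kT w; rewrite divr_ge0 ?(ltW T0)//= ler_pdivrMr// mul1r.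
  have := expR_chord m k01; have := expR_gt0 (g * eta w); set E := expR (g * _) => E0 h1.
  rewrite [leRHS](_ : _ = E * (1 + k w / T * (expR m - 1))); last by ring.
  by rewrite ler_pM2l.
rewrite bm_integralD ?bm_integralZ; [|bm_tac..].
have h1 := mgf_kernel_le g; have h2 := mgf_le g.
have p0 := phi_gt0 g.
have c0 : 0 <= (expR m - 1) / T by rewrite divr_ge0// ltW.
apply: (@le_trans _ _ (phi g * (1 + 2 / 3 * (expR m - 1)))).
  apply: (@le_trans _ _ (phi g + (expR m - 1) / T * (4 / 3 * B ^+ 2 * phi g))).
    by rewrite lerD2l ler_wpM2l.
  rewrite mulrDr mulr1 lerD2l.
  rewrite [leLHS](_ : _ = (expR m - 1) * phi g * (2 / 3) * (2 * B ^+ 2 / T)); last by field; rewrite gt_eqF.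
  rewrite [leRHS](_ : _ = (expR m - 1) * phi g * (2 / 3) * 1); last by ring.
  rewrite ler_wpM2l//; first by rewrite !mulr_ge0// ltW.
  by rewrite ler_pdivrMr// mul1r.
rewrite expRD ler_pM ?(ltW p0)//.
- by rewrite addr_ge0// mulr_ge0.
- apply: (le_trans h2); rewrite ler_expR.
  have -> : g ^+ 2 = h ^+ 2 / T by rewrite /g expr_div_n sT.
  rewrite [leLHS](_ : _ = h ^+ 2 / 3 * (2 * B ^+ 2 / T)); last by field; rewrite gt_eqF.
  rewrite -[leRHS]mulr1 ler_wpM2l ?divr_ge0 ?sqr_ge0//.
  by rewrite ler_pdivrMr// mul1r.
- exact: expR_mgf_slope.
Qed.

End sub_gaussian.

(** * Moments of the spectral scaled Student prior *)

(** The matrix determinant lemma, read off from two block triangular factorizations of one bordered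
    matrix. *)
Lemma det_rank1 (R : fieldType) K (C : 'M[R]_K) (u v : 'cV[R]_K) : C \in unitmx ->
  \det (C + u *m v^T) = \det C * (1 + (v^T *m invmx C *m u) 0 0).
Proof.
move=> uC; pose M : 'M[R]_(1 + K) := block_mx 1%:M (- v^T) u C.
have E1 : M = block_mx 1%:M 0 u 1%:M *m block_mx 1%:M (- v^T) 0 (C + u *m v^T).
  by rewrite mulmx_block !mul1mx !mul0mx !mulmx1 !addr0 mulmxN addrC addrK.
have E2 : M = block_mx (1%:M + v^T *m invmx C *m u) (- v^T) 0 C *m block_mx 1%:M 0 (invmx C *m u) 1%:M.
  by rewrite mulmx_block !mul0mx !mulmx0 !mulmx1 !add0r mulKVmx// mulNmx mulmxA addrK.
have := congr1 determinant E1; rewrite E2 !det_mulmx !det_ublock !det_lblock !det1 !mul1r !mulr1.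
by move=> <-; rewrite mulrC; congr (_ * _); rewrite det_mx11 !mxE eqxx.
Qed.

Section student_integrals.
Context {R : realType}.
Local Notation leb := (@lebesgue_measure R).

Lemma continuous_invr (f : R -> R) : continuous f -> (forall x, f x != 0) -> continuous (fun x => (f x)^-1).
Proof. by move=> cf f0 x; apply: cvgV; [exact: f0|exact: cf]. Qed.

Lemma integral_cauchy : (\int[leb]_x ((1 + x ^+ 2)^-1)%:E)%E = (pi : R)%:E.
Proof.
transitivity (\int[leb]_x ((oneDsqr x)^-1)%:E)%E; first exact: eq_integral.
rewrite ge0_symfun_integralT.
- rewrite -set_itvcy integral0y_oneDsqr -EFinM; congr (_%:E); by field.
- by move=> x; rewrite invr_ge0 addr_ge0 ?sqr_ge0.
- exact: continuous_oneDsqrV.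
- by move=> x /=; rewrite /oneDsqr sqrrN.
Qed.

Section second_moment.
Variable lam : R.
Hypothesis lam0 : 0 < lam.

Let q (t : R) := lam ^+ 2 + t ^+ 2.
Let q0 t : 0 < q t.
Proof. by rewrite ltr_pwDl// ?exprn_gt0// sqr_ge0. Qed.

Let cq : continuous q.
Proof. by move=> t; apply: cvgD; [exact: cvg_cst|exact: (cvgM cvg_id cvg_id)]. Qed.

Let cq2 : continuous (fun t => q t ^+ 2).
Proof.
have : continuous ((fun x : R => x ^+ 2) \o q); last by [].
by move=> t; apply: continuous_comp; [exact: cq|exact: exprn_continuous].
Qed.

Let dq (t : R) : is_derive t (1 : R) q (2 * t).
Proof.
pose p : {poly R} := (lam ^+ 2)%:P + 'X ^+ 2.
rewrite (_ : q = horner p); last first.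
  by apply/funext => u; rewrite /p hornerD hornerC hornerXn.
apply: is_derive_eq; rewrite /p derivD derivC derivXn add0r hornerMn hornerXn; ring.
Qed.

(** Antiderivative of [lam^2 / q^2] for [sg = 1] and of [t^2 / q^2] for [sg = -1]. The sign only
    multiplies [t / q], which vanishes at 0 and at infinity; hence both integrals agree and the
    second moment is [lam^2] times the mass. *)
Let F sg (t : R) := (lam^-1 * atan (lam^-1 * t) + sg * (t * (q t)^-1)) / 2.

Let dF sg (t : R) : is_derive t (1 : R) (F sg) (((q t)^-1 + sg * ((lam ^+ 2 - t ^+ 2) / q t ^+ 2)) / 2).
Proof.
have d1 : is_derive t (1 : R) (fun t : R => lam^-1 * t) lam^-1.
  by rewrite -[X in is_derive _ _ _ X]mulr1; exact: is_deriveZ.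
have d2 := @is_derive1_comp _ atan (fun t : R => lam^-1 * t) t _ _ (is_derive1_atan _) d1.
have qt : q t != 0 by rewrite gt_eqF.
have d3 : is_derive t (1 : R) (fun t => (q t)^-1) (- (q t) ^- 2 *: (2 * t)).
  exact: is_deriveV.
have d4 := is_deriveM (@is_derive_id _ _ t (1 : R)) d3.
have d5 := is_deriveZ lam^-1 d2.
have d6 := is_deriveZ sg d4.
have d7 := is_deriveZ 2^-1 (is_deriveD d5 d6).
rewrite (_ : F sg = 2^-1 \*: (lam^-1 \*: (atan \o (fun t : R => lam^-1 * t)) + sg \*: (id * (fun t => (q t)^-1)))); last first.
  by apply/funext => u; rewrite /F mulrC.
apply: (is_derive_eq d7); rewrite /GRing.scale/=.
have -> : 1 + (lam^-1 * t) ^+ 2 = q t / lam ^+ 2.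
  by rewrite /q; field; rewrite gt_eqF.
have hq : q t = lam ^+ 2 + t ^+ 2 by [].
have l0 : lam != 0 by rewrite gt_eqF.
rewrite invf_div (_ : lam ^+ 2 - t ^+ 2 = q t - 2 * t ^+ 2); last by rewrite hq; ring.
by field; rewrite qt.
Qed.

Let cvgF sg : F sg t @[t --> +oo] --> pi / (4 * lam).
Proof.
have c1 : atan (lam^-1 * t) @[t --> +oo] --> (pi / 2 : R).
  apply: (@cvg_comp _ _ _ (fun t => lam^-1 * t) atan _ +oo) => //; last exact: cvgy_atan.
  by apply: gt0_cvgMry; [rewrite invr_gt0|exact: cvg_id].
have c2 : t * (q t)^-1 @[t --> +oo] --> (0 : R).
  apply: (@squeeze_cvgr _ _ _ _ (fun=> 0) (fun t => t^-1)).
  - near=> t; have t0 : 0 < t by near: t; exact: nbhs_pinfty_gt.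
    rewrite mulr_ge0 ?invr_ge0 ?(ltW (q0 _)) ?(ltW t0)//= ler_pdivrMr//.
    by rewrite mulrC -ler_pdivrMr ?invr_gt0// invrK -expr2 /q lerDr sqr_ge0.
  - exact: cvg_cst.
  - by apply/gtr0_cvgV0; [exact: nbhs_pinfty_gt|exact: cvg_id].
rewrite (_ : pi / (4 * lam) = (lam^-1 * (pi / 2) + sg * 0) / 2); last first.
  by field; rewrite gt_eqF.
exact: (cvgM (cvgD (cvgM (cvg_cst lam^-1) c1) (cvgM (cvg_cst sg) c2)) (cvg_cst _)).
Unshelve. all: by end_near. Qed.

Let cvg_continuous_q sg : continuous (fun t => ((q t)^-1 + sg * ((lam ^+ 2 - t ^+ 2) / q t ^+ 2)) / 2).
Proof.
have qn0 t : q t != 0 by rewrite gt_eqF.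
have ct2 : continuous (fun t : R => t ^+ 2) by move=> t; exact: (cvgM cvg_id cvg_id).
have c1 := continuous_invr cq qn0.
have c2 : continuous (fun t => (q t ^+ 2)^-1).
  apply: continuous_invr => [t|t]; last by rewrite expf_neq0.
  exact: cq2.
move=> t; apply: cvgM; last exact: cvg_cst.
apply: cvgD; first exact: c1.
apply: cvgM; first exact: cvg_cst.
by apply: cvgM; [apply: cvgB; [exact: cvg_cst|exact: ct2]|exact: c2].
Qed.

Let integral_hf sg : sg ^+ 2 = 1 ->
  (\int[leb]_t (((q t)^-1 + sg * ((lam ^+ 2 - t ^+ 2) / q t ^+ 2)) / 2)%:E = (pi / (2 * lam))%:E)%E.
Proof.
move=> sg1; pose h t := ((q t)^-1 + sg * ((lam ^+ 2 - t ^+ 2) / q t ^+ 2)) / 2.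
have ch : continuous h by exact: cvg_continuous_q.
have cF x : {for x, continuous (F sg)}.
  by apply: differentiable_continuous; apply/derivable1_diffP; have [] := dF sg x.
have sgE : sg = 1 \/ sg = -1.
  by move/eqP: sg1; rewrite sqrf_eq1 => /orP[/eqP|/eqP]; [left|right].
have h0 t : 0 <= h t.
  have qt := q0 t; have qn0 : q t != 0 by rewrite gt_eqF.
  rewrite /h divr_ge0//; case: sgE => ->.
    rewrite [leRHS](_ : _ = 2 * lam ^+ 2 / q t ^+ 2); last by move: qn0; rewrite /q => qn0; field.
    by rewrite divr_ge0 ?sqr_ge0// mulr_ge0 ?sqr_ge0.
  rewrite [leRHS](_ : _ = 2 * t ^+ 2 / q t ^+ 2); last by move: qn0; rewrite /q => qn0; field.
  by rewrite divr_ge0 ?sqr_ge0// mulr_ge0 ?sqr_ge0.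
rewrite ge0_symfun_integralT//; last by move=> t /=; rewrite /h /q sqrrN.
rewrite -set_itvcy (ge0_continuous_FTC2y (F := F sg) (l := pi / (4 * lam))).
- rewrite /F mulr0 atan0 !(mulr0, mul0r, addr0) -EFinB -EFinM; congr (_%:E).
  by field; rewrite gt_eqF.
- by move=> t _; exact: h0.
- exact: continuous_subspaceT.
- exact: cvgF.
- by move=> t _; have [] := dF sg t.
- by apply: cvg_at_right_filter; exact: cF.
- by move=> t _; rewrite derive1E; apply: derive_val.
Qed.

Lemma integral_cauchy_sqr :
  (\int[leb]_t ((q t ^+ 2)^-1)%:E = (pi / (2 * lam ^+ 3))%:E)%E.
Proof.
have l0 : lam != 0 by rewrite gt_eqF.
have h : (\int[leb]_t ((lam ^+ 2)%:E * ((q t ^+ 2)^-1)%:E) = (pi / (2 * lam))%:E)%E.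
  rewrite -(@integral_hf 1) ?expr1n//; apply: eq_integral => t _; rewrite -EFinM; congr (_%:E).
  by have := q0 t; rewrite /q => /lt0r_neq0 qn0; field.
have mq : measurable_fun setT (fun t => (q t ^+ 2)^-1).
  apply: continuous_measurable_fun; apply: continuous_invr => [t|t]; first exact: cq2.
  by rewrite expf_neq0// gt_eqF.
move: h; rewrite ge0_integralZl_EFin ?sqr_ge0//; last 2 first.
- by move=> t _; rewrite lee_fin invr_ge0 sqr_ge0.
- exact/measurable_EFinP.
move=> h; have : ((lam ^- 2)%:E * ((lam ^+ 2)%:E * \int[leb]_t ((q t ^+ 2)^-1)%:E) = (lam ^- 2)%:E * (pi / (2 * lam))%:E)%E by rewrite h.
rewrite muleA -!EFinM mulVf ?expf_neq0// mul1e => ->; congr (_%:E).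
by field.
Qed.

Lemma second_moment_cauchy :
  (\int[leb]_t ((t ^+ 2)%:E * ((q t ^+ 2)^-1)%:E) = (lam ^+ 2)%:E * \int[leb]_t ((q t ^+ 2)^-1)%:E)%E.
Proof.
have l0 : lam != 0 by rewrite gt_eqF.
rewrite integral_cauchy_sqr -EFinM (_ : lam ^+ 2 * _ = pi / (2 * lam)); last by field.
rewrite -(@integral_hf (-1)) ?sqrrN ?expr1n//; apply: eq_integral => t _; rewrite -EFinM; congr (_%:E).
by have := q0 t; rewrite /q => /lt0r_neq0 qn0; field.
Qed.

End second_moment.
End student_integrals.

Lemma ge0_integralZl_real d (X : measurableType d) (R : realType)
    (mu : {measure set X -> \bar R}) (k : R) (f : X -> R) : 0 <= k ->
  measurable_fun setT f -> (forall x, 0 <= f x) ->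
  (\int[mu]_x (k * f x)%:E = k%:E * \int[mu]_x (f x)%:E)%E.
Proof.
move=> k0 mf f0; under eq_integral do rewrite EFinM.
by apply: ge0_integralZl_EFin => //; [move=> x _; rewrite lee_fin|exact/measurable_EFinP].
Qed.

Section matrix_student.
Context {R : realType}.
Local Notation leb := (@lebesgue_measure R).

Lemma powR_sqr (x s : R) : 0 < x -> (x ^+ 2) `^ s = x `^ (2 * s).
Proof. by move=> x0; rewrite -powR_mulrn ?ltW// -powRrM. Qed.

Lemma measurable_powR_comp d (X : measurableType d) (f : X -> R) s :
  measurable_fun setT f -> measurable_fun setT (fun x => f x `^ s).
Proof. by move=> mf; exact: (measurableT_comp (measurable_powR s) mf). Qed.

Lemma spd1 K m (F : 'M[R]_(K, m)) : spd (1%:M + F *m F^T).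
Proof. exact: spd_scalar_gram. Qed.

Lemma spd_gramD K m (A : 'M[R]_K) (F : 'M[R]_(K, m)) : spd A -> spd (A + F *m F^T).
Proof.
move=> [AT A0]; split; first by rewrite linearD/= trmx_mul trmxK AT.
move=> l X X0; rewrite mulmxDl dotDr ltr_wpDr//; last exact: A0.
exact: psd_gram.
Qed.

Lemma det_scalar_gram_col K (a : R) (f : 'cV[R]_K) : 0 < a ->
  \det (a%:M + f *m f^T) = a ^+ K * (1 + dot f f / a).
Proof.
move=> a0; rewrite det_rank1; last by rewrite unitmxE det_scalar unitfE expf_neq0// gt_eqF.
rewrite det_scalar; congr (_ * (1 + _)).
rewrite invmx_scalar mul_mx_scalar -scalemxAl mxE mulrC; congr (_ / _).
by rewrite /dot {2}(mx11_scalar (f^T *m f)) mxtrace_scalar.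
Qed.

Local Open Scope ereal_scope.

Definition cauchy_mass K (s : R) : \bar R :=
  \int[lebesgue_mx]_(f in [set: 'cV[R]_K]) ((1 + dot f f) `^ (- s))%:E.

Let mdotp K (a s : R) : measurable_fun setT (fun f : 'cV[R]_K => (a + dot f f) `^ s)%R.
Proof.
apply: measurable_powR_comp; apply: measurable_funD => //; exact: measurable_dot.
Qed.

Lemma cauchy_mass_ge0 K s : 0 <= cauchy_mass K s.
Proof. by apply: integral_ge0 => f _; rewrite lee_fin powR_ge0. Qed.

Lemma cauchy_scale K (a s : R) : (0 < a)%R ->
  \int[lebesgue_mx]_(f in [set: 'cV[R]_K]) ((a + dot f f) `^ (- s))%:E =
  (a `^ (- s + K%:R / 2))%:E * cauchy_mass K s.
Proof.
move=> a0; pose c := Num.sqrt a; have c0 : (0 < c)%R by rewrite sqrtr_gt0.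
have cc : (c ^+ 2 = a)%R by rewrite sqr_sqrtr// ltW.
have mg : measurable_fun setT (fun f : 'cV[R]_K => ((a + dot f f) `^ (- s))%:E).
  by apply/measurable_EFinP; exact: mdotp.
have g0 (f : 'cV[R]_K) : 0 <= ((a + dot f f) `^ (- s))%:E by rewrite lee_fin powR_ge0.
have := integral_mx_scale (lt0r_neq0 c0) mg g0.
set I := \int[_]_(f in _) _ => h.
transitivity ((`|c| ^+ (K * 1))%:E * I).
  by rewrite h muleA -EFinM divff ?mul1e// expf_neq0// normr_eq0 gt_eqF.
rewrite /I.
under eq_integral => f _.
  rewrite dotZl dotZr mulrA -expr2 cc -{1}(mulr1 a) -mulrDr powRM ?(ltW a0)//; last first.
    by rewrite addr_ge0// dot_ge0.
  over.
rewrite (ge0_integralZl_real _ (powR_ge0 _ _) (@mdotp K 1 (- s)) (fun f => powR_ge0 _ _)).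
rewrite muleA -EFinM; congr (_%:E * _).
rewrite (gtr0_norm c0) muln1 -powR_mulrn ?(ltW c0)//.
have -> : c = (a `^ (2^-1))%R by rewrite /c powR12_sqrt// ltW.
rewrite -powRrM -powRD; last by apply/implyP => _; rewrite gt_eqF.
by congr (_ `^ _)%R; rewrite addrC mulrC.
Qed.

Lemma measurable_iter_col K n m (f : 'M[R]_(K + m, n) -> \bar R) :
  measurable_fun setT f -> (forall F, 0 <= f F) ->
  measurable_fun setT (fun A : 'M[R]_(K, n) => \int[lebesgue_mx]_(B in [set: 'M[R]_(m, n)]) f (col_mx A B)).
Proof.
move=> mf f0; apply: (measurable_fun_fubini_tonelli_F (fun p : 'M[R]_(K, n) * 'M[R]_(m, n) => f (col_mx p.1 p.2))) => //.
by apply: (measurableT_comp mf); exact: measurable_col_mx.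
Qed.

Lemma cauchy_split K (s a : R) (phi : R -> \bar R) : (0 < a)%R ->
  measurable_fun setT phi -> (forall t, 0 <= phi t) ->
  \int[lebesgue_mx]_(f in [set: 'cV[R]_(1 + K)]) (phi (f 0 0)%R * ((a + dot f f) `^ (- s))%:E) =
  (\int[leb]_t (phi t * ((a + t ^+ 2) `^ (- s + K%:R / 2))%:E)) * cauchy_mass K s.
Proof.
move=> a0 mphi phi0.
have mphi0 : measurable_fun setT (fun f : 'cV[R]_(1 + K) => phi (f 0 0)%R).
  by apply: (measurableT_comp mphi); exact: measurable_entry.
have mg : measurable_fun setT (fun f : 'cV[R]_(1 + K) => phi (f 0 0)%R * ((a + dot f f) `^ (- s))%:E).
  by apply: emeasurable_funM => //; apply/measurable_EFinP; exact: mdotp.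
have g0 (f : 'cV[R]_(1 + K)) : 0 <= phi (f 0 0)%R * ((a + dot f f) `^ (- s))%:E.
  by rewrite mule_ge0// lee_fin powR_ge0.
rewrite integral_col_mx// integral_mx11; last 2 first.
- exact: (measurable_iter_col mg g0).
- by move=> A; apply: integral_ge0.
have at0 t : (0 < a + t ^+ 2)%R by rewrite ltr_wpDr// sqr_ge0.
under eq_integral => t _.
  rewrite (eq_integral (fun f : 'cV[R]_K => phi t * ((a + t ^+ 2 + dot f f) `^ (- s))%:E)); last first.
    move=> f _; rewrite (_ : (col_mx t%:M f) 0 0 = t)%R; last first.
      transitivity ((col_mx t%:M f : 'cV[R]_(1 + K)) (lshift K 0%R) 0%R).
        by congr (col_mx _ _ _ _); exact: val_inj.
      by rewrite col_mxEu mxE eqxx.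
    by rewrite dot_col_mx addrA; do 3 congr (_ _); rewrite dotE !big_ord_recl !big_ord0 !addr0 mxE eqxx -expr2.
  rewrite ge0_integralZl//; last 2 first.
  - by apply/measurable_EFinP; exact: mdotp.
  - by move=> f _; rewrite lee_fin powR_ge0.
  rewrite cauchy_scale// muleA.
  over.
rewrite ge0_integralZr//; last 2 first.
- by move=> t _; rewrite mule_ge0// lee_fin powR_ge0.
- exact: cauchy_mass_ge0.
apply: emeasurable_funM => //; apply/measurable_EFinP; apply: measurable_powR_comp.
by apply: measurable_funD => //; exact: measurable_funX.
Qed.

(** Integrating out all coordinates but one costs 1/2 in the exponent for each of them; the
    remaining exponent is at least 1, so the Cauchy density dominates. *)
Lemma cauchy_mass_fin K (s : R) : ((K.+1)%:R / 2 <= s)%R -> cauchy_mass K s < +oo.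
Proof.
elim: K s => [|K IH] s sK.
  rewrite /cauchy_mass integral_mx0 ?mul0n//; last first.
  - by move=> f; rewrite lee_fin powR_ge0.
  - by apply/measurable_EFinP; exact: mdotp.
  exact: ltry.
have := @cauchy_split K s 1 (fun=> 1) ltr01 (measurable_cst _) (fun=> lee01).
under eq_integral do rewrite mul1e.
under [X in _ = X * _]eq_integral do rewrite mul1e.
rewrite -/(cauchy_mass K.+1 s) => ->; apply: lte_mul_pinfty.
- by apply: integral_ge0 => t _; rewrite lee_fin powR_ge0.
- rewrite ge0_fin_numE; last by apply: integral_ge0 => t _; rewrite lee_fin powR_ge0.
  apply: (@le_lt_trans _ _ (pi%:E)); last exact: ltry.
  rewrite -integral_cauchy; apply: ge0_le_integral => //.
  + by move=> t _; rewrite lee_fin powR_ge0.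
  + apply/measurable_EFinP; apply: measurable_powR_comp.
    by apply: measurable_funD => //; exact: measurable_funX.
  + apply/measurable_EFinP; apply: measurable_invr; apply: measurable_funD => //.
  + move=> t _; rewrite lee_fin -[leRHS]powR_inv1 ?addr_ge0 ?sqr_ge0//.
    rewrite ler_powR//; first by rewrite lerDl sqr_ge0.
    by move: sK; rewrite -[in X in (X -> _)%R]natr1 -[(K.+1)%:R]natr1; lra.
- by apply: IH; move: sK; rewrite -[(K.+2)%:R]natr1; lra.
Qed.

Definition student_mass K m (s : R) : \bar R :=
  \int[lebesgue_mx]_(F in [set: 'M[R]_(K, m)]) (\det (1%:M + F *m F^T) `^ (- s))%:E.

Lemma student_mass_ge0 K m s : 0 <= student_mass K m s.
Proof. by apply: integral_ge0 => f _; rewrite lee_fin powR_ge0. Qed.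

Let mstudent d (X : measurableType d) K m (A : X -> 'M[R]_K) (F : X -> 'M[R]_(K, m)) s :
  measurable_fun setT A -> measurable_fun setT F ->
  measurable_fun setT (fun x => \det (A x + F x *m (F x)^T) `^ s)%R.
Proof.
move=> mA mF; apply: measurable_powR_comp; apply: measurable_det.
by apply: measurable_addmx => //; apply: measurable_mulmx => //; exact: measurable_trmx.
Qed.

Lemma student_scale K m (A : 'M[R]_K) (s : R) : spd A ->
  \int[lebesgue_mx]_(F in [set: 'M[R]_(K, m)]) (\det (A + F *m F^T) `^ (- s))%:E =
  (\det A `^ (- s + m%:R / 2))%:E * student_mass K m s.
Proof.
move=> hA; have [L [LE L0 JL]] := cholesky hA.
have mf : measurable_fun setT (fun F : 'M[R]_(K, m) => (\det (A + F *m F^T) `^ (- s))%:E).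
  by apply/measurable_EFinP; apply: mstudent.
have f0 (F : 'M[R]_(K, m)) : 0 <= (\det (A + F *m F^T) `^ (- s))%:E by rewrite lee_fin powR_ge0.
have /= h := JL m _ mf f0.
have L1 : (`|\det L| ^+ m)%:E * (`|\det L| ^- m)%:E = 1.
  by rewrite -EFinM divff// expf_neq0// normr_eq0 gt_eqF.
rewrite -[LHS]mul1e -L1 -muleA -h.
under eq_integral => F _.
  have -> : (A + L *m F *m (L *m F)^T = L *m (1%:M + F *m F^T) *m L^T)%R.
    by rewrite mulmxDr mulmx1 mulmxDl -LE trmx_mul !mulmxA.
  rewrite !det_mulmx det_tr mulrAC -expr2 powRM; last 2 first.
  - by rewrite sqr_ge0.
  - exact/ltW/spd_det_gt0/spd1.
  over.
rewrite (ge0_integralZl_real _ (powR_ge0 _ _) _ (fun f => powR_ge0 _ _)); last exact: mstudent.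
rewrite muleA -EFinM; congr (_%:E * _).
rewrite (gtr0_norm L0) LE det_mulmx det_tr -expr2 !powR_sqr//.
rewrite -powR_mulrn ?(ltW L0)// -powRD; last by apply/implyP => _; rewrite gt_eqF.
by congr (_ `^ _)%R; field.
Qed.

(** Peeling off the first column [f] turns the scalar matrix into [c%:M + f *m f^T], which is again
    positive definite, and [student_scale] integrates out the other columns. The function [phi] of
    the corner entry goes along for the moments. *)
Lemma student_split K m (c s : R) (phi : R -> \bar R) (hK : (0 < K)%N) : (0 < c)%R ->
  measurable_fun setT phi -> (forall t, 0 <= phi t) ->
  \int[lebesgue_mx]_(F in [set: 'M[R]_(K, 1 + m)])
    (phi (F (Ordinal hK) 0%R) * (\det (c%:M + F *m F^T) `^ (- s))%:E) =
  (\int[lebesgue_mx]_(f in [set: 'cV[R]_K])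
    (phi (f (Ordinal hK) 0%R) * (\det (c%:M + f *m f^T) `^ (- s + m%:R / 2))%:E)) * student_mass K m s.
Proof.
move=> c0 mphi phi0.
have mphi0 l (j : 'I_l) : measurable_fun setT (fun F : 'M[R]_(K, l) => phi (F (Ordinal hK) j)).
  by apply: (measurableT_comp mphi); exact: measurable_entry.
have mg : measurable_fun setT (fun F : 'M[R]_(K, 1 + m) => phi (F (Ordinal hK) 0%R) * (\det (c%:M + F *m F^T) `^ (- s))%:E).
  by apply: emeasurable_funM; [exact: mphi0|apply/measurable_EFinP; apply: mstudent].
rewrite integral_row_mx//; last by move=> F; rewrite mule_ge0// lee_fin powR_ge0.
under eq_integral => f _.
  rewrite (eq_integral (fun F : 'M[R]_(K, m) => phi (f (Ordinal hK) 0%R) * (\det (c%:M + f *m f^T + F *m F^T) `^ (- s))%:E)); last first.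
    move=> F _; rewrite (_ : (row_mx f F) (Ordinal hK) 0%R = f (Ordinal hK) 0%R); last first.
      transitivity ((row_mx f F : 'M[R]_(K, 1 + m)) (Ordinal hK) (lshift m 0%R)).
        by congr (row_mx _ _ _ _); exact: val_inj.
      by rewrite row_mxEl.
    by rewrite tr_row_mx mul_row_col addrA.
  rewrite ge0_integralZl//; last 2 first.
  - by first [move=> F _; rewrite lee_fin powR_ge0|apply/measurable_EFinP; apply: mstudent].
  - by first [move=> F _; rewrite lee_fin powR_ge0|apply/measurable_EFinP; apply: mstudent].
  rewrite student_scale ?muleA//; last exact: spd_scalar_gram.
  over.
rewrite ge0_integralZr//; last 2 first.
- by move=> t _; rewrite mule_ge0// lee_fin powR_ge0.
- exact: student_mass_ge0.
by apply: emeasurable_funM; [exact: mphi0|apply/measurable_EFinP; apply: mstudent].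
Qed.

Lemma student_mass_fin K m (s : R) : (0 < K)%N -> ((m + K)%:R / 2 <= s)%R -> student_mass K m s < +oo.
Proof.
move=> hK; elim: m => [|m IH] sK.
  rewrite /student_mass integral_mx0 ?muln0//; last first.
  - by move=> f; rewrite lee_fin powR_ge0.
  - by apply/measurable_EFinP; exact: mstudent.
  exact: ltry.
have := @student_split K m 1 s (fun=> 1) hK ltr01 (measurable_cst _) (fun=> lee01).
under eq_integral do rewrite mul1e.
under [X in _ = X * _]eq_integral => f _.
  rewrite mul1e det_scalar_gram_col// expr1n mul1r divr1.
  rewrite (_ : - s + m%:R / 2 = - (s - m%:R / 2))%R; last by rewrite opprB addrC.
  over.
rewrite -/(student_mass K m.+1 s) -/(cauchy_mass _ _) => ->; apply: lte_mul_pinfty.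
- exact: cauchy_mass_ge0.
- rewrite ge0_fin_numE ?cauchy_mass_ge0//; apply: cauchy_mass_fin.
  by move: sK; rewrite addSn -!natr1 natrD; lra.
- by apply: IH; move: sK; rewrite addSn -natr1; lra.
Qed.

End matrix_student.

Section student_density.
Context {R : realType}.
Local Notation leb := (@lebesgue_measure R).

Definition student_density K n (lam : R) (F : 'M[R]_(K, n)) : R :=
  \det ((lam ^+ 2)%:M + F *m F^T) `^ (- ((n + K + 2)%:R / 2)).

Lemma student_density_ge0 K n (lam : R) (F : 'M[R]_(K, n)) : 0 <= student_density lam F.
Proof. exact: powR_ge0. Qed.

Lemma measurable_student_density K n (lam : R) :
  measurable_fun setT (@student_density K n lam).
Proof.
apply: measurable_powR_comp; apply: measurable_det.
by apply: measurable_addmx => //; apply: measurable_mulmx => //; exact: measurable_trmx.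
Qed.

Local Open Scope ereal_scope.

(** The exponent is [(n + K + 4) / 2] in these shifted dimensions; integrating out [n] columns and
    then [K] entries lowers it to 2. A single entry thus has a scaled Student law with 3 degrees of
    freedom, which has a finite second moment. *)
Lemma student_density_marginal K n (lam : R) : (0 < lam)%R ->
  exists2 c : \bar R, 0 <= c < +oo & forall phi : R -> \bar R,
  measurable_fun setT phi -> (forall t, 0 <= phi t) ->
  \int[lebesgue_mx]_(F in [set: 'M[R]_(1 + K, 1 + n)])
    (phi (F 0 0)%R * (student_density lam F)%:E) =
  c * \int[leb]_t (phi t * (((lam ^+ 2 + t ^+ 2) ^+ 2)^-1)%:E).
Proof.
move=> l0; have ll : (0 < lam ^+ 2)%R by rewrite exprn_gt0.
pose s : R := ((1 + n + (1 + K) + 2)%:R / 2)%R.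
pose s' : R := ((K + 4)%:R / 2)%R.
pose k1 : R := (((lam ^+ 2) ^+ K) `^ (- s'))%R.
exists (k1%:E * cauchy_mass K s' * student_mass (1 + K) n s).
  rewrite !mule_ge0 ?cauchy_mass_ge0 ?student_mass_ge0 ?lee_fin ?powR_ge0//=.
  have h1 : cauchy_mass K s' \is a fin_num.
    rewrite ge0_fin_numE ?cauchy_mass_ge0//; apply: cauchy_mass_fin.
    by rewrite /s' ler_pM2r// ler_nat; lia.
  have h2 : student_mass (1 + K) n s \is a fin_num.
    rewrite ge0_fin_numE ?student_mass_ge0//; apply: student_mass_fin => //.
    by rewrite /s ler_pM2r// ler_nat; lia.
  by rewrite -(fineK h1) -(fineK h2) -!EFinM ltry.
move=> phi mphi phi0.
have hK : (0 < 1 + K)%N by [].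
have -> : (0 : 'I_(1 + K))%R = Ordinal hK by exact: val_inj.
rewrite student_split//.
have E (f : 'cV[R]_(1 + K)) : (\det ((lam ^+ 2)%:M + f *m f^T) `^ (- s + n%:R / 2))%R =
    (k1 * (lam ^+ 2 + dot f f) `^ (- s'))%R :> R.
  rewrite det_scalar_gram_col//.
  have -> : ((lam ^+ 2) ^+ (1 + K) * (1 + dot f f / lam ^+ 2))%R =
     ((lam ^+ 2) ^+ K * (lam ^+ 2 + dot f f))%R.
    by rewrite (exprD _ 1%N K) expr1 mulrAC mulrDr mulr1 [X in (_ + X)%R]mulrC divfK ?gt_eqF// mulrC.
  rewrite powRM ?exprn_ge0 ?addr_ge0 ?dot_ge0 ?ltW// /k1.
  have -> : (- s + n%:R / 2 = - s')%R by rewrite /s /s' !natrD; field.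
  by [].
under eq_integral => f _.
  rewrite (E f) EFinM muleA [X in X * _]muleC -muleA.
  have -> : Ordinal hK = (0 : 'I_(1 + K))%R by exact: val_inj.
  over.
have mg : measurable_fun setT (fun f : 'cV[R]_(1 + K) => phi (f 0 0)%R * ((lam ^+ 2 + dot f f) `^ (- s'))%:E).
  apply: emeasurable_funM.
    by apply: (measurableT_comp mphi); exact: measurable_entry.
  apply/measurable_EFinP; apply: measurable_powR_comp; apply: measurable_funD => //.
  exact: measurable_dot.
rewrite ge0_integralZl_EFin//; last 2 first.
- by first [move=> f _; rewrite mule_ge0// lee_fin powR_ge0|exact: powR_ge0].
- by first [move=> f _; rewrite mule_ge0// lee_fin powR_ge0|exact: powR_ge0].
rewrite cauchy_split//.
have -> : (- s' + K%:R / 2 = - 2)%R by rewrite /s' natrD; field.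
rewrite [RHS]muleAC; congr (_ * _); rewrite -[RHS]muleA; congr (_ * _).
rewrite [RHS]muleC; congr (_ * _); apply: eq_integral => t _; congr (_ * _%:E).
have q0 : (0 <= lam ^+ 2 + t ^+ 2)%R by rewrite addr_ge0 ?sqr_ge0.
by rewrite powRN powR_mulrn.
Qed.

Lemma student_density_moment0 K n (lam : R) : (0 < lam)%R ->
  let C := \int[lebesgue_mx]_(F in [set: 'M[R]_(1 + K, 1 + n)]) (student_density lam F)%:E in
  C < +oo /\
  \int[lebesgue_mx]_(F in [set: 'M[R]_(1 + K, 1 + n)]) ((F 0 0)%R ^+ 2 * student_density lam F)%:E =
  (lam ^+ 2)%:E * C.
Proof.
move=> l0 C; have [c /andP[c0 coo] H] := @student_density_marginal K n lam l0.
have HC : C = c * (pi / (2 * lam ^+ 3))%:E.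
  rewrite -integral_cauchy_sqr// /C -[in RHS](eq_integral _ _ (fun t _ => mul1e _)).
  by rewrite -(H (fun=> 1))//; apply: eq_integral => F _; rewrite mul1e.
split; first by rewrite HC -(@fineK _ c) ?ge0_fin_numE// -EFinM ltry.
rewrite HC muleCA -integral_cauchy_sqr// -second_moment_cauchy//.
rewrite -(H (fun t => (t ^+ 2)%:E)); last 2 first.
- by apply/measurable_EFinP; exact: measurable_funX.
- by move=> t; rewrite lee_fin sqr_ge0.
by apply: eq_integral => F _; rewrite EFinM.
Qed.

Variables (K n : nat) (lam : R).
Hypotheses (hK : (0 < K)%N) (hn : (0 < n)%N) (l0 : (0 < lam)%R).

Definition student_total : R :=
  fine (\int[lebesgue_mx]_(F in [set: 'M[R]_(K, n)]) (student_density lam F)%:E).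

Lemma integral_student_density :
  \int[lebesgue_mx]_(F in [set: 'M[R]_(K, n)]) (student_density lam F)%:E = student_total%:E.
Proof.
rewrite /student_total fineK// ge0_fin_numE; last first.
  by apply: integral_ge0 => F _; rewrite lee_fin student_density_ge0.
move: hK hn; case: (K) => // K' _; case: (n) => // n' _.
by have [] := @student_density_moment0 K' n' lam l0.
Qed.

(** The density is invariant under permutations of rows and of columns, so every entry has the
    moment of the corner entry. *)
Lemma student_density_moment (j : 'I_K) (i : 'I_n) :
  \int[lebesgue_mx]_(F in [set: 'M[R]_(K, n)]) ((F j i)%R ^+ 2 * student_density lam F)%:E =
  (lam ^+ 2 * student_total)%:E.
Proof.
rewrite EFinM -integral_student_density.
move: hK hn j i; case: (K) => // K' _; case: (n) => // n' _ j i.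
have [_ <-] := @student_density_moment0 K' n' lam l0.
have sd2 (s : 'S_K'.+1) F : student_density lam (row_perm s F : 'M[R]_(K'.+1, n'.+1)) = student_density lam F.
  rewrite /student_density; congr (_ `^ _)%R.
  rewrite row_permE trmx_mul mulmxA -(mulmxA _ F).
  have h : (lam ^+ 2)%:M = perm_mx s *m (lam ^+ 2)%:M *m (perm_mx s)^T :> 'M[R]_K'.+1.
    rewrite scalar_mxC -mulmxA tr_perm_mx -perm_mxM mulgV perm_mx1 mulmx1.
    by [].
  rewrite {1}h -mulmxDl -mulmxDr !det_mulmx det_tr mulrC mulrA.
  by rewrite det_perm -expr2 sqrr_sign mul1r.
have sd1 (s : 'S_n'.+1) F : student_density lam (col_perm s F : 'M[R]_(K'.+1, n'.+1)) = student_density lam F.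
  rewrite /student_density; congr (\det (_ + _) `^ _)%R.
  rewrite col_permE trmx_mul mulmxA -(mulmxA F).
  by rewrite tr_perm_mx -perm_mxM mulgV perm_mx1 mulmx1.
have mf a b : measurable_fun setT (fun F : 'M[R]_(K'.+1, n'.+1) => (F a b ^+ 2 * student_density lam F)%:E).
  apply/measurable_EFinP; apply: measurable_funM; last exact: measurable_student_density.
  by apply: measurable_funX; exact: measurable_entry.
have f0 a b (F : 'M[R]_(K'.+1, n'.+1)) : 0 <= (F a b ^+ 2 * student_density lam F)%:E.
  by rewrite lee_fin mulr_ge0 ?sqr_ge0 ?student_density_ge0.
rewrite -(integral_mx_row_perm (tperm 0%R j) (mf j i) (f0 j i)).
under eq_integral do rewrite sd2 mxE tpermR.
rewrite -(integral_mx_col_perm (tperm 0%R i) (mf 0%R i) (f0 0%R i)).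
by under eq_integral do rewrite sd1 mxE tpermR.
Qed.

(** The density is positive everywhere, so a zero total would make Lebesgue measure null, contrary
    to the positive Gaussian mass. *)
Lemma student_total_gt0 : (0 < student_total)%R.
Proof.
rewrite lt0r -lee_fin -integral_student_density integral_ge0 ?andbT; last first.
  by move=> F _; rewrite lee_fin student_density_ge0.
apply/negP => /eqP C0.
have mp : measurable_fun setT (EFin \o @student_density K n lam).
  by apply/measurable_EFinP; exact: measurable_student_density.
have pos (F : 'M[R]_(K, n)) : (0 < student_density lam F)%R.
  by rewrite /student_density powR_gt0//; apply/spd_det_gt0/spd_scalar_gram; rewrite exprn_gt0.
have := integral_student_density; rewrite C0 => I0.
have h : {ae lebesgue_mx, forall F : 'M[R]_(K, n), setT F -> (EFin \o @student_density K n lam) F = cst 0 F}.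
  apply/ae_eq_integral_abs => //; rewrite -[RHS]I0; apply: eq_integral => F _ /=.
  by rewrite ger0_norm// student_density_ge0.
have Z : lebesgue_mx [set: 'M[R]_(K, n)] = 0.
  case: h => N [mN N0 sub]; apply/eqP; rewrite eq_le measure_ge0 andbT -N0.
  apply: le_measure; rewrite ?inE//; apply: subset_trans sub => F _ /= hF.
  have := hF I; rewrite /= => -[] /eqP; rewrite gt_eqF//; exact: pos.
have := @gauss_mass_gt0 R K n; rewrite -lte_fin -integral_gauss0.
rewrite (_ : \int[_]_(_ in _) _ = 0) ?ltxx//.
apply: null_set_integral => //; apply/measurable_funTS/measurable_EFinP.
apply: (measurableT_comp (@measurable_expR R)); apply: measurableT_comp => //.
by apply: measurable_funM => //; exact: measurable_dot.
Qed.

Lemma student_density_sqr :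
  \int[lebesgue_mx]_(F in [set: 'M[R]_(K, n)]) (dot F F * student_density lam F)%:E =
  ((n * K)%:R * lam ^+ 2 * student_total)%:E.
Proof.
under eq_integral => F _.
  rewrite dotE mulr_suml -sumEFin (eq_bigr (fun i => \sum_(j < n) ((F i j)%R ^+ 2 * student_density lam F)%:E)); last first.
    by move=> i _; rewrite mulr_suml -sumEFin; apply: eq_bigr => j _; rewrite expr2.
  over.
have mf a b : measurable_fun setT (fun F : 'M[R]_(K, n) => (F a b ^+ 2 * student_density lam F)%:E).
  apply/measurable_EFinP; apply: measurable_funM; last exact: measurable_student_density.
  by apply: measurable_funX; exact: measurable_entry.
have f0 a b (F : 'M[R]_(K, n)) : 0 <= (F a b ^+ 2 * student_density lam F)%:E.
  by rewrite lee_fin mulr_ge0 ?sqr_ge0 ?student_density_ge0.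
rewrite ge0_integral_sum//; last 2 first.
- by move=> i; apply: emeasurable_sum.
- by move=> i F _; apply: sume_ge0.
under eq_bigr => i _.
  rewrite ge0_integral_sum//; under eq_bigr do rewrite student_density_moment.
  rewrite sumEFin; over.
rewrite sumEFin; congr (_%:E).
by rewrite !sumr_const !card_ord -mulrnA -[LHS]mulr_natl mulrA.
Qed.

End student_density.

(** * Gaussian mixture representation *)

Lemma entry_sqr_le_dot (R : realType) K n (X : 'M[R]_(K, n)) j i : X j i ^+ 2 <= dot X X.
Proof.
rewrite dotE (bigD1 j)//= (bigD1 i)//= -expr2 -addrA lerDl addr_ge0//.
  by apply: sumr_ge0 => k _; rewrite -expr2 sqr_ge0.
apply: sumr_ge0 => k _; apply: sumr_ge0 => l _; by rewrite -expr2 sqr_ge0.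
Qed.

Section contraction.
Context {R : realType} {K : nat}.
Variable S : 'M[R]_K.
Hypotheses (ST : S^T = S) (S0 : psd S) (S1 : psd (1%:M - S)).

Lemma contraction_le n (X : 'M[R]_(K, n)) : dot X (S *m X) <= dot X X.
Proof. by have := S1 X; rewrite mulmxBl mul1mx dotBr subr_ge0. Qed.

(** The inequality [S^2 <= S] follows without a square root from [S - S^2 = S (1 - S) S + (1 - S) S
    (1 - S)]. *)
Lemma contraction_sqr_le n (X : 'M[R]_(K, n)) : dot (S *m X) (S *m X) <= dot X (S *m X).
Proof.
have h1 := S1 (S *m X); have h2 := S0 (X - S *m X).
rewrite mulmxBl mul1mx dotBr subr_ge0 in h1.
have e : dot X (S *m (S *m X)) = dot (S *m X) (S *m X) by rewrite [RHS]dotMl ST.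
have e' : dot (S *m X) (S *m (S *m X)) = dot (S *m (S *m X)) (S *m X) by rewrite dotC.
rewrite mulmxBr !dotE_lin e in h2; lra.
Qed.

Lemma contraction_entry n (X : 'M[R]_(K, n)) j i : ((S *m X) j i) ^+ 2 <= dot X X.
Proof.
apply: le_trans (entry_sqr_le_dot _ _ _) _.
exact: le_trans (contraction_sqr_le _) (contraction_le _).
Qed.

End contraction.

Section shrinkage.
Context {R : realType} {K N : nat}.
Variable T : R.
Hypothesis T0 : 0 < T.
Implicit Type G : 'M[R]_(K, N).

Definition precision G : 'M[R]_K := (T^-1)%:M + G *m G^T.
Definition shrink G : 'M[R]_K := T^-1 *: invmx (precision G).

Lemma spd_precision G : spd (precision G).
Proof. by apply: spd_scalar_gram; rewrite invr_gt0. Qed.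

Lemma shrink_sym G : (shrink G)^T = shrink G.
Proof. by rewrite /shrink linearZ/= trmx_inv; case: (spd_precision G) => ->. Qed.

Lemma psd_shrink G : psd (shrink G).
Proof.
apply: psdZ; first by rewrite invr_ge0 ltW.
move=> n X; case: (spd_inv (spd_precision G)) => _ h.
by have [->|X0] := eqVneq X 0; [rewrite dot0l|exact/ltW/h].
Qed.

Lemma shrink_precision G : shrink G *m precision G = (T^-1)%:M.
Proof.
by rewrite /shrink -scalemxAl mulVmx ?scalemx1// spd_unit//; exact: spd_precision.
Qed.

Lemma psd_1Bshrink G : psd (1%:M - shrink G).
Proof.
move=> n X; have uP := spd_unit (spd_precision G).
pose Z := shrink G *m X.
have XE : X = Z + T *: (G *m (G^T *m Z)).
  have -> : X = T *: (precision G *m Z).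
    rewrite /Z /shrink -scalemxAl -scalemxAr scalerA divff ?gt_eqF// scale1r.
    by rewrite mulKVmx.
  rewrite {1}/precision mulmxDl scalerDr mul_scalar_mx scalerA divff ?gt_eqF// scale1r.
  by rewrite mulmxA.
rewrite mulmxBl mul1mx -/Z; have -> : X - Z = T *: (G *m (G^T *m Z)).
  by rewrite {1}XE addrAC subrr add0r.
rewrite {1}XE dotZr dotDl dotZl mulr_ge0 ?(ltW T0)// addr_ge0//.
  by have := psd_gram G Z; rewrite mulmxA.
by rewrite mulr_ge0 ?dot_ge0// ltW.
Qed.

Lemma measurable_precision : measurable_fun setT precision.
Proof.
by apply: measurable_addmx => //; apply: measurable_mulmx => //; exact: measurable_trmx.
Qed.

Lemma measurable_shrink : measurable_fun setT shrink.
Proof.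
apply: measurable_scalemx => //; apply: measurable_invmx; last exact: measurable_precision.
by move=> G; exact/spd_unit/spd_precision.
Qed.

End shrinkage.

(* The scale mixture [det (lam^2 + F F^T)^(- N/2) = c \int exp (- lam^2 |G|^2 / 2 - |G^T F|^2 / 2) dG]
   makes the posterior of [F] given [G] Gaussian with mean [shrink G *m y]. *)
Section latent.
Context {R : realType} {K n : nat}.
Variables (lam T : R).
Hypotheses (hK : (0 < K)%N) (hn : (0 < n)%N) (l0 : 0 < lam) (T0 : 0 < T).
Let N := (n + K + 2)%N.
Local Notation matF := 'M[R]_(K, n).
Local Notation matG := 'M[R]_(K, N).
Implicit Types (y F : matF) (G : matG).
Local Notation leb := lebesgue_mx.

Definition likelihood y F : R := expR (- (dot (F - y) (F - y) / (2 * T))).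

Let obs y F : R := student_density lam F * likelihood y F.

Definition tilt y G : R := expR (dot y (shrink T G *m y) / (2 * T)).

(** Up to constants, the density of [G] at data 0: the Gaussian factor of [G] times the mass of the
    Gaussian of [F] given [G]. The data enter through the factor [tilt] alone. *)
Definition latent_density G : R :=
  \det (precision T G) `^ (- (n%:R / 2)) * expR (- (lam ^+ 2 * dot G G / 2)).

Let joint y (p : matF * matG) : R :=
  expR (- (dot p.2 (((lam ^+ 2)%:M + p.1 *m p.1^T) *m p.2) / 2)) * likelihood y p.1.

Lemma measurable_likelihood y : measurable_fun setT (likelihood y).
Proof.
apply: (measurableT_comp (@measurable_expR R)); apply: measurableT_comp => //.
by apply: measurable_funM => //; apply: measurable_dot; exact: measurable_submx.
Qed.

Lemma likelihood_le1 y F : likelihood y F <= 1.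
Proof.
by rewrite -expR0 ler_expR oppr_le0 divr_ge0 ?dot_ge0// mulr_ge0// ltW.
Qed.

Lemma measurable_tilt y : measurable_fun setT (tilt y).
Proof.
apply: (measurableT_comp (@measurable_expR R)); apply: measurable_funM => //.
apply: measurable_dot => //; apply: measurable_mulmx => //; exact: measurable_shrink.
Qed.

Lemma measurable_latent_density : measurable_fun setT latent_density.
Proof.
apply: measurable_funM.
  by apply: measurable_powR_comp; apply: measurable_det; exact: measurable_precision.
apply: (measurableT_comp (@measurable_expR R)); apply: measurableT_comp => //.
by apply: measurable_funM => //; apply: measurable_funM => //; exact: measurable_dot.
Qed.

Let mjoint y : measurable_fun setT (joint y).
Proof.
apply: measurable_funM; last exact: (measurableT_comp (measurable_likelihood y) measurable_fst).
apply: (measurableT_comp (@measurable_expR R)); apply: measurableT_comp => //.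
apply: measurable_funM => //; apply: measurable_dot; first exact: measurable_snd.
apply: measurable_mulmx; last exact: measurable_snd.
apply: measurable_addmx => //; apply: measurable_mulmx; first exact: measurable_fst.
by apply: measurable_trmx; exact: measurable_fst.
Qed.

Let jointF y F G : joint y (F, G) = likelihood y F * gauss_weight ((lam ^+ 2)%:M + F *m F^T) 0 G.
Proof. by rewrite /joint /gauss_weight/= dot0r sub0r mulrC. Qed.

Let jointG y F G : joint y (F, G) =
  expR (- (lam ^+ 2 * dot G G / 2)) * expR (- (dot y y / (2 * T))) *
  gauss_weight (precision T G) (T^-1 *: y) F.
Proof.
rewrite /joint /likelihood /gauss_weight/= -!expRD; congr expR.
have h : dot G (F *m F^T *m G) = dot F (G *m G^T *m F).
  by rewrite /dot !mulmxA -(mulmxA _ F^T) mxtrace_mulC !mulmxA.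
rewrite /precision !mulmxDl !mul_scalar_mx !dotDr !dotZr h !dotE_lin [dot y F]dotC.
by field; rewrite gt_eqF.
Qed.

Let jointF_integral y F :
  (\int[leb]_G (joint y (F, G))%:E = (gauss_mass K N * obs y F)%:E :> \bar R)%E.
Proof.
under eq_integral do rewrite jointF.
rewrite ge0_integralZl_real ?expR_ge0//; last 2 first.
- exact: measurable_gauss_weight.
- by move=> G; exact: expR_ge0.
rewrite integral_gauss_weight; last by apply: spd_scalar_gram; rewrite exprn_gt0.
rewrite dot0l mul0r expR0 mulr1 -EFinM; congr (_%:E).
by rewrite /obs /student_density /N mulrC -mulrA.
Qed.

Let obs_ge0 y F : 0 <= obs y F.
Proof. by rewrite mulr_ge0 ?student_density_ge0 ?expR_ge0. Qed.

Let mobs y : measurable_fun setT (obs y).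
Proof. by apply: measurable_funM; [exact: measurable_student_density|exact: measurable_likelihood]. Qed.

Let tiltE y G : expR (- (lam ^+ 2 * dot G G / 2)) * expR (- (dot y y / (2 * T))) *
  (gauss_mass K n * \det (precision T G) `^ (- (n%:R / 2)) *
   expR (dot (T^-1 *: y) (invmx (precision T G) *m (T^-1 *: y)) / 2)) =
  gauss_mass K n * expR (- (dot y y / (2 * T))) * (latent_density G * tilt y G).
Proof.
rewrite /latent_density /tilt.
have -> : dot (T^-1 *: y) (invmx (precision T G) *m (T^-1 *: y)) / 2 =
   dot y (shrink T G *m y) / (2 * T).
  by rewrite /shrink -scalemxAl -scalemxAr !dotE_lin; field; rewrite gt_eqF.
ring.
Qed.

Local Open Scope ereal_scope.

(** The two orders of integration of [joint]. Here [phi] will be 1 or an entry of [F], and [m] its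
    conditional mean given [G]. Integrability is checked in the order where [G] is integrated first
    and the Student density reappears. *)
Let latent_fubini y (phi : matF -> R) (m : matG -> R) : measurable_fun setT phi ->
  leb.-integrable setT (fun F => (phi F * obs y F)%:E) ->
  (forall G, leb.-integrable setT (fun F => (phi F * gauss_weight (precision T G) (T^-1 *: y) F)%:E)) ->
  (forall G, \int[leb]_F (phi F * gauss_weight (precision T G) (T^-1 *: y) F)%:E =
     (m G)%:E * \int[leb]_F (gauss_weight (precision T G) (T^-1 *: y) F)%:E) ->
  (gauss_mass K N)%:E * \int[leb]_F (phi F * obs y F)%:E =
  \int[leb]_G (gauss_mass K n * expR (- (dot y y / (2 * T))) *
     (m G * (latent_density G * tilt y G)))%:E.
Proof.
move=> mphi iphi ig hm.
have c0 : (0 < gauss_mass K N :> R)%R by exact: gauss_mass_gt0.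
have mf : measurable_fun setT (fun p : matF * matG => (phi p.1 * joint y p)%:E).
  apply/measurable_EFinP; apply: measurable_funM => //.
  exact: (measurableT_comp mphi measurable_fst).
have inner F : \int[leb]_G (phi F * joint y (F, G))%:E = (gauss_mass K N * (phi F * obs y F))%:E.
  under eq_integral do rewrite EFinM.
  rewrite integralZl//.
    by rewrite jointF_integral -EFinM mulrCA.
  have := @integrable_gauss_weight R K N ((lam ^+ 2)%:M + F *m F^T) 0 (spd_scalar_gram _ (exprn_gt0 2 l0)).
  move=> /(integrableZl measurableT (likelihood y F)); apply: eq_integrable => // G _ /=.
  by rewrite jointF EFinM.
have intf : (leb \x leb).-integrable setT (fun p : matF * matG => (phi p.1 * joint y p)%:E).
  apply/integrable12ltyP => //=.
  under eq_integral => F _.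
    rewrite (eq_integral (fun G => (`|phi F| * joint y (F, G))%:E)); last first.
      by move=> G _; rewrite normrM [X in (_ * X)%R]ger0_norm// mulr_ge0 ?expR_ge0.
    rewrite ge0_integralZl_real//; last 2 first.
    - exact: (measurableT_comp (mjoint y) (pair1_measurable F)).
    - by move=> G; rewrite mulr_ge0 ?expR_ge0.
    rewrite jointF_integral -EFinM mulrCA -(ger0_norm (obs_ge0 y F)) -normrM.
    over.
  rewrite ge0_integralZl_real ?(ltW c0)//; last first.
    by apply: measurableT_comp => //; exact: measurable_funM.
  rewrite lte_mul_pinfty ?lee_fin ?(ltW c0)//.
  by case/integrableP: iphi.
transitivity (\int[leb]_F \int[leb]_G (phi F * joint y (F, G))%:E).
  rewrite -integralZl//; apply: eq_integral => F _; rewrite inner -EFinM//.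
transitivity (\int[leb]_G \int[leb]_F (phi F * joint y (F, G))%:E).
  exact: (Fubini intf).
apply: eq_integral => G _.
pose k := (expR (- (lam ^+ 2 * dot G G / 2)) * expR (- (dot y y / (2 * T))))%R.
have k0 : (0 < k)%R by rewrite mulr_gt0 ?expR_gt0.
transitivity (k%:E * \int[leb]_F (phi F * gauss_weight (precision T G) (T^-1 *: y) F)%:E).
  transitivity (\int[leb]_F (k%:E * (phi F * gauss_weight (precision T G) (T^-1 *: y) F)%:E)).
    by apply: eq_integral => F _; rewrite jointG -/k -EFinM mulrCA.
  by rewrite integralZl.
rewrite hm integral_gauss_weight; last exact: spd_precision.
rewrite -!EFinM; congr (_%:E); rewrite mulrCA tiltE; ring.
Qed.

Let integrable_student : leb.-integrable setT (EFin \o @student_density R K n lam).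
Proof.
apply/integrableP; split; first by apply/measurable_EFinP; exact: measurable_student_density.
under eq_integral => F _ do rewrite /= ger0_norm ?student_density_ge0//.
by rewrite integral_student_density// ltry.
Qed.

Let integrable_obs y : leb.-integrable setT (fun F => (obs y F)%:E).
Proof.
apply: (le_integrable _ _ _ integrable_student) => //.
  by apply/measurable_EFinP; exact: mobs.
move=> F _; rewrite lee_fin !ger0_norm ?student_density_ge0 ?obs_ge0//.
by rewrite ler_piMr ?student_density_ge0 ?likelihood_le1.
Qed.

(** The Gaussian factor bounds [|F j i - y j i|] times the likelihood by [T + 1], through
    [expR u >= 1 + u]; a multiple of the prior density then dominates. *)
Let integrable_entry_obs y j i : leb.-integrable setT (fun F => (F j i * obs y F)%:E).
Proof.
apply: (le_integrable _ _ _ (integrableZl measurableT (`|y j i| + (T + 1)) integrable_student)) => //.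
  by apply/measurable_EFinP; apply: measurable_funM; [exact: measurable_entry|exact: mobs].
move=> F _; rewrite /= lee_fin normrM (ger0_norm (obs_ge0 y F)).
have s0 := student_density_ge0 lam F.
rewrite [leRHS]ger0_norm; last by rewrite mulr_ge0// !addr_ge0// ltW.
rewrite mulrC /obs -mulrA [leRHS]mulrC ler_wpM2l//.
pose x := (F j i - y j i)%R.
have h1 : (`|F j i| <= `|y j i| + `|x|)%R.
  by rewrite -{1}(subrK (y j i) (F j i)) -/x addrC ler_normD.
have h2 : (likelihood y F * `|x| <= T + 1)%R.
  have h3 : (likelihood y F <= expR (- (x ^+ 2 / (2 * T))))%R.
    rewrite ler_expR lerN2 ler_pM2r ?invr_gt0 ?mulr_gt0//.
    by have := entry_sqr_le_dot (F - y) j i; rewrite !mxE.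
  apply: (le_trans (ler_wpM2r (normr_ge0 _) h3)).
  rewrite expRN mulrC ler_pdivrMr ?expR_gt0//.
  have h4 := expR_ge1Dx (x ^+ 2 / (2 * T)).
  apply: (@le_trans _ _ ((T + 1) * (1 + x ^+ 2 / (2 * T)))%R); last first.
    by rewrite ler_wpM2l// addr_ge0// ltW.
  have -> : ((T + 1) * (1 + x ^+ 2 / (2 * T)) = T + 1 + x ^+ 2 / 2 + x ^+ 2 / (2 * T))%R.
    by field; rewrite gt_eqF.
  have h5 : (0 <= x ^+ 2 / (2 * T))%R by rewrite divr_ge0 ?sqr_ge0// mulr_ge0// ltW.
  have h6 : (`|x| <= 1 / 2 + x ^+ 2 / 2)%R.
    by have := sqr_ge0 (`|x| - 1)%R; rewrite sqrrB1 -normrX ger0_norm ?sqr_ge0//; lra.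
  by have := T0; lra.
have h7 := likelihood_le1 y F; have h8 : (0 <= likelihood y F)%R by exact: expR_ge0.
have h9 : (likelihood y F * `|y j i| <= `|y j i|)%R by rewrite ler_piMl.
have := ler_wpM2l h8 h1; rewrite mulrDr; lra.
Qed.

Definition evidence y : R := fine (\int[leb]_F (student_density lam F * likelihood y F)%:E).

Lemma integral_evidence y : \int[leb]_F (student_density lam F * likelihood y F)%:E = (evidence y)%:E.
Proof. by rewrite /evidence fineK//; apply: integrable_fin_num => //; exact: integrable_obs. Qed.

(** The origin of the remainder [K * lambda ^+ 2]: the prior mean of [|F|^2] is [n K lam^2], and the
    proof integrates the tangent line of the exponential at the prior mean of the exponent. *)
Lemma evidence_jensen :
  (@student_total R K n lam * expR (- ((n * K)%:R * lam ^+ 2 / (2 * T))) <= evidence 0)%R.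
Proof.
set m := ((n * K)%:R * lam ^+ 2 / (2 * T))%R.
pose C := @student_total R K n lam; have C0 : (0 < C)%R by exact: student_total_gt0.
have T2 : (0 < 2 * T)%R by rewrite mulr_gt0.
have e0 : (0 <= expR (- m) :> R)%R := expR_ge0 _.
have h : ((1 + m) * expR (- m) * C <= evidence 0 + expR (- m) / (2 * T) * ((n * K)%:R * lam ^+ 2 * C))%R.
  rewrite -lee_fin EFinM -(integral_student_density hK hn l0) EFinD -integral_evidence.
  rewrite (EFinM (expR _ / _)) -(student_density_sqr hK hn l0).
  have m0 : (0 <= m)%R by rewrite divr_ge0 ?mulr_ge0 ?sqr_ge0// ltW.
  have md : measurable_fun setT (fun F : matF => dot F F * student_density lam F)%R.
    by apply: measurable_funM; [exact: measurable_dot|exact: measurable_student_density].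
  have d0 (F : matF) : (0 <= dot F F * student_density lam F)%R.
    by rewrite mulr_ge0 ?dot_ge0 ?student_density_ge0.
  rewrite -(ge0_integralZl_real _ _ (@measurable_student_density R K n lam) (student_density_ge0 lam)); last first.
    by rewrite mulr_ge0// addr_ge0.
  rewrite -(ge0_integralZl_real _ _ md d0); last by rewrite divr_ge0// ltW.
  have p0 : (0 <= expR (- m) / (2 * T))%R by rewrite divr_ge0// ltW.
  rewrite -ge0_integralD//; last first.
  - by apply/measurable_EFinP; apply: measurable_funM.
  - by move=> F _; rewrite lee_fin mulr_ge0.
  - by apply/measurable_EFinP; exact: mobs.
  - by move=> F _; rewrite lee_fin obs_ge0.
  apply: ge0_le_integral => //.
  - by move=> F _; rewrite lee_fin !mulr_ge0 ?student_density_ge0// addr_ge0.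
  - by apply/measurable_EFinP; apply: measurable_funM => //; exact: measurable_student_density.
  - apply: emeasurable_funD; first by apply/measurable_EFinP; exact: mobs.
    by apply/measurable_EFinP; apply: measurable_funM.
  move=> F _; rewrite -EFinD lee_fin /likelihood subr0.
  set x := dot F F; set s := student_density lam F.
  have s0 : (0 <= s)%R by exact: student_density_ge0.
  have -> : (s * expR (- (x / (2 * T))) + expR (- m) / (2 * T) * (x * s) =
     (expR (- (x / (2 * T))) + expR (- m) * (x / (2 * T))) * s)%R by ring.
  rewrite ler_wpM2r//.
  have := expR_ge1Dx (m - x / (2 * T))%R; rewrite expRD => h.
  have := ler_wpM2l e0 h; rewrite [X in (_ <= X)%R -> _]mulrA -expRD addNr expR0 mul1r; lra.
have E : (expR (- m) / (2 * T) * ((n * K)%:R * lam ^+ 2 * C) = expR (- m) * m * C)%R by rewrite /m; ring.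
by rewrite E in h; rewrite -/C; lra.
Qed.

Lemma evidence0_gt0 : (0 < evidence 0)%R.
Proof. by apply: lt_le_trans evidence_jensen; rewrite mulr_gt0 ?expR_gt0 ?student_total_gt0. Qed.

(** The value forced by exchanging the integrals at data 0, where [tilt] is 1. *)
Definition latent_total : R := (gauss_mass K N * evidence 0 / gauss_mass K n)%R.

Lemma latent_total_gt0 : (0 < latent_total)%R.
Proof. by rewrite divr_gt0 ?mulr_gt0 ?gauss_mass_gt0 ?evidence0_gt0. Qed.

Lemma latent_density_ge0 G : (0 <= latent_density G)%R.
Proof. by rewrite mulr_ge0 ?powR_ge0 ?expR_ge0. Qed.

Lemma integral_latent : \int[leb]_G (latent_density G)%:E = latent_total%:E.
Proof.
have c0 : (0 < gauss_mass K n :> R)%R by exact: gauss_mass_gt0.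
have h : (gauss_mass K N)%:E * (evidence 0)%:E = (gauss_mass K n)%:E * \int[leb]_G (latent_density G)%:E.
  rewrite -(ge0_integralZl_real _ (ltW c0) measurable_latent_density latent_density_ge0).
  transitivity ((gauss_mass K N)%:E * \int[leb]_F (1 * obs 0 F)%:E).
    by rewrite -integral_evidence; congr (_ * _); apply: eq_integral => F _; rewrite mul1r.
  rewrite (@latent_fubini 0 (fun=> 1%R) (fun=> 1%R))//.
  - by apply: eq_integral => G _; rewrite /tilt !dot0l mul0r oppr0 expR0 mul1r !mulr1.
  - by under eq_fun do rewrite mul1r; exact: integrable_obs.
  - by move=> G; under eq_fun do rewrite mul1r; apply: integrable_gauss_weight; exact: spd_precision.
  - by move=> G; rewrite mul1e; apply: eq_integral => F _; rewrite mul1r.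
rewrite /latent_total EFinM -EFinM (EFinM (gauss_mass K N * _)%R) EFinM h muleAC -EFinM.
by rewrite divff ?gt_eqF// mul1e.
Qed.

Definition latent_prior : probability matG R :=
  nd_probability measurable_latent_density latent_density_ge0 latent_total_gt0 integral_latent.

Lemma bm_tilt y : bm (tilt y).
Proof.
split; first exact: measurable_tilt.
exists (expR (dot y y / (2 * T))) => G; rewrite ger0_norm ?expR_ge0// ler_expR.
rewrite ler_pM2r ?invr_gt0 ?mulr_gt0//; apply: contraction_le; exact: psd_1Bshrink.
Qed.

Lemma bm_shrink_entry n' (y : 'M[R]_(K, n')) j i : bm (fun G => (shrink T G *m y) j i).
Proof.
split.
  by apply: measurable_mxE; apply: measurable_mulmx => //; exact: measurable_shrink.
exists (Num.sqrt (dot y y)) => G; rewrite -sqrtr_sqr ler_wsqrtr//; apply: contraction_entry.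
- exact: shrink_sym.
- exact: psd_shrink.
- exact: psd_1Bshrink.
Qed.

Lemma latent_integral (phi : matF -> R) (m : matG -> R) y : measurable_fun setT phi -> bm m ->
  leb.-integrable setT (fun F => (phi F * (student_density lam F * likelihood y F))%:E) ->
  (forall G, leb.-integrable setT (fun F => (phi F * gauss_weight (precision T G) (T^-1 *: y) F)%:E)) ->
  (forall G, \int[leb]_F (phi F * gauss_weight (precision T G) (T^-1 *: y) F)%:E =
     (m G)%:E * \int[leb]_F (gauss_weight (precision T G) (T^-1 *: y) F)%:E) ->
  \int[leb]_F (phi F * (student_density lam F * likelihood y F))%:E =
  (evidence 0 * expR (- (dot y y / (2 * T))) * \int[latent_prior]_G (m G * tilt y G))%:E.
Proof.
move=> mphi bmm i1 i2 hm; have h := latent_fubini mphi i1 i2 hm.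
have c1 : (gauss_mass K n != 0 :> R)%R by rewrite gt_eqF// gauss_mass_gt0.
have c2 : (gauss_mass K N != 0 :> R)%R by rewrite gt_eqF// gauss_mass_gt0.
have bg : bm (fun G => m G * tilt y G)%R by apply: bmM => //; exact: bm_tilt.
have ig : leb.-integrable setT (EFin \o (fun G => m G * tilt y G * latent_density G)%R).
  have [mg [M gM]] := bg.
  have il : leb.-integrable setT (EFin \o latent_density).
    apply/integrableP; split; first by apply/measurable_EFinP; exact: measurable_latent_density.
    under eq_integral => G _ do rewrite /= ger0_norm ?latent_density_ge0//.
    by rewrite integral_latent ltry.
  apply: (le_integrable _ _ _ (integrableZl measurableT M il)) => //.
    by apply/measurable_EFinP; apply: measurable_funM => //; exact: measurable_latent_density.
  move=> G _; rewrite /= lee_fin normrM [X in (_ <= X)%R]normrM ler_wpM2r//.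
  exact: le_trans (gM G) (ler_norm _).
have R1 := integral_nd measurable_latent_density latent_density_ge0 latent_total_gt0 integral_latent (proj1 bg) ig.
rewrite bm_integralE// in R1.
have {}R1 : \int[leb]_G (m G * tilt y G * latent_density G)%:E =
   (latent_total * \int[latent_prior]_G (m G * tilt y G))%:E.
  by rewrite EFinM R1 muleA -EFinM divff ?mul1e// gt_eqF// latent_total_gt0.
have E : \int[leb]_G (gauss_mass K n * expR (- (dot y y / (2 * T))) *
     (m G * (latent_density G * tilt y G)))%:E =
  (gauss_mass K n * expR (- (dot y y / (2 * T))))%:E * \int[leb]_G (m G * tilt y G * latent_density G)%:E.
  rewrite -integralZl//; apply: eq_integral => G _; rewrite -EFinM; congr (_%:E); ring.
rewrite E R1 -EFinM in h.
have k : forall x : \bar R, x = (gauss_mass K N)^-1%:E * ((gauss_mass K N)%:E * x).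
  by move=> x; rewrite muleA -EFinM mulVf// mul1e.
rewrite [LHS]k h -EFinM; congr (_%:E).
have -> : (latent_total = gauss_mass K N * evidence 0 / gauss_mass K n)%R by [].
move: (Rintegral _ _ _) c1 c2 => J; move: (gauss_mass K n) (gauss_mass K N) (expR _) (evidence 0).
by move=> a b e v a0 b0; field; rewrite a0 b0.
Qed.

Lemma evidence_latent y :
  evidence y = (evidence 0 * expR (- (dot y y / (2 * T))) * \int[latent_prior]_G tilt y G)%R.
Proof.
have := @latent_integral (fun=> 1%R) (fun=> 1%R) y (measurable_cst _) (bm_cst _ _).
under eq_integral do rewrite mul1r.
rewrite integral_evidence => h; apply: EFin_inj; rewrite h.
- by congr (_ * _)%:E; apply: eq_Rintegral => G _; rewrite mul1r.
- by under eq_fun do rewrite mul1r; exact: integrable_obs.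
- by move=> G; under eq_fun do rewrite mul1r; apply: integrable_gauss_weight; exact: spd_precision.
- by move=> G; rewrite mul1e; apply: eq_integral => F _; rewrite mul1r.
Qed.

Lemma integrable_entry_posterior y j i :
  leb.-integrable setT (fun F => (F j i * (student_density lam F * likelihood y F))%:E).
Proof. exact: integrable_entry_obs. Qed.

Lemma posterior_entry_latent y j i :
  \int[leb]_F (F j i * (student_density lam F * likelihood y F))%:E =
  (evidence 0 * expR (- (dot y y / (2 * T))) *
    \int[latent_prior]_G ((shrink T G *m y) j i * tilt y G))%:E.
Proof.
apply: (@latent_integral (fun F => F j i) (fun G => (shrink T G *m y) j i)).
- exact: measurable_entry.
- exact: bm_shrink_entry.
- exact: integrable_entry_obs.
- by move=> G; apply: integrable_gauss_weight_entry; exact: spd_precision.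
- move=> G; rewrite integral_gauss_weight_entry; last exact: spd_precision.
  by rewrite /shrink -scalemxAl -scalemxAr.
Qed.

End latent.

(** * Cost of a low-rank shift *)

Lemma dot_sqr_le (R : realType) K n (a b : 'M[R]_(K, n)) : dot a b ^+ 2 <= dot a a * dot b b.
Proof.
have [b0|b0] := eqVneq (dot b b) 0; first by rewrite (dot_eq0 b0) !dot0r expr0n mulr0.
have bb : 0 < dot b b by rewrite lt0r b0 dot_ge0.
have := dot_ge0 (dot b b *: a - dot a b *: b); rewrite !dotE_lin [dot b a]dotC => h.
rewrite -subr_ge0 -(pmulr_rge0 _ bb); apply: le_trans h _.
by rewrite le_eqVlt; apply/orP; left; apply/eqP; ring.
Qed.

Section shift_scalar.
Context {R : realType}.

(** The right-hand side is [(1 + q)^(9/4)]; taking fourth powers makes the comparison polynomial. *)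
Lemma ler_expR_root (x q : R) : 0 <= q -> 0 <= x -> x ^+ 4 <= (1 + q) ^+ 9 ->
  x <= expR (9 / 4 * ln (1 + q)).
Proof.
move=> q0; rewrite le_eqVlt => /predU1P[<- _|x0 h]; first exact: expR_ge0.
have q1 : 0 < 1 + q by rewrite ltr_wpDr.
have := h; rewrite -ler_ln ?posrE ?exprn_gt0// !lnXn// -[ln x *+ 4]mulr_natl -[ln _ *+ 9]mulr_natl => h'.
rewrite -[leLHS]lnK ?posrE// ler_expR; lra.
Qed.

(** Here [v] and [b] stand for the lengths of an old and an added vector. For [q > 1] the quotient
    is at most [2 + b^2 <= 2 (1 + q^2)], and [ln (2 + 2 q^2) / ln (1 + q)] peaks near [q = 8] at
    about 2.215, just below [9/4]; for [q <= 1] the sharper factor [1 + b + b^2] is needed. *)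
Lemma rank_one_ratio (v b q : R) : 0 <= v -> 0 <= b -> 0 <= q -> b ^+ 2 <= 2 * q ^+ 2 ->
  1 + (v + b) ^+ 2 <= expR (9 / 4 * ln (1 + q)) * (1 + v ^+ 2).
Proof.
move=> v0 b0 q0 bq; have v1 : 0 <= 1 + v ^+ 2 by rewrite addr_ge0// sqr_ge0.
have [q1|q1] := leP q 1.
  (* [283/200] is a rational just above [sqrt 2]. *)
  have b1 : b <= 283/200 * q.
    have bb : 0 <= 283/200 * q by lra.
    rewrite -ler_sqr ?nnegrE// exprMn.
    by have := sqr_ge0 q; lra.
  apply: (@le_trans _ _ ((1 + b + b ^+ 2) * (1 + v ^+ 2))).
    have h1 := mulr_ge0 b0 (sqr_ge0 (1 - v)).
    have h2 := mulr_ge0 (sqr_ge0 b) (sqr_ge0 v).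
    rewrite -subr_ge0 (_ : _ - _ = b * (1 - v) ^+ 2 + b ^+ 2 * v ^+ 2); last by ring.
    lra.
  rewrite ler_wpM2r//; apply: ler_expR_root => //; first by rewrite !addr_ge0// sqr_ge0.
  have c1 : 1 + b + b ^+ 2 <= (1 + q) ^+ 2 * (1 + 3/16 * q).
    rewrite -subr_ge0.
    have h3 : 0 <= q ^+ 3 by rewrite exprn_ge0.
    have h4 : q ^+ 2 <= q by rewrite expr2 ler_piMl.
    rewrite (_ : (1 + q) ^+ 2 * (1 + 3/16 * q) =
      1 + 35/16 * q + 11/8 * q ^+ 2 + 3/16 * q ^+ 3); last by field.
    by lra.
  have s0 : 0 <= 1 + b + b ^+ 2 by rewrite !addr_ge0// sqr_ge0.
  have q1' : 0 <= 1 + q by rewrite addr_ge0.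
  apply: (le_trans (lerXn2r 4 _ _ c1)); rewrite ?nnegrE//.
    by rewrite mulr_ge0 ?exprn_ge0// addr_ge0// mulr_ge0.
  rewrite exprMn -exprM (exprSr _ 8) ler_wpM2l ?exprn_ge0//.
  have h2 : q ^+ 2 <= q by rewrite expr2 ler_piMl.
  have h3 : q ^+ 3 <= q by rewrite exprS ler_piMr// exprn_ile1.
  have h4 : q ^+ 4 <= q by rewrite exprS ler_piMr// exprn_ile1.
  rewrite (_ : (1 + 3/16 * q) ^+ 4 = 1 + 3/4 * q + 27/128 * q ^+ 2 +
    27/(32*32) * q ^+ 3 + 81/(256*256) * q ^+ 4); last by field.
  lra.
apply: (@le_trans _ _ ((2 + b ^+ 2) * (1 + v ^+ 2))).
  have h1 := sqr_ge0 (1 - v * b); have h2 := sqr_ge0 v.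
  rewrite -subr_ge0 (_ : _ - _ = (1 - v * b) ^+ 2 + v ^+ 2); last by ring.
  lra.
rewrite ler_wpM2r//.
apply: (@le_trans _ _ (2 * (1 + q ^+ 2))); first by lra.
apply: ler_expR_root; [exact: q0|by rewrite mulr_ge0// addr_ge0// sqr_ge0|].
(* The difference [(1 + q)^9 - (2 (1 + q^2))^4], regrouped into terms that are nonnegative for
   [q >= 1]. *)
rewrite -subr_ge0 (_ : _ - _ = q ^+ 7 * ((q - 7/2) ^+ 2 + 95/4) + 20 * q ^+ 6 +
  (111 * q ^+ 5 + 15 * (q ^+ 5 - 1)) + 30 * q ^+ 4 + (56 * q ^+ 3 + 28 * q ^+ 2 * (q - 1)) + 9 * q); last by field.
have q0' : 0 <= q - 1 by lra.
have q5 : 0 <= q ^+ 5 - 1 by rewrite subr_ge0 exprn_ege1// ltW.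
have p k : 0 <= q ^+ k by exact: exprn_ge0.
have m2 := mulr_ge0 (p 2) q0'.
have m1 : 0 <= q ^+ 7 * ((q - 7/2) ^+ 2 + 95/4).
  by apply: mulr_ge0 => //; have := sqr_ge0 (q - 7/2); lra.
move: (p 3) (p 4) (p 5) (p 6); move: m1 m2 q5.
move: (q ^+ 7 * _) (q ^+ 6) (q ^+ 5) (q ^+ 4) (q ^+ 3) => *; lra.
Qed.

(** The tangent to the logarithm at the root mean square [m] lies above it, and the deviations
    [q i - m] have a nonpositive sum because the mean is at most the root mean square. *)
Lemma sum_ln1D_le r (q : 'I_r -> R) : (0 < r)%N -> (forall i, 0 <= q i) ->
  \sum_i ln (1 + q i) <= r%:R * ln (1 + Num.sqrt ((\sum_i q i ^+ 2) / r%:R)).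
Proof.
move=> r0 q0; have rR : 0 < (r%:R : R) by rewrite ltr0n.
set m := Num.sqrt _; have m0 : 0 <= m by exact: sqrtr_ge0.
have mE : r%:R * m ^+ 2 = \sum_i q i ^+ 2.
  rewrite sqr_sqrtr ?divr_ge0 ?ler0n ?sumr_ge0//; last by move=> *; exact: sqr_ge0.
  by rewrite mulrC divfK// gt_eqF.
have m1 : 0 < 1 + m by rewrite ltr_wpDr.
have h : \sum_i (q i - m) <= 0.
  move: m0; rewrite le_eqVlt => /predU1P[m0|m0].
    move: mE; rewrite -m0 expr0n/= mulr0 => /esym/eqP.
    rewrite psumr_eq0; last by move=> *; exact: sqr_ge0.
    move=> /allP h; rewrite big1// => i _; have := h i (mem_index_enum _).
    by rewrite /= sqrf_eq0 => /eqP ->; rewrite subrr.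
  have : \sum_i (2 * m * q i) <= \sum_i (q i ^+ 2 + m ^+ 2).
    by apply: ler_sum => i _; have := sqr_ge0 (q i - m); rewrite sqrrB; lra.
  rewrite -mulr_sumr big_split/= -mE sumr_const card_ord -mulr_natl => h.
  rewrite sumrB sumr_const card_ord -[m *+ r]mulr_natl.
  have : m * (\sum_i q i - r%:R * m) <= 0 by rewrite mulrBr; nra.
  by rewrite pmulr_rle0.
apply: (@le_trans _ _ (\sum_i (ln (1 + m) + (q i - m) / (1 + m)))).
  apply: ler_sum => i _; rewrite -lerBlDl -ln_div ?posrE//; last by rewrite ltr_wpDr.
  have qi : 0 < (1 + q i) / (1 + m) by rewrite divr_gt0// ltr_wpDr.
  have := expR_ge1Dx (ln ((1 + q i) / (1 + m))); rewrite lnK ?posrE// => h1.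
  rewrite (_ : (q i - m) / (1 + m) = (1 + q i) / (1 + m) - 1); first lra.
  by field; rewrite gt_eqF.
rewrite big_split/= sumr_const card_ord -mulr_suml -[ln _ *+ r]mulr_natl gerDl.
by rewrite pmulr_lle0 ?invr_gt0.
Qed.

End shift_scalar.

Section shift_matrix.
Context {R : realType} {K n : nat}.
Variable lam : R.
Hypothesis l0 : 0 < lam.
Let D (F : 'M[R]_(K, n)) := \det ((lam ^+ 2)%:M + F *m F^T).
Let ll : 0 < lam ^+ 2. Proof. by rewrite exprn_gt0. Qed.

Let D_gt0 F : 0 < D F. Proof. exact/spd_det_gt0/spd_scalar_gram. Qed.

Lemma dot_invmx_scalar_gram m (F : 'M[R]_(K, m)) (h : 'cV[R]_K) :
  dot h (invmx ((lam ^+ 2)%:M + F *m F^T) *m h) <= dot h h / lam ^+ 2.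
Proof.
set C := _ + _; have hC : spd C by exact: spd_scalar_gram.
pose z := invmx C *m h; have zE : h = C *m z by rewrite mulKVmx// spd_unit.
rewrite -/z ler_pdivlMr//; have {zE} : h = lam ^+ 2 *: z + F *m F^T *m z.
  by rewrite zE mulmxDl mul_scalar_mx.
move: z => z ->; have := mulr_ge0 (ltW ll) (psd_gram F z).
have := dot_ge0 (F *m F^T *m z); rewrite !dotE_lin [dot (F *m F^T *m z) z]dotC.
set l := lam ^+ 2; move: (dot _ _) (dot _ _) (dot _ _) => a b c; lra.
Qed.

Lemma spd_cauchy_schwarz (P : 'M[R]_K) (x y : 'cV[R]_K) : spd P ->
  dot (x + y) (P *m (x + y)) <=
  (Num.sqrt (dot x (P *m x)) + Num.sqrt (dot y (P *m y))) ^+ 2.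
Proof.
move=> hP; have [L [PE _ _]] := cholesky hP.
have e (u w : 'cV[R]_K) : dot u (P *m w) = dot (L^T *m u) (L^T *m w).
  by rewrite PE -mulmxA [RHS]dotMl trmxK.
rewrite !e mulmxDr; set a := L^T *m x; set b := L^T *m y.
rewrite sqrrD !sqr_sqrtr ?dot_ge0// !dotE_lin [dot b a]dotC -sqrtrM ?dot_ge0//.
have h : dot a b <= Num.sqrt (dot a a * dot b b).
  apply: le_trans (ler_norm _) _; rewrite -sqrtr_sqr ler_wsqrtr//.
  exact: dot_sqr_le.
by lra.
Qed.

(** Split the rows along [v] and its orthogonal complement: the shift only changes the column
    [F *m v]. The determinant lemma then reduces the claim to [1 + |a + h|^2] against [1 + |a|^2] in
    the norm of [invmx C], where [lam^2 <= C] bounds the length of [h]. *)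
Lemma det_rank_one_shift (F : 'M[R]_(K, n)) (h : 'cV[R]_K) (v : 'cV[R]_n) : v^T *m v = 1%:M ->
  D (F + h *m v^T) <= expR (9 / 4 * ln (1 + Num.sqrt (dot h h) / (Num.sqrt 2 * lam))) * D F.
Proof.
move=> vv; set q := Num.sqrt _ / _.
pose Pi := 1%:M - v *m v^T.
have PT : Pi^T = Pi by rewrite /Pi linearB/= trmx1 trmx_mul trmxK.
have vP : v^T *m Pi = 0 by rewrite /Pi mulmxBr mulmx1 mulmxA vv mul1mx subrr.
have PP : Pi *m Pi = Pi by rewrite {1}/Pi mulmxBl mul1mx -mulmxA vP mulmx0 subr0.
have split G : D G = \det ((lam ^+ 2)%:M + (G *m Pi) *m (G *m Pi)^T + (G *m v) *m (G *m v)^T).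
  have e1 : (G *m Pi) *m (G *m Pi)^T = G *m Pi *m G^T.
    by rewrite trmx_mul PT mulmxA -(mulmxA G) PP.
  have e2 : (G *m v) *m (G *m v)^T = G *m (v *m v^T) *m G^T by rewrite trmx_mul !mulmxA.
  by rewrite /D -addrA e1 e2 -mulmxDl -mulmxDr /Pi subrK mulmx1.
rewrite !split mulmxDl -(mulmxA h) vP mulmx0 addr0 mulmxDl -(mulmxA h) vv mulmx1.
set C := _ + _ *m (F *m Pi)^T; set a := F *m v.
have hC : spd C by exact: spd_scalar_gram.
rewrite !det_rank1 ?spd_unit//.
have e (u : 'cV[R]_K) : (u^T *m invmx C *m u) 0 0 = dot u (invmx C *m u).
  by rewrite /dot mulmxA {2}(mx11_scalar (u^T *m _ *m u)) mxtrace_scalar.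
rewrite !e mulrCA ler_wpM2l ?(ltW (spd_det_gt0 hC))//.
have hI := spd_inv hC.
have pI (u : 'cV[R]_K) : 0 <= dot u (invmx C *m u).
  by case: hI => _ h0; have [->|u0] := eqVneq u 0; [rewrite dot0l|exact/ltW/h0].
apply: (@le_trans _ _ (1 + (Num.sqrt (dot a (invmx C *m a)) + Num.sqrt (dot h (invmx C *m h))) ^+ 2)).
  by rewrite lerD2l; exact: spd_cauchy_schwarz.
rewrite -[in leRHS](sqr_sqrtr (pI a)); apply: rank_one_ratio; rewrite ?sqrtr_ge0//.
  by rewrite divr_ge0 ?sqrtr_ge0// mulr_ge0 ?sqrtr_ge0// ltW.
rewrite sqr_sqrtr// (le_trans (dot_invmx_scalar_gram _ _))//.
rewrite /q expr_div_n exprMn !sqr_sqrtr ?dot_ge0//.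
by rewrite le_eqVlt; apply/orP; left; apply/eqP; field; rewrite gt_eqF.
Qed.

(** The shift is made along one column of [V] at a time. The vectors [h l] satisfy
    [sum |h l|^2 = |H|^2], so averaging the [r] logarithms gives the root mean square
    [|H| / (sqrt (2 r) lam)], which is the origin of the factor [sqrt (2 r)]. *)
Lemma det_shift r (V : 'M[R]_(n, r)) (F H : 'M[R]_(K, n)) : (0 < r)%N ->
  V^T *m V = 1%:M -> H *m (V *m V^T) = H ->
  D (F + H) <= expR (9 / 4 * (r%:R * ln (1 + frobenius H / (Num.sqrt (2 * r%:R) * lam)))) * D F.
Proof.
move=> r0 VV HV; pose h l := H *m col l V; pose v l := col l V.
have vv l : (v l)^T *m v l = 1%:M.
  apply/matrixP => i j; rewrite !ord1.
  transitivity ((V^T *m V) l l); last by rewrite VV !mxE !eqxx.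
  by rewrite !mxE; apply: eq_bigr => k _; rewrite !mxE.
have HE : H = \sum_l h l *m (v l)^T.
  rewrite -{1}HV /h; under eq_bigr do rewrite -mulmxA.
  rewrite -mulmx_sumr; congr (_ *m _); apply/matrixP => i j.
  rewrite summxE !mxE; apply: eq_bigr => l _; rewrite !mxE big_ord_recl big_ord0 addr0 !mxE.
  by [].
have hh : \sum_l dot (h l) (h l) = dot H H.
  have -> : dot H H = dot (H *m V) (H *m V) by rewrite -{1}HV mulmxA dotMr trmxK.
  rewrite [RHS]dotE [RHS]exchange_big/=.
  apply: eq_bigr => l _.
  rewrite dotE; apply: eq_bigr => i _; rewrite big_ord_recl big_ord0 addr0.
  by congr (_ * _); rewrite !mxE; apply: eq_bigr => k _; rewrite !mxE.
pose q l := Num.sqrt (dot (h l) (h l)) / (Num.sqrt 2 * lam).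
have q0 l : 0 <= q l by rewrite divr_ge0 ?sqrtr_ge0// mulr_ge0 ?sqrtr_ge0// ltW.
have step (s : seq 'I_r) : D (F + \sum_(l <- s) h l *m (v l)^T) <=
    expR (9 / 4 * \sum_(l <- s) ln (1 + q l)) * D F.
  elim: s => [|l s IH]; first by rewrite !big_nil addr0 mulr0 expR0 mul1r.
  rewrite !big_cons [_ + \sum_(_ <- s) _ *m _]addrC addrA mulrDr expRD -mulrA.
  have h1 := det_rank_one_shift (F + \sum_(j <- s) h j *m (v j)^T) (h l) (vv l).
  by apply: (le_trans h1); rewrite ler_wpM2l ?expR_ge0.
rewrite {1}HE; apply: (le_trans (step _)); rewrite ler_wpM2r ?(ltW (D_gt0 _))//.
rewrite ler_expR ler_wpM2l//; apply: (le_trans (sum_ln1D_le r0 q0)).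
rewrite le_eqVlt; apply/orP; left; apply/eqP; congr (_ * ln (1 + _)).
have -> : (\sum_i q i ^+ 2) = dot H H / (2 * lam ^+ 2).
  rewrite -hh mulr_suml; apply: eq_bigr => l _.
  by rewrite expr_div_n exprMn !sqr_sqrtr ?dot_ge0.
have -> : frobenius H = Num.sqrt (dot H H).
  by rewrite -frobenius_sqr sqrtr_sqr ger0_norm// sqrtr_ge0.
have -> : Num.sqrt (2 * r%:R) * lam = Num.sqrt (2 * r%:R * lam ^+ 2).
  by rewrite [RHS]sqrtrM ?mulr_ge0// sqrtr_sqr gtr0_norm.
have p1 : 0 <= dot H H / (2 * lam ^+ 2) / r%:R.
  have l2 : 0 <= 2 * lam ^+ 2 by rewrite mulr_ge0// ltW.
  exact: divr_ge0 (divr_ge0 (dot_ge0 H) l2) (ler0n _ _).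
have p2 : 0 <= 2 * r%:R * lam ^+ 2 by rewrite mulr_ge0 ?(ltW ll)// mulr_ge0// ler0n.
apply/eqP; rewrite -(@eqrXn2 _ 2) ?divr_ge0 ?sqrtr_ge0// expr_div_n !sqr_sqrtr ?dot_ge0//.
apply/eqP; field; rewrite gt_eqF//= pnatr_eq0 -lt0n r0//.
Qed.

End shift_matrix.

Section evidence_shift.
Context {R : realType} {K n : nat}.
Variables (lam T : R).
Hypotheses (hK : (0 < K)%N) (hn : (0 < n)%N) (l0 : 0 < lam) (T0 : 0 < T).

(** [9/8] is half of [9/4]: the density is the determinant to the power [- (n + K + 2) / 2]. *)
Definition shift_cost r (H : 'M[R]_(K, n)) : R :=
  9 / 8 * (n + K + 2)%:R * (r%:R * ln (1 + frobenius H / (Num.sqrt (2 * r%:R) * lam))).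

Lemma student_density_shift r (V : 'M[R]_(n, r)) (F H : 'M[R]_(K, n)) : (0 < r)%N ->
  V^T *m V = 1%:M -> H *m (V *m V^T) = H ->
  student_density lam (F - H) <= expR (shift_cost r H) * student_density lam F.
Proof.
move=> r0 VV HV; have := det_shift l0 (F - H) r0 VV HV; rewrite subrK.
rewrite /student_density /shift_cost.
have dF : 0 < \det ((lam ^+ 2)%:M + F *m F^T).
  by apply/spd_det_gt0/spd_scalar_gram; rewrite exprn_gt0.
have dH : 0 < \det ((lam ^+ 2)%:M + (F - H) *m (F - H)^T).
  by apply/spd_det_gt0/spd_scalar_gram; rewrite exprn_gt0.
move: (\det _) (\det _) dF dH => a b a0 b0 h.
rewrite -ler_ln ?posrE ?mulr_gt0 ?expR_gt0// lnM ?posrE ?expR_gt0// expRK in h.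
rewrite /powR !gt_eqF// -expRD ler_expR.
set L := _%:R * ln _ in h *; set N := (_ + _ + _)%:R.
have N0 : 0 <= N by exact: ler0n.
have := ler_wpM2l N0 h; lra.
Qed.

(** After the substitution of [F - H] for [F], the shifted likelihood is the original one, so only
    the prior density pays. *)
Lemma evidence_shift r (V : 'M[R]_(n, r)) (y H : 'M[R]_(K, n)) : (0 < r)%N ->
  V^T *m V = 1%:M -> H *m (V *m V^T) = H ->
  evidence lam T (y - H) <= expR (shift_cost r H) * evidence lam T y.
Proof.
move=> r0 VV HV; set c := expR _; have c0 : 0 <= c by exact: expR_ge0.
have e1 := integral_evidence hK hn l0 T0 (y - H); have e2 := integral_evidence hK hn l0 T0 y.
have key (a b : \bar R) (x z : R) : a = x%:E -> b = z%:E -> (a <= c%:E * b)%E -> x <= c * z.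
  by move=> -> ->; rewrite -EFinM lee_fin.
apply: (key _ _ _ _ e1 e2) => {e1 e2 key}.
have mo z : measurable_fun setT (fun F : 'M[R]_(K, n) => student_density lam F * likelihood T z F).
  by apply: measurable_funM; [exact: measurable_student_density|exact: measurable_likelihood].
have o0 z (F : 'M[R]_(K, n)) : 0 <= student_density lam F * likelihood T z F.
  by rewrite mulr_ge0 ?student_density_ge0 ?expR_ge0.
rewrite -(ge0_integralZl_real _ c0 (mo y) (o0 y)).
have mo' z : measurable_fun setT (fun F : 'M[R]_(K, n) => (student_density lam F * likelihood T z F)%:E).
  by apply/measurable_EFinP.
have o0' z (F : 'M[R]_(K, n)) : (0 <= (student_density lam F * likelihood T z F)%:E)%E by rewrite lee_fin.
rewrite -(integral_mx_shift (- H) (mo' (y - H)) (o0' (y - H))).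
apply: ge0_le_integral => //.
- apply: (measurableT_comp (mo' (y - H))); exact: measurable_addmx.
- by apply/measurable_EFinP; apply: measurable_funM.
move=> F _; rewrite lee_fin mulrA.
have -> : likelihood T (y - H) (F - H) = likelihood T y F.
  by rewrite /likelihood opprB addrA subrK.
by rewrite ler_wpM2r ?expR_ge0//; exact: student_density_shift HV.
Qed.

End evidence_shift.

(** * Gibbs averages *)

Section bounded_matrix.
Context d (X : measurableType d) {R : realType}.

Definition bmm K n (f : X -> 'M[R]_(K, n)) := forall i j, bm (fun x => f x i j).

Lemma bmm_cst K n (A : 'M[R]_(K, n)) : bmm (fun=> A).
Proof. by move=> i j; exact: bm_cst. Qed.

Lemma bmm_mul K m n (f : X -> 'M[R]_(K, m)) (g : X -> 'M[R]_(m, n)) :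
  bmm f -> bmm g -> bmm (fun x => f x *m g x).
Proof.
move=> bf bg i j; under eq_fun do rewrite mxE; apply: bm_sum => k; apply: bmM.
  exact: bf.
exact: bg.
Qed.

Lemma bmm_add K n (f g : X -> 'M[R]_(K, n)) : bmm f -> bmm g -> bmm (fun x => f x + g x).
Proof. by move=> bf bg i j; under eq_fun do rewrite mxE; apply: bmD; [exact: bf|exact: bg]. Qed.

Lemma bmm_sub K n (f g : X -> 'M[R]_(K, n)) : bmm f -> bmm g -> bmm (fun x => f x - g x).
Proof. by move=> bf bg i j; under eq_fun do rewrite !mxE; apply: bmB; [exact: bf|exact: bg]. Qed.

Lemma bm_dot K n (f g : X -> 'M[R]_(K, n)) : bmm f -> bmm g -> bm (fun x => dot (f x) (g x)).
Proof.
move=> bf bg; under eq_fun do rewrite dotE; apply: bm_sum => i; apply: bm_sum => j.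
by apply: bmM; [exact: bf|exact: bg].
Qed.

End bounded_matrix.

Section gibbs.
Context d (X : measurableType d) {R : realType} (mu : probability X R) {K n : nat}.
Variables (S : X -> 'M[R]_K) (T : R).
Hypotheses (T0 : 0 < T) (mS : measurable_fun setT S).
Hypotheses (ST : forall x, (S x)^T = S x) (S0 : forall x, psd (S x)).
Hypothesis S1 : forall x, psd (1%:M - S x).
Implicit Types (y H : 'M[R]_(K, n)) (f g : X -> R).

Definition gibbs_weight y x : R := expR (dot y (S x *m y) / (2 * T)).
Definition partition y : R := \int[mu]_x gibbs_weight y x.
Definition gibbs_mean y f : R := (\int[mu]_x (f x * gibbs_weight y x)) / partition y.
Definition gibbs_center y : 'M[R]_(K, n) :=
  \matrix_(j, i) gibbs_mean y (fun x => (S x *m y) j i).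

Lemma bmm_S : bmm S.
Proof.
move=> i j; split; first exact: measurable_mxE.
exists (Num.sqrt (dot (1%:M : 'M[R]_K) 1%:M)) => x.
rewrite -sqrtr_sqr ler_wsqrtr//.
by have := contraction_entry (ST x) (S0 x) (S1 x) (1%:M : 'M[R]_K) i j; rewrite mulmx1.
Qed.

Let bmmS m (A : 'M[R]_(K, m)) : bmm (fun x => S x *m A).
Proof. by apply: bmm_mul; [exact: bmm_S|exact: bmm_cst]. Qed.

Lemma bm_gibbs_weight y : bm (gibbs_weight y).
Proof.
apply: bm_expR; apply: bmM; last exact: bm_cst.
by apply: bm_dot; [exact: bmm_cst|exact: bmmS].
Qed.

Lemma gibbs_weight_ge1 y x : 1 <= gibbs_weight y x.
Proof. by rewrite -expR0 ler_expR divr_ge0 ?S0// mulr_ge0// ltW. Qed.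

Lemma partition_gt0 y : 0 < partition y.
Proof.
apply: bm_integral_gt0; first exact: bm_gibbs_weight.
by exists 1 => // x; exact: gibbs_weight_ge1.
Qed.

Lemma gibbs_meanD y f g : bm f -> bm g ->
  gibbs_mean y (fun x => f x + g x) = gibbs_mean y f + gibbs_mean y g.
Proof.
move=> bf bg; rewrite /gibbs_mean -mulrDl -bm_integralD; last 2 first.
- by apply: bmM => //; exact: bm_gibbs_weight.
- by apply: bmM => //; exact: bm_gibbs_weight.
by congr (_ / _); apply: eq_Rintegral => x _; rewrite mulrDl.
Qed.

Lemma gibbs_meanZ y c f : bm f -> gibbs_mean y (fun x => c * f x) = c * gibbs_mean y f.
Proof.
move=> bf; rewrite /gibbs_mean mulrA -bm_integralZ; last first.
  by apply: bmM => //; exact: bm_gibbs_weight.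
by congr (_ / _); apply: eq_Rintegral => x _; rewrite mulrA.
Qed.

Lemma gibbs_meanB y f g : bm f -> bm g ->
  gibbs_mean y (fun x => f x - g x) = gibbs_mean y f - gibbs_mean y g.
Proof.
move=> bf bg; have -> : (fun x => f x - g x) = (fun x => f x + (-1) * g x).
  by apply/funext => x; rewrite mulN1r.
by rewrite gibbs_meanD ?gibbs_meanZ// ?mulN1r//; exact: bmZ.
Qed.

Lemma gibbs_mean_cst y c : gibbs_mean y (fun=> c) = c.
Proof.
rewrite /gibbs_mean bm_integralZ; last exact: bm_gibbs_weight.
by rewrite mulfK// gt_eqF// partition_gt0.
Qed.

Lemma gibbs_mean_sum y (I : Type) (s : seq I) (F : I -> X -> R) : (forall i, bm (F i)) ->
  gibbs_mean y (fun x => \sum_(i <- s) F i x) = \sum_(i <- s) gibbs_mean y (F i).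
Proof.
move=> bF; elim: s => [|i s IH].
  by rewrite big_nil -[RHS](gibbs_mean_cst y); congr (gibbs_mean y _); apply/funext => x; rewrite big_nil.
rewrite big_cons -IH -gibbs_meanD//; last exact: bm_sum.
by congr (gibbs_mean y _); apply/funext => x; rewrite big_cons.
Qed.

Lemma gibbs_mean_le y f g : bm f -> bm g -> (forall x, f x <= g x) ->
  gibbs_mean y f <= gibbs_mean y g.
Proof.
move=> bf bg fg; rewrite /gibbs_mean ler_pM2r ?invr_gt0 ?partition_gt0//.
apply: bm_integral_le.
- by apply: bmM => //; exact: bm_gibbs_weight.
- by apply: bmM => //; exact: bm_gibbs_weight.
by move=> x; rewrite ler_wpM2r ?expR_ge0.
Qed.

Lemma gibbs_mean_jensen y f : bm f ->
  gibbs_mean y f <= ln ((\int[mu]_x (expR (f x) * gibbs_weight y x)) / partition y).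
Proof.
move=> bf; apply: exp_jensen => //; first exact: bm_gibbs_weight.
  by move=> x; exact: expR_ge0.
exact: partition_gt0.
Qed.

(** The derivative of [gibbs_center y j i] in the entry [y j i]: the mean of the diagonal entry of
    [S] plus the Gibbs variance of the fitted entry divided by [T]. *)
Definition center_slope y j i : R := gibbs_mean y (fun x => S x j j) +
  (gibbs_mean y (fun x => (S x *m y) j i ^+ 2) - gibbs_center y j i ^+ 2) / T.

Section derivative.
Variables (H : 'M[R]_(K, n)) (j : 'I_K) (i : 'I_n).
Let line (v : R) := H + v *: delta_mx j i.
Let s x := S x j j.
Let c x := (S x *m H) j i.
Let w := gibbs_weight H.

Let bs : bm s. Proof. exact: bmm_S. Qed.
Let bc : bm c. Proof. exact: bmmS. Qed.
Let bw : bm w. Proof. exact: bm_gibbs_weight. Qed.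

Let dot_delta (A : 'M[R]_(K, n)) : dot (delta_mx j i) A = A j i.
Proof.
rewrite dotE (bigD1 j)//= (bigD1 i)//= mxE !eqxx mul1r big1 => [|k ki].
  rewrite addr0 big1 ?addr0// => k kj; rewrite big1// => l _.
  by rewrite mxE (negPf kj) mul0r.
by rewrite mxE (negPf ki) andbF mul0r.
Qed.

Let S_delta x : (S x *m delta_mx j i) j i = s x.
Proof.
rewrite mxE (bigD1 j)//= mxE !eqxx mulr1 big1 ?addr0// => k kj.
by rewrite mxE (negPf kj) mulr0.
Qed.

Let lineE x v : (S x *m line v) j i = s x * v + c x.
Proof. by rewrite /line mulmxDr -scalemxAr mxE [X in _ + X]mxE S_delta addrC mulrC. Qed.

Let weightE x v : gibbs_weight (line v) x = w x * expR (exp_phase s c T v x).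
Proof.
rewrite /w /gibbs_weight -expRD; congr expR; rewrite /exp_phase /line mulmxDr -scalemxAr.
have e : dot H (S x *m delta_mx j i) = c x.
  by rewrite dotC dotMl ST dot_delta.
rewrite !dotE_lin e !dot_delta S_delta -/(c x); field; by rewrite gt_eqF.
Qed.

Let momE k g v : exp_moment mu s c T k (fun x => w x * g x) v =
  \int[mu]_x (g x * (S x *m line v) j i ^+ k * gibbs_weight (line v) x).
Proof. by apply: eq_Rintegral => x _; rewrite lineE weightE; ring. Qed.

Let mom k v : exp_moment mu s c T k w v =
  \int[mu]_x ((S x *m line v) j i ^+ k * gibbs_weight (line v) x).
Proof. by apply: eq_Rintegral => x _; rewrite lineE weightE; ring. Qed.

Let em k v := exp_moment mu s c T k w v.
Let em' v := exp_moment mu s c T 0 (fun x => w x * s x) v.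

Let partE v : partition (line v) = em 0 v.
Proof. by rewrite /em mom; apply: eq_Rintegral => x _; rewrite expr0 mul1r. Qed.

Let centerE v : gibbs_center (line v) j i = em 1 v / em 0 v.
Proof.
rewrite mxE /gibbs_mean partE; congr (_ / _); rewrite /em mom.
by apply: eq_Rintegral => x _; rewrite expr1.
Qed.

Let slopeE v : center_slope (line v) j i =
  (em' v + em 2 v / T) / em 0 v - (em 1 v / em 0 v) ^+ 2 / T.
Proof.
have e1 : gibbs_mean (line v) (fun x => S x j j) = em' v / em 0 v.
  rewrite /gibbs_mean partE /em' momE; congr (_ / _).
  by apply: eq_Rintegral => x _; rewrite expr0 mulr1.
have e2 : gibbs_mean (line v) (fun x => (S x *m line v) j i ^+ 2) = em 2 v / em 0 v.
  by rewrite /gibbs_mean partE; congr (_ / _); rewrite /em mom.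
rewrite /center_slope centerE e1 e2; ring.
Qed.

Let em_gt0 v : 0 < em 0 v. Proof. by rewrite -partE; exact: partition_gt0. Qed.

Let dem k v : is_derive v (1 : R) (em k)
   (k%:R * exp_moment mu s c T k.-1 (fun x => w x * s x) v + em k.+1 v / T).
Proof. exact: is_derive_exp_moment. Qed.

Lemma is_derive_center v :
  is_derive v (1 : R) (fun v => gibbs_center (H + v *: delta_mx j i) j i)
    (center_slope (H + v *: delta_mx j i) j i).
Proof.
rewrite -/(line v) slopeE.
have -> : (fun v => gibbs_center (H + v *: delta_mx j i) j i) = (fun v => em 1 v * (em 0 v)^-1).
  by apply/funext => z; rewrite -/(line z) centerE.
have n0 : em 0 v != 0 by rewrite gt_eqF.
have d0 := dem 0 v; have d1 := dem 1 v.
have dV : is_derive v (1 : R) (fun v => (em 0 v)^-1) (- (em 0 v) ^- 2 *: (0%:R * exp_moment mu s c T 0.-1 (fun x => w x * s x) v + em 1 v / T)).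
  exact: is_deriveV.
apply: (is_derive_eq (is_deriveM d1 dV)).
rewrite /GRing.scale/= -/(em' v); field; by rewrite n0 gt_eqF.
Qed.

(** Needed for the fundamental theorem of calculus behind [stein_uniform]. *)
Lemma continuous_center_slope :
  continuous (fun v : R => center_slope (H + v *: delta_mx j i) j i : R).
Proof.
have -> : (fun v : R => center_slope (H + v *: delta_mx j i) j i) =
    (fun v : R => (em' v + em 2 v / T) / em 0 v - (em 1 v / em 0 v) ^+ 2 / T).
  by apply/funext => v; rewrite -slopeE.
have cem k : continuous (em k).
  by move=> v; apply: differentiable_continuous; apply/derivable1_diffP; have [] := dem k v.
have cem' : continuous em'.
  move=> v; apply: differentiable_continuous; apply/derivable1_diffP.
  by have [] := @is_derive_exp_moment _ X R mu s c T bs bc 0 (fun x => w x * s x) v (bmM bw bs).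
have cV : continuous (fun v : R => (em 0 v)^-1 : R).
  by move=> v; apply: cvgV; [rewrite gt_eqF|exact: cem].
move=> v; apply: cvgB; last first.
  apply: cvgM; last exact: cvg_cst.
  rewrite expr2; under eq_fun do rewrite expr2.
  by apply: cvgM; (apply: cvgM; [exact: cem|exact: cV]).
apply: cvgM; last exact: cV.
by apply: cvgD; [exact: cem'|apply: cvgM; [exact: cem|exact: cvg_cst]].
Qed.

End derivative.

Let mjoint (g : 'M[R]_(K, n) * X -> R) : measurable_fun setT g ->
  measurable_fun setT (fun y => gibbs_mean y (fun x => g (y, x))).
Proof.
move=> mg.
have mw : measurable_fun setT (fun p : 'M[R]_(K, n) * X => gibbs_weight p.1 p.2).
  apply: (measurableT_comp (@measurable_expR R)); apply: measurable_funM => //.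
  apply: measurable_dot; first exact: measurable_fst.
  apply: measurable_mulmx; last exact: measurable_fst.
  exact: (measurableT_comp mS measurable_snd).
apply: measurable_funM.
  exact: (measurable_integral2 mu (measurable_funM mg mw)).
apply: measurable_invr; exact: (measurable_integral2 mu mw).
Qed.

Let msy j i : measurable_fun setT (fun p : 'M[R]_(K, n) * X => (S p.2 *m p.1) j i).
Proof.
apply: measurable_mxE; apply: measurable_mulmx; last exact: measurable_fst.
exact: (measurableT_comp mS measurable_snd).
Qed.

Lemma measurable_center j i : measurable_fun setT (fun y => gibbs_center y j i).
Proof. by under eq_fun do rewrite mxE; exact: (mjoint (msy j i)). Qed.

Lemma measurable_center_slope j i : measurable_fun setT (fun y => center_slope y j i).
Proof.
apply: measurable_funD.
  apply: (mjoint (g := fun p => S p.2 j j)); apply: measurable_mxE.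
  exact: (measurableT_comp mS measurable_snd).
apply: measurable_funM => //; apply: measurable_funB.
  exact: (mjoint (measurable_funX 2 (msy j i))).
by apply: measurable_funX; exact: measurable_center.
Qed.

Lemma center_sqr_le y j i :
  gibbs_center y j i ^+ 2 <= gibbs_mean y (fun x => (S x *m y) j i ^+ 2) <= dot y y.
Proof.
have bf : bm (fun x => (S x *m y) j i) by exact: bmmS.
have bf2 := bmX 2 bf.
apply/andP; split; last first.
  rewrite -[leRHS](gibbs_mean_cst y); apply: gibbs_mean_le => //; first exact: bm_cst.
  by move=> x; apply: contraction_entry.
set m := gibbs_center y j i.
have mE : gibbs_mean y (fun x => (S x *m y) j i) = m by rewrite /m mxE.
have : 0 <= gibbs_mean y (fun x => (S x *m y) j i ^+ 2 - 2 * m * (S x *m y) j i + m ^+ 2).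
  rewrite -[leLHS](gibbs_mean_cst y); apply: gibbs_mean_le; [exact: bm_cst| |].
    by apply: bmD; [apply: bmB => //; exact: bmZ|exact: bm_cst].
  by move=> x; have := sqr_ge0 ((S x *m y) j i - m); lra.
rewrite gibbs_meanD ?gibbs_meanB ?gibbs_meanZ ?gibbs_mean_cst// ?mE; [|bm_tac..].
by rewrite -mulrA -expr2; lra.
Qed.

Lemma center_slope_bound y j i (diag : forall x, 0 <= S x j j <= 1) :
  0 <= center_slope y j i <= 1 + dot y y / T.
Proof.
have /andP[h1 h2] := center_sqr_le y j i.
have h3 : 0 <= gibbs_mean y (fun x => S x j j) <= 1.
  apply/andP; split.
    rewrite -[leLHS](gibbs_mean_cst y); apply: gibbs_mean_le; [exact: bm_cst|exact: bmm_S|].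
    by move=> x; case/andP: (diag x).
  rewrite -[leRHS](gibbs_mean_cst y); apply: gibbs_mean_le; [exact: bmm_S|exact: bm_cst|].
  by move=> x; case/andP: (diag x).
case/andP: h3 => h3 h4; rewrite /center_slope; apply/andP; split.
  by rewrite addr_ge0// divr_ge0 ?(ltW T0)// subr_ge0.
rewrite lerD// ler_pM2r ?invr_gt0//; have := sqr_ge0 (gibbs_center y j i); lra.
Qed.

End gibbs.

(** * Spectral inequalities *)

Lemma conjmx_intertwine (F : fieldType) K (P D A : 'M[F]_K) : P \in unitmx ->
  A = invmx P *m D *m P -> P *m A = D *m P.
Proof. by move=> uP ->; rewrite -mulmxA mulKVmx. Qed.

Lemma conjmx_det_quadratic (F : fieldType) K (P A : 'M[F]_K) (d : 'rV[F]_K) (a b c : F) :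
  P \in unitmx -> A = invmx P *m diag_mx d *m P ->
  \det (a%:M + b *: A + c *: (A *m A)) = \prod_i (a + b * d 0 i + c * d 0 i ^+ 2).
Proof.
move=> uP AE; have AP := conjmx_intertwine uP AE.
have -> : a%:M + b *: A + c *: (A *m A) =
    invmx P *m (a%:M + b *: diag_mx d + c *: (diag_mx d *m diag_mx d)) *m P.
  rewrite !mulmxDr !mulmxDl mul_mx_scalar -!scalemxAr -!scalemxAl mulVmx// scalemx1.
  by rewrite -AE; congr (_ + _ *: _); rewrite {1}AE -!mulmxA AP.
rewrite !det_mulmx det_inv mulrAC mulVr ?mul1r -?unitmxE//.
have -> : a%:M + b *: diag_mx d + c *: (diag_mx d *m diag_mx d) =
    diag_mx (\row_i (a + b * d 0 i + c * d 0 i ^+ 2)).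
  apply/matrixP => i j; rewrite mulmx_diag !mxE.
  by case: eqVneq => _; rewrite ?mulr1n ?mulr0n ?mulr0 ?addr0// expr2.
by rewrite det_diag; apply: eq_bigr => i _; rewrite mxE.
Qed.

Lemma conjmx_trace (F : fieldType) K (P D : 'M[F]_K) : P \in unitmx ->
  \tr (invmx P *m D *m P) = \tr D.
Proof. by move=> uP; rewrite mxtrace_mulC mulmxA mulmxV// mul1mx. Qed.

Section spectral.
Import mathcomp.algebra.spectral mathcomp.real_closed.complex.
Context {R : realType} {K : nat}.
Variable S : 'M[R]_K.
Hypothesis ST : S^T = S.

(** The Hermitian spectral theorem over [R[i]] is applied to the complexified matrix; the
    eigenvalues are real, so the identities descend to [R]. Quadratic polynomials suffice, because
    both determinants compared below have this form. *)
Lemma sym_spectrum : exists d : 'I_K -> R, [/\ forall i, eigenvalue S (d i),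
  \tr S = \sum_i d i & forall a b c : R,
  \det (a%:M + b *: S + c *: (S *m S)) = \prod_i (a + b * d i + c * d i ^+ 2)].
Proof.
pose f : {rmorphism R -> R[i]} := real_complex R.
pose A := map_mx f S.
have Ah : A \is hermsymmx.
  apply: realsym_hermsym.
    by apply/is_hermitianmxP; rewrite expr0 scale1r map_mx_id// /A map_trmx ST.
  apply/mxOverP => i j; rewrite mxE; apply/Creal_ImP.
  by rewrite -complexIm.
have /hermitian_normalmx/orthomx_spectralP AE := Ah.
have dR := hermitian_spectral_diag_real Ah.
set P := spectralmx A in AE; set D := spectral_diag A in AE dR.
have uP : P \in unitmx by exact: spectral_unit.
have dE i : exists x, D 0 i = f x.
  have /mxOverP/(_ 0 i)/Creal_ImP h := dR.
  exists (complex.Re (D 0 i)); move: h; rewrite -complexIm => /complexI h.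
  by apply/eqP; rewrite eq_complex/= h !eqxx.
have [d {}dE] := choice dE.
have AP : P *m A = diag_mx D *m P := conjmx_intertwine uP AE.
exists d; split.
- move=> i; rewrite eigenvalue_root_char -(fmorph_root f) map_char_poly -eigenvalue_root_char.
  apply/eigenvalueP; exists (row i P).
    by rewrite -row_mul AP; apply/rowP => j; rewrite mul_diag_mx !mxE dE.
  apply/negP => /eqP P0; have := congr1 (row i) (mulmxV uP).
  rewrite row_mul P0 mul0mx => /rowP/(_ i)/eqP.
  by rewrite !mxE eqxx eq_sym oner_eq0.
- apply: complexI; rewrite -[LHS](trace_map_mx f) -/A AE conjmx_trace//.
  by rewrite mxtrace_diag rmorph_sum; apply: eq_bigr => i _; rewrite dE.
move=> a b c; apply: complexI; rewrite -[LHS](det_map_mx f) !map_mxD !map_mxZ map_mxM map_scalar_mx -/A.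
rewrite (conjmx_det_quadratic _ _ _ uP AE) rmorph_prod.
by apply: eq_bigr => i _; rewrite dE !rmorphD !rmorphM.
Qed.

Hypotheses (S0 : psd S) (S1 : psd (1%:M - S)).

Lemma contraction_eigenvalue x : eigenvalue S x -> 0 <= x <= 1.
Proof.
move=> /eigenvalueP[v vS v0]; pose X := v^T.
have X0 : 0 < dot X X.
  rewrite lt0r dot_ge0 andbT; apply: contra_neq v0 => /dot_eq0 h.
  by rewrite -[v]trmxK -/X h trmx0.
have SX : S *m X = x *: X by rewrite /X -{1}ST -trmx_mul vS linearZ.
have := S0 X; have := S1 X; rewrite mulmxBl mul1mx SX dotBr dotZr.
rewrite -{1}(mul1r (dot X X)) -mulrBl !pmulr_lge0//; lra.
Qed.

Lemma trace_contraction_entry i : 0 <= S i i <= 1.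
Proof.
have e (A : 'M[R]_K) : dot (delta_mx i 0 : 'cV[R]_K) (A *m delta_mx i 0) = A i i.
  rewrite dotE (bigD1 i)//= big_ord_recl big_ord0 addr0 !mxE !eqxx mul1r.
  rewrite [X in _ + X]big1 ?addr0.
    rewrite (bigD1 i)//= mxE !eqxx mulr1 big1 ?addr0// => k ki.
    by rewrite mxE (negPf ki) mulr0.
  move=> k ki; rewrite big1// => j _; by rewrite mxE (negPf ki) mul0r.
have h := S1 (delta_mx i 0 : 'cV[R]_K).
apply/andP; split; first by rewrite -e; exact: S0.
by move: h; rewrite e !mxE eqxx mulr1n subr_ge0.
Qed.

(** The exponential is moved to the right and replaced by its cubic Taylor lower bound. The
    resulting polynomial inequality is nearly tight around [s = 7/25], hence the square in the
    certificate. *)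
Lemma scalar_det_ineq (s : R) : 0 <= s <= 1 ->
  (1 - 99/100 * s) * expR (96/100 * s) <= 1 - 2/3 * s ^+ 2.
Proof.
move=> /andP[s0 s1]; have z0 : 0 <= 96/100 * s by lra.
have h := expRN_ge3 z0; rewrite expRN in h.
have e0 : 0 < expR (96/100 * s) := expR_gt0 _.
rewrite -ler_pdivlMr//; set w := (expR _)^-1 in h *.
have c0 : 0 <= 1 - 2/3 * s ^+ 2.
  by have : s ^+ 2 <= s; [rewrite expr2 ler_piMl|lra].
apply: le_trans (ler_wpM2l c0 h).
have k0 : 0 <= 8/25 - 77/250 * s by lra.
have k1 := mulr_ge0 s0 (mulr_ge0 (sqr_ge0 (s - 7/25)) k0).
have k5 : 0 <= s ^+ 5 by rewrite exprn_ge0.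
have k4 : 0 <= s ^+ 4 by rewrite exprn_ge0.
have k3 : 0 <= s ^+ 3 by rewrite exprn_ge0.
have k2 : s ^+ 2 <= s by rewrite expr2 ler_piMl.
rewrite -subr_ge0.
rewrite (_ : _ - _ = s * ((s - 7/25) ^+ 2 * (8/25 - 77/250 * s)) + 1/1250 * s ^+ 4 +
  1/(125*125) * s ^+ 3 + s * (307/(250*250)) - 1181/(750*625) * s ^+ 2 + 1536/(125*125) * s ^+ 5); first lra.
by field.
Qed.

(** Here [96/100] is twice the [12/25] in the noise bound: the exponential of the trace and the
    Gaussian determinant are together traded for [1 - 99/100 S], a factor that the determinant of
    the precision can absorb. *)
Lemma det_contraction_ineq : \det (1%:M - (99/100) *: S) * expR (96/100 * \tr S) <=
  \det (1%:M - (2/3) *: (S *m S)).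
Proof.
have [d [dE -> dp]] := sym_spectrum.
have -> : \det (1%:M - (99/100) *: S) = \prod_i (1 - 99/100 * d i).
  have := dp 1 (- (99/100)) 0; rewrite scale0r addr0 scaleNr => ->.
  by apply: eq_bigr => i _; ring.
have -> : \det (1%:M - (2/3) *: (S *m S)) = \prod_i (1 - 2/3 * d i ^+ 2).
  have := dp 1 0 (- (2/3)); rewrite scale0r addr0 scaleNr => ->.
  by apply: eq_bigr => i _; ring.
rewrite mulr_sumr expR_sum -big_split/=; apply: ler_prod => i _.
have di := contraction_eigenvalue (dE i).
rewrite scalar_det_ineq// andbT mulr_ge0 ?expR_ge0//.
by move: di => /andP[]; lra.
Qed.

(** This makes the deterministic part of the exponent nonpositive once the noise is integrated out.
    On an eigenvalue [s] it reads [2 s^2 (13/10 s - 95/100)^2 <= 16/10 s - 13/10 s^2]. *)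
Lemma contraction_quadratic n (X : 'M[R]_(K, n)) :
  2 * dot (S *m ((13/10) *: (S *m X) - (95/100) *: X)) (S *m ((13/10) *: (S *m X) - (95/100) *: X)) <=
  16/10 * dot X (S *m X) - 13/10 * dot (S *m X) (S *m X).
Proof.
(* The claim is a combination of [S^2 <= S] at [S X - c X] and at [X]. Matching the coefficients of
   [s], [s^2] and [s^3] forces this [c]; what is left in [s^4] is a nonnegative multiple of [h3]. *)
pose c : R := 301/1374.
have h1 := contraction_sqr_le ST S0 S1 (S *m X - c *: X).
have h2 := contraction_sqr_le ST S0 S1 X.
have h3 := dot_ge0 (S *m (S *m X)).
have e1 : dot X (S *m (S *m X)) = dot (S *m X) (S *m X) by rewrite [RHS]dotMl ST.
have e2 : dot (S *m X) (S *m (S *m X)) = dot (S *m (S *m X)) (S *m X) by rewrite dotC.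
have e3 : dot (S *m X) X = dot X (S *m X) by rewrite dotC.
move: h1 h2 h3; rewrite !mulmxBr -!scalemxAr !dotE_lin e2 e1 /c.
move: (dot _ _) (dot _ _) (dot _ _) (dot _ _) => p q r t; lra.
Qed.

Let P := 1%:M - (2/3) *: (S *m S).

Lemma spd_contraction : spd P.
Proof.
split; first by rewrite linearB/= trmx1 linearZ/= trmx_mul ST.
move=> n X X0; rewrite mulmxBl mul1mx -scalemxAl dotBr dotZr -mulmxA.
have -> : dot X (S *m (S *m X)) = dot (S *m X) (S *m X) by rewrite [RHS]dotMl ST.
have X1 : 0 < dot X X by rewrite lt0r dot_ge0 andbT; apply: contra_neq X0; exact: dot_eq0.
have := contraction_sqr_le ST S0 S1 X; have := contraction_le S1 X; lra.
Qed.

(** Completing the square. The coefficient of [dot c c] is sharp: at [S = 1] it is [1/3 + 2/3]. *)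
Lemma integral_gauss_contraction n (c : 'M[R]_(K, n)) :
  (\int[lebesgue_mx]_(g in [set: 'M[R]_(K, n)])
     (expR (- (dot g g / 2)) * expR (dot (S *m g + c) (S *m g + c) / 3))%:E <=
  (gauss_mass K n * \det P `^ (- (n%:R / 2)) * expR (dot c c))%:E)%E.
Proof.
under eq_integral => g _.
  rewrite (_ : _ * _ = expR (dot c c / 3) * gauss_weight P ((2/3) *: (S *m c)) g); last first.
    rewrite /gauss_weight -!expRD; congr expR.
    have e : dot g (S *m S *m g) = dot (S *m g) (S *m g) by rewrite [RHS]dotMl ST mulmxA.
    have e' : dot g (S *m c) = dot (S *m g) c by rewrite dotMl ST.
    rewrite mulmxBl mul1mx -scalemxAl !dotE_lin e e' [dot c _]dotC; lra.
  over.
rewrite ge0_integralZl_real ?expR_ge0//; last 2 first.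
- exact: measurable_gauss_weight.
- by move=> g; exact: expR_ge0.
rewrite integral_gauss_weight; last exact: spd_contraction.
rewrite -EFinM lee_fin mulrC -!mulrA.
rewrite ler_wpM2l ?(ltW (gauss_mass_gt0 _ _))// ler_wpM2l ?powR_ge0// -expRD ler_expR.
have uP := spd_unit spd_contraction.
pose z := invmx P *m (S *m c).
have Pz : P *m z = S *m c by rewrite mulKVmx.
have tz : dot (S *m c) z = dot c (S *m z) by rewrite dotMl ST.
have e1 : dot (S *m c) z = dot z z - 2/3 * dot (S *m z) (S *m z).
  rewrite -Pz dotC mulmxBl mul1mx -scalemxAl dotBr dotZr -mulmxA.
  by rewrite [in RHS]dotMl ST.
have e2 := contraction_sqr_le ST S0 S1 z; have e3 := contraction_le S1 z.
(* At [S = 1] one has [z = 3 c], the case of equality. *)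
have e4 := dot_ge0 (S *m z - 3 *: c).
rewrite !dotE_lin [dot (S *m z) c]dotC in e4.
rewrite -scalemxAr -/z !dotE_lin; lra.
Qed.

End spectral.

(** * Risk of the posterior mean *)

Lemma risk_split_identity (R : realType) K n (A B Y P N W : 'M[R]_(K, n)) (s : R) :
  dot (A - (Y - N)) (A - (Y - N)) + dot (B - (P - W)) (B - (P - W)) -
    (dot (A - (Y - N)) N + dot B W) + s =
  dot (Y - A) (Y - A) - dot (Y - A) N +
    (dot B B - 2 * dot P B + dot B W + s) + dot (P - W) (P - W).
Proof.
rewrite !dotE_lin; have := dotC Y A; have := dotC N Y; have := dotC N A.
have := dotC P B; have := dotC W P; have := dotC W B; lra.
Qed.

Lemma le_ln_ratio (R : realType) (e a b w : R) : 0 < a -> 0 < b ->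
  e <= ln (a / b) -> a <= expR w * b -> e <= w.
Proof.
move=> a0 b0 h1 h2; apply: (le_trans h1); rewrite -(expRK w).
by rewrite ler_ln ?posrE ?expR_gt0 ?divr_gt0// ler_pdivrMr.
Qed.

Lemma young_dot (R : realType) K n (r e : 'M[R]_(K, n)) : - dot r e <= dot r r / 4 + dot e e.
Proof.
have := dot_ge0 (2^-1 *: r + e); rewrite !dotDr !dotDl !dotZl !dotZr [dot e r]dotC; lra.
Qed.

Lemma contraction_residual (R : realType) K n (S : 'M[R]_K) (X : 'M[R]_(K, n)) :
  S^T = S -> psd S -> psd (1%:M - S) ->
  dot (X - S *m X) (X - S *m X) <= dot X X - dot X (S *m X).
Proof.
move=> ST S0 S1; have := contraction_sqr_le ST S0 S1 X.
rewrite !dotE_lin [dot (S *m X) X]dotC; lra.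
Qed.

Section gibbs_steps.
Context {R : realType}.
Implicit Types a b c e g k m q s t w qq qs rr re gg lq lp ff em ks fe : R.

Lemma gibbs_step_shift t e g q k : 0 < t -> t^-1 * (- e) <= (g - q) / t + k -> - e <= g - q + t * k.
Proof. by move=> t0 /(ler_wpM2l (ltW t0)); rewrite mulVKf ?gt_eqF// mulrDr [t * (_ / t)]mulrC divfK ?gt_eqF. Qed.

(** Since [8/10 * 5/4 = 1], a residual of weight [8/10] uses up exactly the part [qs] of the Gibbs
    exponent. On the complement the exponent [b] is added to [- 26/10 * b], which gives
    [- 16/10 * b]. *)
Lemma gibbs_step_pointwise qq qs rr re gg a b c s : rr <= qq - qs -> - re <= rr / 4 + gg ->
  13/10 * (a - 2 * b + c + s) + 8/10 * (rr - re) + (qs + b) <=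
  qq + 8/10 * gg + (13/10 * a - 16/10 * b + 13/10 * c + 13/10 * s).
Proof. lra. Qed.

Lemma gibbs_step_residual qq qs rr re gg : rr <= qq - qs -> - re <= rr / 4 + gg ->
  rr - re <= (5/4 * qq + gg) - 5/4 * qs.
Proof. lra. Qed.

(** Of the weight [13/10] on [lq], the part [8/10] is covered by the Jensen estimate and the
    remaining half by the separate bound on [lq]. *)
Lemma gibbs_step_final m lq lp ff em ks fe g t k qq w :
  m <= lq + lp + ff + em - ks - fe -> lq <= 5/4 * (g + 2 * t * k) + g ->
  13/10 * lp + 8/10 * lq <= qq + 8/10 * g + w ->
  13/10 * m <= 13/10 * (ff - fe + (em - ks)) + qq + 8/10 * g + w + 5/4 * t * k + 9/8 * g.
Proof. move=> h1 h2 h3; lra. Qed.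

Lemma gibbs_step_mean e qq g t k : - e <= g - qq + 2 * t * k ->
  5/4 * qq + g - 5/4 * e <= 5/4 * (g + 2 * t * k) + g.
Proof. lra. Qed.

End gibbs_steps.

Section gibbs_bound.
Context d (X : measurableType d) {R : realType} (mu : probability X R) {K n : nat}.
Variables (S : X -> 'M[R]_K) (T : R).
Hypotheses (T0 : 0 < T) (mS : measurable_fun setT S).
Hypotheses (ST : forall x, (S x)^T = S x) (S0 : forall x, psd (S x)).
Hypothesis S1 : forall x, psd (1%:M - S x).
Variables (Fs : 'M[R]_(K, n)) (Q : 'M[R]_n).
Hypotheses (QT : Q^T = Q) (QQ : Q *m Q = Q).
Implicit Types (y eta kap : 'M[R]_(K, n)).

Local Notation E := (gibbs_mean mu S T).
Local Notation Z := (partition mu S T).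
Local Notation center := (gibbs_center mu S T).

Definition coproj (A : 'M[R]_(K, n)) := A - A *m Q.

Lemma dot_proj_split (A B : 'M[R]_(K, n)) :
  dot A B = dot (A *m Q) (B *m Q) + dot (coproj A) (coproj B).
Proof.
have e1 : dot (A *m Q) (B *m Q) = dot A (B *m Q) by rewrite dotMr QT -mulmxA QQ.
have e2 : dot (A *m Q) B = dot A (B *m Q) by rewrite dotMr QT.
rewrite /coproj !dotE_lin e1 e2; lra.
Qed.

(** [13/10] times the risk estimate on the complement of [Q], plus the Gibbs exponent there. The
    part of the data along [Q] does not occur. *)
Definition noise_exponent eta kap x : R :=
  let yp := coproj (Fs + eta) in
  13/10 * dot (S x *m yp) (S x *m yp) - 16/10 * dot yp (S x *m yp) +
  13/10 * dot (S x *m yp) (coproj eta) + 13/10 * \sum_j \sum_i kap j i * S x j j.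

Definition noise_partition eta kap : R :=
  \int[mu]_x expR (noise_exponent eta kap x / (2 * T)).

Let bS : bmm S. Proof. exact: bmm_S. Qed.
Ltac bmx := repeat first [ assumption | exact: bm_cst | exact: bmm_cst | exact: bS
  | exact: bm_gibbs_weight | apply: bm_expR | apply: bmX
  | apply: bmD | apply: bmB | apply: bmN | apply: bmM | apply: bm_dot | apply: bmm_mul
  | apply: bmm_sub | apply: bmm_add | (apply: bm_sum; intro) | exact: (bS _ _) ].

Lemma bm_noise_exponent eta kap : bm (noise_exponent eta kap).
Proof. by rewrite /noise_exponent; bmx. Qed.

Lemma noise_partition_gt0 eta kap : 0 < noise_partition eta kap.
Proof.
have bf := bm_noise_exponent eta kap; have [_ [M fM]] := bf.
apply: bm_integral_gt0; first by apply: bm_expR; apply: bmM => //; exact: bm_cst.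
exists (expR (- M / (2 * T))); first exact: expR_gt0.
move=> x; rewrite ler_expR ler_pM2r ?invr_gt0 ?mulr_gt0//.
by have := fM x; rewrite ler_norml => /andP[].
Qed.

Let E_sum y (I : Type) (s : seq I) (F : I -> X -> R) : (forall i, bm (F i)) ->
  E y (fun x => \sum_(i <- s) F i x) = \sum_(i <- s) E y (F i).
Proof. exact: gibbs_mean_sum. Qed.

Let E_dot y (A : 'M[R]_(K, n)) : E y (fun x => dot (S x *m y) A) = dot (center y) A.
Proof.
have -> : (fun x => dot (S x *m y) A) = (fun x => \sum_j \sum_i A j i * (S x *m y) j i).
  by apply/funext => x; rewrite dotE; under eq_bigr do under eq_bigr do rewrite mulrC.
have be j i : bm (fun x => (S x *m y) j i) by apply: bmm_mul; bmx.
rewrite E_sum => [|j]; last by bmx; exact: be.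
rewrite dotE; apply: eq_bigr => j _.
rewrite E_sum => [|i]; last by bmx; exact: be.
by apply: eq_bigr => i _; rewrite gibbs_meanZ// mxE mulrC.
Qed.

Section realization.
Variables (eta kap : 'M[R]_(K, n)) (kQ : R).
Hypothesis kapT : forall j i, 0 <= kap j i <= T.
Let y := Fs + eta.
Let M := center y.
Let FQ := Fs *m Q.
Let yQ := y *m Q.
Let eQ := eta *m Q.
Let yp := coproj y.
Let ep := coproj eta.
Let g2 := dot eQ eQ.
Hypothesis shiftQ : Z (y - FQ) <=
  expR ((dot (y - FQ) (y - FQ) - dot y y) / (2 * T) + kQ) * Z y.

Let SK x := \sum_j \sum_i kap j i * S x j j.
(** The risk estimate for a fixed [S], in which the kernel sum [SK] compensates the product with the
    noise. That product is taken with [S x *m y - FQ], a change of zero mean, so that the part along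
    [Q] depends on the residual [yQ - S x *m yQ] only. *)
Let L x := dot (S x *m y - Fs) (S x *m y - Fs) - dot (S x *m y - FQ) eta + SK x.
Let LQ x := dot (yQ - S x *m yQ) (yQ - S x *m yQ) - dot (yQ - S x *m yQ) eQ.
Let Lp x := dot (S x *m yp) (S x *m yp) - 2 * dot yp (S x *m yp) + dot (S x *m yp) ep + SK x.

Let bSK : bm SK. Proof. by rewrite /SK; bmx. Qed.
Let bL : bm L. Proof. by rewrite /L; bmx. Qed.
Let bLQ : bm LQ. Proof. by rewrite /LQ; bmx. Qed.
Let bLp : bm Lp. Proof. by rewrite /Lp; bmx. Qed.

Let SQ x (A : 'M[R]_(K, n)) : (S x *m A) *m Q = S x *m (A *m Q).
Proof. by rewrite mulmxA. Qed.

Let Sp x (A : 'M[R]_(K, n)) : coproj (S x *m A) = S x *m coproj A.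
Proof. by rewrite /coproj mulmxBr mulmxA. Qed.

Let coprojB (A B : 'M[R]_(K, n)) : coproj (A - B) = coproj A - coproj B.
Proof. by rewrite /coproj mulmxBl !opprB addrACA [RHS]addrACA; congr (_ + _); rewrite addrC. Qed.

Let coprojQ (A : 'M[R]_(K, n)) : coproj (A *m Q) = 0.
Proof. by rewrite /coproj -mulmxA QQ subrr. Qed.

Let L_split x : L x = LQ x + Lp x + dot (coproj Fs) (coproj Fs).
Proof.
have fq0 : coproj FQ = 0 by exact: coprojQ.
have fq1 : FQ *m Q = yQ - eQ by rewrite /FQ -mulmxA QQ /yQ /y mulmxDl addrK.
have fq2 : Fs *m Q = yQ - eQ by rewrite /yQ /y mulmxDl addrK.
have fq3 : coproj Fs = yp - ep by rewrite /yp /y /ep -coprojB addrK.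
have q1 : (S x *m y - Fs) *m Q = S x *m yQ - (yQ - eQ) by rewrite mulmxBl SQ fq2.
have q2 : (S x *m y - FQ) *m Q = S x *m yQ - (yQ - eQ) by rewrite mulmxBl SQ fq1.
have p1 : coproj (S x *m y - Fs) = S x *m yp - (yp - ep) by rewrite coprojB Sp fq3.
have p2 : coproj (S x *m y - FQ) = S x *m yp by rewrite coprojB Sp fq0 subr0.
rewrite /L (dot_proj_split (S x *m y - Fs)) (dot_proj_split (S x *m y - FQ) eta).
rewrite q1 q2 p1 p2 fq3 /LQ /Lp -/eQ -/ep.
exact: risk_split_identity.
Qed.

(** The Gibbs variance of each fitted entry appears with weight 1 in the mean of the squares and
    with weight [kap j i / T] in the Stein term. The bound of the kernel by [T] is exactly what
    makes the difference have the right sign. *)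
Let center_risk : dot (M - Fs) (M - Fs) <= E y L + dot eta M -
  \sum_j \sum_i kap j i * center_slope mu S T y j i - dot FQ eta.
Proof.
have bsq : bm (fun x => dot (S x *m y) (S x *m y)) by bmx.
have bl A : bm (fun x => dot (S x *m y) A) by bmx.
have EL : E y L = E y (fun x => dot (S x *m y) (S x *m y)) - dot M (2 *: Fs + eta) +
    E y SK + (dot Fs Fs + dot FQ eta).
  rewrite /M -E_dot -(gibbs_mean_cst mu T0 mS ST S0 S1 y (dot Fs Fs + dot FQ eta)).
  rewrite -gibbs_meanB// -gibbs_meanD//; last exact: bmB.
  rewrite -gibbs_meanD//; last 2 first.
  - by apply: bmD => //; exact: bmB.
  - exact: bm_cst.
  congr (E y _); apply/funext => x; rewrite /L !dotE_lin [dot Fs _]dotC; lra.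
have Esq : E y (fun x => dot (S x *m y) (S x *m y)) =
    \sum_j \sum_i E y (fun x => (S x *m y) j i ^+ 2).
  have be j i : bm (fun x => (S x *m y) j i) by apply: bmm_mul; bmx.
  have -> : (fun x => dot (S x *m y) (S x *m y)) = (fun x => \sum_j \sum_i (S x *m y) j i ^+ 2).
    by apply/funext => x; rewrite dotE; under eq_bigr do under eq_bigr do rewrite -expr2.
  rewrite E_sum => [|j]; last by apply: bm_sum => i; exact: bmX.
  by apply: eq_bigr => j _; rewrite E_sum => [|i]; last exact: bmX.
have ESK : E y SK = \sum_j \sum_i kap j i * E y (fun x => S x j j).
  rewrite /SK E_sum => [|j]; last by bmx.
  apply: eq_bigr => j _; rewrite E_sum => [|i]; last by bmx.
  by apply: eq_bigr => i _; rewrite gibbs_meanZ//; exact: bS.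
have h : dot M M + \sum_j \sum_i kap j i * center_slope mu S T y j i <=
    \sum_j \sum_i E y (fun x => (S x *m y) j i ^+ 2) +
    \sum_j \sum_i kap j i * E y (fun x => S x j j).
  rewrite dotE -!big_split/=; apply: ler_sum => j _; rewrite -!big_split/=; apply: ler_sum => i _.
  have /andP[h1 _] := center_sqr_le mu T0 mS ST S0 S1 y j i.
  rewrite -expr2 /center_slope -/M in h1 *.
  case/andP: (kapT j i) => k0 k1.
  have k2 : kap j i / T <= 1 by rewrite ler_pdivrMr// mul1r.
  rewrite -subr_ge0.
  rewrite (_ : _ - _ = (E y (fun x => (S x *m y) j i ^+ 2) - M j i ^+ 2) * (1 - kap j i / T)).
    by rewrite mulr_ge0// subr_ge0.
  by field; rewrite gt_eqF.
move: h; rewrite EL Esq ESK !dotE_lin [dot Fs M]dotC [dot eta M]dotC; lra.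
Qed.

(** Jensen for the logarithm of the ratio of the Gibbs weights at [y - FQ] and at [y], whose
    exponential mean is the ratio of the partition functions. This bounds the mean of
    [dot yQ (S x *m yQ)] from below: a large component along [Q] is shrunk little on average. *)
Let LQ_mean : E y LQ <= 5/4 * (g2 + 2 * T * kQ) + g2.
Proof.
have T2 : 0 < 2 * T by rewrite mulr_gt0.
pose h x := (dot (y - FQ) (S x *m (y - FQ)) - dot y (S x *m y)) / (2 * T).
have bh : bm h by rewrite /h; bmx.
have J := gibbs_mean_jensen mu T0 mS ST S0 S1 y bh.
have e1 : \int[mu]_x (expR (h x) * gibbs_weight S T y x) = Z (y - FQ).
  by apply: eq_Rintegral => x _; rewrite /gibbs_weight -expRD; congr expR; rewrite /h; ring.
have Zy := partition_gt0 mu T0 mS ST S0 S1 y.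
have Zy' := partition_gt0 mu T0 mS ST S0 S1 (y - FQ).
have {}J : E y h <= (dot (y - FQ) (y - FQ) - dot y y) / (2 * T) + kQ.
  by rewrite e1 in J; exact: (le_ln_ratio Zy' Zy J shiftQ).
have f2 : coproj (y - FQ) = yp by rewrite coprojB coprojQ subr0.
have f1 : (y - FQ) *m Q = eQ by rewrite mulmxBl /FQ -mulmxA QQ /y mulmxDl addrAC subrr add0r.
have hE x : dot (y - FQ) (S x *m (y - FQ)) - dot y (S x *m y) =
    dot eQ (S x *m eQ) - dot yQ (S x *m yQ).
  have h1 := dot_proj_split (y - FQ) (S x *m (y - FQ)); rewrite SQ Sp f1 f2 in h1.
  have h2 := dot_proj_split y (S x *m y); rewrite SQ Sp in h2.
  by rewrite h1 h2 opprD addrACA subrr addr0.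
have nE : dot (y - FQ) (y - FQ) - dot y y = g2 - dot yQ yQ.
  have h1 := dot_proj_split (y - FQ) (y - FQ); rewrite f1 f2 in h1.
  by rewrite h1 (dot_proj_split y y) opprD addrACA subrr addr0.
have bq : bm (fun x => - dot yQ (S x *m yQ)) by bmx.
have J2 : - E y (fun x => dot yQ (S x *m yQ)) <= g2 - dot yQ yQ + 2 * T * kQ.
  have h1 : E y (fun x => (2 * T)^-1 * (- dot yQ (S x *m yQ))) <= E y h.
    apply: gibbs_mean_le => //; first by bmx.
    move=> x; rewrite /h hE mulrC ler_pM2r ?invr_gt0//.
    by rewrite lerDr; exact: S0.
  have e3 : E y (fun x => (2 * T)^-1 * (- dot yQ (S x *m yQ))) =
      (2 * T)^-1 * (- E y (fun x => dot yQ (S x *m yQ))).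
    have bd : bm (fun x => dot yQ (S x *m yQ)) by bmx.
    rewrite gibbs_meanZ//; congr (_ * _); rewrite -mulN1r -gibbs_meanZ//.
    by congr (E y _); apply/funext => x; rewrite mulN1r.
  have h3 := le_trans h1 J; rewrite e3 nE in h3.
  exact: gibbs_step_shift h3.
have h2 : E y LQ <= E y (fun x => (5/4 * dot yQ yQ + g2) - 5/4 * dot yQ (S x *m yQ)).
  apply: gibbs_mean_le => //; first by bmx.
  move=> x; apply: gibbs_step_residual; last exact: young_dot.
  exact: contraction_residual.
apply: (le_trans h2); rewrite gibbs_meanB ?gibbs_meanZ ?gibbs_mean_cst//; [|bmx..].
exact: gibbs_step_mean.
Qed.

(** Multiplied by the Gibbs weight, the exponential of the part along [Q] is bounded by a constant
    in [x], and only the exponent of the complement remains under the integral. *)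
Let jensen_exponent : 13/10 * E y Lp + 8/10 * E y LQ <=
  dot yQ yQ + 8/10 * g2 + 2 * T * ln (noise_partition eta kap / Z y).
Proof.
have T2 : 0 < 2 * T by rewrite mulr_gt0.
pose h x := (2 * T)^-1 * (13/10 * Lp x + 8/10 * LQ x).
have bh : bm h by rewrite /h; bmx.
have J := gibbs_mean_jensen mu T0 mS ST S0 S1 y bh.
have Zy := partition_gt0 mu T0 mS ST S0 S1 y.
have Np := noise_partition_gt0 eta kap.
have EH : E y h = (2 * T)^-1 * (13/10 * E y Lp + 8/10 * E y LQ).
  have b1 : bm (fun x => 13/10 * Lp x) by bmx.
  have b2 : bm (fun x => 8/10 * LQ x) by bmx.
  have b12 : bm (fun x => 13/10 * Lp x + 8/10 * LQ x) by exact: bmD.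
  rewrite /h gibbs_meanZ//; congr (_ * _).
  by rewrite gibbs_meanD//; congr (_ + _); rewrite gibbs_meanZ.
pose c := (dot yQ yQ + 8/10 * g2) / (2 * T).
have bhw : bm (fun x => expR (h x) * gibbs_weight S T y x).
  by apply: bmM; [exact: bm_expR|exact: bm_gibbs_weight].
have I0 : 0 < \int[mu]_x (expR (h x) * gibbs_weight S T y x).
  apply: bm_integral_gt0 => //; case: (bh) => _ [B hB]; exists (expR (- B)); first exact: expR_gt0.
  move=> x; rewrite -[leLHS]mulr1 ler_pM ?expR_ge0//; last exact: gibbs_weight_ge1.
  by rewrite ler_expR; have := hB x; rewrite ler_norml => /andP[].
have up : \int[mu]_x (expR (h x) * gibbs_weight S T y x) <= expR c * noise_partition eta kap.
  have bn : bm (fun x => expR (noise_exponent eta kap x / (2 * T))).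
    by apply: bm_expR; apply: bmM; [exact: bm_noise_exponent|exact: bm_cst].
  rewrite /noise_partition -(bm_integralZ _ _ bn); apply: bm_integral_le; [exact: bhw|exact: bmZ|].
  move=> x; rewrite /gibbs_weight -!expRD ler_expR /h /c mulrC -!mulrDl ler_pM2r ?invr_gt0//.
  rewrite (dot_proj_split y) SQ Sp.
  apply: gibbs_step_pointwise; last exact: young_dot.
  exact: contraction_residual.
move: J; rewrite EH => J.
have {}J : (2 * T)^-1 * (13/10 * E y Lp + 8/10 * E y LQ) <= c + ln (noise_partition eta kap / Z y).
  apply: (le_ln_ratio I0 Zy J); apply: (le_trans up).
  rewrite expRD lnK ?posrE; last exact: divr_gt0 Np Zy.
  by rewrite -mulrA divfK// gt_eqF.
have := ler_wpM2l (ltW T2) J; rewrite mulVKf ?gt_eqF// mulrDr {1}/c.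
by rewrite [2 * T * (_ / (2 * T))]mulrC divfK ?gt_eqF.
Qed.

Lemma gibbs_risk_bound : 13/10 * dot (M - Fs) (M - Fs) <=
  13/10 * (dot (coproj Fs) (coproj Fs) - dot FQ eta + (dot eta M -
    \sum_j \sum_i kap j i * center_slope mu S T y j i)) +
  dot yQ yQ + 8/10 * g2 + 2 * T * ln (noise_partition eta kap / Z y) +
  5/4 * T * kQ + 9/8 * g2.
Proof.
have EL : E y L = E y LQ + E y Lp + dot (coproj Fs) (coproj Fs).
  have -> : L = (fun x => LQ x + Lp x + dot (coproj Fs) (coproj Fs)).
    by apply/funext => x; exact: L_split.
  by rewrite gibbs_meanD ?gibbs_meanD ?gibbs_mean_cst//; bmx.
have h := center_risk; rewrite EL in h.
exact: (gibbs_step_final h LQ_mean jensen_exponent).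
Qed.

End realization.

End gibbs_bound.

Lemma bm_comp d1 d2 (X : measurableType d1) (Y : measurableType d2) (R : realType)
  (f : Y -> R) (g : X -> Y) : bm f -> measurable_fun setT g -> bm (fun x => f (g x)).
Proof. by move=> [mf [M fM]] mg; split; [exact: (measurableT_comp mf mg)|exists M]. Qed.

(** The logarithm is linearized at [N = a], so that afterwards only the mean of the random partition
    function [N] is needed. *)
Lemma ln_ratio_le (R : realType) (N Z a w : R) : 0 < N -> 0 < Z -> 0 < a ->
  a <= Z * expR w -> ln (N / Z) <= N / a - 1 + w.
Proof.
move=> N0 Z0 a0 h.
have Na : 0 < N / a by exact: divr_gt0.
apply: (@le_ln_ratio _ _ N Z) => //.
have := expR_ge1Dx (N / a - 1); rewrite addrC subrK => h2.
rewrite expRD -mulrA [expR w * Z]mulrC.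
apply: (@le_trans _ _ (N / a * a)); first by rewrite divfK// gt_eqF.
by apply: ler_pM => //; exact: ltW.
Qed.

(** [117/40 = 1 + 8/10 + 9/8] collects the occurrences of [g], and [7/10 = 2 - 13/10] those of [e].
    With the mean noise bound [2/3] it becomes the [39/20] of the next lemma. *)
Lemma noisy_step_combine (R : realType) (T a r f e s qq g w N fe eF k : R) : 0 < T ->
  13/10 * r <= 13/10 * (f - e + s) + qq + 8/10 * g + 2 * T * w + 5/4 * T * k + 9/8 * g ->
  w <= N / a - 1 + fe -> qq = eF + 2 * e + g ->
  13/10 * r <= 13/10 * (f + s) + eF + 7/10 * e + 117/40 * g + 2 * T / a * N - 2 * T +
    2 * T * fe + 5/4 * T * k.
Proof.
move=> t0 h1 h2 h3; have h4 := ler_wpM2l (ltW t0) h2; move: h1; rewrite h3.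
have -> : 2 * T / a * N = 2 * (T * (N / a)) by ring.
rewrite -[2 * T * w]mulrA -[2 * T * fe]mulrA.
move: h4; rewrite mulrDr mulrBr mulr1; lra.
Qed.

Lemma noisy_step_final (R : realType) (T a c e u N : R) : 0 < T -> 0 < a -> e <= 2/3 * u ->
  N <= a -> c + 117/40 * e + 2 * T / a * N <= c + 2 * T + 39/20 * u.
Proof.
move=> T0 a0 h1 h2.
have h3 : 2 * T / a * N <= 2 * T by rewrite mulrAC ler_pdivrMr// ler_wpM2l// mulr_ge0// ltW.
lra.
Qed.

(** * Averaging the risk bound over the noise *)

Section noisy_risk.
Context d (Omega : measurableType d) {R : realType} (P : probability Omega R).
Context d' (U : measurableType d') (mu : probability U R).
Variables (K n : nat) (X Z : Omega -> 'M[R]_(K, n)) (B : R) (B0 : 0 < B).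
Hypotheses (mX : measurable_fun setT X) (mZ : measurable_fun setT Z).
Hypotheses (XB : forall w i j, `|X w i j| <= B) (ZB : forall w i j, `|Z w i j| <= B).
Hypothesis XZ_indep : box_independent P (fun w => col_mx (X w) (Z w)).
Hypothesis X_mean0 : forall i j, \int[P]_w X w i j = 0.
Hypothesis Z_uniform : forall i j (A : set R), measurable A ->
  P ((fun w => Z w i j) @^-1` A) = uniform_prob (gtrN B0) A.
Variables (S : U -> 'M[R]_K) (T : R).
Hypotheses (T0 : 0 < T) (BT : 2 * B ^+ 2 <= T) (mS : measurable_fun setT S).
Hypotheses (ST : forall x, (S x)^T = S x) (S0 : forall x, psd (S x)).
Hypothesis S1 : forall x, psd (1%:M - S x).
Hypothesis Sdiag : forall x j, 0 <= S x j j <= 1.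
Variables (Fs : 'M[R]_(K, n)) (Q : 'M[R]_n).
Hypotheses (QT : Q^T = Q) (QQ : Q *m Q = Q).

Let eta w := X w + Z w.
Let kap w : 'M[R]_(K, n) := \matrix_(j, i) stein_kernel B (X w j i) (eta w j i).
Let center w := gibbs_center mu S T (Fs + eta w).
Let slope w j i := center_slope mu S T (Fs + eta w) j i.

Let meta : measurable_fun setT eta. Proof. exact: measurable_addmx. Qed.

Let bX : bmm X.
Proof. by move=> j i; split; [exact: measurable_mxE|exists B]. Qed.
Let bZ : bmm Z.
Proof. by move=> j i; split; [exact: measurable_mxE|exists B]. Qed.
Let beta : bmm eta. Proof. exact: bmm_add. Qed.

Lemma kernel_range w j i : 0 <= kap w j i <= T.
Proof.
rewrite mxE /eta mxE stein_kernel_ge0//=.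
have := stein_kernel_le (X w j i + Z w j i) (XB w j i); have := sqr_ge0 (X w j i + Z w j i).
by move: BT; lra.
Qed.

Let bkap : bmm kap.
Proof.
move=> j i; split.
  under eq_fun do rewrite mxE; apply: measurable_stein_kernel; exact: measurable_mxE.
exists T => w; case/andP: (kernel_range w j i) => h1 h2; by rewrite ger0_norm.
Qed.

Let q := \sum_j \sum_i (`|Fs j i| + 2 * B) ^+ 2.

Let shift_bound (H : 'M[R]_(K, n)) : (forall k l, `|H k l| <= 2 * B) ->
  dot (Fs + H) (Fs + H) <= q.
Proof.
move=> HB; rewrite dotE /q; apply: ler_sum => j _; apply: ler_sum => i _.
rewrite -expr2 -[leLHS]real_normK ?num_real//; apply: lerXn2r; rewrite ?nnegrE//.
  by rewrite addr_ge0// mulr_ge0// ltW.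
by rewrite mxE (le_trans (ler_normD _ _))// lerD2l.
Qed.

Let eta_bound w k l : `|eta w k l| <= 2 * B.
Proof.
rewrite mxE (le_trans (ler_normD _ _))//.
have := XB w k l; have := ZB w k l; lra.
Qed.

Let q0 : 0 <= q.
Proof. by apply: sumr_ge0 => j _; apply: sumr_ge0 => i _; exact: sqr_ge0. Qed.

Let center_bound (H : 'M[R]_(K, n)) j i : (forall k l, `|H k l| <= 2 * B) ->
  `|gibbs_center mu S T (Fs + H) j i| <= 1 + q + q / T.
Proof.
move=> HB; have /andP[h1 h2] := center_sqr_le mu T0 mS ST S0 S1 (Fs + H) j i.
have h3 := shift_bound HB; have h4 : 0 <= q / T by rewrite divr_ge0// ltW.
have h5 := le_trans h1 (le_trans h2 h3); move: q0 h4 h5 => {h1 h2 h3}.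
move: (gibbs_center _ _ _ _ _ _) (q / T) q => m r s s0 r0 ms.
have := sqr_ge0 (`|m| - 1); rewrite sqrrB1 real_normK ?num_real//.
have := normr_ge0 m; lra.
Qed.

Let slope_bound (H : 'M[R]_(K, n)) j i : (forall k l, `|H k l| <= 2 * B) ->
  `|center_slope mu S T (Fs + H) j i| <= 1 + q + q / T.
Proof.
move=> HB.
have /andP[h1 h2] := center_slope_bound mu T0 mS ST S0 S1 (Fs + H) i (Sdiag ^~ j).
have h3 : dot (Fs + H) (Fs + H) / T <= q / T by rewrite ler_pM2r ?invr_gt0//; exact: shift_bound.
rewrite ger0_norm//; apply: (le_trans h2); have := q0; lra.
Qed.

Let mFs : measurable_fun setT (fun H : 'M[R]_(K, n) => Fs + H).
Proof. exact: measurable_addmx. Qed.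

Let mcF j i : measurable_fun setT (fun H : 'M[R]_(K, n) => gibbs_center mu S T (Fs + H) j i).
Proof.
by apply: (measurableT_comp (f := fun y => gibbs_center mu S T y j i)); [exact: measurable_center|exact: mFs].
Qed.

Let msF j i : measurable_fun setT (fun H : 'M[R]_(K, n) => center_slope mu S T (Fs + H) j i).
Proof.
by apply: (measurableT_comp (f := fun y => center_slope mu S T y j i)); [exact: measurable_center_slope|exact: mFs].
Qed.

Let bcenter j i : bm (fun w => center w j i).
Proof.
split; last by exists (1 + q + q / T) => w; exact: center_bound.
exact: (measurableT_comp (mcF j i) meta).
Qed.

Let bslope j i : bm (fun w => slope w j i).
Proof.
split; last by exists (1 + q + q / T) => w; exact: slope_bound.
exact: (measurableT_comp (msF j i) meta).
Qed.

Let upd_line (H : 'M[R]_(K, n)) j i v : Fs + upd H j i v = (Fs + upd H j i 0) + v *: delta_mx j i.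
Proof.
apply/matrixP => k l; rewrite !mxE.
by case: (_ && _); rewrite ?mulr1 ?mulr0 ?addr0.
Qed.

Let stein j i : \int[P]_w (eta w j i * center w j i - kap w j i * slope w j i) = 0.
Proof.
have := @stein_noise _ Omega R P K n X Z B B0 mX mZ XB ZB XZ_indep X_mean0 Z_uniform
  (fun H => gibbs_center mu S T (Fs + H) j i)
  (fun H => center_slope mu S T (Fs + H) j i) j i (1 + q + q / T).
move=> h; apply: (etrans _ (h _ _ _ _ _)).
- by apply: eq_Rintegral => w _; rewrite /kap mxE.
- exact: mcF.
- exact: msF.
- move=> H v; rewrite (_ : (fun v : R => _) = (fun v : R =>
    gibbs_center mu S T ((Fs + upd H j i 0) + v *: delta_mx j i) j i)); last first.
    by apply/funext => z; rewrite -upd_line.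
  by rewrite (upd_line H j i v); exact: is_derive_center.
- move=> H; rewrite (_ : (fun v : R => _) = (fun v : R =>
    center_slope mu S T ((Fs + upd H j i 0) + v *: delta_mx j i) j i)); last first.
    by apply/funext => z; rewrite -upd_line.
  exact: continuous_center_slope.
- by move=> H HB; split; [exact: center_bound|exact: slope_bound].
Qed.

Let mean_eta j i : \int[P]_w (eta w j i) = 0.
Proof.
have := @stein_noise _ Omega R P K n X Z B B0 mX mZ XB ZB XZ_indep X_mean0 Z_uniform
  (fun=> 1) (fun=> 0) j i 1.
move=> h; apply: (etrans _ (h _ _ _ _ _)).
- by apply: eq_Rintegral => w _; rewrite mulr1 mulr0 subr0.
- exact: measurable_cst.
- exact: measurable_cst.
- by move=> H v; exact: cvg_cst.
- by move=> H _; rewrite normr1 normr0.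
Qed.

Let cov_eta j i i' : \int[P]_w (eta w j i * eta w j i') = (i' == i)%:R * \int[P]_w (kap w j i).
Proof.
have bk : bm (fun w => kap w j i) by exact: bkap.
rewrite -bm_integralZ//; apply/eqP; rewrite -subr_eq0 -bm_integralB; last 2 first.
- by apply: bmM; exact: beta.
- exact: bmZ.
apply/eqP.
have := @stein_noise _ Omega R P K n X Z B B0 mX mZ XB ZB XZ_indep X_mean0 Z_uniform
  (fun H => H j i') (fun=> (i' == i)%:R) j i (2 * B + 1).
move=> h; apply: (etrans _ (h _ _ _ _ _)).
- by apply: eq_Rintegral => w _; rewrite /kap mxE [_%:R * _]mulrC.
- exact: measurable_entry.
- exact: measurable_cst.
- move=> H v; under eq_fun do rewrite mxE eqxx /=.
  by case: (i' == i); [exact: is_derive_id|exact: is_derive_cst].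
- by move=> H v; exact: cvg_cst.
- move=> H HB; split; first by have := HB j i'; lra.
  by case: (i' == i); rewrite ?normr1 ?normr0; have := B0; lra.
Qed.

Let mean_kap j i : \int[P]_w (kap w j i) <= 2 / 3 * T.
Proof.
have be : bm (fun w => eta w j i) by exact: beta.
have bk : bm (fun w => kap w j i) by exact: bkap.
have E : \int[P]_w (eta w j i ^+ 2) = \int[P]_w kap w j i.
  by under eq_Rintegral do rewrite expr2; rewrite cov_eta eqxx mul1r.
rewrite -E; apply: (le_trans (variance_le be bk E (B := B) _)).
  by move=> w; rewrite mxE; exact: stein_kernel_le.
by move: BT; lra.
Qed.

(** Stein's identity with a coordinate as test function shows that the entries of a row are
    uncorrelated and that their variance is the mean kernel, at most [2/3 T]; the projection then
    only contributes its trace. *)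
Lemma mean_proj_noise : \int[P]_w dot (eta w *m Q) (eta w *m Q) <= 2 / 3 * T * K%:R * \tr Q.
Proof.
have e w : dot (eta w *m Q) (eta w *m Q) =
    \sum_j \sum_i \sum_i' Q i' i * (eta w j i * eta w j i').
  rewrite dotMr QT -mulmxA QQ dotE; apply: eq_bigr => j _; apply: eq_bigr => i _.
  by rewrite [(eta w *m Q) j i]mxE mulr_sumr; apply: eq_bigr => i' _; ring.
under eq_Rintegral do rewrite e.
have b3 j i i' : bm (fun w => Q i' i * (eta w j i * eta w j i')).
  by apply: bmZ; apply: bmM; exact: beta.
rewrite bm_integral_sum; last by move=> j; apply: bm_sum => i; apply: bm_sum.
have Qd i : 0 <= Q i i.
  rewrite -{1}QQ mxE; apply: sumr_ge0 => k _.
  by rewrite -{2}QT mxE -expr2 sqr_ge0.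
apply: (@le_trans _ _ (\sum_(j < K) \sum_i Q i i * (2 / 3 * T))).
  apply: ler_sum => j _; rewrite bm_integral_sum; last by move=> i; apply: bm_sum.
  apply: ler_sum => i _; rewrite bm_integral_sum//.
  under eq_bigr => i' _.
    rewrite bm_integralZ; last by apply: bmM; exact: beta.
    rewrite cov_eta; over.
  rewrite (bigD1 i)//= eqxx mul1r big1 ?addr0.
    by rewrite ler_wpM2l.
  by move=> i' /negPf ->; rewrite mul0r mulr0.
rewrite sumr_const card_ord -mulr_suml -[_ *+ K]mulr_natl -/(\tr Q).
by rewrite le_eqVlt; apply/orP; left; apply/eqP; ring.
Qed.

Lemma mean_dot_noise (A : 'M[R]_(K, n)) : \int[P]_w dot A (eta w) = 0.
Proof.
under eq_Rintegral do rewrite dotE.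
have b2 j i : bm (fun w => A j i * eta w j i) by apply: bmZ; exact: beta.
rewrite bm_integral_sum; last by move=> j; apply: bm_sum.
rewrite big1// => j _; rewrite bm_integral_sum// big1// => i _.
by rewrite bm_integralZ ?mean_eta ?mulr0//; exact: beta.
Qed.

Let pS : bmm (fun p : Omega * U => S p.2).
Proof. by move=> j i; apply: (bm_comp (bmm_S mS ST S0 S1 j i)); exact: measurable_snd. Qed.

Let peta : bmm (fun p : Omega * U => eta p.1).
Proof. by move=> j i; apply: (bm_comp (beta j i)); exact: measurable_fst. Qed.

Let pkap : bmm (fun p : Omega * U => kap p.1).
Proof. by move=> j i; apply: (bm_comp (bkap j i)); exact: measurable_fst. Qed.

Lemma bm_noise_exponent2 :
  bm (fun p : Omega * U => expR (noise_exponent S Fs Q (eta p.1) (kap p.1) p.2 / (2 * T))).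
Proof.
have pcoeta : bmm (fun p : Omega * U => coproj Q (eta p.1)).
  by apply: bmm_sub => //; apply: bmm_mul => //; exact: bmm_cst.
have py : bmm (fun p : Omega * U => coproj Q (Fs + eta p.1)).
  have h : bmm (fun p : Omega * U => Fs + eta p.1) by apply: bmm_add => //; exact: bmm_cst.
  by apply: bmm_sub => //; apply: bmm_mul => //; exact: bmm_cst.
have pSy : bmm (fun p : Omega * U => S p.2 *m coproj Q (Fs + eta p.1)) by exact: bmm_mul.
apply: bm_expR; apply: bmM; last exact: bm_cst.
apply: bmD; last first.
  apply: bmZ; apply: bm_sum => j; apply: bm_sum => i; apply: bmM; [exact: pkap|exact: pS].
apply: bmD; last by apply: bmZ; exact: bm_dot.
by apply: bmB; apply: bmZ; exact: bm_dot.
Qed.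

Variables (a m kQ kbar : R) (Fbar : 'M[R]_(K, n)).
Hypotheses (a0 : 0 < a)
  (shiftQ : forall y, partition mu S T (y - Fs *m Q) <=
    expR ((dot (y - Fs *m Q) (y - Fs *m Q) - dot y y) / (2 * T) + kQ) * partition mu S T y)
  (shift_bar : forall y, a <= partition mu S T y *
    expR ((- dot y y + dot (y - Fbar) (y - Fbar) + m) / (2 * T) + kbar))
  (noise_le : \int[P]_w noise_partition mu S T Fs Q (eta w) (kap w) <= a).

Let g2 w := dot (eta w *m Q) (eta w *m Q).
Let Np w := noise_partition mu S T Fs Q (eta w) (kap w).
Let ff := dot (coproj Q Fs) (coproj Q Fs).
Let c0 := 13/10 * ff + dot (Fs *m Q) (Fs *m Q) - 2 * T - 2 * dot Fs Fbar + dot Fbar Fbar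
  + m + 2 * T * kbar + 5/4 * T * kQ.
Let qs w := \sum_j \sum_i (eta w j i * center w j i - kap w j i * slope w j i).

Let pointwise w : 13/10 * dot (center w - Fs) (center w - Fs) <=
  c0 + 7/10 * dot (Fs *m Q) (eta w) - 2 * dot Fbar (eta w) + 13/10 * qs w +
  117/40 * g2 w + 2 * T / a * Np w.
Proof.
have h1 := gibbs_risk_bound T0 mS ST S0 S1 QT QQ (kernel_range w) (shiftQ (Fs + eta w)).
have h2 := ln_ratio_le (noise_partition_gt0 mu T0 mS ST S0 S1 Fs Q (eta w) (kap w))
  (partition_gt0 mu T0 mS ST S0 S1 (Fs + eta w)) a0 (shift_bar (Fs + eta w)).
have h3 : dot ((Fs + eta w) *m Q) ((Fs + eta w) *m Q) =
   dot (Fs *m Q) (Fs *m Q) + 2 * dot (Fs *m Q) (eta w) + g2 w.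
  have e : dot (Fs *m Q) (eta w) = dot (Fs *m Q) (eta w *m Q).
    by rewrite [RHS]dotC [RHS]dotMr QT -mulmxA QQ dotC.
  by rewrite e mulmxDl !dotE_lin [dot (eta w *m Q) (Fs *m Q)]dotC /g2; ring.
have h := noisy_step_combine T0 h1 h2 h3; apply: (le_trans h).
have -> : 2 * T * ((- dot (Fs + eta w) (Fs + eta w) +
    dot (Fs + eta w - Fbar) (Fs + eta w - Fbar) + m) / (2 * T) + kbar) =
    - 2 * dot Fs Fbar - 2 * dot Fbar (eta w) + dot Fbar Fbar + m + 2 * T * kbar.
  rewrite (dotBr (Fs + eta w - Fbar)) (dotBl _ _ (Fs + eta w)) (dotBl _ _ Fbar).
  rewrite [dot Fbar (Fs + eta w)]dotC (dotDl _ _ Fbar) [dot (eta w) Fbar]dotC.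
  by field; rewrite gt_eqF.
have -> : dot (eta w) (gibbs_center mu S T (Fs + eta w)) -
    \sum_j \sum_i kap w j i * center_slope mu S T (Fs + eta w) j i = qs w.
  rewrite dotE -sumrB; apply: eq_bigr => j _; rewrite -sumrB; exact: eq_bigr.
rewrite -/ff -/(Np w) /c0 le_eqVlt; apply/orP; left; apply/eqP; ring.
Qed.

Lemma bm_center_risk : bm (fun w => dot (center w - Fs) (center w - Fs)).
Proof. by apply: bm_dot; apply: bmm_sub; [exact: bcenter|exact: bmm_cst|exact: bcenter|exact: bmm_cst]. Qed.

Lemma noisy_risk : 13/10 * \int[P]_w dot (center w - Fs) (center w - Fs) <=
  13/10 * ff + dot (Fs *m Q) (Fs *m Q) - 2 * dot Fs Fbar + dot Fbar Fbar
  + m + 2 * T * kbar + 5/4 * T * kQ + 39/20 * T * K%:R * \tr Q.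
Proof.
have bN : bm Np by exact: (bm_integral2 mu bm_noise_exponent2).
have bg : bm g2 by apply: bm_dot; apply: bmm_mul => //; exact: bmm_cst.
have bqe j i : bm (fun w => eta w j i * center w j i - kap w j i * slope w j i).
  by apply: bmB; apply: bmM; [exact: beta|exact: bcenter|exact: bkap|exact: bslope].
have bq : bm qs by apply: bm_sum => j; apply: bm_sum => i; exact: bqe.
have bl A : bm (fun w => dot A (eta w)) by apply: bm_dot => //; exact: bmm_cst.
have Eq : \int[P]_w qs w = 0.
  rewrite bm_integral_sum; last by move=> j; apply: bm_sum => i; exact: bqe.
  by rewrite big1// => j _; rewrite bm_integral_sum// big1// => i _; exact: stein.
rewrite -bm_integralZ; last exact: bm_center_risk.
have b1 : bm (fun w => c0 + 7/10 * dot (Fs *m Q) (eta w)) by apply: bmD; [exact: bm_cst|exact: bmZ].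
have b2 : bm (fun w => c0 + 7/10 * dot (Fs *m Q) (eta w) - 2 * dot Fbar (eta w)).
  by apply: bmB => //; exact: bmZ.
have b3 : bm (fun w => c0 + 7/10 * dot (Fs *m Q) (eta w) - 2 * dot Fbar (eta w) + 13/10 * qs w).
  by apply: bmD => //; exact: bmZ.
have b4 : bm (fun w => c0 + 7/10 * dot (Fs *m Q) (eta w) - 2 * dot Fbar (eta w) + 13/10 * qs w + 117/40 * g2 w).
  by apply: bmD => //; exact: bmZ.
apply: (@le_trans _ _ (\int[P]_w (c0 + 7/10 * dot (Fs *m Q) (eta w) - 2 * dot Fbar (eta w) +
    13/10 * qs w + 117/40 * g2 w + 2 * T / a * Np w))).
  apply: bm_integral_le => //; first by apply: bmZ; exact: bm_center_risk.
  by apply: bmD => //; exact: bmZ.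
have e4 := bm_integralD P b4 (bmZ (2 * T / a) bN); cbv beta in e4; rewrite e4 {e4}.
have e3 := bm_integralD P b3 (bmZ (117/40) bg); cbv beta in e3; rewrite e3 {e3}.
have e2 := bm_integralD P b2 (bmZ (13/10) bq); cbv beta in e2; rewrite e2 {e2}.
have e1 := bm_integralB P b1 (bmZ 2 (bl Fbar)); cbv beta in e1; rewrite e1 {e1}.
have e0 := bm_integralD P (bm_cst Omega c0) (bmZ (7/10) (bl (Fs *m Q))); cbv beta in e0; rewrite e0 {e0}.
rewrite !bm_integralZ// bm_integral_cst !mean_dot_noise Eq !mulr0 addr0 subr0 addr0.
have h1 : \int[P]_w g2 w <= 2 / 3 * (T * K%:R * \tr Q).
  by apply: (le_trans mean_proj_noise); rewrite !mulrA.
apply: (le_trans (noisy_step_final _ T0 a0 h1 noise_le)).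
by rewrite /c0 le_eqVlt; apply/orP; left; apply/eqP; ring.
Qed.

End noisy_risk.

(** * Exponential moments of quadratic forms in the noise *)

Section noise_mgf.
Context d (Omega : measurableType d) {R : realType} (P : probability Omega R).
Variables (K n : nat) (X Z : Omega -> 'M[R]_(K, n)) (B : R) (B0 : 0 < B).
Hypotheses (mX : measurable_fun setT X) (mZ : measurable_fun setT Z).
Hypotheses (XB : forall w i j, `|X w i j| <= B) (ZB : forall w i j, `|Z w i j| <= B).
Hypothesis XZ_indep : box_independent P (fun w => col_mx (X w) (Z w)).
Hypothesis X_mean0 : forall i j, \int[P]_w X w i j = 0.
Hypothesis Z_uniform : forall i j (A : set R), measurable A ->
  P ((fun w => Z w i j) @^-1` A) = uniform_prob (gtrN B0) A.
Variable T : R.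
Hypotheses (T0 : 0 < T) (BT : 2 * B ^+ 2 <= T).

Let eta w := X w + Z w.
Let kap w : 'M[R]_(K, n) := \matrix_(j, i) stein_kernel B (X w j i) (eta w j i).

Let bX : bmm X.
Proof. by move=> j i; split; [exact: measurable_mxE|exists B]. Qed.
Let bZ : bmm Z.
Proof. by move=> j i; split; [exact: measurable_mxE|exists B]. Qed.
Let beta : bmm eta. Proof. exact: bmm_add. Qed.
Let krange w j i : 0 <= kap w j i <= T. Proof. exact: kernel_range. Qed.
Let bkap : bmm kap.
Proof.
move=> j i; split.
  under eq_fun do rewrite mxE; apply: measurable_stein_kernel; first exact: measurable_mxE.
  by apply: measurable_mxE; exact: measurable_addmx.
exists T => w; case/andP: (krange w j i) => h1 h2; by rewrite ger0_norm.
Qed.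

Let horner_expR (h : R) (v : R) : is_derive v (1 : R) (fun v : R => expR (h * v)) (h * expR (h * v)).
Proof. exact: is_derive_expRZ. Qed.

Let upd_diag (H : 'M[R]_(K, n)) j i v : (upd H j i v) j i = v.
Proof. by rewrite mxE !eqxx. Qed.

Let stein_exp j i h : \int[P]_w (eta w j i * expR (h * eta w j i)) =
  h * \int[P]_w (kap w j i * expR (h * eta w j i)).
Proof.
have b1 : bm (fun w => expR (h * eta w j i)) by apply: bm_expR; apply: bmZ; exact: beta.
have b2 : bm (fun w => kap w j i * expR (h * eta w j i)) by apply: bmM => //; exact: bkap.
have b3 : bm (fun w => eta w j i * expR (h * eta w j i)) by apply: bmM => //; exact: beta.
rewrite -bm_integralZ//; apply/eqP; rewrite -subr_eq0 -(bm_integralB P b3 (bmZ h b2)); apply/eqP.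
have H := @stein_noise _ Omega R P K n X Z B B0 mX mZ XB ZB XZ_indep X_mean0 Z_uniform
  (fun H => expR (h * H j i)) (fun H => h * expR (h * H j i)) j i
  ((1 + `|h|) * expR (`|h| * (2 * B))).
apply: (etrans _ (H _ _ _ _ _)).
- by apply: eq_Rintegral => w _; rewrite /kap [(\matrix_(_, _) _) _ _]mxE mulrCA.
- apply: (measurableT_comp (@measurable_expR R)); apply: measurable_funM => //.
  exact: measurable_entry.
- apply: measurable_funM => //.
  apply: (measurableT_comp (@measurable_expR R)); apply: measurable_funM => //.
  exact: measurable_entry.
- move=> G v; rewrite (_ : (fun v : R => _) = (fun v : R => expR (h * v))) ?upd_diag//.
  by apply/funext => z; rewrite upd_diag.
- move=> G; rewrite (_ : (fun v : R => _) = (fun v : R => h * expR (h * v))); last first.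
    by apply/funext => z; rewrite upd_diag.
  move=> v; apply: cvgM; first exact: cvg_cst.
  have cE : continuous (fun v : R => expR (h * v)).
    by move=> z; apply: differentiable_continuous; apply/derivable1_diffP; have [] := horner_expR h z.
  exact: cE.
- move=> G GB.
  have e1 : expR (h * G j i) <= expR (`|h| * (2 * B)).
    rewrite ler_expR (le_trans (ler_norm _))// normrM ler_wpM2l//; exact: GB.
  rewrite normrM !(ger0_norm (expR_ge0 _)) mulrDl mul1r; split.
    by rewrite (le_trans e1)// lerDl mulr_ge0// expR_ge0.
  by rewrite (le_trans (ler_wpM2l (normr_ge0 h) e1))// lerDr expR_ge0.
Qed.

Let stein_sqr j i : \int[P]_w (eta w j i ^+ 2) = \int[P]_w (kap w j i).
Proof.
have bk : bm (fun w => kap w j i) by exact: bkap.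
have be : bm (fun w => eta w j i ^+ 2) by apply: bmX; exact: beta.
apply/eqP; rewrite -subr_eq0 -(bm_integralB P be bk); apply/eqP.
have H := @stein_noise _ Omega R P K n X Z B B0 mX mZ XB ZB XZ_indep X_mean0 Z_uniform
  (fun H => H j i) (fun=> 1) j i (2 * B + 1).
apply: (etrans _ (H _ _ _ _ _)).
- by apply: eq_Rintegral => w _; rewrite /kap [(\matrix_(_, _) _) _ _]mxE mulr1 expr2.
- exact: measurable_entry.
- exact: measurable_cst.
- move=> G v; rewrite (_ : (fun v : R => _) = id); first exact: is_derive_id.
  by apply/funext => z; rewrite upd_diag.
- by move=> G v; exact: cvg_cst.
- by move=> G GB; rewrite normr1; split; [have := GB j i; lra|have := B0; lra].
Qed.

Let entry_mgf j i h m : 0 <= m <= 13 / 20 ->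
  \int[P]_w expR (h * (eta w j i / Num.sqrt T) + m * (kap w j i / T)) <=
  expR (h ^+ 2 / 3 + 48 / 65 * m).
Proof.
move=> m01.
have be : bm (fun w => eta w j i) by exact: beta.
have bk : bm (fun w => kap w j i) by exact: bkap.
apply: (mgf_joint_le be bk (stein_exp j i) (stein_sqr j i) (B := B)) => //.
by move=> w; rewrite [(\matrix_(_, _) _) _ _]mxE [eta w j i]mxE; exact: stein_kernel_le.
Qed.

(** [expectation_prod] asks for factors bounded on all of [R * R]; clipping provides this and does
    not change the values taken on the noise. *)
Let clip (t : R) := Num.max (- B) (Num.min t B).

Let clip_id t : `|t| <= B -> clip t = t.
Proof.
rewrite ler_norml => /andP[h1 h2]; rewrite /clip min_l// max_r//.
Qed.

Let clip_le t : `|clip t| <= B.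
Proof.
have BB : - B <= B by rewrite ge0_cp// ltW.
by rewrite ler_norml /clip le_max lexx/= ge_max BB ge_min lexx orbT.
Qed.

Let mclip : measurable_fun setT clip.
Proof. by apply: measurable_maxr => //; apply: measurable_minr. Qed.

Let product_mgf (H : 'M[R]_(K, n)) (m : 'I_K -> R) : (forall j, 0 <= m j <= 13 / 20) ->
  \int[P]_w expR (dot H (eta w) / Num.sqrt T + \sum_j \sum_i m j * (kap w j i / T)) <=
  expR (dot H H / 3 + 48 / 65 * (n%:R * \sum_j m j)).
Proof.
move=> m01.
pose phi (e : 'I_K * 'I_n) (x z : R) := expR (H e.1 e.2 * ((clip x + clip z) / Num.sqrt T) +
  m e.1 * (stein_kernel B (clip x) (clip x + clip z) / T)).
have bphi e : bm (fun p : R * R => phi e p.1 p.2).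
  have b1 : bm (fun p : R * R => clip p.1).
    by split; [exact: (measurableT_comp mclip measurable_fst)|exists B].
  have b2 : bm (fun p : R * R => clip p.2).
    by split; [exact: (measurableT_comp mclip measurable_snd)|exists B].
  apply: bm_expR; apply: bmD; apply: bmZ; apply: bmM; (try exact: bm_cst); first exact: bmD.
  split.
    apply: measurable_stein_kernel; first by case: b1.
    by apply: measurable_funD; [case: b1|case: b2].
  by exists (2 * B ^+ 2) => p; apply: stein_kernel_normr.
have us : uniq (index_enum ('I_K * 'I_n)%type) by exact: index_enum_uniq.
have pE w : expR (dot H (eta w) / Num.sqrt T + \sum_j \sum_i m j * (kap w j i / T)) =
    \prod_(e <- index_enum ('I_K * 'I_n)%type) phi e (X w e.1 e.2) (Z w e.1 e.2).
  rewrite -expR_sum; congr expR; rewrite big_split/=; congr (_ + _).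
    rewrite dotE mulr_suml.
    rewrite [LHS](eq_bigr (fun j => \sum_i H j i * (eta w j i / Num.sqrt T))); last first.
      by move=> j _; rewrite mulr_suml; apply: eq_bigr => i _; rewrite mulrA.
    by rewrite pair_bigA/=; apply: eq_bigr => e _; rewrite !clip_id// /eta mxE.
  rewrite pair_bigA/=; apply: eq_bigr => e _.
  by rewrite !clip_id// /kap [(\matrix_(_, _) _) _ _]mxE [eta w _ _]mxE.
under eq_Rintegral do rewrite pE.
rewrite (expectation_prod mX mZ XZ_indep us bphi).
apply: (@le_trans _ _ (\prod_(e <- index_enum ('I_K * 'I_n)%type) expR (H e.1 e.2 ^+ 2 / 3 + 48 / 65 * m e.1))).
  apply: ler_prod => e _; apply/andP; split.
    by apply: bm_integral_ge0 => w; exact: expR_ge0.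
  rewrite (_ : \int[P]_w _ = \int[P]_w expR (H e.1 e.2 * (eta w e.1 e.2 / Num.sqrt T) + m e.1 * (kap w e.1 e.2 / T))).
    exact: entry_mgf.
  apply: eq_Rintegral => w _; rewrite /phi !clip_id//.
  by rewrite /kap [(\matrix_(_, _) _) _ _]mxE [eta w _ _]mxE.
rewrite -expR_sum ler_expR big_split/= le_eqVlt; apply/orP; left; apply/eqP; congr (_ + _).
  rewrite dotE mulr_suml [RHS](eq_bigr (fun j => \sum_i H j i ^+ 2 / 3)).
    by rewrite pair_bigA.
  by move=> j _; rewrite mulr_suml; apply: eq_bigr => i _; rewrite expr2.
rewrite -(pair_bigA _ (fun j (i : 'I_n) => 48 / 65 * m j))/= mulrA mulr_sumr; apply: eq_bigr => j _.
by rewrite sumr_const card_ord -mulr_natl; ring.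
Qed.

Variable S : 'M[R]_K.
Hypotheses (ST : S^T = S) (S0 : psd S) (S1 : psd (1%:M - S)).

Let SK w := \sum_j \sum_i kap w j i * S j j.

(** The square is linearized by an auxiliary Gaussian matrix [g], through
    [E exp (dot g u) = exp (dot u u / 2)] with [u = S eta / sqrt T]. For fixed [g] the exponent is a
    sum over entries and the noise factorizes; the Gaussian integral over [g] then yields the
    determinant. *)
Lemma gaussian_noise_mgf (C : 'M[R]_(K, n)) :
  \int[P]_w expR ((dot (S *m eta w) (S *m eta w) + 2 * dot C (eta w) + 13/10 * SK w) / (2 * T)) <=
  \det (1%:M - (2/3) *: (S *m S)) `^ (- (n%:R / 2)) * expR (dot C C / T + 12/25 * (n%:R * \tr S)).
Proof.
pose sT := Num.sqrt T; have sT0 : 0 < sT by rewrite sqrtr_gt0.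
have sTE : sT ^+ 2 = T by rewrite sqr_sqrtr// ltW.
pose c := sT^-1 *: C; set D := \det _ `^ _; pose g0 : R := gauss_mass K n.
have g00 : 0 < g0 by exact: gauss_mass_gt0.
(* [13/20] is [13/10] divided by the 2 of [2 * T]. Diagonal entries of [S] lie in [[0, 1]], so the
   coefficients stay in the range of the entrywise bound, and [48/65 * 13/20 = 12/25]. *)
pose W (w : Omega) (g : 'M[R]_(K, n)) := expR (dot (S *m g + c) (eta w) / sT +
  \sum_j \sum_i (13/20 * S j j) * (kap w j i / T)).
have SKE w : \sum_j \sum_i (13/20 * S j j) * (kap w j i / T) = 13/10 * SK w / (2 * T).
  rewrite /SK mulr_sumr mulr_suml; apply: eq_bigr => j _; rewrite mulr_sumr mulr_suml.
  by apply: eq_bigr => i _; field; rewrite gt_eqF.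
have bSK : bm SK.
  by apply: bm_sum => j; apply: bm_sum => i; apply: bmM; [exact: bkap|exact: bm_cst].
set G := fun w => expR ((dot (S *m eta w) (S *m eta w) + 2 * dot C (eta w) + 13/10 * SK w) / (2 * T)).
have bG : bm G.
  apply: bm_expR; apply: bmM; last exact: bm_cst.
  apply: bmD; last exact: bmZ; apply: bmD.
    by apply: bm_dot; apply: bmm_mul => //; exact: bmm_cst.
  by apply: bmZ; apply: bm_dot => //; exact: bmm_cst.
have inner w : (g0 * G w)%:E = (\int[lebesgue_mx]_g (expR (- (dot g g / 2)) * W w g)%:E)%E.
  have h := @integral_gauss_weight R K n 1%:M (sT^-1 *: (S *m eta w)) _.
  have sp1 : spd (1%:M : 'M[R]_K).
    by split; [rewrite trmx1|move=> l Y Y0; rewrite mul1mx lt0r dot_ge0 andbT; apply: contra_neq Y0; exact: dot_eq0].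
  have {}h := h sp1; rewrite det1 powR1 mulr1 invmx1 mul1mx in h.
  pose k := expR (dot c (eta w) / sT + 13/10 * SK w / (2 * T)).
  transitivity (k%:E * (\int[lebesgue_mx]_F (gauss_weight 1%:M (sT^-1 *: (S *m eta w)) F)%:E))%E.
    rewrite h -EFinM; congr (_%:E); rewrite mulrCA; congr (_ * _); rewrite /G /k -expRD; congr expR.
    rewrite /c !dotZl !dotZr -sTE; field; by rewrite gt_eqF.
  have gw0 (F : 'M[R]_(K, n)) : 0 <= gauss_weight 1%:M (sT^-1 *: (S *m eta w)) F by exact: expR_ge0.
  rewrite -(ge0_integralZl_real _ (expR_ge0 _) (measurable_gauss_weight _ _) gw0).
  apply: eq_integral => g _; congr (_%:E).
  rewrite /k /gauss_weight /W SKE -!expRD; congr expR.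
  rewrite mul1mx !dotZr dotDl [dot (S *m g) _]dotMl ST; field; by rewrite !gt_eqF.
have mW : measurable_fun setT (fun p : Omega * 'M[R]_(K, n) => (expR (- (dot p.2 p.2 / 2)) * W p.1 p.2)%:E).
  have mk : measurable_fun setT (fun p : Omega * 'M[R]_(K, n) => \sum_j \sum_i (13/20 * S j j) * (kap p.1 j i / T)).
    under eq_fun do rewrite SKE.
    apply: measurable_funM => //; apply: measurable_funM => //.
    by apply: (measurableT_comp (f := SK)); [case: bSK|exact: measurable_fst].
  have meta : measurable_fun setT (fun p : Omega * 'M[R]_(K, n) => eta p.1).
    by apply: measurable_addmx; [exact: (measurableT_comp mX measurable_fst)|exact: (measurableT_comp mZ measurable_fst)].
  apply/measurable_EFinP; apply: measurable_funM.
    apply: (measurableT_comp (@measurable_expR R)); apply: measurableT_comp => //.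
    by apply: measurable_funM => //; apply: measurable_dot; exact: measurable_snd.
  apply: (measurableT_comp (@measurable_expR R)); apply: measurable_funD => //.
  apply: measurable_funM => //; apply: measurable_dot => //.
  apply: measurable_addmx => //; apply: measurable_mulmx => //; exact: measurable_snd.
have W0 (p : Omega * 'M[R]_(K, n)) : (0 <= (expR (- (dot p.2 p.2 / 2)) * W p.1 p.2)%:E)%E.
  by rewrite lee_fin mulr_ge0 ?expR_ge0.
rewrite -(ler_pM2l g00) -lee_fin -bm_integralZ// -(bm_integralE P (bmZ g0 bG)).
under eq_integral do rewrite inner.
have FT := @fubini_tonelli _ _ _ _ R P lebesgue_mx _ mW W0.
rewrite FT {FT}.
have bW g : bm (fun w => W w g).
  apply: bm_expR; apply: bmD; last by under eq_fun do rewrite SKE; apply: bmM; [exact: bmZ|exact: bm_cst].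
  by apply: bmM; [apply: bm_dot => //; exact: bmm_cst|exact: bm_cst].
have m01 j : 0 <= 13/20 * S j j <= 13/20.
  have /andP[a1 a2] := trace_contraction_entry S0 S1 j; apply/andP; split; lra.
pose k := expR (12/25 * (n%:R * \tr S)).
apply: (@le_trans _ _ (\int[lebesgue_mx]_g (k * (expR (- (dot g g / 2)) * expR (dot (S *m g + c) (S *m g + c) / 3)))%:E)%E).
  apply: ge0_le_integral => //.
  - by move=> g _; apply: integral_ge0 => w _; exact: (W0 (w, g)).
  - exact: (measurable_fun_fubini_tonelli_G _ mW W0).
  - apply/measurable_EFinP; apply: measurable_funM => //; apply: measurable_funM.
      apply: (measurableT_comp (@measurable_expR R)); apply: measurableT_comp => //.
      by apply: measurable_funM => //; exact: measurable_dot.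
    apply: (measurableT_comp (@measurable_expR R)); apply: measurable_funM => //.
    by apply: measurable_dot; apply: measurable_addmx => //; apply: measurable_mulmx.
  move=> g _; have bWg : bm (fun w => expR (- (dot g g / 2)) * W w g) by exact: bmZ.
  rewrite (bm_integralE P bWg) lee_fin bm_integralZ// mulrCA.
  rewrite ler_wpM2l ?expR_ge0//; apply: (le_trans (product_mgf _ m01)).
  rewrite /k -expRD ler_expR -mulr_sumr addrC lerD2r le_eqVlt; apply/orP; left; apply/eqP.
  by rewrite /mxtrace; field.
have mg : measurable_fun setT (fun g : 'M[R]_(K, n) => expR (- (dot g g / 2)) * expR (dot (S *m g + c) (S *m g + c) / 3)).
  apply: measurable_funM.
    apply: (measurableT_comp (@measurable_expR R)); apply: measurableT_comp => //.
    by apply: measurable_funM => //; exact: measurable_dot.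
  apply: (measurableT_comp (@measurable_expR R)); apply: measurable_funM => //.
  by apply: measurable_dot; apply: measurable_addmx => //; apply: measurable_mulmx.
have g1 (g : 'M[R]_(K, n)) : 0 <= expR (- (dot g g / 2)) * expR (dot (S *m g + c) (S *m g + c) / 3).
  by rewrite mulr_ge0 ?expR_ge0.
rewrite (ge0_integralZl_real _ (expR_ge0 _) mg g1).
have GC := integral_gauss_contraction ST S0 S1 c.
have k0 : (0 <= k%:E)%E by rewrite lee_fin expR_ge0.
apply: (le_trans (lee_wpmul2l k0 GC)).
rewrite -EFinM lee_fin le_eqVlt; apply/orP; left; apply/eqP.
have -> : dot c c = dot C C / T by rewrite /c dotZl dotZr -sTE; field; rewrite gt_eqF.
rewrite expRD -/k -/D -/g0; ring.
Qed.

End noise_mgf.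

(** The cross terms collect into one linear form, with [95/100 = (2 * 16/10 - 13/10) / 2]. In the
    part quadratic in [e] the surplus [3/10] over [dot (S *m e) (S *m e)] is cancelled by
    [S^2 <= S]. *)
Lemma noise_quadratic (R : realType) K n (S : 'M[R]_K) (p e : 'M[R]_(K, n)) :
  S^T = S -> psd S -> psd (1%:M - S) ->
  13/10 * dot (S *m (p + e)) (S *m (p + e)) - 16/10 * dot (p + e) (S *m (p + e)) +
    13/10 * dot (S *m (p + e)) e <=
  dot (S *m e) (S *m e) + 2 * dot (S *m ((13/10) *: (S *m p) - (95/100) *: p)) e +
  (13/10 * dot (S *m p) (S *m p) - 16/10 * dot p (S *m p)).
Proof.
move=> ST S0 S1; have h := contraction_sqr_le ST S0 S1 e.
have e1 : dot (S *m (S *m p)) e = dot (S *m p) (S *m e) by rewrite dotMl ST.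
have e2 : dot (S *m p) e = dot p (S *m e) by rewrite dotMl ST.
have e3 : dot e (S *m p) = dot p (S *m e) by rewrite dotC e2.
have e4 : dot (S *m e) e = dot e (S *m e) by rewrite dotC.
have e5 : dot (S *m e) (S *m p) = dot (S *m p) (S *m e) by rewrite dotC.
rewrite !mulmxDr !mulmxN -!scalemxAr !dotE_lin e1 e2 e3 e4 e5; lra.
Qed.

Lemma noise_step_det (R : realType) (m a dd p l t : R) : a + 96/100 * t <= dd -> 0 <= m ->
  - (m / 2) * dd + 12/25 * (m * t) + (- (m / 2) * p + - l) <= - l + - (m / 2) * (p + a).
Proof. by move=> h m0; have := ler_wpM2l m0 h; lra. Qed.

Lemma noise_step_quadratic (R : realType) (a b c : R) :
  2 * c <= 16/10 * b - 13/10 * a -> 13/10 * a - 16/10 * b + 2 * c <= 0.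
Proof. lra. Qed.

Lemma eq_leLR (R : realType) (x y : \bar R) : x = y -> (x <= y)%E.
Proof. by move=> ->. Qed.

(** * The mean of the noise partition function *)

Section star.
Context d (Omega : measurableType d) {R : realType} (P : probability Omega R).
Variables (K n : nat) (X Z : Omega -> 'M[R]_(K, n)) (B : R) (B0 : 0 < B).
Hypotheses (mX : measurable_fun setT X) (mZ : measurable_fun setT Z).
Hypotheses (XB : forall w i j, `|X w i j| <= B) (ZB : forall w i j, `|Z w i j| <= B).
Hypothesis XZ_indep : box_independent P (fun w => col_mx (X w) (Z w)).
Hypothesis X_mean0 : forall i j, \int[P]_w X w i j = 0.
Hypothesis Z_uniform : forall i j (A : set R), measurable A ->
  P ((fun w => Z w i j) @^-1` A) = uniform_prob (gtrN B0) A.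
Variables (lam T : R).
Hypotheses (hK : (0 < K)%N) (hn : (0 < n)%N) (l0 : 0 < lam) (T0 : 0 < T) (BT : 2 * B ^+ 2 <= T).
Variables (Fs : 'M[R]_(K, n)) (Q : 'M[R]_n).
Hypotheses (QT : Q^T = Q) (QQ : Q *m Q = Q).

Let N := (n + K + 2)%N.
Let mu := latent_prior hK hn l0 T0.
Let S : 'M[R]_(K, N) -> 'M[R]_K := shrink T.
Let eta w := X w + Z w.
Let kap w : 'M[R]_(K, n) := \matrix_(j, i) stein_kernel B (X w j i) (eta w j i).

Let mS : measurable_fun setT S. Proof. exact: measurable_shrink. Qed.
Let ST G : (S G)^T = S G. Proof. exact: shrink_sym. Qed.
Let S0 G : psd (S G). Proof. exact: psd_shrink. Qed.
Let S1 G : psd (1%:M - S G). Proof. exact: psd_1Bshrink. Qed.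

Let bound G := \det (1%:M - (2/3) *: (S G *m S G)) `^ (- (n%:R / 2)) * expR (12/25 * (n%:R * \tr (S G))).

Let bexp2 : bm (fun p : Omega * 'M[R]_(K, N) =>
  expR (noise_exponent S Fs Q (eta p.1) (kap p.1) p.2 / (2 * T))).
Proof. exact: bm_noise_exponent2. Qed.

(** The projected noise is enlarged to the full noise in the quadratic term, and the linear
    coefficient [C] is already orthogonal to [Q]. The deterministic remainder is nonpositive by
    [contraction_quadratic], so the bound involves neither [Fs] nor [Q]. *)
Let noise_mgf_le G : \int[P]_w expR (noise_exponent S Fs Q (eta w) (kap w) G / (2 * T)) <= bound G.
Proof.
pose p := coproj Q Fs.
pose C := S G *m ((13/10) *: (S G *m p) - (95/100) *: p).
pose k := (13/10 * dot (S G *m p) (S G *m p) - 16/10 * dot p (S G *m p)) / (2 * T).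
have T2 : 0 < 2 * T by rewrite mulr_gt0.
have pE w : noise_exponent S Fs Q (eta w) (kap w) G / (2 * T) <=
   k + (dot (S G *m eta w) (S G *m eta w) + 2 * dot C (eta w) + 13/10 * (\sum_j \sum_i kap w j i * S G j j)) / (2 * T).
  rewrite -mulrDl ler_pM2r ?invr_gt0// /noise_exponent; cbv zeta.
  have -> : coproj Q (Fs + eta w) = p + coproj Q (eta w).
    by rewrite /p /coproj mulmxDl opprD addrACA.
  rewrite [leRHS]addrA lerD2r.
  apply: (le_trans (noise_quadratic p (coproj Q (eta w)) (ST G) (S0 G) (S1 G))).
  rewrite [leRHS]addrC lerD2r.
  have h1 : dot (S G *m coproj Q (eta w)) (S G *m coproj Q (eta w)) <= dot (S G *m eta w) (S G *m eta w).
    rewrite (dot_proj_split QT QQ (S G *m eta w)).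
    have -> : coproj Q (S G *m eta w) = S G *m coproj Q (eta w) by rewrite /coproj mulmxBr mulmxA.
    by rewrite lerDr dot_ge0.
  have h2 : dot C (coproj Q (eta w)) = dot C (eta w).
    have CQ : C *m Q = 0.
      have pQ : p *m Q = 0 by rewrite /p /coproj mulmxBl -mulmxA QQ subrr.
      have SpQ : S G *m p *m Q = 0 by rewrite -mulmxA pQ mulmx0.
      rewrite /C -[LHS]mulmxA mulmxBl -(scalemxAl (13/10) (S G *m p) Q) -(scalemxAl (95/100) p Q).
      by rewrite SpQ pQ !scaler0 subrr mulmx0.
    have CC : coproj Q C = C by rewrite /coproj CQ subr0.
    by rewrite [RHS](dot_proj_split QT QQ) CQ dot0l add0r CC.
  by rewrite -/C h2 lerD2r.
have bL : bm (fun w => expR (noise_exponent S Fs Q (eta w) (kap w) G / (2 * T))).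
  exact: (bm_pair2 G bexp2).
have beta : bmm eta.
  by apply: bmm_add; [move=> j i; split; [exact: measurable_mxE|exists B]|
                      move=> j i; split; [exact: measurable_mxE|exists B]].
have bkap : bmm kap.
  move=> j i; split.
    under eq_fun do rewrite mxE; apply: measurable_stein_kernel; first exact: measurable_mxE.
    by apply: measurable_mxE; exact: measurable_addmx.
  exists T => w; have /andP[h1 h2] := kernel_range XB ZB BT w j i.
  by rewrite ger0_norm.
pose M w := expR ((dot (S G *m eta w) (S G *m eta w) + 2 * dot C (eta w) + 13/10 * (\sum_j \sum_i kap w j i * S G j j)) / (2 * T)).
have bM : bm M.
  apply: bm_expR; apply: bmM; last exact: bm_cst.
  apply: bmD; last by apply: bmZ; apply: bm_sum => j; apply: bm_sum => i; apply: bmM; [exact: bkap|exact: bm_cst].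
  apply: bmD; first by apply: bm_dot; apply: bmm_mul => //; exact: bmm_cst.
  by apply: bmZ; apply: bm_dot => //; exact: bmm_cst.
apply: (@le_trans _ _ (\int[P]_w (expR k * M w))).
  apply: bm_integral_le => //; first exact: bmZ.
  by move=> w; rewrite /M -expRD ler_expR.
rewrite bm_integralZ//.
have h := gaussian_noise_mgf mX mZ XB ZB XZ_indep X_mean0 Z_uniform T0 BT (ST G) (S0 G) (S1 G) C.
apply: (le_trans (ler_wpM2l (expR_ge0 k) h)).
rewrite mulrCA /bound ler_wpM2l ?powR_ge0// -expRD ler_expR addrA gerDr.
have := contraction_quadratic (ST G) (S0 G) (S1 G) p; rewrite -/C => hC.
rewrite (_ : k + dot C C / T = (13/10 * dot (S G *m p) (S G *m p) - 16/10 * dot p (S G *m p) + 2 * dot C C) / (2 * T)); last first.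
  by rewrite /k; field; rewrite gt_eqF.
rewrite pmulr_lle0 ?invr_gt0//; move: hC; exact: noise_step_quadratic.
Qed.

(** What is left of [T^-1] after removing its [99/100]. It is positive, so [eps%:M + G *m G^T] is
    positive definite even when [G *m G^T] is singular. *)
Let eps := (100 * T)^-1.

Let density_bound G : bound G * latent_density lam T G <=
  expR (- (lam ^+ 2 * dot G G / 2)) * \det (eps%:M + G *m G^T) `^ (- (n%:R / 2)).
Proof.
have e0 : 0 < eps by rewrite invr_gt0 mulr_gt0.
pose A := \det (1%:M - (99/100) *: S G).
have Pg := spd_det_gt0 (spd_precision T0 G).
have De := spd_det_gt0 (spd_scalar_gram G e0).
have AE : \det (precision T G) * A = \det (eps%:M + G *m G^T).
  rewrite mulrC -det_mulmx mulmxBl mul1mx -scalemxAl shrink_precision//; congr (\det _).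
  rewrite /precision addrAC scale_scalar_mx -raddfB/=; congr (_%:M + _).
  by rewrite /eps; field; rewrite gt_eqF.
have A0 : 0 < A by rewrite -(pmulr_rgt0 _ Pg) AE.
have D0 := spd_det_gt0 (spd_contraction (ST G) (S0 G) (S1 G)).
have h := det_contraction_ineq (ST G) (S0 G) (S1 G); rewrite -/A in h.
rewrite -AE /bound /latent_density.
move: h D0; set D := \det (1%:M - _ *: _); set t := \tr _ => h D0.
rewrite -ler_ln ?posrE ?mulr_gt0 ?expR_gt0// lnM ?posrE ?expR_gt0// expRK in h.
rewrite /powR !gt_eqF ?mulr_gt0// lnM ?posrE// -!expRD ler_expR.
have n0 : 0 <= n%:R :> R by exact: ler0n.
exact: noise_step_det.
Qed.

Let joint (F : 'M[R]_(K, n)) (G : 'M[R]_(K, N)) :=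
  expR (- (dot G (((lam ^+ 2)%:M + F *m F^T) *m G) / 2)).

Let jointE F G : joint F G =
  expR (- (lam ^+ 2 * dot G G / 2)) * expR (- (dot F (G *m G^T *m F) / 2)).
Proof.
have h : dot G (F *m F^T *m G) = dot F (G *m G^T *m F).
  by rewrite /dot !mulmxA -(mulmxA _ F^T) mxtrace_mulC !mulmxA.
by rewrite /joint mulmxDl mul_scalar_mx dotDr dotZr h -expRD; congr expR; ring.
Qed.

Let mjoint : measurable_fun setT (fun p : 'M[R]_(K, n) * 'M[R]_(K, N) => (joint p.1 p.2)%:E).
Proof.
apply/measurable_EFinP; apply: (measurableT_comp (@measurable_expR R)); apply: measurableT_comp => //.
apply: measurable_funM => //; apply: measurable_dot; first exact: measurable_snd.
apply: measurable_mulmx; last exact: measurable_snd.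
apply: measurable_addmx => //; apply: measurable_mulmx; first exact: measurable_fst.
by apply: measurable_trmx; exact: measurable_fst.
Qed.

Let joint0 (p : 'M[R]_(K, n) * 'M[R]_(K, N)) : (0 <= (joint p.1 p.2)%:E)%E.
Proof. by rewrite lee_fin expR_ge0. Qed.

(** The determinant is reopened as a Gaussian integral over [F], and dropping [eps] from the
    precision only increases the integrand. *)
Let gauss_lower G : ((gauss_mass K n)%:E * (bound G * latent_density lam T G)%:E <=
  \int[lebesgue_mx]_F (joint F G)%:E)%E.
Proof.
have e0 : 0 < eps by rewrite invr_gt0 mulr_gt0.
set k := expR (- (lam ^+ 2 * dot G G / 2)).
have k0 : 0 <= k by exact: expR_ge0.
have sp : spd (eps%:M + G *m G^T) by exact: spd_scalar_gram.
have gw0 (F : 'M[R]_(K, n)) : 0 <= gauss_weight (eps%:M + G *m G^T) 0 F by exact: expR_ge0.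
have gI := @integral_gauss_weight R K n _ 0 sp.
rewrite dot0l mul0r expR0 mulr1 in gI.
have s : (k%:E * (gauss_mass K n * \det (eps%:M + G *m G^T) `^ (- (n%:R / 2)))%:E =
    \int[lebesgue_mx]_(F in [set: 'M[R]_(K, n)]) (k * gauss_weight (eps%:M + G *m G^T) 0 F)%:E)%E.
  rewrite (ge0_integralZl_real _ k0 (measurable_gauss_weight _ _) gw0); congr (_ * _)%E.
  exact: (esym gI).
apply: (@le_trans _ _ (k%:E * (gauss_mass K n * \det (eps%:M + G *m G^T) `^ (- (n%:R / 2)))%:E)%E).
  rewrite -!EFinM lee_fin [leRHS]mulrCA.
  apply: ler_wpM2l; first exact/ltW/gauss_mass_gt0.
  exact: (density_bound G).
rewrite s.
apply: ge0_le_integral => //.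
- by move=> F _; rewrite lee_fin mulr_ge0.
- by apply/measurable_EFinP; apply: measurable_funM => //; exact: measurable_gauss_weight.
- exact: (measurableT_comp mjoint (pair2_measurable G)).
move=> F _; rewrite lee_fin jointE -/k ler_wpM2l// ler_expR dot0r sub0r lerN2 ler_pM2r ?invr_gt0//.
by rewrite mulmxDl mul_scalar_mx dotDr dotZr lerDr mulr_ge0 ?dot_ge0// ltW.
Qed.

Let integral_jointF F : (\int[lebesgue_mx]_G (joint F G)%:E =
  (gauss_mass K N * student_density lam F)%:E :> \bar R)%E.
Proof.
have sp : spd ((lam ^+ 2)%:M + F *m F^T) by apply: spd_scalar_gram; rewrite exprn_gt0.
have := @integral_gauss_weight R K N _ 0 sp; rewrite dot0l mul0r expR0 mulr1 => <-.
by apply: eq_integral => G _; rewrite /gauss_weight dot0r sub0r.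
Qed.

(** Reading the scale mixture backwards: integrating [joint] over [G] returns the Student density,
    now without likelihood, and the integral over [F] is its total mass. *)
Lemma noise_partition_mean :
  \int[P]_w noise_partition mu S T Fs Q (eta w) (kap w) <=
  @student_total R K n lam / evidence lam T (0 : 'M[R]_(K, n)).
Proof.
pose C := @student_total R K n lam; pose ev0 := evidence lam T (0 : 'M[R]_(K, n)).
have ev : 0 < ev0 by exact: evidence0_gt0.
have g1 : 0 < gauss_mass K n :> R by exact: gauss_mass_gt0.
have g2 : 0 < gauss_mass K N :> R by exact: gauss_mass_gt0.
have tot0 := latent_total_gt0 hK hn l0 T0.
pose h G := \int[P]_w expR (noise_exponent S Fs Q (eta w) (kap w) G / (2 * T)).
set L := (X in X <= _).
have LE : L = \int[mu]_G h G.
  have f1 := bm_fubini1 P mu bexp2; have f2 := bm_fubini2 P mu bexp2.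
  by rewrite /L /h -f2 f1.
have bh : bm h.
  have bsw : bm (fun p : 'M[R]_(K, N) * Omega => expR (noise_exponent S Fs Q (eta p.2) (kap p.2) p.1 / (2 * T))).
    by apply: (bm_comp (f := fun p => expR (noise_exponent S Fs Q (eta p.1) (kap p.1) p.2 / (2 * T)))
      (g := fun p : 'M[R]_(K, N) * Omega => (p.2, p.1)) bexp2); exact: measurable_swap.
  exact: (bm_integral2 P bsw).
have mb : measurable_fun setT bound.
  apply: measurable_funM.
    apply: measurable_powR_comp; apply: measurable_det; apply: measurable_submx => //.
    by apply: measurable_scalemx => //; apply: measurable_mulmx.
  apply: (measurableT_comp (@measurable_expR R)); apply: measurable_funM => //.
  by apply: measurable_funM => //; exact: measurable_mxtrace.
have b0 G : 0 <= bound G by rewrite mulr_ge0 ?powR_ge0 ?expR_ge0.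
have ld0 (G : 'M[R]_(K, N)) : 0 <= @latent_density R K n lam T G by exact: latent_density_ge0.
have mld : measurable_fun setT (@latent_density R K n lam T) by exact: measurable_latent_density.
pose I := (\int[lebesgue_mx]_G (bound G * latent_density lam T G)%:E)%E.
have s1 : (L%:E <= (@latent_total R K n lam T)^-1%:E * I)%E.
  rewrite LE -(bm_integralE mu bh).
  apply: (@le_trans _ _ (\int[mu]_G (bound G)%:E)%E).
    apply: ge0_le_integral => //.
    - by move=> G _; rewrite lee_fin; apply: bm_integral_ge0 => w; exact: expR_ge0.
    - by apply/measurable_EFinP; case: bh.
    - exact/measurable_EFinP.
    - by move=> G _; rewrite lee_fin; exact: noise_mgf_le.
  rewrite /mu /latent_prior ge0_integral_nd//; exact/measurable_EFinP.
have s2 : ((gauss_mass K n)%:E * I <= (gauss_mass K N * C)%:E)%E.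
  rewrite /I -ge0_integralZl_EFin ?(ltW g1)//; last 2 first.
  - by first [move=> G _; rewrite lee_fin mulr_ge0|apply/measurable_EFinP; exact: measurable_funM].
  - by first [move=> G _; rewrite lee_fin mulr_ge0|apply/measurable_EFinP; exact: measurable_funM].
  apply: (@le_trans _ _ (\int[lebesgue_mx]_G \int[lebesgue_mx]_F (joint F G)%:E)%E).
    apply: ge0_le_integral => //.
    - by move=> G _; rewrite mule_ge0 ?lee_fin ?(ltW g1)// mulr_ge0.
    - by apply: emeasurable_funM => //; apply/measurable_EFinP; exact: measurable_funM.
    - exact: (measurable_fun_fubini_tonelli_G _ mjoint joint0).
  have FT := @fubini_tonelli _ _ _ _ R lebesgue_mx lebesgue_mx _ mjoint joint0.
  have FT' := eq_leLR (esym FT).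
  apply: (le_trans FT').
  under eq_integral do rewrite integral_jointF.
  rewrite ge0_integralZl_real ?(ltW g2)//; last 2 first.
  - by first [exact: measurable_student_density|exact: student_density_ge0].
  - by first [exact: measurable_student_density|exact: student_density_ge0].
  by rewrite (integral_student_density hK hn l0) -EFinM.
have s3 : (L * (@latent_total R K n lam T * gauss_mass K n) <= gauss_mass K N * C).
  rewrite -lee_fin; apply: le_trans s2.
  have t0 : (0 <= (@latent_total R K n lam T * gauss_mass K n)%:E)%E.
    by rewrite lee_fin mulr_ge0// ltW.
  rewrite EFinM muleC; apply: (le_trans (lee_wpmul2l t0 s1)).
  by rewrite muleA -EFinM mulrAC divff ?mul1r// gt_eqF.
move: s3; rewrite /latent_total divfK ?gt_eqF// mulrCA ler_pM2l// => s3.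
by rewrite ler_pdivlMr.
Qed.

End star.

(** * The oracle inequality *)

Section scalar_conclusion.
Context {R : realType}.

Lemma ln1D_ge (q : R) : 0 <= q -> 2 * q <= ln (1 + q) * (2 + q).
Proof.
move=> q0; have q1 : 0 < 1 + q by rewrite ltr_wpDr.
have d0 : 0 <= ln (1 + q) by rewrite ln_ge0// lerDl.
have := expR_trapezoid d0; rewrite lnK ?posrE//.
have -> : 1 + q - 1 = q by ring.
by have -> : 1 + q + 1 = 2 + q by ring.
Qed.

Lemma ln1D_concave (p q : R) : 0 <= p <= 1 -> 0 <= q -> p * ln (1 + q) <= ln (1 + p * q).
Proof.
move=> /andP[p0 p1] q0; have q1 : 0 < 1 + q by rewrite ltr_wpDr.
have pq : 0 < 1 + p * q by rewrite ltr_wpDr// mulr_ge0.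
have := @expR_chord R (ln (1 + q)) p; rewrite p0 p1 lnK ?posrE// => /(_ isT).
have -> : 1 + q - 1 = q by ring.
by move=> h; rewrite -[leLHS]expRK ler_ln ?posrE ?expR_gt0// mulrC.
Qed.

Lemma ln10_ge : 9 / 4 <= ln (10 : R).
Proof.
have h1 := @ln1D_ge (1/3) (divr_ge0 ler01 (ler0n _ _)).
have h2 := @ln1D_ge (1/2) (divr_ge0 ler01 (ler0n _ _)).
have h3 := @ln1D_ge (1/4) (divr_ge0 ler01 (ler0n _ _)).
(* Each factor is close to 1, where [ln1D_ge] is accurate: the sum is [3 (2/7 + 2/5) + 2/9], which
   exceeds [9/4]. *)
have -> : (10 : R) = ((1 + 1/3) * (1 + 1/2)) ^+ 3 * (1 + 1/4) by field.
have p1 : 0 < (1 + 1/3 : R) by lra.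
have p2 : 0 < (1 + 1/2 : R) by lra.
have p3 : 0 < (1 + 1/4 : R) by lra.
rewrite lnM ?posrE ?exprn_gt0 ?mulr_gt0// lnXn ?mulr_gt0// lnM ?posrE// -[_ *+ 3]mulr_natl.
lra.
Qed.

(** The coefficients are what [scalar_conclusion] has to spare: [267/400 = 348/100 - 45/16], and
    [113/200] is just below [3/26 * 59/12]. *)
Lemma small_dimension_cost (K N q : R) : 1 <= K -> K + 3 <= N -> 0 < q ->
  3/2 * (K / N) <= ln (1 + q) * (267/400 + 113/200 * K / q ^+ 2).
Proof.
move=> K1 KN q0.
have KN1 : K / N <= K / (K + 3).
  rewrite ler_wpM2l//; first lra.
  by rewrite lef_pV2 ?posrE//; lra.
have k0 : 0 <= K / q ^+ 2 by rewrite divr_ge0 ?sqr_ge0//; lra.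
have l0 : 0 <= ln (1 + q) by rewrite ln_ge0// lerDl ltW.
have [q9|q9] := leP 9 q.
  have h : 9/4 <= ln (1 + q).
    by apply: (le_trans ln10_ge); rewrite ler_ln ?posrE//; lra.
  have : K / (K + 3) <= 1 by rewrite ler_pdivrMr; lra.
  have a1 : 0 <= ln (1 + q) * (113/200 * K / q ^+ 2).
    apply: (mulr_ge0 l0); rewrite -mulrA; apply: (mulr_ge0 _ k0); lra.
  rewrite mulrDr; lra.
have h := ln1D_ge (ltW q0).
have q2 : 0 < 2 + q by lra.
have h1 : 2 * q / (2 + q) <= ln (1 + q) by rewrite ler_pdivrMr.
have c0 : 0 <= 267/400 + 113/200 * K / q ^+ 2 by rewrite -mulrA; lra.
apply: le_trans (ler_wpM2r c0 h1).
apply: (@le_trans _ _ (3/2 * (K / (K + 3)))); first by rewrite ler_pM2l//; lra.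
have K3 : 0 < K + 3 by lra.
rewrite -subr_ge0.
(* A certificate valid for [q <= 9], where the factor multiplying [K] in the numerator is
   nonnegative; larger [q] were treated by [ln10_ge]. *)
have -> : 2 * q / (2 + q) * (267/400 + 113/200 * K / q ^+ 2) - 3/2 * (K / (K + 3)) =
  ((53/50 * K - 2 * q) ^+ 2 + K * (339/100 + 31/25 * q - 33/200 * q ^+ 2)
    + 4/625 * K ^+ 2 + 1/200 * q ^+ 2) / (q * (2 + q) * (K + 3)).
  by field; rewrite !gt_eqF.
apply: divr_ge0; last by rewrite !mulr_ge0// ltW.
have a1 := sqr_ge0 (53/50 * K - 2 * q).
have a2 : 0 <= K * (339/100 + 31/25 * q - 33/200 * q ^+ 2).
  apply: mulr_ge0; first lra.
  have : q ^+ 2 <= 9 * q by rewrite expr2 ler_pM2r// ltW.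
  lra.
have a3 := sqr_ge0 K; have a4 := sqr_ge0 q.
by apply: addr_ge0; [apply: addr_ge0; [exact: addr_ge0|lra]|lra].
Qed.

(** This quadratic arises in [shift_tradeoff]. The point [40/57] is close to its minimizer and the
    minimum is about 1/1000, so [348/100] is nearly the best constant there. *)
Lemma tradeoff_quadratic (p : R) : 0 <= p ->
  0 <= 35/6 * (p - 40/57) ^+ 2 + (59/6 - 696/100 - 35/6 * (40/57) ^+ 2) + (35/3 * (40/57) - 614/75) * p.
Proof.
move=> p0; have u0 := sqr_ge0 (p - 40/57).
have c1 : 0 <= 59/6 - 696/100 - 35/6 * (40/57) ^+ 2 :> R by lra.
have c2 : 0 <= 35/3 * (40/57) - 614/75 :> R by lra.
by apply: addr_ge0; [apply: addr_ge0 => //; exact: mulr_ge0|exact: mulr_ge0].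
Qed.

(** With [p = qy / qx], concavity of the logarithm gives [p ln (1 + qx) <= ln (1 + qy)], while the
    distance bound gives [(1 - p)^2 L qx^2 <= D]: either the two logarithms are comparable, or [D]
    is large. For [qx <= qy] monotonicity suffices. *)
Lemma shift_tradeoff (L D qx qy : R) : 0 <= L -> 0 <= D -> 0 <= qx -> 0 <= qy ->
  L * (qx - qy) ^+ 2 <= D -> D + 59/6 * ln (1 + qy) < L * qx ^+ 2 ->
  [/\ 0 < qx, 348/100 * ln (1 + qx) <= D + 4 * ln (1 + qy) &
      59/12 * ln (1 + qx) <= L * qx ^+ 2].
Proof.
move=> L0 D0 x0 y0 hD hL.
have lx : 0 <= ln (1 + qx) by rewrite ln_ge0// lerDl.
have ly : 0 <= ln (1 + qy) by rewrite ln_ge0// lerDl.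
have xp : 0 < qx.
  rewrite lt_def x0 andbT; apply/eqP => xE; move: hL; rewrite xE expr0n/= mulr0; lra.
have [xy|yx] := leP qx qy.
  have : ln (1 + qx) <= ln (1 + qy) by rewrite ler_ln ?posrE ?lerD2l// ltr_wpDr.
  by split=> //; lra.
pose p := qy / qx; have yE : qy = p * qx by rewrite /p divfK// gt_eqF.
have p0 : 0 <= p by rewrite divr_ge0.
have p1 : p < 1 by rewrite ltr_pdivrMr// mul1r.
have hly : p * ln (1 + qx) <= ln (1 + qy) by rewrite yE; apply: ln1D_concave => //; rewrite p0 ltW.
set W := L * qx ^+ 2 in hL *.
have hDW : W * (1 - p) ^+ 2 <= D.
  by apply: le_trans hD; rewrite /W yE le_eqVlt; apply/orP; left; apply/eqP; ring.
move: hly hL lx ly hDW; move: (ln (1 + qx)) (ln (1 + qy)) W => a b W hb hL a0 b0 hDW {hD yE}.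
have s0 : 0 <= (1 - p) ^+ 2 by exact: sqr_ge0.
have pp : 0 < p.
  rewrite lt_def p0 andbT; apply/eqP => pE; move: hDW; rewrite pE subr0 expr1n mulr1; lra.
have h1 : (D + 59/6 * b) * (1 - p) ^+ 2 <= D by apply: le_trans hDW; rewrite ler_wpM2r// ltW.
have h2 : p * (59/6 * a * (1 - p) ^+ 2) <= p * (D * (2 - p)).
  have := ler_wpM2r s0 hb.
  have -> : p * (D * (2 - p)) = D - D * (1 - p) ^+ 2 by ring.
  move: h1; rewrite mulrDl; move=> h1 h3.
  have -> : p * (59/6 * a * (1 - p) ^+ 2) = 59/6 * (p * a * (1 - p) ^+ 2) by ring.
  move: h1; rewrite -[59/6 * b * _]mulrA.
  move: (D * _) (p * a * _) (b * _) h3 => *; lra.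
rewrite ler_pM2l// in h2.
have t0 : 0 < 2 - p by lra.
have h3 : p * a * (2 - p) <= b * (2 - p) by rewrite ler_wpM2r// ltW.
split=> //.
  rewrite -(ler_pM2r t0).
  apply: (@le_trans _ _ (59/6 * a * (1 - p) ^+ 2 + 4 * (p * a * (2 - p)))); last first.
    have h4 : 4 * (p * a * (2 - p)) <= 4 * (b * (2 - p)) by rewrite ler_pM2l.
    have -> : (D + 4 * b) * (2 - p) = D * (2 - p) + 4 * (b * (2 - p)) by ring.
    exact: lerD.
  rewrite -subr_ge0.
  have -> : 59/6 * a * (1 - p) ^+ 2 + 4 * (p * a * (2 - p)) - 348/100 * a * (2 - p) =
    a * (35/6 * (p - 40/57) ^+ 2 + (59/6 - 696/100 - 35/6 * (40/57) ^+ 2) + (35/3 * (40/57) - 614/75) * p).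
    by field.
  have tq := tradeoff_quadratic p0; apply: mulr_ge0; [exact a0|exact tq].
apply: ltW; apply: le_lt_trans hL; rewrite -(ler_pM2r t0).
apply: (@le_trans _ _ (59/6 * a * (1 - p) ^+ 2 + 59/6 * (p * a * (2 - p)))); last first.
  have h4 : 59/6 * (p * a * (2 - p)) <= 59/6 * (b * (2 - p)) by rewrite ler_pM2l.
  have -> : (D + 59/6 * b) * (2 - p) = D * (2 - p) + 59/6 * (b * (2 - p)) by ring.
  exact: lerD.
have -> : 59/6 * a * (1 - p) ^+ 2 + 59/6 * (p * a * (2 - p)) = 59/6 * a by ring.
have := mulr_ge0 a0 p0; rewrite mulrBr -mulrA; lra.
Qed.

(** Here [qx] and [qy] are the arguments of the logarithms for [Fstar Q] and [Fbar], while [L qx^2]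
    and [D] are [|Fstar Q|^2] and [|Fstar Q - Fbar|^2] measured in units of [T N r]. *)
Lemma scalar_conclusion (K N L D qx qy : R) : 1 <= K -> K + 3 <= N ->
  0 <= L -> 0 <= D -> 0 <= qx -> 0 <= qy ->
  L * (qx - qy) ^+ 2 <= D -> D + 59/6 * ln (1 + qy) < L * qx ^+ 2 ->
  45/16 * ln (1 + qx) + 3/2 * (K / N) <= D + 4 * ln (1 + qy) + 3/26 * (K * L).
Proof.
move=> K1 KN L0 D0 x0 y0 hD hL.
have [xp h1 h2] := shift_tradeoff L0 D0 x0 y0 hD hL.
have h3 := small_dimension_cost K1 KN xp.
have x2 : 0 < qx ^+ 2 by rewrite exprn_gt0.
have h4 : 59/12 * (ln (1 + qx) * (K / qx ^+ 2)) <= K * L.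
  have K0 : 0 <= K / qx ^+ 2 by rewrite divr_ge0// ?ltW//; lra.
  have := ler_wpM2r K0 h2.
  have -> : L * qx ^+ 2 * (K / qx ^+ 2) = K * L by field; rewrite gt_eqF.
  by rewrite [59/12 * (_ * _)]mulrA.
have lx : 0 <= ln (1 + qx) by rewrite ln_ge0// lerDl.
have h5 : 0 <= ln (1 + qx) * (K / qx ^+ 2).
  by rewrite mulr_ge0// divr_ge0 ?ltW//; lra.
have e : ln (1 + qx) * (267/400 + 113/200 * K / qx ^+ 2) =
  267/400 * ln (1 + qx) + 113/200 * (ln (1 + qx) * (K / qx ^+ 2)) by ring.
rewrite e in h3; clear e; lra.
Qed.

End scalar_conclusion.

(** Gram-Schmidt on the row space, by the Cholesky factor of the Gram matrix of a row basis. *)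
Lemma orthonormal_basis (R : realType) K n (A : 'M[R]_(K, n)) :
  exists V : 'M[R]_(n, \rank A), V^T *m V = 1%:M /\ A *m (V *m V^T) = A.
Proof.
pose r := \rank A; pose W := row_base A.
have WW : spd (W *m W^T).
  split; first by rewrite trmx_mul trmxK.
  move=> l Y Y0; rewrite -mulmxA; have {1}-> : W = W^T^T by rewrite trmxK.
  rewrite -dotMl lt0r dot_ge0 andbT; apply: contra_neq Y0 => /dot_eq0 h.
  have rf : row_free W by exact: row_base_free.
  have := congr1 trmx h; rewrite trmx_mul trmxK trmx0 => h2.
  have : Y^T = 0 by apply: (row_free_inj rf); rewrite h2 mul0mx.
  by move/(congr1 trmx); rewrite trmxK trmx0.
have [L [LE L0 _]] := cholesky WW.
have uL : L \in unitmx by rewrite unitmxE unitfE gt_eqF.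
pose V := (invmx L *m W)^T; exists V.
have VT : V^T = invmx L *m W by rewrite trmxK.
split.
  rewrite VT /V trmx_mul mulmxA -(mulmxA (invmx L) W) LE trmx_inv mulmxA mulVmx// mul1mx.
  by rewrite mulmxV// unitmx_tr.
have [D AE] : exists D, A = D *m V^T.
  have /submxP[D0 hD] : (A <= W)%MS by rewrite eq_row_base.
  by exists (D0 *m L); rewrite VT -mulmxA mulKVmx.
have V1 : V^T *m V = 1%:M.
  rewrite VT /V trmx_mul mulmxA -(mulmxA (invmx L) W) LE trmx_inv mulmxA mulVmx// mul1mx.
  by rewrite mulmxV// unitmx_tr.
have e : D *m V^T *m (V *m V^T) = D *m V^T by rewrite -!mulmxA (mulmxA V^T V) V1 mul1mx.
by rewrite -AE in e.
Qed.

Lemma le_oracle_small (R : realType) (rho d fs w a m : R) : 0 <= m ->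
  13/10 * rho <= 3/10 * fs + d + m + 9/4 * w -> fs - d <= 59/6 * w -> a = 4 * w ->
  rho <= d + a + m.
Proof. move=> m0 h1 h2 ->; lra. Qed.

Lemma le_oracle_big (R : realType) (rho p e x y u v m t : R) :
  13/10 * rho <= 13/10 * p + m + 13/4 * t + 39/20 * u -> t = 9/8 * x ->
  45/16 * x + 3/2 * u <= e + 4 * y + 3/26 * v -> v <= 2 * m ->
  rho <= (p + e) + 4 * y + m.
Proof. by move=> h1 tE h2 h3; rewrite tE in h1; lra. Qed.

Lemma ratio_le_expR (R : realType) (e0 a b p q k : R) : 0 < e0 ->
  e0 * expR (- a) * p <= expR k * (e0 * expR (- b) * q) -> p <= expR (a - b + k) * q.
Proof.
move=> e00; have -> : expR k * (e0 * expR (- b) * q) = e0 * expR (- a) * (expR (a - b + k) * q).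
  rewrite (_ : a - b + k = a + (- b + k)) ?addrA// !expRD [expR (- a)]expRN.
  by field; rewrite gt_eqF// expR_gt0.
by rewrite ler_pM2l// mulr_gt0 ?expR_gt0.
Qed.

Lemma frobenius_dist_le (R : realType) K n (A B : 'M[R]_(K, n)) :
  (frobenius A - frobenius B) ^+ 2 <= dot (A - B) (A - B).
Proof.
have a0 : 0 <= frobenius A by exact: sqrtr_ge0.
have b0 : 0 <= frobenius B by exact: sqrtr_ge0.
have h : dot A B <= frobenius A * frobenius B.
  apply: (le_trans (ler_norm _)); rewrite -ler_sqr ?nnegrE ?mulr_ge0//.
  by rewrite real_normK ?num_real// exprMn !frobenius_sqr dot_sqr_le.
rewrite sqrrB !frobenius_sqr !dotE_lin [dot B A]dotC; lra.
Qed.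

Lemma oracle_scalar (R : realType) (rho K N T r lam m s a b fq del p tk : R) :
  1 <= K -> K + 3 <= N -> 0 < T -> 0 < r -> 0 < s -> s ^+ 2 = 2 * r * lam ^+ 2 ->
  0 <= a -> 0 <= b -> a ^+ 2 = fq -> (a - b) ^+ 2 <= del -> r * K * lam ^+ 2 <= m ->
  let A := T * N * r in
  tk = 9/8 * (A * ln (1 + a / s)) ->
  13/10 * rho <= 3/10 * (fq + p) + (p + del) + m + 2 * (9/8 * (A * ln (1 + b / s))) ->
  13/10 * rho <= 13/10 * p + fq - 2 * fq + fq + m + 2 * tk + 5/4 * tk + 39/20 * (T * K * r) ->
  rho <= (p + del) + 4 * (A * ln (1 + b / s)) + m.
Proof.
move=> K1 KN T0 r0 s0 sE a0 b0 fqE hdel hm A tkE h1 h2.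
have N0 : 0 < N by lra.
have A0 : 0 < A by rewrite !mulr_gt0.
have l2 := sqr_ge0 lam.
have K0 : 0 <= K by lra.
have m0 : 0 <= m by apply: le_trans hm; apply: mulr_ge0 => //; apply: mulr_ge0 => //; exact: ltW.
have TN0 : 0 < T * N by exact: mulr_gt0.
(* The threshold solves [3/10 * (59/6) + 9/4 = 13/10 * 4]: below it the first bound pays for the
   surplus by itself. *)
have [small|big] := leP (fq - del) (59/6 * (A * ln (1 + b / s))).
  move: small h1; move: (A * _) => w *; lra.
(* Chosen so that [L * (a / s) ^+ 2] is [fq / A]; division by [A] puts every term in the units of
   [scalar_conclusion]. *)
pose L := 2 * lam ^+ 2 / (T * N).
have LE : L = s ^+ 2 / A by rewrite sE /L /A; field; rewrite !gt_eqF.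
have fx : L * (a / s) ^+ 2 = fq / A by rewrite LE -fqE; field; rewrite !gt_eqF.
have fxy : L * (a / s - b / s) ^+ 2 = (a - b) ^+ 2 / A by rewrite LE; field; rewrite !gt_eqF.
have del0 : 0 <= del by apply: le_trans hdel; exact: sqr_ge0.
have D0 : 0 <= del / A by rewrite divr_ge0// ltW.
have L0 : 0 <= L by apply: divr_ge0; [exact: mulr_ge0|exact: ltW].
have hD : L * (a / s - b / s) ^+ 2 <= del / A by rewrite fxy ler_pM2r ?invr_gt0.
have hL : del / A + 59/6 * ln (1 + b / s) < L * (a / s) ^+ 2.
  rewrite fx -(ltr_pM2r A0) mulrDl !divfK ?gt_eqF//.
  have -> : 59/6 * ln (1 + b / s) * A = 59/6 * (A * ln (1 + b / s)) by ring.
  by rewrite addrC -ltrBrDr.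
have x0 : 0 <= a / s by rewrite divr_ge0// ltW.
have y0 : 0 <= b / s by rewrite divr_ge0// ltW.
have h3 := scalar_conclusion K1 KN L0 D0 x0 y0 hD hL; rewrite -(ler_pM2r A0) in h3.
have e1 : (45/16 * ln (1 + a / s) + 3/2 * (K / N)) * A =
    45/16 * (A * ln (1 + a / s)) + 3/2 * (T * K * r).
  by rewrite /A; move: (ln _) => l; field; rewrite gt_eqF.
have e2 : (del / A + 4 * ln (1 + b / s) + 3/26 * (K * L)) * A =
    del + 4 * (A * ln (1 + b / s)) + 3/13 * (r * K * lam ^+ 2).
  have -> : K * L = 2 * (r * K * lam ^+ 2) / A by rewrite /L /A; field; rewrite !gt_eqF.
  by move: (ln _) => l; field; rewrite gt_eqF.
rewrite e1 e2 in h3; clear e1 e2 fx fxy hD hL big h1 LE L0 D0.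
move: h3 h2 hm tkE m0; move: (A * ln (1 + a / s)) (A * ln (1 + b / s)) (r * K * lam ^+ 2) (T * K * r).
move=> x y v u h3 h2 hm tkE m0; clear -h3 h2 hm tkE m0; lra.
Qed.

Section oracle.
Context d (Omega : measurableType d) {R : realType} (P : probability Omega R).
Variables (K n : nat) (X Z : Omega -> 'M[R]_(K, n)) (B : R) (B0 : 0 < B).
Hypotheses (mX : measurable_fun setT X) (mZ : measurable_fun setT Z).
Hypotheses (XB : forall w i j, `|X w i j| <= B) (ZB : forall w i j, `|Z w i j| <= B).
Hypothesis XZ_indep : box_independent P (fun w => col_mx (X w) (Z w)).
Hypothesis X_mean0 : forall i j, \int[P]_w X w i j = 0.
Hypothesis Z_uniform : forall i j (A : set R), measurable A ->
  P ((fun w => Z w i j) @^-1` A) = uniform_prob (gtrN B0) A.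
Variables (lam T : R).
Hypotheses (hK : (0 < K)%N) (hn : (0 < n)%N) (l0 : 0 < lam) (T0 : 0 < T) (BT : 2 * B ^+ 2 <= T).
Variable Fs : 'M[R]_(K, n).

Let N := (n + K + 2)%N.
Let mu := latent_prior hK hn l0 T0.
Let S : 'M[R]_(K, N) -> 'M[R]_K := shrink T.
Let ev := @evidence R K n lam T.
Let m : R := (n * K)%:R * lam ^+ 2.

Definition noisy_mean_risk : R := \int[P]_w
  dot (gibbs_center mu S T (Fs + (X w + Z w)) - Fs) (gibbs_center mu S T (Fs + (X w + Z w)) - Fs).
Let rho := noisy_mean_risk.

Let ev0 : 0 < ev 0. Proof. exact: evidence0_gt0. Qed.

Let partE y : ev y = ev 0 * expR (- (dot y y / (2 * T))) * partition mu S T y.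
Proof. exact: (@evidence_latent R K n lam T hK hn l0 T0 y). Qed.

Let pgt0 (y : 'M[R]_(K, n)) : 0 < partition mu S T y.
Proof.
by apply: partition_gt0 => //; [exact: measurable_shrink|exact: shrink_sym|exact: psd_shrink|exact: psd_1Bshrink].
Qed.

Let part_ge1 (y : 'M[R]_(K, n)) : 1 <= partition mu S T y.
Proof.
rewrite -[leLHS](bm_integral_cst mu); apply: bm_integral_le; [exact: bm_cst| |].
  by apply: bm_gibbs_weight; [exact: measurable_shrink|exact: shrink_sym|exact: psd_shrink|exact: psd_1Bshrink].
by move=> G; apply: gibbs_weight_ge1 => //; exact: psd_shrink.
Qed.

Let T2 : 0 < 2 * T. Proof. by rewrite mulr_gt0. Qed.

Let shift_part k (y H : 'M[R]_(K, n)) : ev (y - H) <= expR k * ev y ->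
  partition mu S T (y - H) <= expR ((dot (y - H) (y - H) - dot y y) / (2 * T) + k) * partition mu S T y.
Proof.
move=> h; rewrite (partE (y - H)) (partE y) in h; have := ratio_le_expR ev0 h.
by rewrite -mulrBl.
Qed.

Let triv (y : 'M[R]_(K, n)) : ev (y - 0) <= expR 0 * ev y.
Proof.
have e : expR 0 * ev y = ev y.
  exact: etrans (congr1 (fun c => c * ev y) (expR0 R)) (mul1r (ev y)).
have e' : y - 0 = y := subr0 y.
by rewrite e' e; exact: lexx.
Qed.

(** The partition function is at least 1 everywhere, in particular at [y - H], and the shift
    comparison carries this back to [y]. The factor in [m] comes from [evidence_jensen]. *)
Let part_lower k (y H : 'M[R]_(K, n)) : ev (y - H) <= expR k * ev y ->
  @student_total R K n lam / ev 0 <= partition mu S T y *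
    expR ((- dot y y + dot (y - H) (y - H) + m) / (2 * T) + k).
Proof.
move=> /shift_part h.
have h1 : @student_total R K n lam / ev 0 <= expR (m / (2 * T)).
  have := evidence_jensen hK hn l0 T0; rewrite -/m -/ev => h2.
  by rewrite ler_pdivrMr// -ler_pdivrMl ?expR_gt0// -expRN mulrC.
apply: (le_trans h1); have h3 := le_trans (part_ge1 _) h.
have := ler_wpM2l (expR_ge0 (m / (2 * T))) h3; rewrite mulr1 mulrA -expRD => h4.
apply: (le_trans h4); rewrite mulrC ler_wpM2l ?(ltW (pgt0 _))// ler_expR.
by rewrite le_eqVlt; apply/orP; left; apply/eqP; ring.
Qed.

Let risk_bound Q kQ kbar (Fbar : 'M[R]_(K, n)) : Q^T = Q -> Q *m Q = Q ->
  (forall y, ev (y - Fs *m Q) <= expR kQ * ev y) ->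
  (forall y, ev (y - Fbar) <= expR kbar * ev y) ->
  13/10 * rho <= 13/10 * dot (coproj Q Fs) (coproj Q Fs) + dot (Fs *m Q) (Fs *m Q) -
    2 * dot Fs Fbar + dot Fbar Fbar + m + 2 * T * kbar + 5/4 * T * kQ + 39/20 * T * K%:R * \tr Q.
Proof.
move=> QT QQ hQ hbar.
have mS : measurable_fun setT S by exact: measurable_shrink.
have ST G : (S G)^T = S G by exact: shrink_sym.
have S0 G : psd (S G) by exact: psd_shrink.
have S1 G : psd (1%:M - S G) by exact: psd_1Bshrink.
have Sd G j : 0 <= S G j j <= 1 by exact: trace_contraction_entry.
apply: (noisy_risk mX mZ XB ZB XZ_indep X_mean0 Z_uniform T0 BT mS ST S0 S1 Sd QT QQ
  (a := @student_total R K n lam / ev 0)).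
- by rewrite divr_gt0// student_total_gt0.
- by move=> y; exact: shift_part.
- by move=> y; exact: part_lower.
- exact: noise_partition_mean.
Qed.

Let coproj0 : coproj 0 Fs = Fs. Proof. by rewrite /coproj mulmx0 subr0. Qed.

Let risk_bound0 k (Fbar : 'M[R]_(K, n)) : (forall y, ev (y - Fbar) <= expR k * ev y) ->
  13/10 * rho <= 3/10 * dot Fs Fs + dot (Fbar - Fs) (Fbar - Fs) + m + 2 * T * k.
Proof.
move=> h.
have hQ y : ev (y - Fs *m 0) <= expR 0 * ev y by rewrite mulmx0; exact: triv.
have h2 := @risk_bound 0 0 k Fbar (trmx0 _ _ _) (mulmx0 _ _) hQ h.
rewrite coproj0 mulmx0 dot0l mxtrace0 !mulr0 in h2; apply: (le_trans h2).
rewrite !dotE_lin [dot Fbar Fs]dotC le_eqVlt; apply/orP; left; apply/eqP; by field.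
Qed.

Let m0 : 0 <= m. Proof. by rewrite mulr_ge0 ?sqr_ge0. Qed.

Lemma noisy_oracle (Fbar : 'M[R]_(K, n)) : noisy_mean_risk <=
  dot (Fbar - Fs) (Fbar - Fs) + 4 * ((T * N%:R * (\rank Fbar)%:R) *
    ln (1 + frobenius Fbar / (Num.sqrt (2 * (\rank Fbar)%:R) * lam))) + m.
Proof.
(* In rank 0 no shift is made and the logarithmic term is 0. The loss of [Fbar = 0] is [dot Fs Fs],
   which absorbs the surplus. *)
have [r0|rpos] := posnP (\rank Fbar).
  have F0 : Fbar = 0 by apply/eqP; rewrite -mxrank_eq0 r0.
  have h := @risk_bound0 0 0 _; rewrite r0 F0.
  apply: (@le_oracle_small _ _ _ (dot Fs Fs) 0).
  - exact: m0.
  - rewrite mulr0 addr0; have h2 := h triv; rewrite mulr0 addr0 in h2; exact: h2.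
  - by rewrite sub0r dotNl dotNr opprK subrr mulr0.
  - by rewrite mulr0 mul0r.
have [V [VV FV]] := orthonormal_basis Fbar.
set r := \rank Fbar in V VV FV rpos *.
pose Q := V *m V^T.
have QT : Q^T = Q by rewrite /Q trmx_mul trmxK.
have QQ : Q *m Q = Q by rewrite /Q -mulmxA (mulmxA V^T) VV mul1mx.
have trQ : \tr Q = r%:R by rewrite /Q mxtrace_mulC VV mxtrace1.
pose FQ := Fs *m Q.
have FQV : FQ *m (V *m V^T) = FQ by rewrite /FQ -mulmxA QQ.
have sb y := evidence_shift hK hn l0 T0 y rpos VV FV.
have sq y := evidence_shift hK hn l0 T0 y rpos VV FQV.
have rR : 0 < r%:R :> R by rewrite ltr0n.
pose s2 : R := Num.sqrt (2 * r%:R) * lam.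
have s20 : 0 < s2 by rewrite mulr_gt0// sqrtr_gt0 mulr_gt0.
have s2E : s2 ^+ 2 = 2 * r%:R * lam ^+ 2 by rewrite exprMn sqr_sqrtr// mulr_ge0.
have kE (H : 'M[R]_(K, n)) : T * shift_cost lam r H = 9/8 * (T * N%:R * r%:R * ln (1 + frobenius H / s2)).
  have assoc (t a b c : R) : t * (9/8 * a * (b * c)) = 9/8 * (t * a * b * c) by ring.
  exact: assoc.
pose del := dot (FQ - Fbar) (FQ - Fbar).
pose p := dot (coproj Q Fs) (coproj Q Fs).
have FsE : dot Fs Fs = dot FQ FQ + p by exact: dot_proj_split.
have FFQ : dot Fs FQ = dot FQ FQ.
  by rewrite [RHS]dotMr QT FQV.
have dE : dot (Fbar - Fs) (Fbar - Fs) = p + del.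
  rewrite (dot_proj_split QT QQ (Fbar - Fs)).
  have -> : (Fbar - Fs) *m Q = Fbar - FQ by rewrite mulmxBl FV.
  have -> : coproj Q (Fbar - Fs) = - coproj Q Fs.
    by rewrite /coproj mulmxBl FV !opprB addrC addrA subrK.
  by rewrite dotNl dotNr opprK /del /p -(opprB FQ Fbar) dotNl dotNr opprK addrC.
have tA (k : R) : 2 * T * k = 2 * (T * k) by rewrite mulrA.
have tB (k : R) : 5/4 * T * k = 5/4 * (T * k) by rewrite mulrA.
have tC : 39/20 * T * K%:R * r%:R = 39/20 * (T * K%:R * r%:R) by rewrite !mulrA.
have h1 := risk_bound0 sb; rewrite tA kE FsE dE in h1.
(* The second bound takes [FQ] itself as the shift of the partition function, so that both costs are
   those of [FQ] and the terms in [dot FQ FQ] cancel. *)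
have h2 := risk_bound QT QQ sq sq; rewrite -/FQ -/p FFQ trQ tA tB tC in h2.
have K1 : 1 <= K%:R :> R by rewrite ler1n.
have KN : K%:R + 3 <= N%:R :> R.
  have h : (K + 3 <= n + K + 2)%N by rewrite (addnC n) -addnA leq_add2l addnC; exact: hn.
  by have := h; rewrite -(ler_nat R) natrD.
have hm : r%:R * K%:R * lam ^+ 2 <= m.
  rewrite /m natrM; apply: ler_wpM2r; first exact: sqr_ge0.
  by apply: ler_wpM2r; [exact: ler0n|rewrite ler_nat; exact: rank_leq_col].
have f1 : 0 <= frobenius FQ by exact: sqrtr_ge0.
have f2 : 0 <= frobenius Fbar by exact: sqrtr_ge0.
have fd := frobenius_dist_le FQ Fbar; rewrite -/del in fd.
rewrite dE; exact: (oracle_scalar K1 KN T0 rR s20 s2E f1 f2 (frobenius_sqr FQ) fd hm (kE FQ) h1 h2).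
Qed.

End oracle.

(** * The aggregate as a Gibbs average *)

Section posterior_mean.
Context {R : realType} {K n : nat}.
Variables (lam tau : R).
Hypotheses (hK : (0 < K)%N) (hn : (0 < n)%N) (l0 : 0 < lam) (tau0 : 0 < tau).
Let T := n%:R * tau.
Let nR : 0 < n%:R :> R. Proof. by rewrite ltr0n. Qed.
Lemma temperature_gt0 : 0 < T. Proof. exact: mulr_gt0. Qed.
Let T0 := temperature_gt0.

Lemma gibbs_likelihoodE (F y : 'M[R]_(K, n)) :
  expR (- ((2 * tau)^-1 * loss F y)) = likelihood T y F.
Proof.
rewrite /loss frobenius_sqr /likelihood /T; congr (expR (- _)).
by field; rewrite !gt_eqF.
Qed.

Let sdm : measurable_fun setT (@student_density R K n lam). Proof. exact: measurable_student_density. Qed.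
Let sd0 (F : 'M[R]_(K, n)) : 0 <= student_density lam F. Proof. exact: student_density_ge0. Qed.
Let C := @student_total R K n lam.
Let C0 : 0 < C. Proof. exact: student_total_gt0. Qed.
Let CE : (\int[lebesgue_mx]_(F in [set: 'M[R]_(K, n)]) (student_density lam F)%:E = C%:E)%E.
Proof. exact: integral_student_density. Qed.
Let prior : probability 'M[R]_(K, n) R := nd_probability sdm sd0 C0 CE.

Let ev (y : 'M[R]_(K, n)) := evidence lam T y.
Let evE (y : 'M[R]_(K, n)) : ev y = ev 0 * expR (- (dot y y / (2 * T))) *
  partition (latent_prior hK hn l0 T0) (shrink T) T y.
Proof. exact: (@evidence_latent R K n lam T hK hn l0 T0 y). Qed.

Let Zgt0 (y : 'M[R]_(K, n)) : 0 < partition (latent_prior hK hn l0 T0) (shrink T) T y.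
Proof.
by apply: partition_gt0 => //; [exact: measurable_shrink|exact: shrink_sym|exact: psd_shrink|exact: psd_1Bshrink].
Qed.

Let evgt0 (y : 'M[R]_(K, n)) : 0 < ev y.
Proof. by rewrite (evE y); apply: mulr_gt0 => //; apply: mulr_gt0; [exact: evidence0_gt0|exact: expR_gt0]. Qed.

Let lik (y F : 'M[R]_(K, n)) := expR (- ((2 * tau)^-1 * loss F y)).
Let likm y : measurable_fun setT (lik y).
Proof.
rewrite (_ : lik y = likelihood T y); first exact: measurable_likelihood.
by apply/funext => F; exact: gibbs_likelihoodE.
Qed.
Let lik0 y F : 0 <= lik y F. Proof. exact: expR_ge0. Qed.

Let likC y : (\int[prior]_F (lik y F)%:E = (C^-1 * ev y)%:E)%E.
Proof.
have ml : measurable_fun setT (fun F : 'M[R]_(K, n) => (lik y F)%:E) by apply/measurable_EFinP; exact: likm.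
have l00 (F : 'M[R]_(K, n)) : (0 <= (lik y F)%:E)%E by rewrite lee_fin.
rewrite (ge0_integral_nd sdm sd0 C0 CE ml l00).
have := integral_evidence hK hn l0 T0 y; rewrite -/(ev y) => h.
rewrite EFinM -h; congr (_ * _)%E; apply: eq_integral => F _.
by rewrite /lik gibbs_likelihoodE -EFinM mulrC.
Qed.

Let c0 y : 0 < C^-1 * ev y. Proof. by rewrite mulr_gt0 ?invr_gt0. Qed.

Let post y : probability 'M[R]_(K, n) R := nd_probability (likm y) (lik0 y) (c0 y) (likC y).

Let int_leb y j i : lebesgue_mx.-integrable setT (EFin \o (fun F : 'M[R]_(K, n) => F j i * lik y F * student_density lam F)).
Proof.
have := integrable_entry_posterior hK hn l0 T0 y j i; apply: eq_integrable => // F _ /=.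
by rewrite /lik gibbs_likelihoodE; congr (_%:E); ring.
Qed.

Let int_leb_abs y j i : lebesgue_mx.-integrable setT (EFin \o (fun F : 'M[R]_(K, n) => `|F j i * lik y F| * student_density lam F)).
Proof.
have := integrable_abse (int_leb y j i); apply: eq_integrable => // F _ /=.
by rewrite normrM (ger0_norm (sd0 F)).
Qed.

Let mel y j i : measurable_fun setT (fun F : 'M[R]_(K, n) => F j i * lik y F).
Proof. by apply: measurable_funM; [exact: measurable_entry|exact: likm]. Qed.

Let int_prior y j i : prior.-integrable setT (EFin \o (fun F : 'M[R]_(K, n) => F j i * lik y F)).
Proof.
apply/integrableP; split; first by apply/measurable_EFinP; exact: mel.
have ma : measurable_fun setT (fun F : 'M[R]_(K, n) => `|(F j i * lik y F)%:E|%E).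
  by apply: measurableT_comp => //; apply/measurable_EFinP; exact: mel.
rewrite (ge0_integral_nd sdm sd0 C0 CE ma (fun F => abse_ge0 _)).
have /integrableP[_] := int_leb_abs y j i; under eq_integral => F _.
  rewrite /= ger0_norm; last by rewrite mulr_ge0.
  rewrite EFinM -abse_EFin; over.
move=> h; rewrite lte_mul_pinfty// ?lee_fin ?invr_ge0 ?ltW//.
Qed.

(** The two nested densities are removed one after the other, from the posterior to the prior and
    from the prior to Lebesgue measure, and all normalizing constants cancel in the end. *)
Lemma nEWA_gibbs (y : 'M[R]_(K, n)) :
  nEWA lam tau y = gibbs_center (latent_prior hK hn l0 T0) (shrink T) T y.
Proof.
apply/matrixP => j i; rewrite mxE [RHS]mxE.
have h1 : (\int[post y]_F (F j i)%:E = (C^-1 * ev y)^-1%:E * \int[prior]_F (F j i * lik y F)%:E)%E.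
  apply: integral_nd; first exact: measurable_entry.
  exact: int_prior.
have h2 : (\int[prior]_F (F j i * lik y F)%:E = C^-1%:E * \int[lebesgue_mx]_F (F j i * lik y F * student_density lam F)%:E)%E.
  by apply: integral_nd; [exact: mel|exact: int_leb].
have h3 : (\int[lebesgue_mx]_F (F j i * lik y F * student_density lam F)%:E =
   \int[lebesgue_mx]_F (F j i * (student_density lam F * likelihood T y F))%:E)%E.
  by apply: eq_integral => F _; rewrite /lik gibbs_likelihoodE; congr (_%:E); ring.
have h4 := posterior_entry_latent hK hn l0 T0 y j i.
have -> : (\int[posterior lam tau y]_F (F j i)%:E)%E = (\int[post y]_F (F j i)%:E)%E by [].
rewrite h1 h2 h3 h4 -!EFinM/=.
have e0 : ev 0 != 0 by rewrite gt_eqF.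
have z0 := Zgt0 y.
rewrite /gibbs_mean (evE y) -/(ev 0).
have -> : \int[latent_prior hK hn l0 T0]_G ((shrink T G *m y) j i * tilt T y G) =
  \int[latent_prior hK hn l0 T0]_x ((shrink T x *m y) j i * gibbs_weight (shrink T) T y x) by [].
move: (Rintegral _ _ _) (partition _ _ _ _) z0 => I0 Z0 z0.
by field; rewrite e0 !gt_eqF// ?expR_gt0.
Qed.

End posterior_mean.

(** * Truncation of the noise and conclusion *)

Section truncation.
Context {R : realType}.
Variable B : R.
Hypothesis B0 : 0 < B.

(** The noise is bounded almost everywhere only, and for [zeta] this is known through its law,
    whereas the Stein and moment estimates assume bounds everywhere. The truncated matrices satisfy
    these bounds and agree almost surely with the given ones. *)
Definition trunc (t : R) := Num.max (- B) (Num.min t B).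

Lemma trunc_id t : `|t| <= B -> trunc t = t.
Proof. by rewrite ler_norml => /andP[h1 h2]; rewrite /trunc min_l// max_r. Qed.

Lemma trunc_le t : `|trunc t| <= B.
Proof.
have BB : - B <= B by rewrite ge0_cp// ltW.
by rewrite ler_norml /trunc le_max lexx/= ge_max BB ge_min lexx orbT.
Qed.

Lemma measurable_trunc : measurable_fun setT trunc.
Proof. by apply: measurable_maxr => //; apply: measurable_minr. Qed.

Lemma measurable_trunc_mx d (X : measurableType d) K n (f : X -> 'M[R]_(K, n)) :
  measurable_fun setT f -> measurable_fun setT (fun x => map_mx trunc (f x)).
Proof.
move=> mf; apply: measurable_fun_mx => j i; under eq_fun do rewrite mxE.
by apply: (measurableT_comp measurable_trunc); exact: measurable_mxE.
Qed.

Lemma trunc_mx_id K n (F : 'M[R]_(K, n)) : (forall j i, `|F j i| <= B) -> map_mx trunc F = F.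
Proof. by move=> h; apply/matrixP => j i; rewrite mxE trunc_id. Qed.

Lemma uniform_prob_trunc (A : set R) :
  uniform_prob (gtrN B0) (trunc @^-1` A) = uniform_prob (gtrN B0) A.
Proof.
rewrite /uniform_prob [LHS]integral_mkcond [RHS]integral_mkcond; apply: eq_integral => x _.
rewrite !patchE; have [h|h] := boolP (`|x| <= B).
  have -> : (x \in trunc @^-1` A) = (x \in A) by apply/idP/idP; rewrite !in_setE /= trunc_id.
  by [].
have -> : uniform_pdf (- B) B x = 0.
  by rewrite /uniform_pdf -ler_norml (negbTE h).
by case: ifP; case: ifP.
Qed.

Lemma uniform_prob_outside : uniform_prob (gtrN B0) (~` [set x : R | `|x| <= B]) = 0%E.
Proof.
rewrite /uniform_prob; apply: integral0_eq => x /= hx.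
rewrite /uniform_pdf; case: ifP => // /andP[h1 h2]; exfalso; apply: hx.
by rewrite ler_norml h1 h2.
Qed.

End truncation.

Section iid_box.
Context d (Omega : measurableType d) {R : realType} (P : probability Omega R).

Lemma mutually_independent_box K n (X : Omega -> 'M[R]_(K, n)) (A : 'I_K -> 'I_n -> set R) :
  iid_entries P X -> (forall j i, measurable (A j i)) ->
  P (X @^-1` mx_box A) = (\prod_j \prod_i P ((fun w => X w j i) @^-1` A j i))%E.
Proof.
move=> [h _] mA; have := h [set: 'I_K * 'I_n]%SET (fun e => A e.1 e.2) (fun e => mA e.1 e.2).
rewrite (_ : \bigcap_(e in _) _ = X @^-1` mx_box A); last first.
  apply/seteqP; split => w /=.
    by move=> hw j i; apply: (hw (j, i)); rewrite /= inE.
  by move=> hw [j i] _; exact: (hw j i).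
move=> ->; rewrite (eq_bigl xpredT); last by move=> e; rewrite inE.
by rewrite pair_bigA.
Qed.

Lemma box_independent_pair K n (X Z : Omega -> 'M[R]_(K, n)) (f : R -> R) :
  measurable_fun setT f -> iid_entries P X -> iid_entries P Z -> independent_pair P X Z ->
  box_independent P (fun w => col_mx (map_mx f (X w)) (map_mx f (Z w))).
Proof.
move=> mf iX iZ XZ A mA.
pose A1 (j : 'I_K) i := f @^-1` A (lshift K j) i.
pose A2 (j : 'I_K) i := f @^-1` A (rshift K j) i.
have m1 j i : measurable (A1 j i) by rewrite /A1 -[X in measurable X]setTI; exact: mf.
have m2 j i : measurable (A2 j i) by rewrite /A2 -[X in measurable X]setTI; exact: mf.
rewrite (_ : _ @^-1` _ = X @^-1` mx_box A1 `&` Z @^-1` mx_box A2); last first.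
  apply/seteqP; split => w /=.
    move=> h; split=> j i; rewrite /A1 /A2 /=.
      by have := h (lshift K j) i; rewrite col_mxEu mxE.
    by have := h (rshift K j) i; rewrite col_mxEd mxE.
  move=> [h1 h2] k i; case: (split_ordP k) => j ->.
    by rewrite col_mxEu mxE; exact: h1.
  by rewrite col_mxEd mxE; exact: h2.
rewrite XZ; [|exact: measurable_mx_box|exact: measurable_mx_box].
rewrite !mutually_independent_box// big_split_ord/=; congr (_ * _)%E; apply: eq_bigr => j _; apply: eq_bigr => i _.
  by congr (P _); apply/seteqP; split => w /=; rewrite col_mxEu mxE.
by congr (P _); apply/seteqP; split => w /=; rewrite col_mxEd mxE.
Qed.

End iid_box.

Theorem theorem6 (R : realType) (K n : nat) (hK : (1 <= K)%N) (hn : (1 <= n)%N)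
    (Fstar : 'M[R]_(K, n))
    (d : measure_display) (Omega : measurableType d) (P : probability Omega R)
    (xi zeta : {RV P >-> 'M[R]_(K, n)})
    (xi_zeta_indep : independent_pair P xi zeta)
    (B : R) (B_gt0 : 0 < B)
    (xi_iid : iid_entries P xi)
    (xi_mean0 : forall j i, ('E_P[fun w => xi w j i] = 0)%E)
    (xi_bounded : {ae P, forall w, forall j i, `|xi w j i| <= B})
    (zeta_iid : iid_entries P zeta)
    (zeta_uniform : forall j i (A : set R), measurable A ->
       P ((fun w => zeta w j i) @^-1` A) = uniform_prob (gtrN B_gt0) A)
    (lambda : R) (lambda_gt0 : 0 < lambda)
    (tau : R) (tau_ge : 2 * B ^+ 2 / n%:R <= tau) :
  let Y w := Fstar + xi w in
  let Ybar w := Y w + zeta w in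
  ('E_P[fun w => loss (nEWA lambda tau (Ybar w)) Fstar] <=
    ereal_inf [set (oracle_bound lambda tau Fstar Fbar)%:E
               | Fbar in [set: 'M[R]_(K, n)]]
    + (K%:R * lambda ^+ 2)%:E)%E.
Proof.
pose Y w := Fstar + xi w; pose Ybar w := Y w + zeta w.
change (is_true ('E_P[fun w => loss (nEWA lambda tau (Ybar w)) Fstar] <=
    ereal_inf [set (oracle_bound lambda tau Fstar Fbar)%:E | Fbar in [set: 'M[R]_(K, n)]]
    + (K%:R * lambda ^+ 2)%:E)%E).
have nR : 0 < n%:R :> R by rewrite ltr0n.
have tau0 : 0 < tau.
  by apply: lt_le_trans tau_ge; apply: divr_gt0 => //; apply: mulr_gt0 => //; exact: exprn_gt0.
pose T0 := temperature_gt0 hn tau0.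
have BT : 2 * B ^+ 2 <= n%:R * tau by move: tau_ge; rewrite ler_pdivrMr// [leRHS]mulrC.
pose X w := map_mx (trunc B) (xi w); pose Z w := map_mx (trunc B) (zeta w).
have mxi : measurable_fun setT xi by first [exact: measurable_funPT | exact: measurable_funP].
have mzeta : measurable_fun setT zeta by first [exact: measurable_funPT | exact: measurable_funP].
have mX : measurable_fun setT X by exact: measurable_trunc_mx.
have mZ : measurable_fun setT Z by exact: measurable_trunc_mx.
have XB w j i : `|X w j i| <= B by rewrite mxE trunc_le.
have ZB w j i : `|Z w j i| <= B by rewrite mxE trunc_le.
have XZ : box_independent P (fun w => col_mx (X w) (Z w)).
  exact: (box_independent_pair (measurable_trunc B) xi_iid zeta_iid xi_zeta_indep).
have aeX : {ae P, forall w, xi w = X w}.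
  by apply: filterS xi_bounded => w h; rewrite /X trunc_mx_id.
have mset : measurable [set x : R | `|x| <= B].
  rewrite (_ : [set x : R | `|x| <= B] = `[- B, B]%classic); first exact: measurable_itv.
  by apply/seteqP; split => x /=; rewrite in_itv/= ler_norml.
have zeta_bounded : {ae P, forall w, forall j i, `|zeta w j i| <= B}.
  apply: filter_forall => j; apply: filter_forall => i.
  exists ((fun w => zeta w j i) @^-1` (~` [set x : R | `|x| <= B])); split.
  - rewrite -[X in measurable X]setTI; apply: (measurable_mxE j i mzeta) => //; exact: measurableC.
  - by rewrite zeta_uniform ?uniform_prob_outside//; exact: measurableC.
  - by [].
have aeZ : {ae P, forall w, zeta w = Z w}.
  by apply: filterS zeta_bounded => w h; rewrite /Z trunc_mx_id.
have X0 j i : \int[P]_w X w j i = 0.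
  rewrite /Rintegral; have := xi_mean0 j i; rewrite unlock => h.
  rewrite (_ : (\int[P]_w (X w j i)%:E = 0)%E)//; rewrite -[RHS]h.
  apply: ae_eq_integral => //.
  - by apply/measurable_EFinP; exact: measurable_mxE.
  - by apply/measurable_EFinP; exact: measurable_mxE.
  - by apply: filterS aeX => w e _; rewrite /= e.
have Zu j i (A : set R) : measurable A ->
    P ((fun w => Z w j i) @^-1` A) = uniform_prob (gtrN B_gt0) A.
  move=> mA; rewrite -uniform_prob_trunc -(zeta_uniform j i).
    by congr (P _); apply/seteqP; split => w /=; rewrite mxE.
  by rewrite -[X in measurable X]setTI; exact: measurable_trunc.
pose mu := latent_prior hK hn lambda_gt0 T0; pose T := n%:R * tau.
pose h (y : 'M[R]_(K, n)) := n%:R^-1 * dot (gibbs_center mu (shrink T) T y - Fstar)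
   (gibbs_center mu (shrink T) T y - Fstar).
have mS : measurable_fun setT (shrink T : 'M[R]_(K, n + K + 2) -> 'M[R]_K) by exact: measurable_shrink.
have mh : measurable_fun setT h.
  apply: measurable_funM => //.
  have mc : measurable_fun setT (fun y => gibbs_center mu (shrink T) T y - Fstar).
    by apply: measurable_submx => //; apply: measurable_fun_mx => j i; exact: measurable_center.
  exact: measurable_dot.
have lossE y : loss (nEWA lambda tau y) Fstar = h y.
  by rewrite /loss frobenius_sqr (nEWA_gibbs hK hn lambda_gt0 tau0).
pose W w := Fstar + (X w + Z w).
have mW : measurable_fun setT W by apply: measurable_addmx => //; exact: measurable_addmx.
have mY : measurable_fun setT Ybar by apply: measurable_addmx => //; exact: measurable_addmx.
have bW : bm (fun w => dot (gibbs_center mu (shrink T) T (W w) - Fstar) (gibbs_center mu (shrink T) T (W w) - Fstar)).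
  have ST (G : 'M[R]_(K, n + K + 2)) : (shrink T G)^T = shrink T G by exact: shrink_sym.
  have S0 (G : 'M[R]_(K, n + K + 2)) : psd (shrink T G) by exact: psd_shrink.
  have S1 (G : 'M[R]_(K, n + K + 2)) : psd (1%:M - shrink T G) by exact: psd_1Bshrink.
  exact: (bm_center_risk mu B_gt0 mX mZ XB ZB T0 mS ST S0 S1).
pose rho := noisy_mean_risk P X Z hK hn lambda_gt0 T0 Fstar.
have E : ('E_P[fun w => loss (nEWA lambda tau (Ybar w)) Fstar] = (n%:R^-1 * rho)%:E)%E.
  rewrite unlock; transitivity (\int[P]_w (h (W w))%:E)%E.
    (* Passing to the truncated noise changes the integrand on a null set only. *)
    apply: ae_eq_integral => //.
    - apply/measurable_EFinP; rewrite (_ : (fun w => _) = h \o Ybar); first exact: (measurableT_comp mh mY).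
      by apply/funext => w; exact: lossE.
    - by apply/measurable_EFinP; exact: (measurableT_comp mh mW).
    - apply: filterS2 aeX aeZ => w e1 e2 _; congr (_%:E); rewrite lossE; congr h.
      by rewrite /Ybar /Y /W e1 e2 addrA.
  by rewrite (bm_integralE P (bmZ n%:R^-1 bW)) bm_integralZ.
(* The finite remainder is moved to the left, so that the infimum is tested on each [Fbar]
   separately. *)
rewrite E -leeBlDr//.
apply: le_ereal_inf_tmp => _ [Fbar _ <-]; rewrite -EFinB lee_fin.
have O := noisy_oracle mX mZ XB ZB XZ X0 Zu hK hn lambda_gt0 T0 BT Fstar Fbar.
rewrite lerBlDr -(ler_pM2l nR) mulVKf ?gt_eqF//; apply: (le_trans O).
rewrite /oracle_bound /loss frobenius_sqr natrM.
move: (dot _ _) (ln _) => u v; rewrite le_eqVlt; apply/orP; left; apply/eqP.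
by field; rewrite gt_eqF.
Qed.
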